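(* Consider the decision problems: given a finite $W\subseteq\mathcal{L}_\Sigma$ and $\varphi\in\mathcal{L}_\Sigma$ (together with an index set $I$ for $T_1,T_2$, and a ranking function $\varrho$ for the hierarchic variants), decide whether $W\vdash\varphi$ for the relations below, computed with respect to $T_0=(D_\Sigma,W^\pm)$, $T_1=(D^1_\Sigma,W^\pm_I)$ or $T_2=(D^2_\Sigma,W^\pm_I)$, where signed relations are only considered for $T_0$. Both for ordinary extensions (relations $\vdash_c,\vdash_s,\vdash_p,\vdash^\pm_c,\vdash^\pm_s,\vdash^\pm_p$) and for hierarchic extensions (relations $\vdash_{ch},\vdash_{sh},\vdash_{ph},\vdash^\pm_{ch},\vdash^\pm_{sh},\vdash^\pm_{ph}$): (a) the credulous unsigned relation is $\Sigma^P_2$-complete for each of $T_0,T_1,T_2$; (b) the skeptical unsigned relation is $\Pi^P_2$-complete for each of $T_0,T_1,T_2$; (c) the prudent unsigned relation is $\Pi^P_2$-complete for $T_0$ and in $\Pi^P_2$ for $T_1$ and $T_2$; (d) the credulous signed relation (w.r.t. $T_0$) is $\Sigma^P_2$-complete; (e) the skeptical signed relation is $\Pi^P_2$-complete; (f) the prudent signed relation is in $\Pi^P_2$.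
   Context: Propositional logic over $\Sigma$, $\mathcal{L}_\Sigma$, $\mathit{var}$, $\mathit{Cn}$ as usual; occurrence polarity as usual. $\Sigma^\pm=\{p^+,p^-\mid p\in\Sigma\}$ fresh atoms; $\alpha^\pm$ replaces each positive occurrence of $p$ by $p^+$ and each negative one by $\neg p^-$; $W^\pm$ elementwise. Default $\delta=\frac{\alpha:\beta}{\gamma}$, $j(\delta)=\beta$, $c(\delta)=\gamma$. Extension of $(D,V)$: $E_1=V$, $E_{n+1}=\mathit{Cn}(E_n)\cup\{\gamma\mid\frac{\alpha:\beta}{\gamma}\in D,\alpha\in E_n,\neg\beta\notin E\}$, $E$ extension iff $E=\bigcup_nE_n$. $\delta_p=\frac{\top:p^+\equiv\neg p^-}{(p\equiv p^+)\wedge(\neg p\equiv p^-)}$, $D_\Sigma=\{\delta_p\mid p\in\Sigma\}$. Index set $I$: distinct indices for all atom occurrences in $W$; $p$ has complementary occurrences if it occurs positively and negatively in $W$; $W^\pm_I$ replaces, for such $p$, $p^+$/$p^-$ stemming from occurrence $i$ by fresh $p^+_i$/$p^-_i$. $D^1_\Sigma$: for such $p$, $\delta^{i,j}_p=\frac{\top:(p\equiv p^+_i)\wedge(\neg p\equiv p^-_j)}{(p\equiv p^+_i)\wedge(\neg p\equiv p^-_j)}$ ($i$ positive, $j$ negative occurrence index), $\delta_p$ for other $p$. $D^2_\Sigma$: for such $p$, $\delta^{i+}_p=\frac{\top:p\equiv p^+_i}{p\equiv p^+_i}$ and $\delta^{j-}_p=\frac{\top:\neg p\equiv p^-_j}{\neg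 p\equiv p^-_j}$, $\delta_p$ for other $p$. For a default theory $(D,V)$ among $T_0,T_1,T_2$ with set of extensions $\mathcal{E}$ and $\Pi_S=\{c(\delta)\mid\delta\in D,\neg j(\delta)\notin S\}$: $W\vdash_c\varphi$ iff $\varphi\in\bigcup_{E\in\mathcal{E}}\mathit{Cn}(V\cup\Pi_E)$; $W\vdash_s\varphi$ iff $\varphi\in\bigcap_{E\in\mathcal{E}}\mathit{Cn}(V\cup\Pi_E)$; $W\vdash_p\varphi$ iff $\varphi\in\mathit{Cn}(V\cup\bigcap_{E\in\mathcal{E}}\Pi_E)$. Signed relations $\vdash^\pm_c,\vdash^\pm_s,\vdash^\pm_p$: the same for $T_0$ but with $\varphi^\pm$ in place of $\varphi$ on the right-hand side. Hierarchic relations (subscript $h$): the same with $\mathcal{E}$ the set of hierarchic extensions w.r.t. the hierarchy induced by $\varrho:\Sigma\to\mathbb{N}$, namely the partition $\langle D_k\rangle_{k\in\omega}$ with $\delta\in D_k$ iff $\delta$ is of form $\delta_p,\delta^{i,j}_p,\delta^{i+}_p,\delta^{i-}_p$ with $\varrho(p)=k$; $E=\bigcup_kE_k$ is a hierarchic extension of $(D,V)$ if $E_1=V$ and $E_{k+1}$ is an extension of $(D_k,E_k)$ for all $k\ge1$. $\Sigma^P_2$ is the class of problems decidable in nondeterministic polynomial time with an NP oracle, $\Pi^P_2=\mathrm{co}\text{-}\Sigma^P_2$. *)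

(* Defs.v *)
From HB Require Import structures.
From mathcomp Require Import all_boot.
From mathcomp Require Import boolp classical_sets.
From Corelib Require Import BinNums.
From Stdlib Require List.

Set Implicit Arguments.
Unset Strict Implicit.
Unset Printing Implicit Defensive.

Local Open Scope classical_set_scope.

Definition language := set (seq bool).

Inductive direction := GoLeft | Stay | GoRight.

(* [None] is the blank, [Some (inl b)] an input bit, [Some (inr a)] an
   auxiliary tape symbol. *)
Definition symbol (aux : finType) : finType := option (bool + aux)%type.

(* There are [ntapes.+1] tapes; tape [ord0] holds the input, and tape [ord_max]
   is both the query tape and the output tape.  In a state [q] with
   [query q = Some (qyes, qno)] the only possible step is to ask the oracle
   about the word on the query tape. *)
Record machine := Machine {
  ntapes : nat;
  state : finType;
  aux : finType;
  start : state;
  accepting : pred state;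
  query : state -> option (state * state);
  trans : state -> {ffun 'I_ntapes.+1 -> symbol aux} ->
          state -> {ffun 'I_ntapes.+1 -> symbol aux * direction} -> bool
}.

(* A two-way infinite tape: the cells left of the head (nearest first), the
   scanned cell, and the cells right of the head; all others are blank. *)
Record tape (G : Type) := Tape { left : seq G; scanned : G; right : seq G }.

Section Runs.
Variable M : machine.
Notation sym := (symbol (aux M)).
Notation blank := (None : sym).

Record config := Config {
  cstate : state M;
  ctapes : {ffun 'I_(ntapes M).+1 -> tape sym}
}.

Definition move (d : direction) (t : tape sym) : tape sym :=
  match d with
  | GoLeft => Tape (behead (left t)) (head blank (left t))
                   (scanned t :: right t)
  | Stay => t
  | GoRight => Tape (scanned t :: left t) (head blank (right t))
                    (behead (right t))
  end.

Definition act (a : sym * direction) (t : tape sym) : tape sym :=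
  move a.2 (Tape (left t) a.1 (right t)).

Fixpoint bit_prefix (s : seq sym) : seq bool :=
  if s is Some (inl b) :: s' then b :: bit_prefix s' else [::].

Definition word (t : tape sym) : seq bool :=
  bit_prefix (scanned t :: right t).

Definition load (x : seq bool) : tape sym :=
  let s := [seq Some (inl b) : sym | b <- x] in
  Tape [::] (head blank s) (behead s).

Definition init (x : seq bool) : config :=
  Config (start M) [ffun i => load (if i == ord0 then x else [::])].

Definition step (A : language) (c c' : config) : Prop :=
  match query (cstate c) with
  | Some (qyes, qno) =>
      let w := word (ctapes c ord_max) in
      (A w /\ c' = Config qyes (ctapes c)) \/
      (~ A w /\ c' = Config qno (ctapes c))
  | None =>
      exists q a, trans (cstate c) [ffun i => scanned (ctapes c i)] q a /\
                  c' = Config q [ffun i => act (a i) (ctapes c i)]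
  end.

Fixpoint run (A : language) (n : nat) (c c' : config) : Prop :=
  if n is m.+1 then exists2 d, step A c d & run A m d c' else c = c'.

Definition halted (A : language) (c : config) : Prop :=
  forall c', ~ step A c c'.

Definition oracle_free : Prop := forall q, query (m := M) q = None.

Definition deterministic : Prop :=
  forall q s q1 a1 q2 a2,
    trans (m := M) q s q1 a1 -> trans q s q2 a2 -> (q1, a1) = (q2, a2).

Definition accepts (A : language) (x : seq bool) : Prop :=
  exists n c, [/\ run A n (init x) c, halted A c & accepting (cstate c)].

End Runs.

(* Every computation path halts within [n ^ e + e] steps on inputs of
   length [n]. *)
Definition polytime_machine (A : language) (M : machine) : Prop :=
  exists e : nat, forall (x : seq bool) (n : nat) (c : config M),
    run A n (init M x) c -> n <= size x ^ e + e.

Definition decides (A : language) (M : machine) (L : language) : Prop :=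
  forall x, L x <-> accepts M A x.

(* An oracle-free machine never consults its oracle, here [set0]. *)
Definition NP (L : language) : Prop :=
  exists M, [/\ oracle_free M, polytime_machine set0 M & decides set0 M L].

Definition Sigma2P (L : language) : Prop :=
  exists2 A, NP A & exists M, polytime_machine A M /\ decides A M L.

Definition Pi2P (L : language) : Prop := Sigma2P (~` L).

Definition polytime_function (f : seq bool -> seq bool) : Prop :=
  exists M, [/\ oracle_free M, deterministic M, polytime_machine set0 M &
    forall x, exists n c, [/\ run set0 n (init M x) c, halted set0 c &
                              word (ctapes c ord_max) = f x]].

Definition reducible (L1 L2 : language) : Prop :=
  exists2 f, polytime_function f & forall x, L1 x <-> L2 (f x).

Definition complete (C : language -> Prop) (L : language) : Prop :=
  C L /\ forall L', C L' -> reducible L' L.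

Inductive form (A : Type) :=
  | Atom of A
  | Top
  | Bot
  | Not of form A
  | And of form A & form A
  | Or of form A & form A
  | Imp of form A & form A.

Arguments Top {A}.
Arguments Bot {A}.

Definition Iff A (a b : form A) : form A := And (Imp a b) (Imp b a).

Fixpoint eval A (v : A -> bool) (f : form A) : bool :=
  match f with
  | Atom p => v p
  | Top => true
  | Bot => false
  | Not a => ~~ eval v a
  | And a b => eval v a && eval v b
  | Or a b => eval v a || eval v b
  | Imp a b => eval v a ==> eval v b
  end.

Definition Cn A (S : set (form A)) : set (form A) :=
  [set f | forall v, (forall g, S g -> eval v g) -> eval v f].

Fixpoint map_form A B (h : A -> B) (f : form A) : form B :=
  match f with
  | Atom p => Atom (h p)
  | Top => Top
  | Bot => Bot
  | Not a => Not (map_form h a)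
  | And a b => And (map_form h a) (map_form h b)
  | Or a b => Or (map_form h a) (map_form h b)
  | Imp a b => Imp (map_form h a) (map_form h b)
  end.

(* The atom occurrences of [f] from left to right with their polarities, where
   [s] ([true] = positive) is the polarity of the occurrence of [f] itself. *)
Fixpoint occurrences A (s : bool) (f : form A) : seq (A * bool) :=
  match f with
  | Atom p => [:: (p, s)]
  | Top | Bot => [::]
  | Not a => occurrences (~~ s) a
  | And a b | Or a b => occurrences s a ++ occurrences s b
  | Imp a b => occurrences (~~ s) a ++ occurrences s b
  end.

Fixpoint polarize A B (pos neg : A -> B) (s : bool) (f : form A) : form B :=
  match f with
  | Atom p => if s then Atom (pos p) else Not (Atom (neg p))
  | Top => Top
  | Bot => Bot
  | Not a => Not (polarize pos neg (~~ s) a)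
  | And a b => And (polarize pos neg s a) (polarize pos neg s b)
  | Or a b => Or (polarize pos neg s a) (polarize pos neg s b)
  | Imp a b => Imp (polarize pos neg (~~ s) a) (polarize pos neg s b)
  end.

(* The alphabet Sigma is the countably infinite set [nat]. *)
Notation sentence := (form nat).

(* [Base p] is p, [Plus p] and [Minus p] are p^+ and p^-, and [PlusI p i] and
   [MinusI p i] are p^+_i and p^-_i. *)
Inductive xatom :=
  | Base of nat
  | Plus of nat
  | Minus of nat
  | PlusI of nat & nat
  | MinusI of nat & nat.

Notation xform := (form xatom).

Definition unsigned (f : sentence) : xform := map_form Base f.

Definition signed (f : sentence) : xform := polarize Plus Minus true f.

Record default := Default { prereq : xform; justif : xform; conseq : xform }.

(* [stage D V E n] is E_{n+1} in the definition of an extension. *)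
Fixpoint stage (D : set default) (V E : set xform) (n : nat) : set xform :=
  if n is m.+1 then
    let En := stage D V E m in
    Cn En `|` [set g | exists d, [/\ D d, En (prereq d), ~ E (Not (justif d)) &
                                     g = conseq d]]
  else V.

Definition extension (D : set default) (V E : set xform) : Prop :=
  E = \bigcup_n stage D V E n.

(* A default theory whose defaults come grouped by the atom of Sigma that they
   are about, as needed for the hierarchy induced by a ranking. *)
Record theory := Theory {
  defaults_of : nat -> set default;
  facts : set xform
}.

Definition defaults (T : theory) : set default := \bigcup_p defaults_of T p.

Definition defaults_at (T : theory) (rho : nat -> nat) (n : nat) : set default :=
  \bigcup_(p in [set p | rho p = n]) defaults_of T p.

Definition extensions (T : theory) : set (set xform) :=
  [set E | extension (defaults T) (facts T) E].

Definition hierarchic_extensions (T : theory) (rho : nat -> nat) :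
    set (set xform) :=
  [set E | exists Es : nat -> set xform,
     [/\ Es 1 = facts T,
         forall n, 1 <= n -> extension (defaults_at T rho n) (Es n) (Es n.+1) &
         E = \bigcup_(n in [set n | 1 <= n]) Es n]].

Definition delta (p : nat) : default :=
  Default Top
    (Iff (Atom (Plus p)) (Not (Atom (Minus p))))
    (And (Iff (Atom (Base p)) (Atom (Plus p)))
         (Iff (Not (Atom (Base p))) (Atom (Minus p)))).

Definition link_pos (p i : nat) : xform :=
  Iff (Atom (Base p)) (Atom (PlusI p i)).

Definition link_neg (p j : nat) : xform :=
  Iff (Not (Atom (Base p))) (Atom (MinusI p j)).

Definition normal (f : xform) : default := Default Top f f.

Definition list_set A (s : seq A) : set A := [set x | List.In x s].

Definition all_occurrences A (W : seq (form A)) : seq (A * bool) :=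
  flatten [seq occurrences true f | f <- W].

Definition complementary (W : seq sentence) (p : nat) : bool :=
  ((p, true) \in all_occurrences W) && ((p, false) \in all_occurrences W).

(* An index set for [W] is given by the list [I] of the indices of the atom
   occurrences in [W], taken from left to right. *)
Definition index_set (W : seq sentence) (I : seq nat) : Prop :=
  uniq I /\ size I = size (all_occurrences W).

Fixpoint label (I : seq nat) (f : sentence) : form (nat * nat) :=
  let n (a : sentence) := size (occurrences true a) in
  match f with
  | Atom p => Atom (p, head 0 I)
  | Top => Top
  | Bot => Bot
  | Not a => Not (label I a)
  | And a b => And (label (take (n a) I) a) (label (drop (n a) I) b)
  | Or a b => Or (label (take (n a) I) a) (label (drop (n a) I) b)
  | Imp a b => Imp (label (take (n a) I) a) (label (drop (n a) I) b)
  end.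

Fixpoint label_all (I : seq nat) (W : seq sentence) : seq (form (nat * nat)) :=
  if W is f :: W' then
    let n := size (occurrences true f) in
    label (take n I) f :: label_all (drop n I) W'
  else [::].

Definition signed_indexed (W : seq sentence) (I : seq nat) : seq xform :=
  let pos x := if complementary W x.1 then PlusI x.1 x.2 else Plus x.1 in
  let neg x := if complementary W x.1 then MinusI x.1 x.2 else Minus x.1 in
  [seq polarize pos neg true f | f <- label_all I W].

Definition pos_index (W : seq sentence) (I : seq nat) (p : nat) : set nat :=
  [set i | (p, i, true) \in all_occurrences (label_all I W)].

Definition neg_index (W : seq sentence) (I : seq nat) (p : nat) : set nat :=
  [set j | (p, j, false) \in all_occurrences (label_all I W)].

Definition T0 (W : seq sentence) : theory :=
  Theory (fun p => [set delta p]) (list_set [seq signed f | f <- W]).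

Definition T1 (W : seq sentence) (I : seq nat) : theory :=
  Theory
    (fun p => if complementary W p then
       [set d | exists i j, [/\ pos_index W I p i, neg_index W I p j &
                                d = normal (And (link_pos p i) (link_neg p j))]]
     else [set delta p])
    (list_set (signed_indexed W I)).

Definition T2 (W : seq sentence) (I : seq nat) : theory :=
  Theory
    (fun p => if complementary W p then
       [set d | exists2 i, pos_index W I p i & d = normal (link_pos p i)] `|`
       [set d | exists2 j, neg_index W I p j & d = normal (link_neg p j)]
     else [set delta p])
    (list_set (signed_indexed W I)).

Definition Pi (T : theory) (S : set xform) : set xform :=
  [set g | exists d, [/\ defaults T d, ~ S (Not (justif d)) & g = conseq d]].

(* The second argument is the set of (ordinary or hierarchic) extensions. *)
Definition consequence := theory -> set (set xform) -> set xform.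

Definition credulous : consequence := fun T Es =>
  \bigcup_(E in Es) Cn (facts T `|` Pi T E).

Definition skeptical : consequence := fun T Es =>
  \bigcap_(E in Es) Cn (facts T `|` Pi T E).

Definition prudent : consequence := fun T Es =>
  Cn (facts T `|` \bigcap_(E in Es) Pi T E).

Fixpoint pos_bits (n : positive) : seq bool :=
  match n with
  | xH => [:: true]
  | xO m => false :: pos_bits m
  | xI m => true :: pos_bits m
  end.

Definition binary (n : nat) : seq bool :=
  match bin_of_nat n with N0 => [::] | Npos m => pos_bits m end.

(* All codes below are prefix-free, so that they may be concatenated. *)
Definition code_seq A (code : A -> seq bool) (s : seq A) : seq bool :=
  flatten [seq true :: code x | x <- s] ++ [:: false].

Definition code_nat (n : nat) : seq bool := code_seq (fun b => [:: b]) (binary n).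

Fixpoint code_form (f : sentence) : seq bool :=
  match f with
  | Atom p => [:: false; false; false] ++ code_nat p
  | Top => [:: false; false; true]
  | Bot => [:: false; true; false]
  | Not a => [:: false; true; true] ++ code_form a
  | And a b => [:: true; false; false] ++ code_form a ++ code_form b
  | Or a b => [:: true; false; true] ++ code_form a ++ code_form b
  | Imp a b => [:: true; true; false] ++ code_form a ++ code_form b
  end.

Definition code_rank (r : seq (nat * nat)) : seq bool :=
  code_seq (fun x => code_nat x.1 ++ code_nat x.2) r.

(* A ranking function is given by its finitely many values different from 1
   (possibly along with some values 1).  Ranks start at 1, like the levels of
   a hierarchic extension. *)
Definition ranking (r : seq (nat * nat)) : Prop :=
  uniq (unzip1 r) /\ all (leq 1) (unzip2 r).

Definition rank (r : seq (nat * nat)) (p : nat) : nat :=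
  nth 1 (unzip2 r) (index p (unzip1 r)).

Inductive kind := Ordinary | Hierarchic.

(* [tr] is [unsigned] or [signed]. *)
Definition problem0 (h : kind) (R : consequence) (tr : sentence -> xform) :
    language :=
  match h with
  | Ordinary =>
      [set x | exists W f,
         [/\ List.NoDup W,
             x = code_seq code_form W ++ code_form f &
             R (T0 W) (extensions (T0 W)) (tr f)]]
  | Hierarchic =>
      [set x | exists W f r,
         [/\ List.NoDup W, ranking r,
             x = code_seq code_form W ++ code_form f ++ code_rank r &
             R (T0 W) (hierarchic_extensions (T0 W) (rank r)) (tr f)]]
  end.

(* [T] is [T1] or [T2]. *)
Definition problemI (h : kind) (T : seq sentence -> seq nat -> theory)
    (R : consequence) : language :=
  match h with
  | Ordinary =>
      [set x | exists W f I,
         [/\ List.NoDup W, index_set W I,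
             x = code_seq code_form W ++ code_form f ++ code_seq code_nat I &
             R (T W I) (extensions (T W I)) (unsigned f)]]
  | Hierarchic =>
      [set x | exists W f I r,
         [/\ List.NoDup W, index_set W I, ranking r,
             x = code_seq code_form W ++ code_form f ++
                 code_seq code_nat I ++ code_rank r &
             R (T W I) (hierarchic_extensions (T W I) (rank r)) (unsigned f)]]
  end.

(* Main.v *)
From mathcomp Require Import all_boot.
From mathcomp Require Import boolp classical_sets.
From mathcomp Require Import zify.
Require Import Defs.

(** Defaults without prerequisites make the extensions of the three theories
    correspond to the models of the facts that satisfy a maximal set of
    defaults, maximality being lexicographic along the ranks in the hierarchic
    case.  Hence a credulous conclusion, a failing skeptical conclusion and a
    failing prudent conclusion are all of the form "there is a valuation such
    that for all valuations ...", with a polynomial-time matrix over finitely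
    many atoms, which gives membership.

    For hardness, a run of a nondeterministic machine with an NP oracle is
    described by a propositional formula: positive oracle answers are justified
    by guessed runs of the oracle machine, negative ones by a single universally
    quantified run.  The resulting problem "for some values of the atoms X, psi
    is valid" is reduced to each relation.  For each x in X the facts
    a, a -> x, b, b -> ~x make every maximal set of defaults sacrifice one of
    a, b, x, so that a classical value of x is chosen freely.  For the
    skeptical and prudent relations the facts t, t -> (~psi /\ u) are added:
    t stays classical, and u follows, unless psi is valid for the chosen
    values. *)

Set Implicit Arguments.
Unset Strict Implicit.
Unset Printing Implicit Defensive.

Local Open Scope classical_set_scope.

(** * Programs on seven stacks of bits and their compilation to machines *)

(** Complexity is measured on concrete Turing machines, so programs are compiled once and for all,
    and polynomial time is then handled through closure properties of functions on unlabelled trees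
    ([tmap], [poly]). After [NP_intro] and [Sigma2P_intro], machines return only as the subject of
    run formulas. The passage from extensions to models rests on [seminormal]: a consistent
    justification of [delta p] can be upgraded to its conclusion by changing the unsigned atom
    alone. Ordinary extensions are hierarchic ones with all ranks 1, and the three theories are one
    theory [thy] with a mode, so each bound is proved once. Two facts keep the quantifier count
    down. A model of the facts and of the applied conclusions is itself maximal, so one valuation
    refutes a skeptical conclusion. For a prudent one, every discarded default needs its own maximal
    model; there are polynomially many, and they are guessed together. The alphabet is infinite, but
    the defaults of all atoms foreign to the input can be made true ([fixv]). The reductions pack
    all clauses into one conjunction, so repeated clauses do not matter. *)

Inductive reg := RI | RA | RB | RC | RD | RE | RO.

Record store := Store {
  rI : seq bool; rA : seq bool; rB : seq bool; rC : seq bool;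
  rD : seq bool; rE : seq bool; rO : seq bool }.

Definition get (r : reg) (s : store) : seq bool :=
  match r with
  | RI => rI s | RA => rA s | RB => rB s | RC => rC s
  | RD => rD s | RE => rE s | RO => rO s
  end.

Definition put (r : reg) (w : seq bool) (s : store) : store :=
  let: Store i a b c d e o := s in
  match r with
  | RI => Store w a b c d e o | RA => Store i w b c d e o
  | RB => Store i a w c d e o | RC => Store i a b w d e o
  | RD => Store i a b c w e o | RE => Store i a b c d w o
  | RO => Store i a b c d e w
  end.

Definition idx (r : reg) : 'I_7 :=
  match r with
  | RI => @Ordinal 7 0 isT | RA => @Ordinal 7 1 isT | RB => @Ordinal 7 2 isT
  | RC => @Ordinal 7 3 isT | RD => @Ordinal 7 4 isT | RE => @Ordinal 7 5 isT
  | RO => @Ordinal 7 6 isT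
  end.

Lemma idx_inj : injective idx.
Proof. by case; case. Qed.

Lemma get_put_eq r w s : get r (put r w s) = w.
Proof. by case: s; case: r. Qed.

Lemma get_put_neq r r' w s : r <> r' -> get r (put r' w s) = get r s.
Proof. by case: s; case: r; case: r'. Qed.

(* [Pop r c0 c1 ce] pops a bit from [r] and branches on it, or runs [ce] if [r]
   is empty; [Loop r c0 c1] repeats this until [r] is empty, and [LoopT r c]
   until the popped bit is not [true]. *)
Inductive cmd :=
  | Skip
  | Push of reg & bool
  | Seq of cmd & cmd
  | Pop of reg & cmd & cmd & cmd
  | Loop of reg & cmd & cmd
  | LoopT of reg & cmd
  | Choose of cmd & cmd
  | Ask of cmd & cmd.

(* [sem A c s n Q]: with oracle [A], every run of [c] from [s] ends within [n]
   machine steps, and the final stores of these runs are those in [Q]. *)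
Inductive sem (A : language) : cmd -> store -> nat -> (store -> Prop) -> Prop :=
  | sem_weaken c s n m Q Q' : sem A c s n Q -> n <= m ->
      (forall s', Q s' <-> Q' s') -> sem A c s m Q'
  | sem_skip s : sem A Skip s 1 (eq s)
  | sem_push r b s : sem A (Push r b) s 2 (eq (put r (b :: get r s) s))
  | sem_seq c1 c2 s n m Q1 Q2 : sem A c1 s n Q1 ->
      (forall s1, Q1 s1 -> sem A c2 s1 m (Q2 s1)) ->
      sem A (Seq c1 c2) s (n + m) (fun s' => exists2 s1, Q1 s1 & Q2 s1 s')
  | sem_pop_nil r c0 c1 ce s n Q : get r s = [::] -> sem A ce s n Q ->
      sem A (Pop r c0 c1 ce) s n.+1 Q
  | sem_pop r c0 c1 ce s b w n Q : get r s = b :: w ->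
      sem A (if b then c1 else c0) (put r w s) n Q ->
      sem A (Pop r c0 c1 ce) s n.+1 Q
  | sem_loop_nil r c0 c1 s : get r s = [::] -> sem A (Loop r c0 c1) s 1 (eq s)
  | sem_loop r c0 c1 s b w n m Q1 Q2 : get r s = b :: w ->
      sem A (if b then c1 else c0) (put r w s) n Q1 ->
      (forall s1, Q1 s1 -> sem A (Loop r c0 c1) s1 m (Q2 s1)) ->
      sem A (Loop r c0 c1) s (n + m).+1
        (fun s' => exists2 s1, Q1 s1 & Q2 s1 s')
  | sem_loopT_false r c s w : get r s = false :: w ->
      sem A (LoopT r c) s 1 (eq (put r w s))
  | sem_loopT r c s w n m Q1 Q2 : get r s = true :: w ->
      sem A c (put r w s) n Q1 ->
      (forall s1, Q1 s1 -> sem A (LoopT r c) s1 m (Q2 s1)) ->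
      sem A (LoopT r c) s (n + m).+1 (fun s' => exists2 s1, Q1 s1 & Q2 s1 s')
  | sem_choose c1 c2 s n Q1 Q2 : sem A c1 s n Q1 -> sem A c2 s n Q2 ->
      sem A (Choose c1 c2) s n.+1 (fun s' => Q1 s' \/ Q2 s')
  | sem_ask_yes c1 c2 s n Q : A (get RO s) -> sem A c1 s n Q ->
      sem A (Ask c1 c2) s n.+1 Q
  | sem_ask_no c1 c2 s n Q : ~ A (get RO s) -> sem A c2 s n Q ->
      sem A (Ask c1 c2) s n.+1 Q.

(** An instruction touches one tape: [IAct r f] reads the top cell of [r], and [f] yields the symbol
    to write, the head move and the next label. [IHalt] never occurs in compiled code; it is the
    value read at labels beyond its end. *)
Inductive instr :=
  | IAct of reg & (option bool -> option bool * direction * nat)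
  | IFork of nat & nat
  | IAsk of nat & nat
  | IHalt.

Fixpoint csize (c : cmd) : nat :=
  match c with
  | Skip => 1
  | Push _ _ => 2
  | Seq a b => csize a + csize b
  | Pop _ a b e => (csize a + (csize b + csize e)).+1
  | Loop _ a b | Choose a b | Ask a b => (csize a + csize b).+1
  | LoopT _ a => (csize a).+1
  end.

(* The code of [c] occupies the labels from [l] on and exits to label [k]. *)
Fixpoint comp (c : cmd) (l k : nat) : seq instr :=
  match c with
  | Skip => [:: IFork k k]
  | Push r b => [:: IAct r (fun x => (x, GoLeft, l.+1));
                    IAct r (fun _ => (Some b, Stay, k))]
  | Seq a b => comp a l (l + csize a) ++ comp b (l + csize a) k
  | Pop r a b e =>
      IAct r (fun x => match x with
                       | Some false => (None, GoRight, l.+1)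
                       | Some true => (None, GoRight, l.+1 + csize a)
                       | None => (None, Stay, l.+1 + csize a + csize b)
                       end) ::
      comp a l.+1 k ++ comp b (l.+1 + csize a) k ++
      comp e (l.+1 + csize a + csize b) k
  | Loop r a b =>
      IAct r (fun x => match x with
                       | Some false => (None, GoRight, l.+1)
                       | Some true => (None, GoRight, l.+1 + csize a)
                       | None => (None, Stay, k)
                       end) ::
      comp a l.+1 l ++ comp b (l.+1 + csize a) l
  | LoopT r a =>
      IAct r (fun x => match x with
                       | Some false => (None, GoRight, k)
                       | Some true => (None, GoRight, l.+1)
                       | None => (None, Stay, k)
                       end) :: comp a l.+1 l
  | Choose a b => IFork l.+1 (l.+1 + csize a) ::
      comp a l.+1 k ++ comp b (l.+1 + csize a) k
  | Ask a b => IAsk l.+1 (l.+1 + csize a) ::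
      comp a l.+1 k ++ comp b (l.+1 + csize a) k
  end.

Lemma size_comp c l k : size (comp c l k) = csize c.
Proof.
elim: c l k => //=.
- by move=> a IHa b IHb l k; rewrite size_cat IHa IHb.
- by move=> r a IHa b IHb e IHe l k; rewrite !size_cat IHa IHb IHe.
- by move=> r a IHa b IHb l k; rewrite !size_cat IHa IHb.
- by move=> r a IHa l k; rewrite IHa.
- by move=> a IHa b IHb l k; rewrite !size_cat IHa IHb.
- by move=> a IHa b IHb l k; rewrite !size_cat IHa IHb.
Qed.

Notation sym0 := (symbol (void : finType)).

Definition bit_of (x : sym0) : option bool :=
  if x is Some (inl b) then Some b else None.

Definition of_bit (x : option bool) : sym0 :=
  if x is Some b then Some (inl b) else None.

(* After [c], the top of stack [RA] decides on acceptance. *)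
Definition program (c : cmd) : seq instr :=
  let n := csize c in
  rcons (comp c 0 n)
    (IAct RA (fun x => (x, Stay, if x is Some true then n.+1 else n.+2))).

(** * Correctness of the compiled machine *)

Section Machine.
Variable c0 : cmd.
Let n0 := csize c0.
Let lab := 'I_n0.+3.
Let ins (q : lab) : instr := nth IHalt (program c0) q.

(** The labels [n0.+1] and [n0.+2] lie beyond the program, so [nth] reads [IHalt] there and no step
    is possible; the first of them is the accepting one. *)
Definition tm_trans (q : lab) (s : {ffun 'I_7 -> sym0}) (q' : lab)
    (a : {ffun 'I_7 -> sym0 * direction}) : bool :=
  `[< match ins q with
      | IAct r f =>
          let o := f (bit_of (s (idx r))) in
          q' = inord o.2 /\
          a = [ffun j => if j == idx r then (of_bit o.1.1, o.1.2)
                         else (s j, Stay)]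
      | IFork l1 l2 =>
          (q' = inord l1 \/ q' = inord l2) /\ a = [ffun j => (s j, Stay)]
      | _ => False
      end >].

Definition tm : machine :=
  @Machine 6 lab void (inord 0) (fun q => q == inord n0.+1)
    (fun q => if ins q is IAsk l1 l2 then Some (inord l1, inord l2) else None)
    tm_trans.

(** The top of the stack is under the head and the stack extends to the right. Left of the head
    there are only blanks, because a pop erases the cell before moving right; a push can therefore
    step left onto a blank. *)
Definition tape_ok (t : tape sym0) (w : seq bool) : Prop :=
  (exists i, left t = nseq i None) /\
  exists j, scanned t :: right t = [seq of_bit (Some b) | b <- w] ++ nseq j None.

Definition rep (x : config tm) (l : nat) (s : store) : Prop :=
  cstate x = inord l /\ forall r, tape_ok (ctapes x (idx r)) (get r s).

Lemma tape_ok_scanned t w : tape_ok t w -> bit_of (scanned t) = ohead w.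
Proof. by case=> _ [[|j]]; case: w => [|b w] //= [->]. Qed.

Lemma tape_ok_word t w : tape_ok t w -> @word tm t = w.
Proof.
rewrite /word => -[_ [j ->]].
by elim: w => [|b w IHw] /=; [case: j | rewrite IHw].
Qed.

Lemma tape_ok_pop t b w : tape_ok t (b :: w) ->
  tape_ok (@act tm (None, GoRight) t) w.
Proof.
case: t => l s r [[i /= ->] [j /= [_ ->]]].
split; first by exists i.+1.
case: w => [|b' w] /=; last by exists j.
by case: j => [|j]; [exists 1 | exists j.+1].
Qed.

Lemma tape_ok_push1 t w : tape_ok t w ->
  forall b, tape_ok (@act tm (of_bit (Some b), Stay)
    (@act tm (of_bit (bit_of (scanned t)), GoLeft) t)) (b :: w).
Proof.
move=> ok b; move: (ok) => /tape_ok_scanned ->; move: ok.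
case: t => l s r [[i /= ->] [j /= e]].
split; first by exists i.-1; rewrite /=; case: i.
exists j => /=; congr cons.
by case: w e => [|b' w] /=; [case: j => [|j] //= [_ ->] | case=> _ ->].
Qed.

Lemma act_same t : @act tm (scanned t, Stay) t = t.
Proof. by case: t. Qed.

Lemma load_ok w : tape_ok (load tm w) w.
Proof.
split; first by exists 0.
by case: w => [|b w]; [exists 1 | exists 0; rewrite /= cats0].
Qed.

(** An inevitability predicate. The demand for a successor rules out paths that get stuck before
    [Q], which would satisfy the universal clause vacuously. *)
Inductive hits (A : language) : nat -> config tm -> (config tm -> Prop) -> Prop :=
  | hits_now n x (Q : config tm -> Prop) : Q x -> hits A n x Q
  | hits_step n x Q : (exists y, step A x y) ->
      (forall y, step A x y -> hits A n y Q) -> hits A n.+1 x Q.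

Lemma hits_leq A n m x Q : hits A n x Q -> n <= m -> hits A m x Q.
Proof.
move=> h; elim: h m => {n x Q} [n x Q Qx|n x Q ex _ IH] m.
  by move=> _; apply: hits_now.
by case: m => // m le_nm; apply: hits_step => // y /IH; apply.
Qed.

Lemma hits_bind A n m x Q Q' : hits A n x Q ->
  (forall y, Q y -> hits A m y Q') -> hits A (n + m) x Q'.
Proof.
move=> h; elim: h => {n x Q} [n x Q Qx|n x Q ex _ IH] H.
  by apply: hits_leq (H _ Qx) (leq_addl _ _).
by rewrite addSn; apply: hits_step => // y sxy; apply: IH.
Qed.

Lemma hits_run_leq A n x k y :
  hits A n x (@halted tm A) -> run A k x y -> k <= n.
Proof.
move=> h; move eQ: (@halted tm A) h => Q h; elim: h eQ k => {n x Q}.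
  by move=> n x Q Qx eQ [|k] //= [d sxd]; move: Qx; rewrite -eQ => /(_ d sxd).
move=> n x Q ex _ IH eQ [|k] //= [d sxd rdy].
by rewrite ltnS; apply: IH rdy.
Qed.

Lemma hits_run A n x k y Q : hits A n x Q -> (forall z, Q z -> halted A z) ->
  run A k x y -> halted A y -> Q y.
Proof.
move=> h; elim: h k => {n x Q} [n x Q Qx|n x Q ex _ IH] k QH.
  by case: k => [|k] /=; [move=> <- | case=> d /(QH _ Qx)].
case: k => [|k] /=; first by move=> <- hx; case: ex => d /hx.
by case=> d sxd; apply: IH sxd _ QH.
Qed.

Lemma run_cat A m n (x y z : config tm) :
  run A m x y -> run A n y z -> run A (m + n) x z.
Proof.
elim: m x => [|m IH] x /=; first by move=> ->.
by case=> d sxd rdy ryz; exists d => //; apply: IH ryz.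
Qed.

(** Two halves because of nondeterminism: inevitability bounds all runs, as the time bound demands,
    and reachability of each store in [Q] provides the run that acceptance asks for. *)
Definition prog A n x k (Q : store -> Prop) : Prop :=
  hits A n x (fun y => exists2 s, Q s & rep y k s) /\
  forall s, Q s -> exists m, exists2 y, run A m x y & rep y k s.

Lemma prog_bind A n m x k k' (Q : store -> Prop) Q' : prog A n x k Q ->
  (forall s y, Q s -> rep y k s -> prog A m y k' (Q' s)) ->
  prog A (n + m) x k' (fun s' => exists2 s, Q s & Q' s s').
Proof.
case=> h ex H; split.
  apply: hits_bind h _ => y [s Qs rys].
  have [h' _] := H _ _ Qs rys.
  rewrite -[m]addn0; apply: hits_bind h' _ => z [s' Q's rz].
  by apply: hits_now; exists s' => //; exists s.
move=> s' [s Qs Q's]; have [i [y rxy rys]] := ex _ Qs.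
have [_ /(_ _ Q's) [j [z ryz rz]]] := H _ _ Qs rys.
by exists (i + j), z => //; apply: run_cat ryz.
Qed.

Lemma prog_step A n x k Q : (exists y, step A x y) ->
  (forall y, step A x y -> prog A n y k Q) -> prog A n.+1 x k Q.
Proof.
move=> [y sxy] H; split.
  by apply: hits_step; [exists y | move=> z /H []].
move=> s Qs; have [_ /(_ _ Qs) [i [z ryz rz]]] := H _ sxy.
by exists i.+1, z => //; exists y.
Qed.

Lemma prog_weaken A n m x k (Q Q' : store -> Prop) : prog A n x k Q -> n <= m ->
  (forall s, Q s <-> Q' s) -> prog A m x k Q'.
Proof.
move=> [h ex] le_nm eQ; split; last by move=> s /eQ /ex.
apply: hits_leq le_nm; rewrite -[n]addn0; apply: hits_bind h _ => y [s Qs r].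
by apply: hits_now; exists s => //; apply/eQ.
Qed.

Lemma prog_now A n x k s : rep x k s -> prog A n x k (eq s).
Proof.
move=> r; split; first by apply: hits_now; exists s.
by move=> _ <-; exists 0, x.
Qed.

Lemma step_act A x l s r f : rep x l s -> l < n0.+3 ->
  nth IHalt (program c0) l = IAct r f ->
  (exists y, step A x y) /\
  forall y, step A x y ->
    let o := f (ohead (get r s)) in
    cstate y = inord o.2 /\
    forall j, ctapes y j =
      if j == idx r then @act tm (of_bit o.1.1, o.1.2) (ctapes x j)
      else ctapes x j.
Proof.
case=> cx tx lt_l il.
have ex : ins (cstate x) = IAct r f by rewrite cx /ins inordK.
rewrite /step /= ex -(tape_ok_scanned (tx r)); split.
  by do 3!eexists; split=> //=; apply/asboolP; rewrite ex; split.
move=> y [q [a [/asboolP + ->]]] /=; rewrite ex => -[-> ->]; split=> [|j].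
  by rewrite !ffunE.
by rewrite !ffunE; case: eqP => // _; rewrite act_same.
Qed.

Lemma rep_same_tapes x l s (y : config tm) l' : rep x l s -> cstate y = inord l' ->
  (forall j, ctapes y j = ctapes x j) -> rep y l' s.
Proof. by case=> _ tx cy ty; split=> // r; rewrite ty. Qed.

Lemma rep_put x l s (y : config tm) l' r w : rep x l s -> cstate y = inord l' ->
  (forall j, j <> idx r -> ctapes y j = ctapes x j) ->
  tape_ok (ctapes y (idx r)) w -> rep y l' (put r w s).
Proof.
case=> _ tx cy ty tr; split=> // r'.
have [->|ne] := pselect (r' = r); first by rewrite get_put_eq.
by rewrite get_put_neq // ty // => /idx_inj.
Qed.

(* Reading an empty stack writes a blank over a blank. *)
Lemma act_blank x l s r : rep x l s -> get r s = [::] ->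
  @act tm (None, Stay) (ctapes x (idx r)) = ctapes x (idx r).
Proof.
case=> _ /(_ r) + e; rewrite e; case: (ctapes _ _) => tl sc tr [_ [[|j] //= [-> _]]].
by [].
Qed.

Lemma step_fork A x l s l1 l2 : rep x l s -> l < n0.+3 ->
  nth IHalt (program c0) l = IFork l1 l2 ->
  (exists2 y, step A x y & rep y l1 s) /\
  (exists2 y, step A x y & rep y l2 s) /\
  forall y, step A x y -> rep y l1 s \/ rep y l2 s.
Proof.
move=> rx lt_l il; case: (rx) => cx tx.
have ex : ins (cstate x) = IFork l1 l2 by rewrite cx /ins inordK.
have st q : q = inord l1 \/ q = inord l2 ->
    step A x (@Config tm q [ffun i => @act tm (scanned (ctapes x i), Stay) (ctapes x i)]).
  rewrite /step /= ex => eq; exists q, [ffun i => (scanned (ctapes x i), Stay)].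
  split; last by congr Config; apply/ffunP => i; rewrite !ffunE.
  apply/asboolP; rewrite ex; split => //.
  by apply/ffunP => i; rewrite !ffunE.
have rp q l' : q = inord l' ->
    rep (@Config tm q [ffun i => @act tm (scanned (ctapes x i), Stay) (ctapes x i)]) l' s.
  by move=> ->; apply: (rep_same_tapes rx) => // j; rewrite ffunE act_same.
split; last split.
- by eexists; [apply: (st (inord l1)); left | apply: rp].
- by eexists; [apply: (st (inord l2)); right | apply: rp].
move=> y; rewrite {1}/step /= ex => -[q [a [/asboolP + ->]]] /=; rewrite ex.
move=> [eq ->]; case: eq => eq; [left|right].
  apply: (rep_same_tapes rx) => //= j; by rewrite !ffunE act_same.
apply: (rep_same_tapes rx) => //= j; by rewrite !ffunE act_same.
Qed.

Lemma step_ask A x l s l1 l2 : rep x l s -> l < n0.+3 ->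
  nth IHalt (program c0) l = IAsk l1 l2 ->
  (exists y, step A x y) /\
  forall y, step A x y -> (A (get RO s) /\ rep y l1 s) \/
                          (~ A (get RO s) /\ rep y l2 s).
Proof.
move=> rx lt_l il; case: (rx) => cx tx.
have ex : ins (cstate x) = IAsk l1 l2 by rewrite cx /ins inordK.
have eo : ord_max = idx RO by apply: val_inj.
rewrite /step /= ex eo (tape_ok_word (tx RO)); split.
  have [Aw|nAw] := pselect (A (get RO s)).
    by eexists; left; split.
  by eexists; right; split.
by move=> y [[Aw ->]|[nAw ->]]; [left|right]; split=> //;
  apply: (rep_same_tapes rx).
Qed.

Definition code_at l (p : seq instr) : Prop :=
  forall i, i < size p -> nth IHalt (program c0) (l + i) = nth IHalt p i.

Lemma code_at_cons l i p : code_at l (i :: p) ->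
  nth IHalt (program c0) l = i /\ code_at l.+1 p.
Proof.
move=> H; split; first by have := H 0 isT; rewrite addn0.
by move=> j lt_j; have := H j.+1 lt_j; rewrite addnS.
Qed.

Lemma code_at_cat l p q : code_at l (p ++ q) ->
  code_at l p /\ code_at (l + size p) q.
Proof.
move=> H; split=> j lt_j.
  by rewrite H ?size_cat ?nth_cat ?lt_j // ltn_addr.
rewrite -addnA H ?size_cat ?ltn_add2l // nth_cat ltnNge leq_addr /=.
by rewrite addKn.
Qed.

Lemma prog_act A n x l s r f k Q : rep x l s -> l < n0.+3 ->
  nth IHalt (program c0) l = IAct r f ->
  (forall y : config tm, let o := f (ohead (get r s)) in
     cstate y = inord o.2 ->
     (forall j, ctapes y j =
       if j == idx r then @act tm (of_bit o.1.1, o.1.2) (ctapes x j)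
       else ctapes x j) -> prog A n y k Q) ->
  prog A n.+1 x k Q.
Proof.
move=> rx lt_l il H; have [ex al] := step_act A rx lt_l il.
by apply: prog_step => // y /al [cy ty]; apply: H.
Qed.

(* The first instruction of [Pop], [Loop] and [LoopT]. *)
Lemma prog_read A n x l s r f k Q b w : rep x l s -> l < n0.+3 ->
  nth IHalt (program c0) l = IAct r f -> get r s = b :: w ->
  (f (Some b)).1 = (None, GoRight) ->
  (forall y, rep y (f (Some b)).2 (put r w s) -> prog A n y k Q) ->
  prog A n.+1 x k Q.
Proof.
move=> rx lt_l il er ef H; apply: (prog_act rx lt_l il) => y /=.
rewrite er /= ef => cy ty; apply: H.
apply: (rep_put rx) => //; first by move=> j /eqP/negbTE ne; rewrite ty ne.
rewrite ty eqxx /=; case: rx => _ /(_ r); rewrite er; exact: tape_ok_pop.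
Qed.

Lemma prog_read_nil A n x l s r f k Q : rep x l s -> l < n0.+3 ->
  nth IHalt (program c0) l = IAct r f -> get r s = [::] ->
  (f None).1 = (None, Stay) ->
  (forall y, rep y (f None).2 s -> prog A n y k Q) ->
  prog A n.+1 x k Q.
Proof.
move=> rx lt_l il er ef H; apply: (prog_act rx lt_l il) => y /=.
rewrite er /= ef => cy ty; apply: H.
apply: (rep_same_tapes rx) => // j; rewrite ty; case: eqP => // -> /=.
exact: act_blank rx er.
Qed.

(** Induction on the run rather than on the command, since a loop body is followed by another run of
    the same loop. *)
Lemma sem_prog A c s n Q : sem A c s n Q -> forall l k x,
  code_at l (comp c l k) -> l + csize c <= n0 -> rep x l s ->
  prog A n x k Q.
Proof.
elim=> {c s n Q}.
- move=> c s n m Q Q' _ IH le_nm eQ l k x ca lc rx.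
  by apply: prog_weaken (IH _ _ _ ca lc rx) le_nm eQ.
- move=> s l k x /= /code_at_cons [il _] lc rx.
  have lt_l : l < n0.+3 by lia.
  have [[y sy _] [_ al]] := step_fork A rx lt_l il.
  by apply: prog_step; [exists y | move=> z /al [] rz; apply: prog_now].
- move=> r b s l k x /= /code_at_cons [i1 /code_at_cons [i2 _]] lc rx.
  have lt_l : l < n0.+3 by lia.
  have lt_l1 : l.+1 < n0.+3 by lia.
  have [ex al] := step_act A rx lt_l i1.
  apply: prog_step => // y /al /= [cy ty].
  have ey : ins (cstate y) = IAct r (fun=> (Some b, Stay, k)).
    by rewrite cy /ins inordK.
  apply: prog_step.
    rewrite /step /= ey; do 3!eexists; split=> //=.
    by apply/asboolP; rewrite ey; split.
  move=> z; rewrite {1}/step /= ey => -[q [a [/asboolP + ->]]]; rewrite ey /=.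
  move=> [-> ->]; apply: prog_now.
  apply: (rep_put rx) => //=.
    move=> j /eqP/negbTE ne; rewrite !ffunE ne act_same ty ne //.
  rewrite !ffunE eqxx ty eqxx; case: (rx) => _ /(_ r) tr.
  rewrite -(tape_ok_scanned tr); exact: tape_ok_push1.
- move=> c1 c2 s n m Q1 Q2 _ IH1 _ IH2 l k x /= ca lc rx.
  have [ca1 ca2] := code_at_cat ca; rewrite size_comp in ca2.
  apply: (@prog_bind A n m x (l + csize c1)).
    by apply: (IH1 _ _ _ ca1) => //; lia.
  by move=> s1 y Qs1 ry; apply: (IH2 s1 Qs1 _ _ _ ca2) => //; lia.
- move=> r c1 c2 ce s n Q er _ IH l k x /= /code_at_cons [il ca] lc rx.
  have [ca1 ca'] := code_at_cat ca; have [ca2 ca3] := code_at_cat ca'.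
  rewrite !size_comp in ca2 ca3.
  apply: (prog_read_nil rx _ il er) => //=; first by lia.
  by move=> y ry; apply: IH ry => //; lia.
- move=> r c1 c2 ce s b w n Q er _ IH l k x /= /code_at_cons [il ca] lc rx.
  have [ca1 ca'] := code_at_cat ca; have [ca2 ca3] := code_at_cat ca'.
  rewrite !size_comp in ca2 ca3.
  apply: (prog_read rx _ il er) => //=; [by lia | by case: b er IH |].
  by case: b er IH => er IH y /= ry; apply: IH ry => //; lia.
- move=> r c1 c2 s er l k x /= /code_at_cons [il ca] lc rx.
  apply: (prog_read_nil rx _ il er) => //=; first by lia.
  by move=> y ry; apply: prog_now.
- move=> r c1 c2 s b w n m Q1 Q2 er _ IH1 _ IH2 l k x /= ca lc rx.
  have [il ca'] := code_at_cons ca.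
  have [ca1 ca2] := code_at_cat ca'; rewrite !size_comp in ca2.
  apply: (prog_read rx _ il er) => //=; [by lia | by case: b er IH1 |].
  (* The body was compiled with exit label [l], the label of the loop itself, so the remaining
     iterations run the same piece of code. *)
  move=> y ry; apply: (@prog_bind A n m y l); last first.
    by move=> s1 z Qs1 rz; apply: (IH2 s1 Qs1 l).
  by case: b er IH1 ry => er IH1 /= ry; apply: IH1 ry => //; lia.
- move=> r c s w er l k x /= /code_at_cons [il ca] lc rx.
  apply: (prog_read rx _ il er) => //=; first by lia.
  by move=> y ry; apply: prog_now.
- move=> r c s w n m Q1 Q2 er _ IH1 _ IH2 l k x /= ca lc rx.
  have [il ca'] := code_at_cons ca.
  apply: (prog_read rx _ il er) => //=; first by lia.
  move=> y ry; apply: (@prog_bind A n m y l); last first.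
    by move=> s1 z Qs1 rz; apply: (IH2 s1 Qs1 l).
  by apply: IH1 ry => //; lia.
- move=> c1 c2 s n Q1 Q2 _ IH1 _ IH2 l k x /= /code_at_cons [il ca] lc rx.
  have [ca1 ca2] := code_at_cat ca; rewrite !size_comp in ca2.
  have lt_l : l < n0.+3 by lia.
  have [[y1 sy1 r1] [[y2 sy2 r2] al]] := step_fork A rx lt_l il.
  have P1 y : rep y l.+1 s -> prog A n y k Q1 by move=> ry; apply: IH1 ry => //; lia.
  have P2 y : rep y (l.+1 + csize c1) s -> prog A n y k Q2.
    by move=> ry; apply: IH2 ry => //; lia.
  split.
    apply: hits_step; first by exists y1.
    move=> y /al [/P1|/P2] [h _]; rewrite -[n]addn0; apply: hits_bind h _.
      by move=> z [s' Q' rz]; apply: hits_now; exists s' => //; left.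
    by move=> z [s' Q' rz]; apply: hits_now; exists s' => //; right.
  move=> s' [Q'|Q'].
    have [_ /(_ _ Q') [i [z rz rz']]] := P1 _ r1.
    by exists i.+1, z => //; exists y1.
  have [_ /(_ _ Q') [i [z rz rz']]] := P2 _ r2.
  by exists i.+1, z => //; exists y2.
- move=> c1 c2 s n Q As _ IH l k x /= /code_at_cons [il ca] lc rx.
  have [ca1 ca2] := code_at_cat ca; rewrite !size_comp in ca2.
  have lt_l : l < n0.+3 by lia.
  have [ex al] := step_ask A rx lt_l il.
  apply: prog_step => // y /al [[_ ry]|[]//]; apply: IH ry => //; lia.
- move=> c1 c2 s n Q As _ IH l k x /= /code_at_cons [il ca] lc rx.
  have [ca1 ca2] := code_at_cat ca; rewrite !size_comp in ca2.
  have lt_l : l < n0.+3 by lia.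
  have [ex al] := step_ask A rx lt_l il.
  apply: prog_step => // y /al [[]//|[_ ry]]; apply: IH ry => //; lia.
Qed.

Definition init_store (w : seq bool) : store := Store w [::] [::] [::] [::] [::] [::].

Lemma rep_init w : rep (init tm w) 0 (init_store w).
Proof.
split=> // r; rewrite /= ffunE.
have -> : (idx r == ord0) = (if r is RI then true else false) by case: r.
by case: r => /=; apply: load_ok.
Qed.

Lemma sem_machine A w n Q : sem A c0 (init_store w) n Q ->
  [/\ forall k y, run A k (init tm w) y -> k <= n.+1,
      accepts tm A w <-> exists2 s, Q s & head false (rA s)
    & forall s, Q s -> exists k y, [/\ run A k (init tm w) y, halted A y
                                     & word (ctapes y ord_max) = rO s]].
Proof.
move=> /sem_prog /(_ 0 n0 (init tm w)) P.
have {P} [h ex] : prog A n (init tm w) n0 Q.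
  apply: P; last exact: rep_init; last by rewrite add0n.
  move=> i; rewrite size_comp add0n => lt_i.
  by rewrite /program nth_rcons size_comp lt_i.
(* The instruction appended to the compiled code inspects the top of [RA]; it accounts for the
   additional step in [n.+1]. *)
have il : nth IHalt (program c0) n0 =
    IAct RA (fun x => (x, Stay, if x is Some true then n0.+1 else n0.+2)).
  by rewrite /program nth_rcons size_comp ltnn eqxx.
have halt l (y : config tm) : n0 < l < n0.+3 -> cstate y = inord l :> lab -> halted A y.
  move=> /andP [lt1 lt2] cy z.
  have ey : ins (cstate y) = IHalt.
    by rewrite cy /ins inordK // nth_default // size_rcons size_comp.
  by rewrite /step /= ey => -[q [a [/asboolP]]]; rewrite ey.
have eo : ord_max = idx RO by apply: val_inj.
pose Qf y := exists2 s, Q s &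
  rep y (if head false (rA s) then n0.+1 else n0.+2) s.
have last y s : Q s -> rep y n0 s -> (exists z, step A y z) /\
    forall z, step A y z -> rep z (if head false (rA s) then n0.+1 else n0.+2) s.
  move=> Qs ry; have [|ez al] := step_act A ry _ il; first by lia.
  split=> // z /al /= [cz tz].
  have -> : (if head false (rA s) then n0.+1 else n0.+2) =
    (if ohead (rA s) is Some true then n0.+1 else n0.+2) by case: (rA s).
  apply: (rep_same_tapes ry) => // j; rewrite tz; case: eqP => // ->.
  case: ry => _ /(_ RA) tA; rewrite -(tape_ok_scanned tA).
  have -> : of_bit (bit_of (scanned (ctapes y (idx RA)))) =
     scanned (ctapes y (idx RA)) by case: (scanned _) => [[]|].
  exact: act_same.
have Qfh y : Qf y -> halted A y.
  by case=> s _ [cy _]; apply: (halt _ _ _ cy); case: ifP => _; lia.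
have hf : hits A n.+1 (init tm w) Qf.
  rewrite -addn1; apply: hits_bind h _ => y [s Qs /(last _ _ Qs) [ez al]].
  by apply: hits_step => // z /al rz; apply: hits_now; exists s.
have exf s : Q s -> exists m, exists2 z, run A m (init tm w) z &
    rep z (if head false (rA s) then n0.+1 else n0.+2) s.
  move=> Qs; have [i [y rxy ry]] := ex _ Qs.
  have [[z sz] /(_ _ sz) rz] := last _ _ Qs ry.
  by exists (i + 1), z => //; apply: run_cat rxy _; exists z.
split.
- move=> k y; apply: hits_run_leq.
  rewrite -[n.+1]addn0; apply: hits_bind hf _ => z /Qfh; exact: hits_now.
- split=> [[k [y [rxy hy ay]]]|[s Qs hs]].
    have [s Qs [cy _]] := hits_run hf Qfh rxy hy.
    exists s => //; move: ay; rewrite cy /=; case: ifP => // _ /eqP.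
    by move=> /(congr1 val); rewrite /= !inordK //; lia.
  have [m [z rxz rz]] := exf _ Qs; exists m, z; split=> //.
    by apply: Qfh; exists s.
  by case: rz => -> _; rewrite hs /=.
- move=> s Qs; have [m [z rxz rz]] := exf _ Qs; exists m, z; split=> //.
    by apply: Qfh; exists s.
  by rewrite eo; apply: tape_ok_word; case: rz => _ /(_ RO).
Qed.

End Machine.

(** * Polynomial bounds *)

(** The base [n + 2] is at least 2 even at [n = 0], so powers are monotone in the exponent and
    absorb constants and sums. *)
Definition pbounded (p : nat -> nat) : Prop := exists e, forall n, p n <= (n + 2) ^ e.

Lemma pbounded_leq p q : pbounded q -> (forall n, p n <= q n) -> pbounded p.
Proof. by move=> [e He] H; exists e => n; apply: leq_trans (H n) (He n). Qed.

Lemma pbounded_const c : pbounded (fun=> c).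
Proof.
exists c => n; apply: leq_trans (ltnW (ltn_expl c (ltnSn 1))) _.
by case: c => // c; rewrite leq_exp2r ?leq_addl.
Qed.

Lemma expn2_mono n e e' : e <= e' -> (n + 2) ^ e <= (n + 2) ^ e'.
Proof. by move=> le_e; rewrite leq_pexp2l // addn2. Qed.

Lemma pbounded_id : pbounded id.
Proof. by exists 1 => n; rewrite expn1 leq_addr. Qed.

Lemma pbounded_add p q : pbounded p -> pbounded q -> pbounded (fun n => p n + q n).
Proof.
move=> [e He] [f Hf]; exists (maxn e f).+1 => n.
have h1 := leq_trans (He n) (expn2_mono n (leq_maxl e f)).
have h2 := leq_trans (Hf n) (expn2_mono n (leq_maxr e f)).
apply: leq_trans (leq_add h1 h2) _; rewrite expnS addnn -mul2n leq_mul2r.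
by rewrite addn2 orbT.
Qed.

Lemma pbounded_mul p q : pbounded p -> pbounded q -> pbounded (fun n => p n * q n).
Proof. by move=> [e He] [f Hf]; exists (e + f) => n; rewrite expnD leq_mul. Qed.

Lemma pbounded_exp p e : pbounded p -> pbounded (fun n => p n ^ e).
Proof.
move=> Hp; elim: e => [|e IHe]; first exact: pbounded_const 1.
by apply: pbounded_leq (pbounded_mul Hp IHe) _ => n; rewrite expnS.
Qed.

Lemma pbounded_S p : pbounded p -> pbounded (fun n => (p n).+1).
Proof.
by move=> Hp; apply: pbounded_leq (pbounded_add Hp (pbounded_const 1)) _ => n;
  rewrite addn1.
Qed.

Ltac pbd := repeat match goal with
  | |- pbounded ?f => lazymatch f with
                      | (fun _ => _) => fail
                      | _ => change (pbounded (fun n => f n))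
                      end
  | |- pbounded (fun=> _) => apply: pbounded_const
  | |- pbounded (fun n => n) => exact: pbounded_id
  | |- pbounded (fun n => _ + _) => apply: pbounded_add
  | |- pbounded (fun n => _ * _) => apply: pbounded_mul
  | |- pbounded (fun n => _ ^ _) => apply: pbounded_exp
  | |- pbounded (fun n => _.+1) => apply: pbounded_S
  end.

Lemma leq_bound n m e : n <= m -> (n + 2) ^ e <= (m + 2) ^ e.
Proof. by move=> le_nm; case: e => // e; rewrite leq_exp2r // leq_add2r. Qed.

(** * Functions on binary trees *)

(** Unlabelled binary trees are the one data type of the programs. Their prefix code is
    self-delimiting, so several trees can lie on one stack without separators. *)
Inductive tree := Leaf | Node of tree & tree.

Fixpoint tsize (t : tree) : nat :=
  if t is Node a b then (tsize a + tsize b).+1 else 0.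

Fixpoint tcode (t : tree) : seq bool :=
  if t is Node a b then true :: tcode a ++ tcode b else [:: false].

Lemma size_tcode t : size (tcode t) = (tsize t).*2.+1.
Proof. by elim: t => //= a IHa b IHb; rewrite size_cat IHa IHb; lia. Qed.

Lemma tcode_cat_inj t u a b : tcode t ++ a = tcode u ++ b -> t = u /\ a = b.
Proof.
elim: t u a b => [|t1 IH1 t2 IH2] [|u1 u2] a b //=; first by case.
by rewrite -!catA => -[/IH1 [-> /IH2 [-> ->]]].
Qed.

Definition tleft (t : tree) : tree := if t is Node a _ then a else Leaf.
Definition tright (t : tree) : tree := if t is Node _ b then b else Leaf.

(** * Deterministic programs on trees *)

Section Det.
Variable A : language.

Definition dsem c s n s' : Prop := sem A c s n (eq s').

Lemma dsem_weaken c s n m s' : dsem c s n s' -> n <= m -> dsem c s m s'.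
Proof. by move=> h le_nm; apply: sem_weaken h le_nm _. Qed.

Lemma dsem_seq c1 c2 s1 s2 s3 n m : dsem c1 s1 n s2 -> dsem c2 s2 m s3 ->
  dsem (Seq c1 c2) s1 (n + m) s3.
Proof.
move=> h1 h2; have H := @sem_seq A c1 c2 s1 n m _ (fun _ => eq s3) h1.
apply: (sem_weaken (H _)) => //; first by move=> _ <-.
by move=> s'; split=> [[_ _ ->]|<-] //; exists s2.
Qed.

Lemma dsem_pop r c0 c1 ce s b w n s' : get r s = b :: w ->
  dsem (if b then c1 else c0) (put r w s) n s' -> dsem (Pop r c0 c1 ce) s n.+1 s'.
Proof. exact: sem_pop. Qed.

Lemma dsem_pop_false r c0 c1 ce s w n s' : get r s = false :: w ->
  dsem c0 (put r w s) n s' -> dsem (Pop r c0 c1 ce) s n.+1 s'.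
Proof. by move=> e; apply: dsem_pop e. Qed.

Lemma dsem_pop_true r c0 c1 ce s w n s' : get r s = true :: w ->
  dsem c1 (put r w s) n s' -> dsem (Pop r c0 c1 ce) s n.+1 s'.
Proof. by move=> e; apply: dsem_pop e. Qed.

Lemma dsem_loop r c0 c1 s b w n m s1 s' : get r s = b :: w ->
  dsem (if b then c1 else c0) (put r w s) n s1 ->
  dsem (Loop r c0 c1) s1 m s' -> dsem (Loop r c0 c1) s (n + m).+1 s'.
Proof.
move=> e h1 h2; have H := @sem_loop A r c0 c1 s b w n m _ (fun _ => eq s') e h1.
apply: (sem_weaken (H _)) => //; first by move=> _ <-.
by move=> s''; split=> [[_ _ ->]|<-] //; exists s1.
Qed.

Lemma dsem_loop_nil r c0 c1 s : get r s = [::] -> dsem (Loop r c0 c1) s 1 s.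
Proof. exact: sem_loop_nil. Qed.

Lemma dsem_loopT r c s w n m s1 s' : get r s = true :: w ->
  dsem c (put r w s) n s1 -> dsem (LoopT r c) s1 m s' ->
  dsem (LoopT r c) s (n + m).+1 s'.
Proof.
move=> e h1 h2; have H := @sem_loopT A r c s w n m _ (fun _ => eq s') e h1.
apply: (sem_weaken (H _)) => //; first by move=> _ <-.
by move=> s''; split=> [[_ _ ->]|<-] //; exists s1.
Qed.

Lemma dsem_push r b s : dsem (Push r b) s 2 (put r (b :: get r s) s).
Proof. exact: sem_push. Qed.

Lemma dsem_skip s : dsem Skip s 1 s.
Proof. exact: sem_skip. Qed.

(* [walk cl cn] consumes the top tree of [RA], running [cl] on each leaf and
   [cn] on each node; [RD] counts the subtrees that remain to be read. *)
Definition walk_loop cl cn :=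
  Loop RD Skip (Pop RA cl (Seq (Seq (Push RD true) (Push RD true)) cn) Skip).
Definition walk cl cn := Seq (Push RD true) (walk_loop cl cn).

Definition move_tree r := walk (Push r false) (Push r true).

(** The rest of the loop enters as a hypothesis because the end of a subtree does not end the loop:
    [RD] still counts the subtrees to come. Ten steps per code bit are a generous bound; a node
    costs eight. *)
Lemma dsem_move_loop_B t i a b c d e o n s' :
  dsem (walk_loop (Push RB false) (Push RB true))
    (Store i a (rev (tcode t) ++ b) c d e o) n s' ->
  dsem (walk_loop (Push RB false) (Push RB true))
    (Store i (tcode t ++ a) b c (true :: d) e o) (n + 10 * size (tcode t)) s'.
Proof.
elim: t a b d n => [|u IHu v IHv] a b d n h /=.
  apply: dsem_weaken (dsem_loop (s1 := Store i a (false :: b) c d e o) _ _ h) _;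
    first reflexivity.
    by apply: dsem_pop; [reflexivity | apply: dsem_push].
  by rewrite /=; lia.
have h1 : dsem (walk_loop (Push RB false) (Push RB true))
   (Store i ((tcode u ++ tcode v) ++ a) (true :: b) c (true :: true :: d) e o)
   (n + 10 * size (tcode v) + 10 * size (tcode u)) s'.
  rewrite -catA; apply: IHu; apply: IHv.
  by move: h; rewrite /= rev_cons rev_cat -cats1 -!catA.
apply: dsem_weaken (dsem_loop _ _ h1) _; first reflexivity.
  apply: dsem_pop; first reflexivity.
  exact: dsem_seq (dsem_seq (dsem_push _ _ _) (dsem_push _ _ _)) (dsem_push _ _ _).
by rewrite size_cat; lia.
Qed.

Lemma dsem_move_B t i a b c e o :
  dsem (move_tree RB) (Store i (tcode t ++ a) b c [::] e o)
    (10 * size (tcode t) + 3) (Store i a (rev (tcode t) ++ b) c [::] e o).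
Proof.
apply: dsem_weaken (dsem_seq (dsem_push _ _ _) _) _ => /=.
- by apply: dsem_move_loop_B; apply: dsem_loop_nil.
- lia.
Qed.

Lemma dsem_move_loop_E t i a b c d e o n s' :
  dsem (walk_loop (Push RE false) (Push RE true))
    (Store i a b c d (rev (tcode t) ++ e) o) n s' ->
  dsem (walk_loop (Push RE false) (Push RE true))
    (Store i (tcode t ++ a) b c (true :: d) e o) (n + 10 * size (tcode t)) s'.
Proof.
elim: t a e d n => [|u IHu v IHv] a e d n h /=.
  apply: dsem_weaken (dsem_loop (s1 := Store i a b c d (false :: e) o) _ _ h) _;
    first reflexivity.
    by apply: dsem_pop; [reflexivity | apply: dsem_push].
  by rewrite /=; lia.
have h1 : dsem (walk_loop (Push RE false) (Push RE true))
   (Store i ((tcode u ++ tcode v) ++ a) b c (true :: true :: d) (true :: e) o)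
   (n + 10 * size (tcode v) + 10 * size (tcode u)) s'.
  rewrite -catA; apply: IHu; apply: IHv.
  by move: h; rewrite /= rev_cons rev_cat -cats1 -!catA.
apply: dsem_weaken (dsem_loop _ _ h1) _; first reflexivity.
  apply: dsem_pop; first reflexivity.
  exact: dsem_seq (dsem_seq (dsem_push _ _ _) (dsem_push _ _ _)) (dsem_push _ _ _).
by rewrite size_cat; lia.
Qed.

Lemma dsem_move_E t i a b c e o :
  dsem (move_tree RE) (Store i (tcode t ++ a) b c [::] e o)
    (10 * size (tcode t) + 3) (Store i a b c [::] (rev (tcode t) ++ e) o).
Proof.
apply: dsem_weaken (dsem_seq (dsem_push _ _ _) _) _ => /=.
- by apply: dsem_move_loop_E; apply: dsem_loop_nil.
- lia.
Qed.

Definition drop_tree := walk Skip Skip.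

Lemma dsem_drop_loop t i a b c d e o n s' :
  dsem (walk_loop Skip Skip) (Store i a b c d e o) n s' ->
  dsem (walk_loop Skip Skip)
    (Store i (tcode t ++ a) b c (true :: d) e o) (n + 10 * size (tcode t)) s'.
Proof.
elim: t a d n => [|u IHu v IHv] a d n h /=.
  apply: dsem_weaken (dsem_loop (s1 := Store i a b c d e o) _ _ h) _;
    first reflexivity.
    by apply: dsem_pop; [reflexivity | apply: dsem_skip].
  by rewrite /=; lia.
have h1 : dsem (walk_loop Skip Skip)
   (Store i ((tcode u ++ tcode v) ++ a) b c (true :: true :: d) e o)
   (n + 10 * size (tcode v) + 10 * size (tcode u)) s'.
  by rewrite -catA; apply: IHu; apply: IHv.
apply: dsem_weaken (dsem_loop _ _ h1) _; first reflexivity.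
  apply: dsem_pop; first reflexivity.
  exact: dsem_seq (dsem_seq (dsem_push _ _ _) (dsem_push _ _ _)) (dsem_skip _).
by rewrite size_cat; lia.
Qed.

Lemma dsem_drop t i a b c e o :
  dsem drop_tree (Store i (tcode t ++ a) b c [::] e o)
    (10 * size (tcode t) + 3) (Store i a b c [::] e o).
Proof.
apply: dsem_weaken (dsem_seq (dsem_push _ _ _) _) _ => /=.
- by apply: dsem_drop_loop; apply: dsem_loop_nil.
- lia.
Qed.

Definition count_tree := walk Skip (Push RC true).

Lemma dsem_count_loop t i a b c d e o n s' :
  dsem (walk_loop Skip (Push RC true))
    (Store i a b (nseq (tsize t) true ++ c) d e o) n s' ->
  dsem (walk_loop Skip (Push RC true))
    (Store i (tcode t ++ a) b c (true :: d) e o) (n + 10 * size (tcode t)) s'.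
Proof.
elim: t a c d n => [|u IHu v IHv] a c d n h /=.
  apply: dsem_weaken (dsem_loop (s1 := Store i a b c d e o) _ _ h) _;
    first reflexivity.
    by apply: dsem_pop; [reflexivity | apply: dsem_skip].
  by rewrite /=; lia.
have h1 : dsem (walk_loop Skip (Push RC true))
   (Store i ((tcode u ++ tcode v) ++ a) b (true :: c) (true :: true :: d) e o)
   (n + 10 * size (tcode v) + 10 * size (tcode u)) s'.
  rewrite -catA; apply: IHu; apply: IHv.
  move: h => /=; congr dsem; congr Store.
  rewrite -cat_rcons -cats1 -(nseqD _ 1) catA -nseqD.
  rewrite -[true :: _ ++ c](_ : nseq (tsize u + tsize v).+1 true ++ c = _) //.
  by congr (nseq _ _ ++ _); lia.
apply: dsem_weaken (dsem_loop _ _ h1) _; first reflexivity.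
  apply: dsem_pop; first reflexivity.
  exact: dsem_seq (dsem_seq (dsem_push _ _ _) (dsem_push _ _ _)) (dsem_push _ _ _).
by rewrite size_cat; lia.
Qed.

Lemma dsem_count t i a b c e o :
  dsem count_tree (Store i (tcode t ++ a) b c [::] e o)
    (10 * size (tcode t) + 3) (Store i a b (nseq (tsize t) true ++ c) [::] e o).
Proof.
apply: dsem_weaken (dsem_seq (dsem_push _ _ _) _) _ => /=.
- by apply: dsem_count_loop; apply: dsem_loop_nil.
- lia.
Qed.

Definition move_all r r' := Loop r (Push r' false) (Push r' true).
Definition move_all2 r r1 r2 := Loop r (Seq (Push r1 false) (Push r2 false))
                                       (Seq (Push r1 true) (Push r2 true)).

Lemma dsem_move_all r r' w s : r <> r' -> get r s = w ->
  dsem (move_all r r') s (3 * size w + 1)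
    (put r' (rev w ++ get r' s) (put r [::] s)).
Proof.
move=> ne; elim: w s => [|b w IHw] s e.
  have -> : put r' (rev [::] ++ get r' s) (put r [::] s) = s.
    by move: e; case: s; case: r ne; case: r' => //= *; subst.
  by apply: dsem_weaken (dsem_loop_nil _ _ e) _.
pose s1 := put r' (b :: get r' s) (put r w s).
have e1 : get r s1 = w by rewrite get_put_neq // get_put_eq.
have -> : put r' (rev (b :: w) ++ get r' s) (put r [::] s) =
    put r' (rev w ++ get r' s1) (put r [::] s1).
  by move: ne; rewrite /s1 rev_cons cat_rcons; case: s {e s1 e1}; case: r {IHw}; case: r'.
have hb : dsem (if b then Push r' true else Push r' false) (put r w s) 2 s1.
  have := dsem_push r' b (put r w s); rewrite get_put_neq; last by move=> e'; apply: ne.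
  by rewrite /s1; case: b {e s1 e1}.
by apply: dsem_weaken (dsem_loop e hb (IHw _ e1)) _; rewrite /=; lia.
Qed.

Lemma dsem_move_all2 i a b c d e o :
  dsem (move_all2 RB RA RE) (Store i a b c d e o) (5 * size b + 1)
    (Store i (rev b ++ a) [::] c d (rev b ++ e) o).
Proof.
elim: b a e => [|x b IHb] a e.
  by apply: dsem_weaken (dsem_loop_nil _ _ _) _.
rewrite !rev_cons !cat_rcons.
have hb : dsem (if x then Seq (Push RA true) (Push RE true)
                else Seq (Push RA false) (Push RE false))
    (Store i a b c d e o) 4 (Store i (x :: a) b c d (x :: e) o).
  by case: x; apply: (dsem_seq (dsem_push _ _ _) (dsem_push _ _ _)).
apply: (@dsem_weaken _ _ (4 + (5 * size b + 1)).+1); last by rewrite /=; lia.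
by apply: (dsem_loop _ _ (IHb _ _)); [reflexivity | exact: hb].
Qed.

(** Each move of a stack reverses it. The copy on [RE] is already in reading order, so it returns to
    [RA] through [RB], reversed twice. *)
Definition dup_tree := Seq (move_tree RB)
  (Seq (move_all2 RB RA RE) (Seq (move_all RE RB) (move_all RB RA))).

Lemma dsem_dup t i a c o :
  dsem dup_tree (Store i (tcode t ++ a) [::] c [::] [::] o)
    (60 * (tsize t + 2)) (Store i (tcode t ++ tcode t ++ a) [::] c [::] [::] o).
Proof.
have h1 := dsem_move_B t i a [::] c [::] o; rewrite cats0 in h1.
have h2 := dsem_move_all2 i a (rev (tcode t)) c [::] [::] o.
rewrite revK cats0 in h2.
have h3 := @dsem_move_all RE RB _
  (Store i (tcode t ++ a) [::] c [::] (tcode t) o) ltac:(by []) erefl.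
rewrite /= cats0 in h3.
have h4 := @dsem_move_all RB RA _
  (Store i (tcode t ++ a) (rev (tcode t)) c [::] [::] o) ltac:(by []) erefl.
rewrite /= revK in h4.
apply: dsem_weaken (dsem_seq h1 (dsem_seq h2 (dsem_seq h3 h4))) _.
by rewrite ?size_rev !size_tcode; lia.
Qed.

Definition swap_tree := Seq (move_tree RB)
  (Seq (move_tree RE) (Seq (move_all RB RA) (move_all RE RA))).

Lemma dsem_swap t u i a c o :
  dsem swap_tree (Store i (tcode t ++ tcode u ++ a) [::] c [::] [::] o)
    (60 * (tsize t + tsize u + 2))
    (Store i (tcode u ++ tcode t ++ a) [::] c [::] [::] o).
Proof.
have h1 := dsem_move_B t i (tcode u ++ a) [::] c [::] o; rewrite cats0 in h1.
have h2 := dsem_move_E u i a (rev (tcode t)) c [::] o; rewrite cats0 in h2.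
have h3 := @dsem_move_all RB RA _
  (Store i a (rev (tcode t)) c [::] (rev (tcode u)) o) ltac:(by []) erefl.
rewrite /= revK in h3.
have h4 := @dsem_move_all RE RA _
  (Store i (tcode t ++ a) [::] c [::] (rev (tcode u)) o) ltac:(by []) erefl.
rewrite /= revK in h4.
apply: dsem_weaken (dsem_seq h1 (dsem_seq h2 (dsem_seq h3 h4))) _.
by rewrite ?size_rev !size_tcode; lia.
Qed.

Fixpoint push_word r (w : seq bool) : cmd :=
  if w is b :: w' then Seq (push_word r w') (Push r b) else Skip.

Lemma dsem_push_word r w s :
  dsem (push_word r w) s (2 * size w + 1) (put r (w ++ get r s) s).
Proof.
elim: w s => [|b w IHw] s /=.
  have -> : put r (get r s) s = s by case: s; case: r.
  exact: dsem_skip.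
have -> : put r (b :: w ++ get r s) s =
    put r (b :: get r (put r (w ++ get r s) s)) (put r (w ++ get r s) s).
  by case: s; case: r {IHw}.
by apply: dsem_weaken (dsem_seq (IHw s) (dsem_push r b _)) _; lia.
Qed.

End Det.

Fixpoint plain (c : cmd) : bool :=
  match c with
  | Skip | Push _ _ => true
  | Seq a b | Loop _ a b => plain a && plain b
  | Pop _ a b e => [&& plain a, plain b & plain e]
  | LoopT _ a => plain a
  | Choose _ _ | Ask _ _ => false
  end.

Lemma plain_push_word r w : plain (push_word r w).
Proof. by elim: w => //= b w ->. Qed.

(** The word below the tree on [RA], and the contents of [RI], [RC] and [RO], are arbitrary and
    preserved. This lets programs be nested: pending values wait under the argument, counters of
    outer loops wait in [RC]. *)
Definition tcomputes (c : cmd) (n : nat) (t t' : tree) : Prop :=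
  forall A i a k o, dsem A c (Store i (tcode t ++ a) [::] k [::] [::] o) n
                             (Store i (tcode t' ++ a) [::] k [::] [::] o).

(* One program takes [u x] to [v x] for all [x], with cost and result size
   polynomially bounded in the size of [u x]. *)
Definition tmap X (u v : X -> tree) : Prop :=
  exists c e, [/\ plain c,
    forall x, tcomputes c ((tsize (u x) + 2) ^ e) (u x) (v x) &
    forall x, tsize (v x) <= (tsize (u x) + 2) ^ e].

Section Tmap.
Variable X : Type.
Implicit Types u v w : X -> tree.

Lemma tmap_intro u v c p q : plain c -> pbounded p -> pbounded q ->
  (forall x, tcomputes c (p (tsize (u x))) (u x) (v x)) ->
  (forall x, tsize (v x) <= q (tsize (u x))) -> tmap u v.
Proof.
move=> pc [e He] [f Hf] H1 H2; exists c, (maxn e f); split=> // x.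
  move=> A i a k o; apply: dsem_weaken (H1 _ _ _ _ _ _) _.
  exact: leq_trans (He _) (expn2_mono _ (leq_maxl _ _)).
apply: leq_trans (H2 x) (leq_trans (Hf _) (expn2_mono _ (leq_maxr _ _))).
Qed.

Lemma tmap_ext u v v' : tmap u v -> v =1 v' -> tmap u v'.
Proof.
by move=> [c [e [pc h1 h2]]] eFG; exists c, e; split=> // t; rewrite -eFG.
Qed.

Lemma tmap_reindex Y (h : Y -> X) u v : tmap u v -> tmap (u \o h) (v \o h).
Proof. by move=> [c [e [pc h1 h2]]]; exists c, e; split=> // y; [apply: h1|apply: h2]. Qed.

Lemma tmap_id u : tmap u u.
Proof.
apply: (@tmap_intro _ _ Skip (fun=> 1) id) => //; pbd.
by move=> t A i a k o; apply: dsem_skip.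
Qed.

Lemma tmap_comp u v w : tmap u v -> tmap v w -> tmap u w.
Proof.
move=> [c [e [pc h1 h2]]] [d [f [pd g1 g2]]].
apply: (@tmap_intro _ _ (Seq c d)
  (fun n => (n + 2) ^ e + ((n + 2) ^ e + 2) ^ f) (fun n => ((n + 2) ^ e + 2) ^ f)).
- by rewrite /= pc.
- by pbd.
- by pbd.
- move=> t A i a k o; apply: dsem_weaken (dsem_seq (h1 t A i a k o) (g1 _ _ _ _ _ _)) _.
  by rewrite leq_add2l; apply: leq_bound (h2 t).
- by move=> t; apply: leq_trans (g2 _) _; apply: leq_bound (h2 t).
Qed.

Lemma tmap_const u t : tmap u (fun=> t).
Proof.
apply: (@tmap_intro _ _ (Seq drop_tree (push_word RA (tcode t)))
  (fun n => 20 * (n + 2) + (2 * size (tcode t) + 1)) (fun=> tsize t)) => //; pbd.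
- by rewrite /= plain_push_word.
- move=> x A i a k o.
  apply: dsem_weaken (dsem_seq (dsem_drop _ _ _ _ _ _ _ _) (dsem_push_word _ _ _ _)) _.
  by rewrite !size_tcode; lia.
Qed.

Lemma tmap_node u v w : tmap u v -> tmap u w -> tmap u (fun x => Node (v x) (w x)).
Proof.
move=> [c [e [pc h1 h2]]] [d [f [pd g1 g2]]].
pose cc := Seq dup_tree (Seq c (Seq swap_tree (Seq d (Seq swap_tree (Push RA true))))).
apply: (@tmap_intro _ _ cc
  (fun n => 60 * (n + 2) + ((n + 2) ^ e + (60 * ((n + 2) ^ e + n + 2) +
     ((n + 2) ^ f + (60 * ((n + 2) ^ f + (n + 2) ^ e + 2) + 2)))))
  (fun n => ((n + 2) ^ e + (n + 2) ^ f).+1)).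
- by rewrite /= pc pd.
- by pbd.
- by pbd.
- move=> x A i a k o.
  apply: dsem_weaken (dsem_seq (dsem_dup _ (u x) _ _ _ _)
    (dsem_seq (h1 x A _ _ _ _) (dsem_seq (dsem_swap _ _ (u x) _ _ _ _)
    (dsem_seq (g1 x A _ _ _ _) (dsem_seq (dsem_swap _ _ (v x) _ _ _ _)
    (s3 := Store i (tcode (Node (v x) (w x)) ++ a) [::] k [::] [::] o) _))))) _.
    by rewrite /= -catA; apply: dsem_push.
  by rewrite !(leq_add2l, leq_add2r, leq_mul2l) /=; have := h2 x; have := g2 x; lia.
- by move=> x /=; rewrite ltnS leq_add.
Qed.

Lemma tmap_tleft u : tmap u (fun x => tleft (u x)).
Proof.
pose c := Pop RA (Push RA false)
  (Seq (move_tree RB) (Seq drop_tree (move_all RB RA))) Skip.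
apply: (@tmap_intro _ _ c (fun n => 100 * (n + 2)) id) => //; pbd.
  move=> x; case: (u x) => [|t v] A i a k o.
    apply: (@dsem_weaken _ _ _ 3) => //.
    by apply: dsem_pop_false => //; apply: dsem_push.
  rewrite /= -catA.
  have h1 := dsem_move_B A t i (tcode v ++ a) [::] k [::] o; rewrite cats0 in h1.
  have h2 := dsem_drop A v i a (rev (tcode t)) k [::] o.
  have h3 := @dsem_move_all A RB RA _
    (Store i a (rev (tcode t)) k [::] [::] o) ltac:(by []) erefl.
  rewrite /= revK in h3.
  apply: dsem_weaken.
    apply: dsem_pop_true; first reflexivity.
    exact: dsem_seq h1 (dsem_seq h2 h3).
  by rewrite ?size_rev !size_tcode; lia.
by move=> x; case: (u x) => //= t v; lia.
Qed.

Lemma tmap_tright u : tmap u (fun x => tright (u x)).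
Proof.
pose c := Pop RA (Push RA false) drop_tree Skip.
apply: (@tmap_intro _ _ c (fun n => 100 * (n + 2)) id) => //; pbd.
  move=> x; case: (u x) => [|t v] A i a k o.
    apply: (@dsem_weaken _ _ _ 3) => //.
    by apply: dsem_pop_false => //; apply: dsem_push.
  rewrite /= -catA.
  apply: dsem_weaken.
    apply: dsem_pop_true; first reflexivity.
    exact: (dsem_drop A t i (tcode v ++ a) [::] k [::] o).
  by rewrite !size_tcode; lia.
by move=> x; case: (u x) => //= t v; lia.
Qed.

Lemma tmap_left u v : tmap u v -> tmap u (fun x => tleft (v x)).
Proof. by move=> h; apply: tmap_comp h (tmap_tleft _). Qed.

Lemma tmap_right u v : tmap u v -> tmap u (fun x => tright (v x)).
Proof. by move=> h; apply: tmap_comp h (tmap_tright _). Qed.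

(* The two branches only need to be computable where they are taken. *)
Lemma tmap_if u b (v : X -> tree) : tmap u b ->
  tmap (fun x : {x | b x = Leaf} => u (sval x)) (fun x => v (sval x)) ->
  tmap (fun x : {x | b x <> Leaf} => u (sval x)) (fun x => v (sval x)) ->
  tmap u v.
Proof.
move=> [c [e [pc h1 h2]]] [d [f [pd g1 g2]]] [d' [f' [pd' g1' g2']]].
pose cc := Seq dup_tree (Seq c (Pop RA d (Seq drop_tree (Seq drop_tree d')) Skip)).
apply: (@tmap_intro _ _ cc
  (fun n => 60 * (n + 2) + ((n + 2) ^ e + (40 * ((n + 2) ^ e + 2) +
     ((n + 2) ^ f + (n + 2) ^ f')).+1)) (fun n => (n + 2) ^ f + (n + 2) ^ f')).
- by rewrite /= pc pd pd'.
- by pbd.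
- by pbd.
- move=> x A i a k o.
  apply: dsem_seq; first exact: dsem_dup.
  apply: dsem_seq; first exact: (h1 x).
  have := h2 x; case ex: (b x) => [|p q] /= bd.
    apply: dsem_pop_false; first reflexivity.
    apply: dsem_weaken (g1 (exist _ x ex) _ _ _ _ _) _ => /=; lia.
  have nx : b x <> Leaf by rewrite ex.
  apply: dsem_pop_true; first reflexivity.
  rewrite -catA; apply: dsem_weaken.
    apply: dsem_seq; first exact: dsem_drop.
    apply: dsem_seq; first exact: dsem_drop.
    exact: (g1' (exist _ x nx)).
  by rewrite /= !size_tcode; lia.
- move=> x; case ex: (b x) => [|p q].
    by have := g2 (exist _ x ex); rewrite /=; lia.
  have nx : b x <> Leaf by rewrite ex.
  by have := g2' (exist _ x nx); rewrite /=; lia.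
Qed.

(** The iteration count is the size of a tree, written in unary on [RC] above a [false] that shields
    the counters of enclosing loops. The bound on all intermediate states excludes an exponential
    growth of the data. *)
Lemma tmap_iter (n : X -> tree) (st : X -> nat -> tree) e :
  tmap (fun p : X * nat => st p.1 p.2) (fun p => st p.1 p.2.+1) ->
  (forall x k, k <= tsize (n x) ->
     tsize (st x k) <= (tsize (n x) + tsize (st x 0) + 2) ^ e) ->
  tmap (fun x => Node (n x) (st x 0)) (fun x => st x (tsize (n x))).
Proof.
move=> [c [f [pc h1 h2]]] bd.
pose cc := Pop RA Skip
  (Seq (Push RC false) (Seq count_tree (LoopT RC c))) Skip.
apply: (@tmap_intro _ _ cc
  (fun n => 100 * (n + 2) + n * (((n + 2) ^ e + 2) ^ f + 1)) (fun n => (n + 2) ^ e)).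
- by rewrite /= pc.
- by pbd.
- by pbd.
- move=> x A i a k o; rewrite /= -catA.
  pose N := (tsize (n x) + tsize (st x 0)).+1.
  have h2' := dsem_count A (n x) i (tcode (st x 0) ++ a) [::] (false :: k) [::] o.
  have h3 m : m <= tsize (n x) ->
      dsem A (LoopT RC c) (Store i (tcode (st x (tsize (n x) - m)) ++ a) [::]
          (nseq m true ++ false :: k) [::] [::] o)
       (m * (((N + 2) ^ e + 2) ^ f + 1) + 1)
       (Store i (tcode (st x (tsize (n x))) ++ a) [::] k [::] [::] o).
    elim: m => [|m IHm] lm.
      by rewrite subn0; apply: dsem_weaken (sem_loopT_false _ _ _) _ => //=.
    have {}IHm := IHm (ltnW lm).
    apply: (@dsem_weaken _ _ _ (((N + 2) ^ e + 2) ^ f + (m * (((N + 2) ^ e + 2) ^ f + 1) + 1)).+1);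
      last by lia.
    apply: (dsem_loopT _ _ IHm); first reflexivity.
    have := h1 (x, tsize (n x) - m.+1) A i a (nseq m true ++ false :: k) o => /=.
    have -> : (tsize (n x) - m.+1).+1 = tsize (n x) - m by lia.
    move=> h; apply: dsem_weaken h _.
    apply: leq_bound; apply: leq_trans (bd x _ (leq_subr _ _)) _.
    by apply: leq_bound; rewrite /N; lia.
  have h3' := h3 (tsize (n x)) (leqnn _).
  rewrite subnn in h3'.
  apply: (@dsem_weaken _ _ _ (2 + (10 * size (tcode (n x)) + 3 +
     (tsize (n x) * (((N + 2) ^ e + 2) ^ f + 1) + 1))).+1).
    apply: dsem_pop_true; first reflexivity.
    apply: dsem_seq; first exact: dsem_push.
    by apply: dsem_seq; first exact: h2'.
  rewrite -/N !size_tcode.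
  have : tsize (n x) * (((N + 2) ^ e + 2) ^ f + 1) <= N * (((N + 2) ^ e + 2) ^ f + 1).
    by rewrite leq_mul2r; apply/orP; right; rewrite /N; lia.
  set P := tsize (n x) * _; set Q := N * _; rewrite /N; lia.
- move=> x /=.
  by apply: leq_trans (bd _ _ (leqnn _)) _; apply: leq_bound; lia.
Qed.

End Tmap.

(** * Polynomial-time functions between encoded types *)

Structure encType := EncType { esort :> Type; enc : esort -> tree }.
Arguments enc {e} _ : rename.

Canonical enc_unit := EncType (fun _ : unit => Leaf).
Canonical enc_bool := EncType (fun b : bool => if b then Node Leaf Leaf else Leaf).
(** Unary on purpose: naturals serve as lengths, clocks and positions, all polynomial in the input.
    The binary numbers of the instances are kept as bit sequences. *)
Canonical enc_nat := EncType (fun n : nat => iter n (Node Leaf) Leaf).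
Canonical enc_prod (A B : encType) :=
  EncType (fun p : A * B => Node (enc p.1) (enc p.2)).
Canonical enc_seq (A : encType) :=
  EncType (foldr (fun (x : A) t => Node (enc x) t) Leaf).
Canonical enc_option (A : encType) :=
  EncType (fun o : option A => if o is Some x then Node (enc x) Leaf else Leaf).

Definition sz (A : encType) (a : A) : nat := tsize (enc a).

Lemma sz_nat n : sz n = n.
Proof. by rewrite /sz; elim: n => //= n ->. Qed.

Lemma sz_pair (A B : encType) (a : A) (b : B) : sz (a, b) = (sz a + sz b).+1.
Proof. by []. Qed.

Lemma sz_prod (A B : encType) (p : A * B) : sz p = (sz p.1 + sz p.2).+1.
Proof. by []. Qed.

Lemma sz_nil (A : encType) : sz ([::] : seq A) = 0.
Proof. by []. Qed.

Lemma sz_cons (A : encType) a (l : seq A) : sz (a :: l) = (sz a + sz l).+1.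
Proof. by []. Qed.

Lemma sz_cat (A : encType) (l m : seq A) : sz (l ++ m) = sz l + sz m.
Proof. by elim: l => //= a l IH; rewrite !sz_cons IH addSn addnA. Qed.

Lemma sz_rev (A : encType) (l : seq A) : sz (rev l) = sz l.
Proof.
by elim: l => //= a l IH; rewrite rev_cons -cats1 sz_cat IH !sz_cons sz_nil; lia.
Qed.

Lemma sz_bool (b : bool) : sz b <= 1.
Proof. by case: b. Qed.

Lemma sz_some (A : encType) (a : A) : sz (Some a) = (sz a).+1.
Proof. by rewrite /sz /= addn0. Qed.

Lemma sz_none (A : encType) : sz (None : option A) = 0.
Proof. by []. Qed.

Definition szE := (sz_nat, sz_pair, @sz_nil, sz_cons, sz_cat, sz_rev, sz_some, @sz_none).

Lemma size_leq_sz (A : encType) (l : seq A) : size l <= sz l.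
Proof. by elim: l => //= a l IH; rewrite sz_cons ltnS; lia. Qed.

Lemma sz_bits_leq (l : seq bool) : sz l <= 2 * size l.
Proof. by elim: l => //= a l IH; rewrite sz_cons; have := sz_bool a; lia. Qed.

Lemma sz_drop (A : encType) k (l : seq A) : sz (drop k l) <= sz l.
Proof. by rewrite -{2}(cat_take_drop k l) sz_cat leq_addl. Qed.

Ltac szlia :=
  repeat match goal with |- context [@sz ?T ?x] => generalize (@sz T x) end;
  clear; intros; lia.

Definition poly (A B : encType) (f : A -> B) : Prop :=
  tmap (fun a => enc a) (fun a => enc (f a)).

Lemma poly_bound (A B : encType) (f : A -> B) : poly f ->
  exists2 p, pbounded p & (forall m n, m <= n -> p m <= p n) /\ forall a, sz (f a) <= p (sz a).
Proof.
case=> c [e [_ _ h]]; exists (fun n => (n + 2) ^ e); first by exists e.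
by split=> // m n; apply: leq_bound.
Qed.

Section Poly.
Variables G A B C : encType.

Lemma poly_ext (f g : A -> B) : poly f -> f =1 g -> poly g.
Proof. by move=> h e; apply: tmap_ext h _ => a; rewrite e. Qed.

Lemma poly_id : poly (fun a : A => a).
Proof. exact: tmap_id. Qed.

Lemma poly_const (b : B) : poly (fun _ : A => b).
Proof. exact: tmap_const. Qed.

Lemma poly_comp (f : A -> B) (g : B -> C) : poly g -> poly f -> poly (fun a => g (f a)).
Proof. by move=> hg hf; apply: tmap_comp hf (tmap_reindex f hg). Qed.

Lemma poly_pair (f : G -> A) (g : G -> B) : poly f -> poly g -> poly (fun x => (f x, g x)).
Proof. exact: tmap_node. Qed.

Lemma poly_fst (f : G -> A * B) : poly f -> poly (fun x => (f x).1).
Proof. exact: tmap_left. Qed.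

Lemma poly_snd (f : G -> A * B) : poly f -> poly (fun x => (f x).2).
Proof. exact: tmap_right. Qed.

Lemma poly_if (b : G -> bool) (f g : G -> A) : poly b -> poly f -> poly g ->
  poly (fun x => if b x then f x else g x).
Proof.
move=> hb hf hg; apply: (tmap_if hb).
  apply: tmap_ext (tmap_reindex _ hg) _ => -[x] /=.
  by case: (b x).
apply: tmap_ext (tmap_reindex _ hf) _ => -[x] /=.
by case: (b x).
Qed.

Lemma poly_cons (f : G -> A) (g : G -> seq A) : poly f -> poly g ->
  poly (fun x => f x :: g x).
Proof. exact: tmap_node. Qed.

Lemma poly_some (f : G -> A) : poly f -> poly (fun x => Some (f x)).
Proof. by move=> h; apply: tmap_node h (tmap_const _ _). Qed.

Lemma poly_succ (f : G -> nat) : poly f -> poly (fun x => (f x).+1).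
Proof. by move=> h; apply: tmap_node (tmap_const _ _) h. Qed.

Lemma poly_match_seq (l : G -> seq A) (f : G -> B) (h : G -> A -> seq A -> B) :
  poly l -> poly f -> poly (fun p : G * A * seq A => h p.1.1 p.1.2 p.2) ->
  poly (fun x => if l x is a :: r then h x a r else f x).
Proof.
move=> hl hf hh; apply: (tmap_if hl).
  by apply: tmap_ext (tmap_reindex _ hf) _ => -[x] /=; case: (l x).
set X := sig _.
(* Only on the inputs with a nonempty list do head and tail exist; choice selects them there, and
   the branch becomes a function of the triple of parameter, head and tail. *)
have [sel Hs] : {s : X -> A * seq A & forall x, l (sval x) = (s x).1 :: (s x).2}.
  apply: (choice (P := fun x s => l (sval x) = s.1 :: s.2)) => -[x] /= ne.
  by case: (l x) ne => [//|a r] _; exists (a, r).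
apply: (tmap_comp (v := fun x : X => enc (sval x, (sel x).1, (sel x).2))).
  have hl' := tmap_reindex (sval : X -> G) hl.
  apply: tmap_ext (tmap_node (tmap_node (tmap_id _) (tmap_left hl')) (tmap_right hl')) _.
  by move=> x /=; rewrite Hs.
apply: tmap_ext (tmap_reindex (fun x : X => (sval x, (sel x).1, (sel x).2)) hh) _.
by move=> x /=; rewrite Hs.
Qed.

Lemma poly_match_option (l : G -> option A) (f : G -> B) (h : G -> A -> B) :
  poly l -> poly f -> poly (fun p : G * A => h p.1 p.2) ->
  poly (fun x => if l x is Some a then h x a else f x).
Proof.
move=> hl hf hh; apply: (tmap_if hl).
  by apply: tmap_ext (tmap_reindex _ hf) _ => -[x] /=; case: (l x).
set X := sig _.
have [sel Hs] : {s : X -> A & forall x, l (sval x) = Some (s x)}.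
  by apply: (choice (P := fun x s => l (sval x) = Some s)) => -[x] /= ne; case: (l x) ne => [a|//] _; exists a.
apply: (tmap_comp (v := fun x : X => enc (sval x, sel x))).
  have hl' := tmap_reindex (sval : X -> G) hl.
  apply: tmap_ext (tmap_node (tmap_id _) (tmap_left hl')) _.
  by move=> x /=; rewrite Hs.
apply: tmap_ext (tmap_reindex (fun x : X => (sval x, sel x)) hh) _.
by move=> x /=; rewrite Hs.
Qed.

Lemma poly_match_nat (l : G -> nat) (f : G -> B) (h : G -> nat -> B) :
  poly l -> poly f -> poly (fun p : G * nat => h p.1 p.2) ->
  poly (fun x => if l x is n.+1 then h x n else f x).
Proof.
move=> hl hf hh; apply: (tmap_if hl).
  by apply: tmap_ext (tmap_reindex _ hf) _ => -[x] /=; case: (l x).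
set X := sig _.
have [sel Hs] : {s : X -> nat & forall x, l (sval x) = (s x).+1}.
  by apply: (choice (P := fun x s => l (sval x) = s.+1)) => -[x] /= ne; case: (l x) ne => [//|a] _; exists a.
apply: (tmap_comp (v := fun x : X => enc (sval x, sel x))).
  have hl' := tmap_reindex (sval : X -> G) hl.
  apply: tmap_ext (tmap_node (tmap_id _) (tmap_right hl')) _.
  by move=> x /=; rewrite Hs.
apply: tmap_ext (tmap_reindex (fun x : X => (sval x, sel x)) hh) _.
by move=> x /=; rewrite Hs.
Qed.

(** The parameter [g] travels along with the iterate, because the step function depends on it. *)
Lemma poly_iter_sz (m : G -> C) (z : G -> A) (f : G -> A -> A) p :
  poly m -> poly z -> poly (fun q : G * A => f q.1 q.2) -> pbounded p ->
  (forall g k, k <= sz (m g) -> sz (iter k (f g) (z g)) <= p (sz g)) ->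
  poly (fun g => iter (sz (m g)) (f g) (z g)).
Proof.
move=> hm hz hf [e he] bd.
pose st g k := enc (g, iter k (f g) (z g)).
have hs : tmap (fun q : G * nat => st q.1 q.2) (fun q => st q.1 q.2.+1).
  apply: (tmap_node (v := fun q : G * nat => enc q.1)).
    exact: (@tmap_tleft _ (fun q : G * nat => st q.1 q.2)).
  exact: (tmap_reindex (fun q : G * nat => (q.1, iter q.2 (f q.1) (z q.1))) hf).
have [e' he'] : pbounded (fun n => (n + (n + 2) ^ e).+1) by pbd.
have hi := @tmap_iter _ (fun g => enc (m g)) st e' hs.
apply: (tmap_comp (v := fun g => Node (enc (m g)) (st g 0))).
  by apply: (tmap_node hm); apply: tmap_node (tmap_id _) hz.
have {}hi := tmap_right (hi _); apply: tmap_ext (hi _) _ => // g k le_k.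
apply: leq_trans (he' _); rewrite /= ltnS.
have := leq_trans (bd g k le_k) (he _); rewrite /sz => h1.
rewrite leq_add //; first by lia.
apply: leq_trans h1 _; apply: leq_bound; lia.
Qed.

End Poly.

(** * Automation for polynomial-time claims *)

Ltac pstep := lazymatch goal with
  | |- poly (fun x => x) => exact: poly_id
  | |- poly (fun _ => ?c) => exact: poly_const
  | |- poly (fun x => (@?f x, @?g x)) => refine (@poly_pair _ _ _ f g _ _)
  | |- poly (fun x => fst (@?f x)) => refine (@poly_fst _ _ _ f _)
  | |- poly (fun x => snd (@?f x)) => refine (@poly_snd _ _ _ f _)
  | |- poly (fun x => (@?f x) :: (@?g x)) => refine (@poly_cons _ _ f g _ _)
  | |- poly (fun x => Some (@?f x)) => refine (@poly_some _ _ f _)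
  | |- poly (fun x => (@?f x).+1) => refine (@poly_succ _ f _)
  end; cbv beta.

Create HintDb poly.

Ltac plib := fail.
Ltac puser := fail.

Tactic Notation "pref" uconstr(t) := refine t; cbv beta.

(* Decomposes [poly] goals; functions [f] with a lemma [poly f] are found in the
   hint database, operators in [plib]. *)
Ltac peta := match goal with
  | |- @poly _ _ (fun _ => _) => fail 1
  | |- @poly ?A ?B ?f => change (@poly A B (fun x => f x))
  end.

Ltac ptac := repeat first [assumption | pstep | plib | puser | peta
  | solve [trivial with poly]
  | match goal with |- poly (fun x => ?h (@?f x)) =>
      refine (@poly_comp _ _ _ f h _ _); cbv beta; [solve [trivial with poly | assumption] |] end
  | refine (@poly_if _ _ _ _ _ _ _ _); cbv beta
  | refine (@poly_match_seq _ _ _ _ _ _ _ _ _); cbv beta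
  | refine (@poly_match_option _ _ _ _ _ _ _ _ _); cbv beta
  | refine (@poly_match_nat _ _ _ _ _ _ _ _); cbv beta ].

Section Foldl.
Variables G A B : encType.

(** Additive growth is the safe criterion: a step may add to the accumulator a polynomial in the
    parameter and the list element, but may not multiply it, so the total stays polynomial. *)
Lemma poly_foldl (l : G -> seq B) (z : G -> A) (f : G -> A -> B -> A) p :
  poly l -> poly z -> poly (fun q : G * A * B => f q.1.1 q.1.2 q.2) -> pbounded p ->
  (forall g a b, sz (f g a b) <= sz a + p (sz g + sz b)) ->
  poly (fun g => foldl (f g) (z g) (l g)).
Proof.
move=> hl hz hf hp bd.
(* [F] idles once the list is exhausted, so the encoded size of the list, which is at least its
   length, can serve as the number of iterations. *)
pose F (g : G) (s : A * seq B) := if s.2 is b :: r then (f g s.1 b, r) else (s.1, [::]).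
have FE g k a s : iter k (F g) (a, s) = (foldl (f g) a (take k s), drop k s).
  elim: k a s => [|k IH] a s; first by rewrite take0 drop0.
  by rewrite iterSr; case: s => [|b s]; rewrite /F IH.
have [q hq [mq bq]] := poly_bound hl; have [r hr [mr br]] := poly_bound hz.
have [e he] := hp.
have bt g k a s : sz (foldl (f g) a (take k s)) <= sz a + size s * (sz g + sz s + 2) ^ e.
  elim: k a s => [|k IH] a s; first by rewrite take0 leq_addr.
  case: s => [|b s] /=; first by rewrite mul0n addn0.
  apply: leq_trans (IH _ _) _.
  move: (bd g a b) (he (sz g + sz b)).
  have : (sz g + sz b + 2) ^ e <= (sz g + sz (b :: s) + 2) ^ e.
    by apply: leq_bound; rewrite sz_cons; lia.
  have : (sz g + sz s + 2) ^ e <= (sz g + sz (b :: s) + 2) ^ e.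
    by apply: leq_bound; rewrite sz_cons; lia.
  move: (_ ^ e) (_ ^ e) (_ ^ e) => x1 x2 x3 h1 h2 h3 h4.
  have := leq_mul (leqnn (size s)) h1; rewrite mulSn; lia.
have H1 : poly (fun g => (iter (sz (l g)) (F g) (z g, l g)).1).
  apply: poly_fst.
  have [q1 hq1] : exists2 q1, pbounded q1 & forall n, q1 n =
     (r n + q n * (n + q n + 2) ^ e + q n).+1.
    exists (fun n => (r n + q n * (n + q n + 2) ^ e + q n).+1) => //.
    by apply: pbounded_S; apply: pbounded_add => //; apply: pbounded_add => //;
       apply: pbounded_mul => //; apply: pbounded_exp; apply: pbounded_add;
       [apply: pbounded_add => //; exact: pbounded_id | exact: pbounded_const].
  move=> eq1; apply: (poly_iter_sz (m := l) (f := F) (p := q1)) => //.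
  - exact: poly_pair.
  - refine (poly_match_seq (l := fun q : G * (A * seq B) => q.2.2)
      (f := fun q => (q.2.1, [::])) (h := fun q b r => (f q.1 q.2.1 b, r)) _ _ _).
    + by ptac.
    + by ptac.
    + pstep; last by ptac.
      refine (poly_comp (f := fun q : G * (A * seq B) * B * seq B =>
                (q.1.1.1, q.1.1.2.1, q.1.2)) hf _).
      by ptac.
  - move=> g k _; rewrite FE sz_pair eq1 ltnS leq_add //.
      apply: leq_trans (bt _ _ _ _) _; apply: leq_add => //.
      apply: leq_mul; first exact: leq_trans (size_leq_sz _) (bq g).
      by case: (e) => // n; rewrite leq_exp2r // leq_add2r leq_add2l.
    exact: leq_trans (sz_drop _ _) (bq g).
apply: poly_ext H1 _ => g; rewrite FE take_oversize //; exact: size_leq_sz.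
Qed.

End Foldl.

(** * Lists, booleans and unary arithmetic in polynomial time *)

Section Library.
Variables G A B C : encType.

Lemma poly_rev (l : G -> seq A) : poly l -> poly (fun g => rev (l g)).
Proof.
move=> hl; apply: (@poly_ext _ _ (fun g => foldl (fun r x => x :: r) [::] (l g))).
  pref (poly_foldl (f := fun g r x => x :: r) (p := fun n => n.+1) hl (poly_const _ _) _ _ _) => /=.
  - by ptac.
  - by pbd.
  - by move=> g a b; rewrite sz_cons; lia.
by move=> g; rewrite /rev; elim: (l g) [::] => //=.
Qed.

End Library.

Section Library1.
Variables G A B C : encType.

Lemma poly_foldr (l : G -> seq B) (z : G -> A) (f : G -> B -> A -> A) p :
  poly l -> poly z -> poly (fun q : G * B * A => f q.1.1 q.1.2 q.2) -> pbounded p ->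
  (forall g a b, sz (f g b a) <= sz a + p (sz g + sz b)) ->
  poly (fun g => foldr (f g) (z g) (l g)).
Proof.
move=> hl hz hf hp bd.
apply: (@poly_ext _ _ (fun g => foldl (fun a b => f g b a) (z g) (rev (l g)))).
  pref (poly_foldl (f := fun g a b => f g b a) (poly_rev hl) hz _ hp _) => //=.
  by pref (poly_comp (f := fun q : G * A * B => (q.1.1, q.2, q.1.2)) hf _); ptac.
by move=> g; rewrite foldl_rev.
Qed.

End Library1.

Section Library2.
Variables G A B C : encType.

Lemma poly_cat (l m : G -> seq A) : poly l -> poly m -> poly (fun g => l g ++ m g).
Proof.
move=> hl hm; apply: (@poly_ext _ _ (fun g => foldr (fun x r => x :: r) (m g) (l g))).
  pref (poly_foldr (f := fun g x r => x :: r) (p := fun n => n.+1) hl hm _ _ _) => /=.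
  - by ptac.
  - by pbd.
  - by move=> g a b; rewrite sz_cons; lia.
by move=> g; elim: (l g) => //= x r ->.
Qed.

End Library2.

Section Library3.
Variables G A B C : encType.

Lemma poly_map (f : G -> A -> B) (l : G -> seq A) :
  poly (fun q : G * A => f q.1 q.2) -> poly l -> poly (fun g => [seq f g x | x <- l g]).
Proof.
move=> hf hl; have [p hp [mp bp]] := poly_bound hf.
apply: (@poly_ext _ _ (fun g => foldr (fun x r => f g x :: r) [::] (l g))).
  have hp' : pbounded (fun n => (p n.+1).+1).
    case: hp => e he; apply: pbounded_leq (_ : pbounded (fun n => ((n + 3) ^ e).+1)) _.
      by pbd.
    by move=> n; rewrite ltnS (leq_trans (he _)) // addSnnS.
  pref (poly_foldr (f := fun g x r => f g x :: r) hl (poly_const _ _) _ hp' _) => /=.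
  - by pstep; [pref (poly_comp (f := fun q : G * A * seq B => (q.1.1, q.1.2)) hf _)|]; ptac.
  - by move=> g a b; rewrite sz_cons; have := bp (g, b); rewrite sz_pair /=; lia.
by move=> g; elim: (l g) => //= x r ->.
Qed.

Lemma poly_flatten (l : G -> seq (seq A)) : poly l -> poly (fun g => flatten (l g)).
Proof.
move=> hl; pref (poly_foldr (f := fun g x r => x ++ r) (p := id) hl (poly_const _ _) _ _ _) => /=.
- by pref (poly_cat _ _); ptac.
- exact: pbounded_id.
- by move=> g a b; rewrite sz_cat; lia.
Qed.

Lemma poly_filter (b : G -> A -> bool) (l : G -> seq A) :
  poly (fun q : G * A => b q.1 q.2) -> poly l -> poly (fun g => [seq x <- l g | b g x]).
Proof.
move=> hb hl.
apply: (@poly_ext _ _ (fun g => foldr (fun x r => if b g x then x :: r else r) [::] (l g))).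
  pref (poly_foldr (f := fun g x r => if b g x then x :: r else r) (p := fun n => n.+1)
    hl (poly_const _ _) _ _ _) => /=.
  - pref (poly_if _ _ _); [|by ptac|by ptac].
    by pref (poly_comp (f := fun q : G * A * seq A => (q.1.1, q.1.2)) hb _); ptac.
  - by pbd.
  - by move=> g a x; case: ifP => _; rewrite ?sz_cons; lia.
by move=> g; elim: (l g) => //= x r ->.
Qed.

Lemma poly_all (b : G -> A -> bool) (l : G -> seq A) :
  poly (fun q : G * A => b q.1 q.2) -> poly l -> poly (fun g => all (b g) (l g)).
Proof.
move=> hb hl.
pref (poly_foldr (f := fun g x r => if b g x then r else false) (p := fun n => n.+1)
    hl (poly_const _ _) _ _ _) => /=.
- pref (poly_if _ _ _); [|by ptac|by ptac].
  by pref (poly_comp (f := fun q : G * A * bool => (q.1.1, q.1.2)) hb _); ptac.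
- by pbd.
- by move=> g a x; case: ifP => _; rewrite ?leq_addr.
Qed.

Lemma poly_has (b : G -> A -> bool) (l : G -> seq A) :
  poly (fun q : G * A => b q.1 q.2) -> poly l -> poly (fun g => has (b g) (l g)).
Proof.
move=> hb hl.
pref (poly_foldr (f := fun g x r => if b g x then true else r) (p := fun n => n.+1)
    hl (poly_const _ _) _ _ _) => /=.
- pref (poly_if _ _ _); [|by ptac|by ptac].
  by pref (poly_comp (f := fun q : G * A * bool => (q.1.1, q.1.2)) hb _); ptac.
- by pbd.
- by move=> g a x; case: ifP => _; rewrite ?leq_addr //; have := sz_bool true; lia.
Qed.

Lemma poly_size (l : G -> seq A) : poly l -> poly (fun g => size (l g)).
Proof.
move=> hl; pref (poly_foldr (f := fun g x r => r.+1) (p := fun n => n.+1)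
    hl (poly_const _ _) _ _ _) => /=.
- by ptac.
- by pbd.
- by move=> g a x; rewrite !sz_nat; lia.
Qed.

Lemma poly_behead (l : G -> seq A) : poly l -> poly (fun g => behead (l g)).
Proof. by move=> hl; pref (poly_match_seq hl (poly_const _ _) _); ptac. Qed.

Lemma poly_head x (l : G -> seq A) : poly l -> poly (fun g => head x (l g)).
Proof. by move=> hl; pref (poly_match_seq hl (poly_const _ _) _); ptac. Qed.

End Library3.

Section Library4.
Variables G A B C : encType.

Lemma poly_zip (l : G -> seq A) (m : G -> seq B) : poly l -> poly m ->
  poly (fun g => zip (l g) (m g)).
Proof.
move=> hl hm.
pose f (g : G) (a : seq B * seq (A * B)) (x : A) :=
  if a.1 is y :: r then (r, (x, y) :: a.2) else a.
have H : poly (fun g => rev (foldl (f g) (m g, [::]) (l g)).2).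
  pref (poly_rev _); pstep.
  pref (poly_foldl (f := f) (p := fun n => n.+2) hl (poly_pair hm (poly_const _ _)) _ _ _).
  - by rewrite /f; ptac.
  - by pbd.
  - move=> g [[|y r] a] x; rewrite /f /= ?sz_pair ?sz_cons ?sz_pair; lia.
apply: poly_ext H _ => g.
have E s t a : (foldl (f g) (t, a) s).2 = rev (zip s t) ++ a.
  elim: s t a => [|x s IH] [|y t] a //=; rewrite IH ?cat_rcons.
    by case: s {IH}.
  by rewrite rev_cons cat_rcons.
by rewrite E cats0 revK.
Qed.

Lemma poly_andb (a b : G -> bool) : poly a -> poly b -> poly (fun g => a g && b g).
Proof. by move=> ha hb; pref (poly_if ha hb (poly_const _ _)). Qed.

Lemma poly_orb (a b : G -> bool) : poly a -> poly b -> poly (fun g => a g || b g).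
Proof. by move=> ha hb; pref (poly_if ha (poly_const _ _) hb). Qed.

Lemma poly_implb (a b : G -> bool) : poly a -> poly b -> poly (fun g => a g ==> b g).
Proof. by move=> ha hb; pref (poly_if ha hb (poly_const _ _)). Qed.

Lemma poly_negb (a : G -> bool) : poly a -> poly (fun g => ~~ a g).
Proof. by move=> ha; pref (poly_if ha (poly_const _ _) (poly_const _ _)). Qed.

Lemma poly_eqb (a b : G -> bool) : poly a -> poly b -> poly (fun g => a g == b g).
Proof.
move=> ha hb; apply: (poly_ext (poly_if ha hb (poly_negb hb))).
by move=> g; case: (a g); case: (b g).
Qed.

Lemma poly_iter (n : G -> nat) (z : G -> A) (f : G -> A -> A) p :
  poly n -> poly z -> poly (fun q : G * A => f q.1 q.2) -> pbounded p ->
  (forall g a, sz (f g a) <= sz a + p (sz g)) ->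
  poly (fun g => iter (n g) (f g) (z g)).
Proof.
move=> hn hz hf hp bd.
have [q hq [_ bq]] := poly_bound hn; have [r hr [_ br]] := poly_bound hz.
apply: (@poly_ext _ _ (fun g => iter (sz (n g)) (f g) (z g))); last first.
  by move=> g; rewrite sz_nat.
pref (poly_iter_sz (p := fun k => r k + q k * p k) hn hz hf _ _).
  by apply: pbounded_add => //; apply: pbounded_mul.
move=> g k le_k; apply: (@leq_trans (sz (z g) + k * p (sz g))).
  elim: k {le_k} => [|k IH] /=; first by rewrite leq_addr.
  by apply: leq_trans (bd _ _) _; rewrite mulSn; lia.
by apply: leq_add => //; rewrite leq_mul2r (leq_trans le_k (bq g)) orbT.
Qed.

End Library4.

Ltac plib ::= lazymatch goal with
  | |- poly (fun x => rev (@?f x)) => refine (@poly_rev _ _ f _)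
  | |- poly (fun x => (@?f x) ++ (@?g x)) => refine (@poly_cat _ _ f g _ _)
  | |- poly (fun x => map (@?h x) (@?l x)) => refine (@poly_map _ _ _ h l _ _)
  | |- poly (fun x => flatten (@?f x)) => refine (@poly_flatten _ _ f _)
  | |- poly (fun x => filter (@?b x) (@?l x)) => refine (@poly_filter _ _ b l _ _)
  | |- poly (fun x => all (@?b x) (@?l x)) => refine (@poly_all _ _ b l _ _)
  | |- poly (fun x => has (@?b x) (@?l x)) => refine (@poly_has _ _ b l _ _)
  | |- poly (fun x => size (@?f x)) => refine (@poly_size _ _ f _)
  | |- poly (fun x => behead (@?f x)) => refine (@poly_behead _ _ f _)
  | |- poly (fun x => head ?a (@?f x)) => refine (@poly_head _ _ a f _)
  | |- poly (fun x => zip (@?f x) (@?g x)) => refine (@poly_zip _ _ _ f g _ _)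
  | |- poly (fun x => (@?f x) && (@?g x)) => refine (@poly_andb _ f g _ _)
  | |- poly (fun x => (@?f x) || (@?g x)) => refine (@poly_orb _ f g _ _)
  | |- poly (fun x => (@?f x) ==> (@?g x)) => refine (@poly_implb _ f g _ _)
  | |- poly (fun x => ~~ (@?f x)) => refine (@poly_negb _ f _)
  | |- poly (fun x => @eq_op _ (@?f x) (@?g x)) => refine (@poly_eqb _ f g _ _)
  end; cbv beta.

Lemma poly_addn (G : encType) (m n : G -> nat) : poly m -> poly n -> poly (fun g => m g + n g).
Proof.
move=> hm hn; apply: (@poly_ext _ _ (fun g => iter (m g) S (n g))).
  pref (poly_iter (f := fun _ : G => S) (p := fun=> 1) hm hn _ _ _); [by ptac|by pbd|].
  by move=> g a; rewrite !sz_nat addn1.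
by move=> g; rewrite iter_succn addnC.
Qed.

Lemma poly_predn (G : encType) (n : G -> nat) : poly n -> poly (fun g => (n g).-1).
Proof.
move=> hn; pref (@poly_ext _ _ (fun g => if n g is k.+1 then k else 0) _ _ _); last by move=> g; case: (n g).
by pref (poly_match_nat hn (poly_const _ _) _); ptac.
Qed.

Lemma poly_subn (G : encType) (m n : G -> nat) : poly m -> poly n -> poly (fun g => m g - n g).
Proof.
move=> hm hn; apply: (@poly_ext _ _ (fun g => iter (n g) predn (m g))).
  pref (poly_iter (f := fun _ : G => predn) (p := fun=> 1) hn hm _ _ _).
  - by pref (@poly_predn _ (fun q : G * nat => q.2) _); ptac.
  - by pbd.
  - by move=> g a; rewrite !sz_nat; lia.
by move=> g; elim: (n g) => [|k IH] /=; [rewrite subn0 | rewrite IH subnS].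
Qed.

Lemma poly_leq (G : encType) (m n : G -> nat) : poly m -> poly n -> poly (fun g => m g <= n g).
Proof.
move=> hm hn; pref (poly_ext (f := fun g => if m g - n g is k.+1 then false else true) _ _).
  by pref (poly_match_nat (poly_subn hm hn) _ _); ptac.
by move=> g; rewrite -subn_eq0; case: (_ - _).
Qed.

Lemma poly_muln (G : encType) (m n : G -> nat) : poly m -> poly n -> poly (fun g => m g * n g).
Proof.
move=> hm hn; have [p hp [mp bp]] := poly_bound hn.
apply: (@poly_ext _ _ (fun g => iter (m g) (addn (n g)) 0)).
  pref (poly_iter (f := fun g : G => addn (n g)) hm (poly_const _ _) _ hp _).
    by pref (poly_addn (m := fun q : G * nat => n q.1) _ _); ptac.
  by move=> g a; have := bp g; rewrite !sz_nat; lia.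
by move=> g; rewrite iter_addn_0 mulnC.
Qed.

Lemma poly_expn (G : encType) (n : G -> nat) e : poly n -> poly (fun g => n g ^ e).
Proof.
move=> hn; elim: e => [|e IH]; first exact: poly_const.
by apply: (poly_ext (poly_muln hn IH)) => g; rewrite expnS.
Qed.

Lemma poly_iota (G : encType) (n : G -> nat) : poly n -> poly (fun g => iota 0 (n g)).
Proof.
move=> hn; have [p hp [mp bp]] := poly_bound hn.
pose f (_ : G) (l : seq nat) := size l :: l.
have E g k : iter k (f g) [::] = rev (iota 0 k).
  elim: k => //= k IH.
  by rewrite IH /f size_rev size_iota -/(iota 0 k.+1) -addn1 iotaD rev_cat add0n.
have S k : sz (iota 0 k) <= k * k.+1.
  by elim: k => // k IH; rewrite -addn1 iotaD sz_cat /= !szE add0n; lia.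
apply: (@poly_ext _ _ (fun g => rev (iter (sz (n g)) (f g) [::]))); last first.
  by move=> g; rewrite E revK sz_nat.
pref (poly_rev _).
pref (poly_iter_sz (p := fun k => p k * (p k).+1) hn (poly_const _ _) _ _ _).
- by rewrite /f; ptac.
- by apply: pbounded_mul => //; apply: pbounded_S.
- move=> g k le_k; rewrite E sz_rev; apply: leq_trans (S _) _.
  by apply: leq_mul; rewrite ?ltnS; apply: leq_trans le_k (bp g).
Qed.

Lemma poly_eqn (G : encType) (m n : G -> nat) : poly m -> poly n ->
  poly (fun g => m g == n g).
Proof.
move=> hm hn; apply: (poly_ext (poly_andb (poly_leq hm hn) (poly_leq hn hm))).
by move=> g; rewrite eqn_leq.
Qed.

Lemma poly_eq_bits (G : encType) (s t : G -> seq bool) : poly s -> poly t -> poly (fun g => s g == t g).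
Proof.
move=> hs ht.
pose f (_ : G) (a : bool * seq bool) (x : bool) :=
  if a.2 is y :: r then (a.1 && (x == y), r) else (false, [::]).
have H : poly (fun g => let a := foldl (f g) (true, t g) (s g) in
                        if a.2 is [::] then a.1 else false).
  have hf : poly (fun g => foldl (f g) (true, t g) (s g)).
    pref (poly_foldl (f := f) (p := fun n => n.+2) hs _ _ _ _).
    - by ptac.
    - by rewrite /f; ptac.
    - by pbd.
    - move=> g [b [|y r]] x; rewrite /f /= ?szE; first by rewrite /sz /=; lia.
      by move: (sz_bool (b && (x == y))); lia.
  pref (poly_comp (g := fun a : bool * seq bool => if a.2 is [::] then a.1 else false) _ hf).
  by pref (poly_match_seq (h := fun _ _ _ => false) _ _ _); ptac.
apply: poly_ext H _ => g /=.
pose k (a : bool * seq bool) := if a.2 is [::] then a.1 else false.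
have E u v b : k (foldl (f g) (b, v) u) = b && (u == v).
  elim: u v b => [|x u IH] [|y v] b /=; rewrite ?andbT ?andbF //.
    by rewrite {1}/f /= IH.
  by rewrite {1}/f /= IH eqseq_cons andbA.
exact: (E (s g) (t g) true).
Qed.

Lemma poly_mem_bits (G : encType) (s : G -> seq bool) (l : G -> seq (seq bool)) : poly s -> poly l ->
  poly (fun g => s g \in l g).
Proof.
move=> hs hl; apply: (@poly_ext _ _ (fun g => has (fun x => x == s g) (l g))).
  pref (poly_has (b := fun g (x : seq bool) => x == s g) _ hl).
  by pref (poly_eq_bits (s := fun q : G * seq bool => q.2) _ _); ptac.
by move=> g; rewrite has_pred1.
Qed.

Ltac plib ::= lazymatch goal with
  | |- poly (fun x => rev (@?f x)) => refine (@poly_rev _ _ f _)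
  | |- poly (fun x => (@?f x) ++ (@?g x)) => refine (@poly_cat _ _ f g _ _)
  | |- poly (fun x => map (@?h x) (@?l x)) => refine (@poly_map _ _ _ h l _ _)
  | |- poly (fun x => flatten (@?f x)) => refine (@poly_flatten _ _ f _)
  | |- poly (fun x => filter (@?b x) (@?l x)) => refine (@poly_filter _ _ b l _ _)
  | |- poly (fun x => all (@?b x) (@?l x)) => refine (@poly_all _ _ b l _ _)
  | |- poly (fun x => has (@?b x) (@?l x)) => refine (@poly_has _ _ b l _ _)
  | |- poly (fun x => size (@?f x)) => refine (@poly_size _ _ f _)
  | |- poly (fun x => behead (@?f x)) => refine (@poly_behead _ _ f _)
  | |- poly (fun x => head ?a (@?f x)) => refine (@poly_head _ _ a f _)
  | |- poly (fun x => zip (@?f x) (@?g x)) => refine (@poly_zip _ _ _ f g _ _)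
  | |- poly (fun x => (@?f x) && (@?g x)) => refine (@poly_andb _ f g _ _)
  | |- poly (fun x => (@?f x) || (@?g x)) => refine (@poly_orb _ f g _ _)
  | |- poly (fun x => (@?f x) ==> (@?g x)) => refine (@poly_implb _ f g _ _)
  | |- poly (fun x => ~~ (@?f x)) => refine (@poly_negb _ f _)
  | |- poly (fun x => @eq_op _ (@?f x) (@?g x)) =>
      first [refine (@poly_eqb _ f g _ _) | refine (@poly_eqn _ f g _ _)
            | refine (@poly_eq_bits _ f g _ _)]
  | |- poly (fun x => (@?f x) \in (@?g x)) => refine (@poly_mem_bits _ f g _ _)
  | |- poly (fun x => (@?f x) + (@?g x)) => refine (@poly_addn _ f g _ _)
  | |- poly (fun x => (@?f x) - (@?g x)) => refine (@poly_subn _ f g _ _)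
  | |- poly (fun x => (@?f x) * (@?g x)) => refine (@poly_muln _ f g _ _)
  | |- poly (fun x => (@?f x) ^ ?e) => refine (@poly_expn _ f e _)
  | |- poly (fun x => (@?f x).-1) => refine (@poly_predn _ f _)
  | |- poly (fun x => (@?f x) <= (@?g x)) => refine (@poly_leq _ f g _ _)
  | |- poly (fun x => iota 0 (@?f x)) => refine (@poly_iota _ f _)
  end; cbv beta.

Lemma poly_uniq_bits (G : encType) (l : G -> seq (seq bool)) : poly l -> poly (fun g => uniq (l g)).
Proof.
move=> hl.
pose f (_ : G) (x : seq bool) (a : bool * seq (seq bool)) :=
  (a.1 && (x \notin a.2), x :: a.2).
have H : poly (fun g => (foldr (f g) (true, [::]) (l g)).1).
  pstep; pref (poly_foldr (f := f) (p := fun n => n + 3) hl (poly_const _ _) _ _ _).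
  - by rewrite /f; ptac.
  - by pbd.
  - by move=> g [b a] x; rewrite /f /= !szE; move: (_ && _) => c;
      move: (sz_bool c); szlia.
apply: poly_ext H _ => g.
have E s : foldr (f g) (true, [::]) s = (uniq s, s).
  by elim: s => //= x s ->; rewrite /f /= andbC.
by rewrite E.
Qed.

Ltac plib ::= lazymatch goal with
  | |- poly (fun x => rev (@?f x)) => refine (@poly_rev _ _ f _)
  | |- poly (fun x => (@?f x) ++ (@?g x)) => refine (@poly_cat _ _ f g _ _)
  | |- poly (fun x => map (@?h x) (@?l x)) => refine (@poly_map _ _ _ h l _ _)
  | |- poly (fun x => flatten (@?f x)) => refine (@poly_flatten _ _ f _)
  | |- poly (fun x => filter (@?b x) (@?l x)) => refine (@poly_filter _ _ b l _ _)
  | |- poly (fun x => all (@?b x) (@?l x)) => refine (@poly_all _ _ b l _ _)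
  | |- poly (fun x => has (@?b x) (@?l x)) => refine (@poly_has _ _ b l _ _)
  | |- poly (fun x => size (@?f x)) => refine (@poly_size _ _ f _)
  | |- poly (fun x => behead (@?f x)) => refine (@poly_behead _ _ f _)
  | |- poly (fun x => head ?a (@?f x)) => refine (@poly_head _ _ a f _)
  | |- poly (fun x => zip (@?f x) (@?g x)) => refine (@poly_zip _ _ _ f g _ _)
  | |- poly (fun x => (@?f x) && (@?g x)) => refine (@poly_andb _ f g _ _)
  | |- poly (fun x => (@?f x) || (@?g x)) => refine (@poly_orb _ f g _ _)
  | |- poly (fun x => (@?f x) ==> (@?g x)) => refine (@poly_implb _ f g _ _)
  | |- poly (fun x => ~~ (@?f x)) => refine (@poly_negb _ f _)
  | |- poly (fun x => @eq_op _ (@?f x) (@?g x)) =>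
      first [refine (@poly_eqb _ f g _ _) | refine (@poly_eqn _ f g _ _)
            | refine (@poly_eq_bits _ f g _ _)]
  | |- poly (fun x => (@?f x) \in (@?g x)) => refine (@poly_mem_bits _ f g _ _)
  | |- poly (fun x => (@?f x) + (@?g x)) => refine (@poly_addn _ f g _ _)
  | |- poly (fun x => (@?f x) - (@?g x)) => refine (@poly_subn _ f g _ _)
  | |- poly (fun x => (@?f x) * (@?g x)) => refine (@poly_muln _ f g _ _)
  | |- poly (fun x => (@?f x) ^ ?e) => refine (@poly_expn _ f e _)
  | |- poly (fun x => (@?f x).-1) => refine (@poly_predn _ f _)
  | |- poly (fun x => (@?f x) <= (@?g x)) => refine (@poly_leq _ f g _ _)
  | |- poly (fun x => iota 0 (@?f x)) => refine (@poly_iota _ f _)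
  | |- poly (fun x => uniq (@?f x)) => refine (@poly_uniq_bits _ f _)
  end; cbv beta.

(** * Machines for polynomial-time functions, NP and the second level *)

(** For [n <= 1] the additive constant [3 ^ e] suffices, and from [n = 2] on [n + 2 <= n ^ 2], which
    doubles the exponent. *)
Lemma pbounded_machine p : pbounded p -> exists e, forall n, p n <= n ^ e + e.
Proof.
case=> e he; exists (maxn (2 * e) (3 ^ e)) => n; apply: leq_trans (he n) _.
have [n_le1|n_gt1] := leqP n 1.
  apply: leq_trans (leq_addl _ _); apply: leq_trans (leq_maxr _ _).
  by case: e {he} => // e; rewrite leq_exp2r //; lia.
apply: leq_trans (leq_addr _ _).
apply: (@leq_trans ((n ^ 2) ^ e)).
  case: e {he} => // e; rewrite leq_exp2r // -mulnn; nia.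
by rewrite -expnM leq_pexp2l ?leq_maxl // ltnW.
Qed.

Fixpoint oracleless (c : cmd) : bool :=
  match c with
  | Skip | Push _ _ => true
  | Seq a b | Loop _ a b | Choose a b => oracleless a && oracleless b
  | Pop _ a b e => [&& oracleless a, oracleless b & oracleless e]
  | LoopT _ a => oracleless a
  | Ask _ _ => false
  end.

Lemma plain_oracleless c : plain c -> oracleless c.
Proof.
elim: c => //=.
- by move=> a IHa b IHb /andP [/IHa -> /IHb ->].
- by move=> r a IHa b IHb d IHd /and3P [/IHa -> /IHb -> /IHd ->].
- by move=> r a IHa b IHb /andP [/IHa -> /IHb ->].
Qed.

Lemma oracleless_comp c l k : oracleless c ->
  all (fun i => if i is IAsk _ _ then false else true) (comp c l k).
Proof.
elim: c l k => //=.
- by move=> a IHa b IHb l k /andP [/IHa ha /IHb hb]; rewrite all_cat ha hb.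
- move=> r a IHa b IHb d IHd l k /and3P [/IHa ha /IHb hb /IHd hd].
  by rewrite !all_cat ha hb hd.
- by move=> r a IHa b IHb l k /andP [/IHa ha /IHb hb]; rewrite all_cat ha hb.
- by move=> r a IHa l k /IHa.
- by move=> a IHa b IHb l k /andP [/IHa ha /IHb hb]; rewrite all_cat ha hb.
Qed.

(** [Skip] is compiled to a fork whose two targets coincide, so forks do not by themselves break
    determinism. *)
Lemma plain_comp c l k : plain c ->
  all (fun i => if i is IFork l1 l2 then l1 == l2 else true) (comp c l k).
Proof.
elim: c l k => //=.
- by move=> l k; rewrite eqxx.
- by move=> a IHa b IHb l k /andP [/IHa ha /IHb hb]; rewrite all_cat ha hb.
- move=> r a IHa b IHb d IHd l k /and3P [/IHa ha /IHb hb /IHd hd].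
  by rewrite !all_cat ha hb hd.
- by move=> r a IHa b IHb l k /andP [/IHa ha /IHb hb]; rewrite all_cat ha hb.
- by move=> r a IHa l k /IHa.
Qed.

Lemma oracleless_tm c : oracleless c -> oracle_free (tm c).
Proof.
move=> hc q; rewrite /=; case E: (nth _ _ _) => [r f|l1 l2|l1 l2|] //.
have [lt_q|ge_q] := ltnP q (size (program c)); last by rewrite nth_default in E.
have /all_nthP/(_ _ lt_q) : all (fun i => if i is IAsk _ _ then false else true) (program c).
  by rewrite /program all_rcons oracleless_comp.
by move=> /(_ IHalt); rewrite E.
Qed.

Lemma plain_tm c : plain c -> deterministic (tm c).
Proof.
move=> hc q s q1 a1 q2 a2 /asboolP h1 /asboolP h2; move: h1 h2.
case E: (nth _ _ _) => [r f|l1 l2|l1 l2|] //.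
  by move=> /= [-> ->] [-> ->].
have [lt_q|ge_q] := ltnP q (size (program c)); last by rewrite nth_default in E.
have /all_nthP/(_ _ lt_q) :
    all (fun i => if i is IFork l1 l2 then l1 == l2 else true) (program c).
  by rewrite /program all_rcons plain_comp.
move=> /(_ IHalt); rewrite E => /eqP <- [h1 ->] [h2 ->].
by case: h1 => ->; case: h2 => ->.
Qed.

(** * Input, output and guessing *)

Definition push_bit (b : bool) : cmd := Seq (push_word RA (tcode (enc b))) (Push RA true).

Lemma enc_bits_inj (y z : seq bool) : enc y = enc z -> y = z.
Proof.
elim: y z => [|b y IH] [|c z] //= -[eb /IH ->].
by case: b c eb => -[].
Qed.

Lemma dsem_push_bit A x (y : seq bool) i a b c d e o :
  dsem A (push_bit x) (Store i (tcode (enc y) ++ a) b c d e o) 9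
    (Store i (tcode (enc (x :: y)) ++ a) b c d e o).
Proof.
apply: (@dsem_weaken _ _ _ (2 * size (tcode (enc x)) + 1 + 2)); last by case: x.
have -> : tcode (enc (x :: y)) ++ a = true :: tcode (enc x) ++ tcode (enc y) ++ a.
  by rewrite /= catA.
by apply: dsem_seq; [exact: dsem_push_word | exact: dsem_push].
Qed.

(** Going through [RB] reverses the input, so that its last bit is the first to be consed. *)
Definition input_cmd : cmd := Seq (move_all RI RB)
  (Seq (Push RA false) (Loop RB (push_bit false) (push_bit true))).

Lemma dsem_input A x a c o :
  dsem A input_cmd (Store x a [::] c [::] [::] o) (20 * (size x + 1))
    (Store [::] (tcode (enc x) ++ a) [::] c [::] [::] o).
Proof.
have h1 := @dsem_move_all A RI RB x (Store x a [::] c [::] [::] o) ltac:(by []) erefl.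
rewrite /= cats0 in h1.
have h2 w y : dsem A (Loop RB (push_bit false) (push_bit true))
   (Store [::] (tcode (enc y) ++ a) w c [::] [::] o) (10 * size w + 1)
   (Store [::] (tcode (enc (catrev w y)) ++ a) [::] c [::] [::] o).
  elim: w y => [|b w IH] y; first by apply: dsem_loop_nil.
  apply: (@dsem_weaken _ _ _ (9 + (10 * size w + 1)).+1); last by rewrite /=; lia.
  apply: (dsem_loop _ _ (IH (b :: y))); first reflexivity.
  by case: b {IH}; exact: dsem_push_bit.
apply: (@dsem_weaken _ _ _ (3 * size x + 1 + (2 + (10 * size (rev x) + 1)))).
  apply: dsem_seq; first exact: h1.
  apply: dsem_seq; first exact: dsem_push.
  by have := h2 (rev x) [::]; rewrite -/(rev (rev x)) revK.
by rewrite size_rev; lia.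
Qed.

(** In the code of a bit list, [true] announces a further element. The element itself is either a
    leaf, or a node with two leaves, which the inner pops discard. *)
Definition output_cmd : cmd := Seq
  (LoopT RA (Pop RA (Push RB false)
    (Seq (Pop RA Skip Skip Skip) (Seq (Pop RA Skip Skip Skip) (Push RB true))) Skip))
  (move_all RB RO).

Lemma dsem_output A (w : seq bool) i a c :
  dsem A output_cmd (Store i (tcode (enc w) ++ a) [::] c [::] [::] [::])
    (20 * (size w + 1)) (Store i a [::] c [::] [::] w).
Proof.
rewrite /output_cmd; set body := Pop RA (Push RB false) _ _.
have h1 (v b : seq bool) : dsem A (LoopT RA body) (Store i (tcode (enc v) ++ a) b c [::] [::] [::])
   (10 * size v + 1) (Store i a (catrev v b) c [::] [::] [::]).
  elim: v b => [|x v IH] b; first by apply: sem_loopT_false.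
  apply: (@dsem_weaken _ _ _ (8 + (10 * size v + 1)).+1); last by rewrite /=; lia.
  apply: (dsem_loopT _ _ (IH (x :: b))); first reflexivity.
  case: x {IH} => /=; last first.
    apply: (@dsem_weaken _ _ _ 3) => //.
    by apply: dsem_pop_false; [reflexivity | exact: dsem_push].
  apply: (@dsem_weaken _ _ _ (2 + (2 + 2)).+1) => //.
  apply: dsem_pop_true; first reflexivity.
  apply: dsem_seq.
    by apply: dsem_pop_false; [reflexivity | exact: dsem_skip].
  apply: dsem_seq; first by apply: dsem_pop_false; [reflexivity | exact: dsem_skip].
  exact: dsem_push.
have h2 := @dsem_move_all A RB RO (rev w) (Store i a (rev w) c [::] [::] [::])
  ltac:(by []) erefl.
rewrite /= revK cats0 in h2.
apply: dsem_weaken (dsem_seq (h1 w [::]) h2) _.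
by rewrite size_rev; lia.
Qed.

Lemma poly_sz_size (B : encType) (f : seq bool -> B) : poly f ->
  exists2 p, pbounded p & forall x, sz (f x) <= p (size x).
Proof.
case=> c [e [_ _ h]]; exists (fun n => (2 * n + 2) ^ e); first by pbd.
by move=> x; apply: leq_trans (h x) _; apply: leq_bound; apply: sz_bits_leq.
Qed.

Theorem poly_polytime (f : seq bool -> seq bool) : poly f -> polytime_function f.
Proof.
move=> hf; have [c [e [pc h1 h2]]] := hf; have [p hp bp] := poly_sz_size hf.
pose cc := Seq input_cmd (Seq c output_cmd).
have plc : plain cc by rewrite /= pc.
have hs x : sem set0 cc (init_store x)
    (20 * (size x + 1) + ((2 * size x + 2) ^ e + 20 * (p (size x) + 1)))
    (eq (Store [::] [::] [::] [::] [::] [::] (f x))).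
  apply: dsem_seq; first exact: (dsem_input set0 x [::] [::] [::]).
  apply: dsem_seq.
    apply: dsem_weaken (h1 x set0 [::] [::] [::] [::]) _.
    by apply: leq_bound; apply: sz_bits_leq.
  apply: dsem_weaken (dsem_output set0 (f x) [::] [::] [::]) _.
  by rewrite leq_mul2l /= leq_add2r (leq_trans (size_leq_sz _)).
have [e' he'] : exists e', forall n,
    (20 * (n + 1) + ((2 * n + 2) ^ e + 20 * (p n + 1))).+1 <= n ^ e' + e'.
  apply: (@pbounded_machine (fun n => (20 * (n + 1) + ((2 * n + 2) ^ e + 20 * (p n + 1))).+1)).
  by pbd.
exists (tm cc); split.
- by apply: oracleless_tm; apply: plain_oracleless.
- exact: plain_tm.
- exists e' => x n y r; have [+ _ _] := sem_machine (hs x).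
  by move=> /(_ _ _ r) /leq_trans; apply; apply: he'.
- move=> x; have [_ _ /(_ _ erefl)] := sem_machine (hs x).
  by case=> k [y [r hy wy]]; exists k, y.
Qed.

(* Replaces a unary number on top of [RA] by a guessed word of that length. *)
Definition guess_cmd : cmd := Seq (Push RC false) (Seq count_tree
  (Seq (Push RA false) (LoopT RC (Choose (push_bit false) (push_bit true))))).

Lemma sem_guess A (n : nat) a o :
  sem A guess_cmd (Store [::] (tcode (enc n) ++ a) [::] [::] [::] [::] o)
    (50 * (n + 1))
    (fun s => exists2 y : seq bool, size y = n &
       s = Store [::] (tcode (enc y) ++ a) [::] [::] [::] [::] o).
Proof.
have h2 m (y : seq bool) :
    sem A (LoopT RC (Choose (push_bit false) (push_bit true)))
     (Store [::] (tcode (enc y) ++ a) [::] (nseq m true ++ [:: false]) [::] [::] o)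
     (11 * m + 1)
     (fun s => exists2 w : seq bool, size w = m &
       s = Store [::] (tcode (enc (w ++ y)) ++ a) [::] [::] [::] [::] o).
  elim: m y => [|m IH] y.
    apply: (sem_weaken (n := 1) (Q := eq (Store [::] (tcode (enc y) ++ a)
      [::] [::] [::] [::] o))) => //; first exact: sem_loopT_false.
    move=> s; split=> [<-|[w /size0nil -> ->]] //; by exists [::].
  pose Q1 s := exists b, s = Store [::] (tcode (enc (b :: y)) ++ a) [::]
    (nseq m true ++ [:: false]) [::] [::] o.
  pose Q2 (s1 s : store) := exists b (w : seq bool), [/\
     s1 = Store [::] (tcode (enc (b :: y)) ++ a) [::] (nseq m true ++ [:: false]) [::] [::] o,
     size w = m &
     s = Store [::] (tcode (enc (w ++ b :: y)) ++ a) [::] [::] [::] [::] o].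
  apply: (sem_weaken (n := (10 + (11 * m + 1)).+1)
    (Q := fun s => exists2 s1, Q1 s1 & Q2 s1 s)); [ | by lia | ].
  - apply: sem_loopT; first reflexivity.
      have := sem_choose (dsem_push_bit A false y [::] a [::] (nseq m true ++ [:: false])
        [::] [::] o) (dsem_push_bit A true y [::] a [::] (nseq m true ++ [:: false])
        [::] [::] o).
      move=> h; apply: sem_weaken h _ _ => // s; split.
        by case=> <-; [exists false | exists true].
      by case=> -[] ->; [right | left].
    move=> s1 [b ->]; apply: sem_weaken (IH (b :: y)) _ _ => // s; split.
      by case=> w sw ->; exists b, w.
    case=> b' [w [e sw ->]]; exists w => //; congr Store; congr (tcode (enc _) ++ _).
    congr (_ ++ _ :: _); case: e.
    by case: (b); case: (b').
  - move=> s; split.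
      case=> s1 _ [b [w [_ sw ->]]]; exists (rcons w b); first by rewrite size_rcons sw.
      by rewrite cat_rcons.
    case=> w; case/lastP: w => // w b; rewrite size_rcons => -[sw] ->.
    exists (Store [::] (tcode (enc (b :: y)) ++ a) [::] (nseq m true ++ [:: false]) [::] [::] o).
      by exists b.
    by exists b, w; rewrite cat_rcons.
have h1 : dsem A (Push RC false) (Store [::] (tcode (enc n) ++ a) [::] [::] [::] [::] o) 2
  (Store [::] (tcode (enc n) ++ a) [::] [:: false] [::] [::] o) by exact: dsem_push.
have h3 := dsem_count A (enc n) [::] a [::] [:: false] [::] o.
rewrite -/(sz n) sz_nat in h3.
have h4 : dsem A (Push RA false) (Store [::] a [::] (nseq n true ++ [:: false]) [::] [::] o) 2
  (Store [::] (tcode (enc ([::] : seq bool)) ++ a) [::] (nseq n true ++ [:: false]) [::] [::] o).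
  exact: dsem_push.
have D c1 c2 s1 s2 k1 k2 Q : dsem A c1 s1 k1 s2 -> sem A c2 s2 k2 Q ->
    sem A (Seq c1 c2) s1 (k1 + k2) Q.
  move=> g1 g2; have := @sem_seq A c1 c2 s1 k1 k2 _ (fun _ => Q) g1.
  move=> H; apply: sem_weaken (H _) _ _ => //; first by move=> _ <-.
  by move=> s; split=> [[]//|qs]; exists s2.
apply: sem_weaken (D _ _ _ _ _ _ _ h1 (D _ _ _ _ _ _ _ h3 (D _ _ _ _ _ _ _ h4 (h2 n [::])))) _ _.
  by rewrite size_tcode -/(sz n) sz_nat; lia.
by move=> s; split=> -[w sw ->]; exists w => //; rewrite cats0.
Qed.

Lemma dsem_then A c1 c2 s1 s2 k1 k2 Q : dsem A c1 s1 k1 s2 -> sem A c2 s2 k2 Q ->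
  sem A (Seq c1 c2) s1 (k1 + k2) Q.
Proof.
move=> g1 g2; have := @sem_seq A c1 c2 s1 k1 k2 _ (fun _ => Q) g1.
move=> H; apply: sem_weaken (H _) _ _ => //; first by move=> _ <-.
by move=> s; split=> [[]//|qs]; exists s2.
Qed.

Definition guess_pair (c : cmd) : cmd := Seq input_cmd (Seq dup_tree (Seq c
  (Seq guess_cmd (Seq swap_tree (Push RA true))))).

Lemma sem_guess_pair (clock : seq bool -> nat) : poly clock -> exists c,
  oracleless c /\ exists2 p, pbounded p & forall A x,
  sem A c (init_store x) (p (size x))
    (fun s => exists2 y : seq bool, size y = clock x &
       s = Store [::] (tcode (enc (x, y))) [::] [::] [::] [::] [::]).
Proof.
move=> hc; have [c [e [pc h1 h2]]] := hc; have [q hq bq] := poly_sz_size hc.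
exists (guess_pair c); split; first by rewrite /= plain_oracleless.
exists (fun n => 20 * (n + 1) + (60 * (2 * n + 2) + ((2 * n + 2) ^ e +
  (50 * (q n + 1) + (60 * (2 * q n + 2 * n + 2) + 2))))).
  by pbd.
move=> A x.
apply: dsem_then; first exact: (dsem_input A x [::] [::] [::]).
apply: dsem_then.
  apply: dsem_weaken (dsem_dup A (enc x) [::] [::] [::] [::]) _.
  by rewrite leq_mul2l /= leq_add2r sz_bits_leq.
apply: dsem_then.
  apply: dsem_weaken (h1 x A _ _ _ _) _.
  by apply: leq_bound; apply: sz_bits_leq.
have bc : clock x <= q (size x) by have := bq x; rewrite sz_nat.
pose Q2 (s1 s : store) := exists y : seq bool, [/\ size y = clock x,
  s1 = Store [::] (tcode (enc y) ++ tcode (enc x) ++ [::]) [::] [::] [::] [::] [::] &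
  s = Store [::] (tcode (enc (x, y))) [::] [::] [::] [::] [::]].
have hg := sem_guess A (clock x) (tcode (enc x) ++ [::]) [::].
have := @sem_seq A guess_cmd (Seq swap_tree (Push RA true)) _ _
  (60 * (2 * q (size x) + 2 * size x + 2) + 2) _ Q2 hg.
move=> H; apply: sem_weaken (H _) _ _.
- move=> s1 [y sy ->].
  apply: (sem_weaken (n := 60 * (2 * q (size x) + 2 * size x + 2) + 2)
    (Q := eq (Store [::] (tcode (enc (x, y))) [::] [::] [::] [::] [::]))) => //.
    apply: dsem_seq.
      apply: dsem_weaken (dsem_swap A (enc y) (enc x) [::] [::] [::] [::]) _.
      rewrite leq_mul2l /= leq_add2r -!/(sz _).
      have := sz_bits_leq y; have := sz_bits_leq x; rewrite sy; move: bc; szlia.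
    rewrite /= !cats0; exact: dsem_push.
  move=> s; split=> [<-|[y' [sy' [e'] ->]]]; first by exists y.
  by have [/enc_bits_inj -> _] := tcode_cat_inj e'.
- by rewrite leq_add2r leq_mul2l /= leq_add2r.
- move=> s; split=> [[s1 _ [y [sy _ ->]]]|[y sy ->]]; first by exists y.
  by eexists; [exists y|exists y].
Qed.

(** Each bit of the first word is announced by [true], and [false] closes the word. This is also the
    format of [code_nat], so [pair_decode] can split a number off an input. *)
Definition pair_code (p : seq bool * seq bool) : seq bool :=
  flatten [seq [:: true; b] | b <- p.1] ++ false :: p.2.

Definition pair_step (s : bool * seq bool * seq bool) : bool * seq bool * seq bool :=
  if s.1.1 then s else
  if s.2 is b :: r then
    if b then if r is c :: r' then (false, c :: s.1.2, r') else (true, s.1.2, r)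
    else (true, s.1.2, r)
  else (true, s.1.2, [::]).

Definition pair_decode (w : seq bool) : seq bool * seq bool :=
  let s := iter (size w) pair_step (false, [::], w) in (rev s.1.2, s.2).

Lemma pair_codeK p : pair_decode (pair_code p) = p.
Proof.
case: p => x y; rewrite /pair_decode /pair_code /=.
have H n a : size x < n ->
  iter n pair_step (false, a, flatten [seq [:: true; b] | b <- x] ++ false :: y) =
  (true, catrev x a, y).
  elim: x n a => [|b x IH] [|n] a // lt_n; rewrite iterSr; last exact: (IH n (b :: a)).
  by elim: n {lt_n} => //= n ->.
rewrite H /= ?revK // size_cat size_flatten /shape -map_comp /=.
by elim: x {H} => //= b x; lia.
Qed.

Lemma poly_pair_code : poly pair_code.
Proof. by rewrite /pair_code; ptac. Qed.

Lemma poly_pair_decode : poly pair_decode.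
Proof.
have h : poly (fun w : seq bool => iter (size w) pair_step (false, [::], w)).
  pref (poly_iter (f := fun _ => pair_step) (p := fun=> 3) _ _ _ _ _).
  - by ptac.
  - by ptac.
  - by rewrite /pair_step; ptac.
  - by pbd.
  - move=> _ [[b x] w]; rewrite /pair_step /=.
    case: b => /=; first by rewrite leq_addr.
    case: w => [|[] [|c r]] /=; rewrite ?szE /sz /=; lia.
by rewrite /pair_decode; pref (poly_comp (g := fun s : bool * seq bool * seq bool => (rev s.1.2, s.2)) _ h); ptac.
Qed.

#[export] Hint Resolve poly_pair_code poly_pair_decode : poly.

(** Certificates have exactly the length [clock x], so a unary counter suffices to guess them. The
    verdict needs no conversion: the code of a boolean starts with that boolean, and acceptance
    looks at the top of [RA]. *)
Theorem NP_intro (L : language) (clock : seq bool -> nat) (V : seq bool * seq bool -> bool) :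
  poly clock -> poly V ->
  (forall x, L x <-> exists2 y, size y = clock x & V (x, y)) -> NP L.
Proof.
move=> hc hV HL; have [g [og [p hp hg]]] := sem_guess_pair hc.
have [c [e [pc h1 h2]]] := hV; have [q hq bq] := poly_sz_size hc.
pose cc := Seq g c.
pose bd n := p n + (2 * n + 2 * q n + 3) ^ e.
have hs x : sem set0 cc (init_store x) (bd (size x))
    (fun s => exists2 y : seq bool, size y = clock x &
       s = Store [::] (tcode (enc (V (x, y)))) [::] [::] [::] [::] [::]).
  pose Q2 (s1 s : store) := exists y : seq bool, [/\ size y = clock x,
    s1 = Store [::] (tcode (enc (x, y))) [::] [::] [::] [::] [::] &
    s = Store [::] (tcode (enc (V (x, y)))) [::] [::] [::] [::] [::]].
  have := @sem_seq set0 g c _ _ ((2 * size x + 2 * q (size x) + 3) ^ e) _ Q2 (hg _ x).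
  move=> H; apply: sem_weaken (H _) _ _ => //.
    move=> s1 [y sy ->]; have hh := h1 (x, y) set0 [::] [::] [::] [::].
    rewrite !cats0 in hh; apply: sem_weaken hh _ _.
      have bc : clock x <= q (size x) by have := bq x; rewrite sz_nat.
      have := sz_bits_leq y; have := sz_bits_leq x; rewrite sy => b1 b2.
      have : sz (x, y) + 2 <= 2 * size x + 2 * q (size x) + 3.
        by rewrite sz_pair; move: b1 b2 bc; szlia.
      by rewrite -/(sz (x, y)); case: (e) => // n le; rewrite leq_exp2r.
    move=> s; split=> [<-|[y' [_ [e'] ->]]]; first by exists y.
    have := @tcode_cat_inj (enc (x, y)) (enc (x, y')) [::] [::]; rewrite !cats0 /= e'.
    by case=> // -[/enc_bits_inj ->].
  move=> s; split=> [[s1 _ [y [sy _ ->]]]|[y sy ->]]; first by exists y.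
  by eexists; [exists y|exists y].
have [e' he'] : exists e', forall n, (bd n).+1 <= n ^ e' + e'.
  by apply: (@pbounded_machine (fun n => (bd n).+1)); rewrite /bd; pbd.
exists (tm cc); split.
- by apply: oracleless_tm; rewrite /= og plain_oracleless.
- exists e' => x n y r; have [+ _ _] := sem_machine (hs x).
  by move=> /(_ _ _ r) /leq_trans; apply; apply: he'.
- move=> x; have [_ -> _] := sem_machine (hs x).
  split=> [/HL [y sy Vy]|[_ [y sy ->] /= Vy]].
    exists (Store [::] (tcode (enc (V (x, y)))) [::] [::] [::] [::] [::]).
      by exists y.
    by rewrite /= Vy.
  by apply/HL; exists y => //; move: Vy; case: (V _).
Qed.

Theorem Sigma2P_intro (L : language) (clock1 : seq bool -> nat)
    (clock2 : seq bool * seq bool -> nat) (V : seq bool * seq bool * seq bool -> bool) :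
  poly clock1 -> poly clock2 -> poly V ->
  (forall x, L x <-> exists2 y, size y = clock1 x &
     forall z, size z = clock2 (x, y) -> V (x, y, z)) -> Sigma2P L.
Proof.
move=> hc hc2 hV HL.
(* The oracle holds the refutable guesses: it searches for a [z] at which [V] fails, and the machine
   accepts on a negative answer. *)
pose A : language := fun w => exists2 z, size z = clock2 (pair_decode w) &
  ~~ V (pair_decode w, z).
exists A.
  apply: (@NP_intro _ (fun w => clock2 (pair_decode w))
    (fun q => ~~ V (pair_decode q.1, q.2))) => //; last by ptac.
  exact: (poly_comp hc2 poly_pair_decode).
have [g [og [p hp hg]]] := sem_guess_pair hc.
have [c [e [pc h1 h2]]] := poly_pair_code; have [q hq bq] := poly_sz_size hc.
pose cc := Seq g (Seq c (Seq output_cmd (Ask (Push RA false) (Push RA true)))).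
pose N n := (2 * n + 2 * q n + 3) ^ e.
pose bd n := p n + (N n + (20 * (N n + 1) + 3)).
have hs x : sem A cc (init_store x) (bd (size x))
    (fun s => exists2 y : seq bool, size y = clock1 x &
       s = Store [::] [:: `[< ~ A (pair_code (x, y)) >] ] [::] [::] [::] [::] (pair_code (x, y))).
  pose Q2 (s1 s : store) := exists y : seq bool, [/\ size y = clock1 x,
    s1 = Store [::] (tcode (enc (x, y))) [::] [::] [::] [::] [::] &
    s = Store [::] [:: `[< ~ A (pair_code (x, y)) >] ] [::] [::] [::] [::] (pair_code (x, y))].
  have := @sem_seq A g (Seq c (Seq output_cmd (Ask (Push RA false) (Push RA true))))
    _ _ (N (size x) + (20 * (N (size x) + 1) + 3)) _ Q2 (hg _ x).
  move=> H; apply: sem_weaken (H _) _ _ => //.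
    move=> s1 [y sy ->]; have hh := h1 (x, y) A [::] [::] [::] [::].
    have bN : (sz (x, y) + 2) ^ e <= N (size x).
      have bc : clock1 x <= q (size x) by have := bq x; rewrite sz_nat.
      have := sz_bits_leq y; have := sz_bits_leq x; rewrite sy => b1 b2.
      have : sz (x, y) + 2 <= 2 * size x + 2 * q (size x) + 3.
        by rewrite sz_pair; move: b1 b2 bc; szlia.
      by rewrite /N; case: (e) => // n le; rewrite leq_exp2r.
    apply: (sem_weaken (n := N (size x) + (20 * (N (size x) + 1) + 3)) (Q := eq
      (Store [::] [:: `[< ~ A (pair_code (x, y)) >] ] [::] [::] [::] [::] (pair_code (x, y))))) => //.
      rewrite !cats0 in hh.
      apply: dsem_then; first exact: dsem_weaken hh bN.
      have ho := dsem_output A (pair_code (x, y)) [::] [::] [::].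
      rewrite cats0 in ho.
      apply: dsem_then.
        apply: dsem_weaken ho _; rewrite leq_mul2l /= leq_add2r.
        apply: leq_trans (size_leq_sz _) (leq_trans (h2 (x, y)) bN).
      have [a|na] := pselect (A (pair_code (x, y))).
        apply: sem_ask_yes => //; rewrite (_ : `[< _ >] = false); first exact: sem_push.
        by apply/asboolP => /(_ a).
      apply: sem_ask_no => //; rewrite (_ : `[< _ >] = true); first exact: sem_push.
      exact/asboolP.
    move=> s; split=> [<-|[y' [_ [e'] ->]]]; first by exists y.
    have := @tcode_cat_inj (enc (x, y)) (enc (x, y')) [::] [::]; rewrite !cats0 /= e'.
    by case=> // -[/enc_bits_inj ->].
  move=> s; split=> [[s1 _ [y [sy _ ->]]]|[y sy ->]]; first by exists y.
  by eexists; [exists y|exists y].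
have [e' he'] : exists e', forall n, (bd n).+1 <= n ^ e' + e'.
  by apply: (@pbounded_machine (fun n => (bd n).+1)); rewrite /bd /N; pbd.
exists (tm cc); split.
- exists e' => x n y r; have [+ _ _] := sem_machine (hs x).
  by move=> /(_ _ _ r) /leq_trans; apply; apply: he'.
- move=> x; have [_ -> _] := sem_machine (hs x).
  split=> [/HL [y sy Vy]|[_ [y sy ->] /= /asboolP nA]].
    exists (Store [::] [:: `[< ~ A (pair_code (x, y)) >] ] [::] [::] [::] [::]
      (pair_code (x, y))); first by exists y.
    by apply/asboolP => -[z]; rewrite pair_codeK => sz_; rewrite Vy.
  apply/HL; exists y => // z sz_; apply: contrapT => /negP nV; apply: nA.
  by exists z; rewrite pair_codeK.
Qed.

(** * Extensions as maximal models *)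

Section Consequence.
Variable A : Type.
Implicit Types (S V : set (form A)) (v : A -> bool).

Definition models v S : Prop := forall g, S g -> eval v g.

Lemma models_Cn v S : models v (Cn S) <-> models v S.
Proof.
split=> h g Sg; last exact: Sg.
by apply: h => w; apply.
Qed.

Lemma models_setU v S V : models v (S `|` V) <-> models v S /\ models v V.
Proof.
split=> [h|[h1 h2] g [/h1|/h2]] //.
by split=> g Sg; apply: h; [left|right].
Qed.

Lemma eq_Cn S V : (forall v, models v S <-> models v V) -> Cn S = Cn V.
Proof.
by move=> h; apply/predeqP => f; split=> H v /h; apply: H.
Qed.

End Consequence.

(** When every prerequisite is [Top], nothing substantial has to be derived before a default may
    fire, so the stages become stationary and only the self-reference through the justifications
    remains. *)
Lemma extensionE (D : set default) V E : (forall d, D d -> prereq d = Top) ->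
  extension D V E <->
  E = Cn (V `|` [set g | exists d, [/\ D d, ~ E (Not (justif d)) & g = conseq d]]).
Proof.
move=> pT; set U := V `|` _; rewrite /extension.
suff -> : \bigcup_n stage D V E n = Cn U by [].
apply/predeqP => f; split=> [[n _]|Uf].
  elim: n f => [|n IH] f /=; first by move=> Vf v; apply; left.
  case=> [h|[d [Dd _ nE ->]]].
    by move=> v vU; apply: h => g /IH; apply.
  by move=> v; apply; right; exists d.
(* Stage 1 contains [Top], stage 2 the facts and all conclusions of applicable defaults, stage 3
   their consequences. *)
exists 3 => //=; left; move=> v vs; apply: Uf => g [Vg|[d [Dd nE ->]]].
  by apply: vs; left=> w ws; apply: ws; left => w' ws'; exact: ws'.
apply: vs; right; exists d; split=> //; rewrite (pT _ Dd); left; by [].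
Qed.

Section Theory.
Variable T : theory.
Variable rho : nat -> nat.

(** A Pareto improvement with threshold [rho p]: defaults up to this rank must be kept, those of
    higher rank may be lost. For a constant ranking, better means satisfying a proper superset of
    defaults. *)
Definition better (m z : xatom -> bool) : Prop := exists p d,
  [/\ defaults_of T p d, eval z (conseq d), ~~ eval m (conseq d) &
      forall p' d', rho p' <= rho p -> defaults_of T p' d' ->
        eval m (conseq d') -> eval z (conseq d')].

Definition maximal (m : xatom -> bool) : Prop :=
  models m (facts T) /\ forall z, models z (facts T) -> ~ better m z.

(* The second condition holds for normal defaults, and for [delta p] because
   [Base p] occurs in no other default and not in the facts. *)
Definition seminormal : Prop := forall p d, defaults_of T p d ->
  [/\ prereq d = Top,
      forall v, eval v (conseq d) -> eval v (justif d) &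
      forall v, eval v (justif d) -> models v (facts T) -> exists v',
        [/\ eval v' (conseq d), models v' (facts T) &
            forall p' d', defaults_of T p' d' ->
              eval v (conseq d') -> eval v' (conseq d')]].

Hypothesis snT : seminormal.
Hypothesis rho_gt0 : forall p, 0 < rho p.

Lemma defaults_at_Top n d : defaults_at T rho n d -> prereq d = Top.
Proof. by case=> p _ /snT []. Qed.

Lemma unsat_hierarchic : (forall v, ~ models v (facts T)) ->
  hierarchic_extensions T rho setT.
Proof.
move=> nV; exists (fun n => if n is 1 then facts T else setT); split=> //.
- move=> n n1; apply/extensionE; first exact: defaults_at_Top.
  apply/predeqP => f; case: n n1 => // -[|n] _.
    by split=> // _ v /models_setU [/nV []].
  by split=> // _ v /models_setU [h _]; have := h Bot I.
- by apply/predeqP => f; split=> // _; exists 2.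
Qed.

(** Whether a default applies depends on [E] alone, so all models of [E] satisfy the same defaults,
    namely the applied ones; any of them can be taken for [m]. That a model of the facts and of the
    applied conclusions is a model of [E] follows level by level. *)
Lemma hierarchic_models E : hierarchic_extensions T rho E ->
  (exists v, models v (facts T)) -> (exists N, forall p, rho p <= N) ->
  exists m, [/\ maximal m,
    forall g, Pi T E g <->
      exists p d, [/\ defaults_of T p d, g = conseq d & eval m g],
    forall v, models v (facts T `|` Pi T E) -> maximal v &
    forall v p d, models v (facts T `|` Pi T E) -> defaults_of T p d ->
      eval v (conseq d) -> eval m (conseq d)].
Proof.
case=> Es [E1 Ex Eu] [v0 v0V] [N leN].
have En n : 0 < n -> Es n.+1 = Cn (Es n `|` [set g | exists d,
    [/\ defaults_at T rho n d, ~ Es n.+1 (Not (justif d)) & g = conseq d]]).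
  by move=> n0; apply/extensionE; [exact: defaults_at_Top | apply: Ex].
have sub n : 0 < n -> Es n `<=` Es n.+1.
  by move=> n0 f Ef; rewrite En // => v /models_setU [h _]; apply: h.
have subD n k : 0 < n -> Es n `<=` Es (n + k).
  move=> n0; elim: k => [|k IH]; first by rewrite addn0.
  by rewrite addnS => f /IH; apply: sub; rewrite addn_gt0 n0.
have ex n : 0 < n -> exists v, models v (Es n).
  elim: n => // -[|n] IH _; first by exists v0; rewrite E1.
  have [//|v vE] := IH; apply: contrapT => no.
  have all f : Es n.+2 f.
    by rewrite En // => w wE; case: no; exists w; rewrite En //; apply/models_Cn.
  apply: no; exists v; rewrite En //; apply/models_Cn/models_setU; split=> //.
  by move=> g [d [_ []]].
have step n v d : 0 < n -> models v (Es n.+1) -> defaults_at T rho n d ->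
    eval v (conseq d) <-> ~ Es n.+1 (Not (justif d)).
  move=> n0 vE Dd; split=> [vc Ej|nE].
    have [p _ pd] := Dd; have [_ cj _] := snT pd.
    by have := vE _ Ej; rewrite /= cj.
  move: vE; rewrite En // => /models_Cn/models_setU [_]; apply.
  by exists d.
(* Ranks are at most [N], so no defaults are left above this level and the later levels have the
   same models. *)
have top n : N < n -> forall v, models v (Es N.+1) -> models v (Es n).
  elim: n => // n IH; rewrite ltnS leq_eqVlt => /orP [/eqP <- //|lt_N] v vE.
  rewrite En; last by lia.
  apply/models_Cn/models_setU; split; first exact: IH.
  by move=> g [d [[p /= rp _] _ _]]; have := leN p; lia.
have EN v : models v E <-> models v (Es N.+1).
  split=> h g; rewrite ?Eu; first by move=> Eg; apply: h; rewrite Eu; exists N.+1.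
  case=> n /= n0 Eg; have [lt|le] := ltnP N n; first exact: top lt _ h _ Eg.
  by apply: h; have := subD n (N.+1 - n) n0; rewrite subnKC; [apply|lia].
have [m mE] := ex N.+1 isT.
have inE n f : 0 < n -> Es n f -> E f by move=> n0 Ef; rewrite Eu; exists n.
have SE v p d : models v E -> defaults_of T p d ->
    eval v (conseq d) <-> ~ E (Not (justif d)).
  move=> vE pd.
  have vEk : models v (Es (rho p).+1) by move=> g Eg; apply: vE; apply: inE Eg.
  have Dd : defaults_at T rho (rho p) d by exists p.
  split=> [vc Ej|nE].
    by have [_ cj _] := snT pd; have := vE _ Ej; rewrite /= cj.
  by apply/(step _ _ _ (rho_gt0 p) vEk Dd) => Ej; apply: nE; apply: inE Ej.
have PE g : Pi T E g <-> exists p d, [/\ defaults_of T p d, g = conseq d & eval m g].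
  have mE' : models m E by apply/EN.
  split=> [[d [[p _ pd] nE ->]]|[p [d [pd -> md]]]].
    by exists p, d; split=> //; apply/(SE _ _ _ mE' pd).
  by exists d; split=> //; [exists p | apply/(SE _ _ _ mE' pd)].
have lev v k : models v (facts T) -> (forall p d, rho p < k -> defaults_of T p d ->
    ~ E (Not (justif d)) -> eval v (conseq d)) ->
    forall n, 0 < n <= k -> models v (Es n).
  move=> vV vS; elim=> // -[|n] IH /andP [_ le_k]; first by rewrite E1.
  have vn : models v (Es n.+1) by apply: IH; lia.
  rewrite En //; apply/models_Cn/models_setU; split=> // g [d [[p /= rp pd] nE ->]].
  apply: (vS p) => //; first by rewrite rp.
  (* A default applied at its own level is never contradicted later: a model of [E] satisfies its
     conclusion, and by [SE] this keeps the negated justification out of [E]. *)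
  move=> Ej; have [w wE] : exists w, models w E by exists m; apply/EN.
  have wE2 : models w (Es n.+2) by move=> f Ef; apply: wE; apply: inE Ef.
  have Dd : defaults_at T rho n.+1 d by exists p.
  by have /(SE _ _ _ wE pd) := (step n.+1 w d isT wE2 Dd).2 nE; apply.
have modE v : models v (facts T `|` Pi T E) -> models v E.
  move=> /models_setU [vV vP]; apply/EN; apply: (lev v N.+1) => //; last by rewrite leqnn.
  by move=> p d _ pd nE; apply: vP; exists d; split=> //; exists p.
have maxE v : models v E -> maximal v.
  move=> vE; split; first by move=> g Vg; apply: vE; apply: (@inE 1) => //; rewrite E1.
  move=> z zV [p [d [pd zd nvd H]]].
  (* The rival [z] keeps every applied default up to the rank of [p], so it is a model of that
     level. As it satisfies the conclusion of [d], the default was applied there, and [v] satisfies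
     it too. *)
  have zE : models z (Es (rho p).+1).
    apply: (lev z (rho p).+1) => //; last by rewrite leqnn.
    by move=> p' d' lt pd' nE; apply: (H p') => //; apply/(SE _ _ _ vE pd').
  have Dd : defaults_at T rho (rho p) d by exists p.
  have vEk : models v (Es (rho p).+1) by move=> g Eg; apply: vE; apply: inE Eg.
  have /(step _ _ _ (rho_gt0 p) vEk Dd) := (step _ _ _ (rho_gt0 p) zE Dd).1 zd.
  exact/negP.
have mE' : models m E by apply/EN.
exists m; split=> //.
- exact: maxE.
- by move=> v /modE/maxE.
- by move=> v p d /modE vE pd; move=> /(SE _ _ _ vE pd) /(SE _ _ _ mE' pd).
Qed.

Lemma maximal_hierarchic m : maximal m -> exists2 E, hierarchic_extensions T rho E &
  forall g, Pi T E g <-> exists p d, [/\ defaults_of T p d, g = conseq d & eval m g].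
Proof.
move=> [mV mm].
pose U n := facts T `|` [set g | exists p d,
  [/\ rho p < n, defaults_of T p d, g = conseq d & eval m g]].
(* Level 1 must be [facts T] literally, which need not be deductively closed. *)
pose Es n := if n <= 1 then facts T else Cn (U n).
have mU n : models m (U n) by apply/models_setU; split=> // g [p [d []]].
have mEs n : models m (Es n).
  by rewrite /Es; case: ifP => // _; apply/models_Cn.
have Es1 n v : models v (Es n) <-> models v (U n).
  rewrite /Es; case: ifP => [le1|_]; last exact: models_Cn.
  split=> [h|/models_setU [] //]; apply/models_setU; split=> // g [p [d [lt _ _ _]]].
  by have := rho_gt0 p; lia.
(* If the justification is consistent with its level, [seminormal] turns a model of both into one
   that satisfies the conclusion and loses no default. Were the conclusion false in [m], this model
   would be better than [m]. *)
have app p d : defaults_of T p d ->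
    eval m (conseq d) <-> ~ Es (rho p).+1 (Not (justif d)).
  move=> pd; have [_ cj fix_] := snT pd; split=> [mc Ej|nE].
    by have := mEs _ _ Ej; rewrite /= cj.
  have [z zU zj] : exists2 z, models z (U (rho p).+1) & eval z (justif d).
    apply: contrapT => no; apply: nE; rewrite /Es ltnS leqNgt rho_gt0 /= => v vU.
    by apply/negP => vj; apply: no; exists v.
  have [zV zP] := (models_setU _ _ _).1 zU.
  have [z' [z'c z'V zz']] := fix_ _ zj zV.
  apply: contrapT => /negP nmc; apply: (mm _ z'V); exists p, d; split=> //.
  by move=> p' d' le pd' md'; apply: (zz' p') => //; apply: zP; exists p', d'.
exists (\bigcup_(n in [set n | 1 <= n]) Es n).
  exists Es; split=> // n n1; apply/extensionE; first exact: defaults_at_Top.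
  rewrite {1}/Es ltnS leqNgt n1 /=; apply: eq_Cn => v.
  rewrite models_setU; split=> [vU|[/Es1 vU vD]].
    have [vV vP] := (models_setU _ _ _).1 vU.
    split; first by apply/Es1/models_setU; split=> // g [p [d [lt pd -> md]]];
      apply: vP; exists p, d; split=> //; apply: ltnW.
    move=> g [d [[p /= rp pd] nE ->]]; apply: vP; exists p, d; split=> //.
      by rewrite rp.
    by apply/(app _ _ pd); rewrite rp.
  have [vV vP] := (models_setU _ _ _).1 vU.
  apply/models_setU; split=> // g [p [d [lt pd -> md]]].
  move: lt; rewrite ltnS leq_eqVlt => /orP [/eqP rp|lt].
    apply: vD; exists d; split=> //; first by exists p.
    by rewrite -rp; apply/(app _ _ pd).
  by apply: vP; exists p, d.
move=> g; split=> [[d [[p _ pd] nE ->]]|[p [d [pd -> md]]]].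
  exists p, d; split=> //; apply/(app _ _ pd) => Ej; apply: nE.
  by exists (rho p).+1.
exists d; split=> //; first by exists p.
case=> n _ Ej; have [_ cj _] := snT pd.
by have := mEs n _ Ej; rewrite /= cj.
Qed.

Hypothesis rho_bd : exists N, forall p, rho p <= N.

(** The first alternative stems from inconsistent facts, for which [setT] is an extension. *)
Theorem credulousE f : credulous T (hierarchic_extensions T rho) f <->
  (forall v, ~ models v (facts T)) \/
  exists m, maximal m /\ forall z, models z (facts T) ->
    (forall p d, defaults_of T p d -> eval m (conseq d) -> eval z (conseq d)) -> eval z f.
Proof.
split=> [[E hE Ef]|[nV|[m [mm mf]]]].
- have [sV|nV] := pselect (exists v, models v (facts T)); last first.
    by left=> v vV; apply: nV; exists v.
  have [m [mm PE _ _]] := hierarchic_models hE sV rho_bd.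
  right; exists m; split=> // z zV zd; apply: Ef; apply/models_setU; split=> //.
  by move=> g /PE [p [d [pd -> md]]]; apply: zd pd md.
- exists setT; first exact: unsat_hierarchic.
  by move=> v /models_setU [/nV].
- have [E hE PE] := maximal_hierarchic mm; exists E => //.
  move=> v /models_setU [vV vP]; apply: mf => // p d pd md.
  by apply: vP; apply/PE; exists p, d.
Qed.

(** A valuation that refutes [f] over some extension is itself maximal, so a single valuation
    describes both the extension and the refutation. *)
Theorem skepticalE f : ~ skeptical T (hierarchic_extensions T rho) f <->
  exists2 m, maximal m & ~~ eval m f.
Proof.
split=> [nS|[m mm nf] S].
  have [E hE [v vP nf]] : exists2 E, hierarchic_extensions T rho E &
      exists2 v, models v (facts T `|` Pi T E) & ~~ eval v f.
    apply: contrapT => no; apply: nS => E hE v vP; apply: contrapT => /negP nf.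
    by apply: no; exists E => //; exists v.
  have sV : exists v, models v (facts T) by exists v; case/models_setU: vP.
  have [m [_ _ mx _]] := hierarchic_models hE sV rho_bd.
  by exists v => //; apply: mx.
have [E hE PE] := maximal_hierarchic mm.
move/negP: nf; apply; apply: (S _ hE); apply/models_setU; split; first by case: mm.
by move=> g /PE [p [d []]].
Qed.

(** A conclusion drops out of the intersection when some maximal model violates it, and different
    conclusions may need different models. *)
Theorem prudentE f : ~ prudent T (hierarchic_extensions T rho) f <->
  exists v, [/\ models v (facts T), ~~ eval v f &
    forall p d, defaults_of T p d ->
      eval v (conseq d) \/ exists2 m, maximal m & ~~ eval m (conseq d)].
Proof.
split=> [nP|[v [vV nf H]] P].
  have [v vP nf] : exists2 v, models v (facts T `|`
      \bigcap_(E in hierarchic_extensions T rho) Pi T E) & ~~ eval v f.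
    apply: contrapT => no; apply: nP => v vP; apply: contrapT => /negP nf.
    by apply: no; exists v.
  have [vV vB] := (models_setU _ _ _).1 vP.
  exists v; split=> // p d pd; have [|/negP nvd] := boolP (eval v (conseq d)); first by left.
  right; have [E hE nE] : exists2 E, hierarchic_extensions T rho E & ~ Pi T E (conseq d).
    apply: contrapT => no; apply: nvd; apply: vB => E hE; apply: contrapT => nE.
    by apply: no; exists E.
  have [m [mm PE _ _]] := hierarchic_models hE (ex_intro _ v vV) rho_bd.
  by exists m => //; apply/negP => md; apply: nE; apply/PE; exists p, d.
move/negP: nf; apply; apply: P; apply/models_setU; split=> // g Bg.
(* An intersection over no extensions would contain every formula, so some maximal model must exist.
   If there were none, [v] would satisfy all defaults and be maximal itself. *)
have exE : exists m, maximal m.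
  apply: contrapT => no.
  have vd p d : defaults_of T p d -> eval v (conseq d).
    by move=> /H [//|[m mm]]; case: no; exists m.
  apply: no; exists v; split=> // z zV [p [d [pd _ /negP nvd _]]].
  by apply: nvd; apply: vd pd.
have [m mm] := exE; have [E hE PE] := maximal_hierarchic mm.
have /PE [p [d [pd eg _]]] := Bg _ hE; rewrite eg.
have [//|[m' mm' nd]] := H _ _ pd.
have [E' hE' PE'] := maximal_hierarchic mm'.
by have /PE' [_ [_ [_ _]]] := Bg _ hE'; rewrite eg (negbTE nd).
Qed.

End Theory.

(** From level 2 on there are no defaults, and an extension is already closed under [Cn], so the
    chain of levels is constant from there. *)
Lemma extensions_hierarchic T : seminormal T ->
  extensions T = hierarchic_extensions T (fun=> 1).
Proof.
move=> sn; have pT d : defaults T d -> prereq d = Top by case=> p _ /sn [].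
have D1 : defaults_at T (fun=> 1) 1 = defaults T.
  by apply/predeqP => d; split=> -[p _ pd]; exists p.
have D2 n : defaults_at T (fun=> 1) n.+2 = set0.
  by apply/predeqP => d; split=> // -[p].
have CnK E n : extension (defaults_at T (fun=> 1) n.+2) E E <-> E = Cn E.
  rewrite extensionE; last by rewrite D2.
  suff -> : Cn (E `|` [set g | exists d, [/\ defaults_at T (fun=> 1) n.+2 d,
    ~ E (Not (justif d)) & g = conseq d]]) = Cn E by [].
  apply: eq_Cn => v; rewrite models_setU; split=> [[]//|h]; split=> //.
  by move=> g [d []]; rewrite D2.
apply/predeqP => E; split=> [hE|[Es [E1 Ex ->]]].
  exists (fun n => if n is 1 then facts T else E); split=> //.
    move=> [|[|n]] // _; first by rewrite D1.
    apply/CnK; move: hE => /(extensionE _ _ pT) eE.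
    rewrite [in LHS]eE; rewrite [in RHS]eE.
    by apply: eq_Cn => v; rewrite models_Cn.
  apply/predeqP => f; split=> [Ef|[[|[|n]] // _]]; first by exists 2.
  by move=> Vf; move: hE => /(extensionE _ _ pT) -> v; apply; left.
have e2 : extension (defaults T) (facts T) (Es 2) by rewrite -E1 -D1; apply: Ex.
have CE : Es 2 = Cn (Es 2).
  move: e2 => /(extensionE _ _ pT) eE; rewrite [in LHS]eE; rewrite [in RHS]eE.
  by apply: eq_Cn => v; rewrite models_Cn.
have En n : Es n.+2 = Es 2.
  elim: n => // n IH; have := Ex n.+2 isT; rewrite IH extensionE; last by rewrite D2.
  move=> ->; rewrite [RHS]CE; apply: eq_Cn => v; rewrite models_setU; split=> [[]//|h].
  by split=> // g [d []]; rewrite D2.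
suff -> : \bigcup_(n in [set n | 1 <= n]) Es n = Es 2 by [].
apply/predeqP => f; split=> [[[|[|n]] // _]|Ef]; last by exists 2.
  by rewrite E1 => Vf; move: e2 => /(extensionE _ _ pT) -> v; apply; left.
by rewrite En.
Qed.

(** * The theories T0, T1, T2 and their finite parts *)

Inductive mode := M0 | M1 | M2.

(** [M0] counts no atom as complementary, which makes [T0] the case of [thy] in which indices leave
    no trace. *)
Definition cmp (md : mode) (W : seq sentence) (p : nat) : bool :=
  if md is M0 then false else complementary W p.

Definition posx md W (x : nat * nat) : xatom :=
  if cmp md W x.1 then PlusI x.1 x.2 else Plus x.1.

Definition negx md W (x : nat * nat) : xatom :=
  if cmp md W x.1 then MinusI x.1 x.2 else Minus x.1.

Definition thy md W I : theory :=
  Theory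
    (fun p => if cmp md W p then
       if md is M2 then
         [set d | exists2 i, pos_index W I p i & d = normal (link_pos p i)] `|`
         [set d | exists2 j, neg_index W I p j & d = normal (link_neg p j)]
       else
         [set d | exists i j, [/\ pos_index W I p i, neg_index W I p j &
                                  d = normal (And (link_pos p i) (link_neg p j))]]
     else [set delta p])
    (list_set [seq polarize (posx md W) (negx md W) true f | f <- label_all I W]).

Lemma polarize_label B (pos neg : nat -> B) s I f :
  polarize (fun x => pos x.1) (fun x => neg x.1) s (label I f) = polarize pos neg s f.
Proof. by elim: f s I => //= [a IHa|a IHa b IHb|a IHa b IHb|a IHa b IHb] s I; rewrite ?IHa ?IHb. Qed.

Lemma T0E W I : T0 W = thy M0 W I.
Proof.
rewrite /T0 /thy /=; congr Theory; congr list_set.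
elim: W I => //= f W IH I; congr cons; last exact: IH.
exact: esym (polarize_label Plus Minus true _ f).
Qed.

(* The value of a polarized formula when positive occurrences take their value
   from [P] and negative ones the negated value of [N]. *)
Fixpoint pev A (P N : A -> bool) (s : bool) (f : form A) : bool :=
  match f with
  | Atom p => if s then P p else ~~ N p
  | Top => true
  | Bot => false
  | Not a => ~~ pev P N (~~ s) a
  | And a b => pev P N s a && pev P N s b
  | Or a b => pev P N s a || pev P N s b
  | Imp a b => pev P N (~~ s) a ==> pev P N s b
  end.

Lemma eval_polarize A B (pos neg : A -> B) v s f :
  eval v (polarize pos neg s f) = pev (v \o pos) (v \o neg) s f.
Proof.
elim: f s => [p|||a IHa|a IHa b IHb|a IHa b IHb|a IHa b IHb] s /=;
  rewrite ?IHa ?IHb //; by case: s.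
Qed.

Lemma eq_pev A (P P' N N' : A -> bool) s f : P =1 P' -> N =1 N' ->
  pev P N s f = pev P' N' s f.
Proof.
move=> eP eN; elim: f s => [p|||a IHa|a IHa b IHb|a IHa b IHb|a IHa b IHb] s /=;
  rewrite ?IHa ?IHb ?eP ?eN //.
Qed.

Lemma eval_Iff A (v : A -> bool) a b : eval v (Iff a b) = (eval v a == eval v b).
Proof. by rewrite /=; case: (eval v a); case: (eval v b). Qed.

Lemma eval_delta v p : eval v (conseq (delta p)) =
  (v (Base p) == v (Plus p)) && (v (Base p) != v (Minus p)).
Proof. by rewrite /=; case: (v (Base p)); case: (v (Plus p)); case: (v (Minus p)). Qed.

Lemma eval_link_pos v p i : eval v (link_pos p i) = (v (Base p) == v (PlusI p i)).
Proof. by rewrite /link_pos eval_Iff. Qed.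

Lemma eval_link_neg v p i : eval v (link_neg p i) = (v (Base p) != v (MinusI p i)).
Proof. by rewrite /link_neg eval_Iff /=; case: (v _); case: (v _). Qed.

Lemma facts_thyP md W I v : models v (facts (thy md W I)) <->
  List.Forall (fun f => pev (v \o posx md W) (v \o negx md W) true f) (label_all I W).
Proof.
rewrite /= /list_set /models /=; elim: (label_all I W) => [|f l IH] /=.
  by split=> //.
split=> [h|h].
  constructor; first by rewrite -eval_polarize; apply: h; left.
  by apply/IH => g gl; apply: h; right.
by inversion h; subst=> g [<-|gl]; rewrite ?eval_polarize //; apply: IH.2 gl.
Qed.

Lemma thy_seminormal md W I : seminormal (thy md W I).
Proof.
move=> p d; rewrite /=; case: ifP => cp; last first.
  move=> ->; split=> // v; first by rewrite eval_delta eval_Iff /=;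
    case: (v (Base p)); case: (v (Plus p)); case: (v (Minus p)).
  move=> vj vV; exists (fun x => if x is Base q then if q == p then v (Plus p) else v x else v x).
  split.
  - move: vj; rewrite eval_delta eval_Iff /= eqxx.
    by case: (v (Plus p)); case: (v (Minus p)).
  - apply/facts_thyP; move/facts_thyP: vV; apply: List.Forall_impl => f.
    by rewrite (@eq_pev _ _ (v \o posx md W) _ (v \o negx md W)) // => x /=;
      rewrite /posx /negx; case: ifP.
  - move=> q d' /=; have [->|neq] := eqVneq q p.
      rewrite cp => -> _; move: vj; rewrite eval_delta eval_Iff /= eqxx.
      by case: (v (Plus p)); case: (v (Minus p)).
    case: ifP => cq; last by move=> ->; rewrite !eval_delta (negbTE neq).
    case: md {vV cp cq} => //.
    - by case=> i [j [_ _ ->]] /=; rewrite (negbTE neq).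
    - by case=> i [j [_ _ ->]] /=; rewrite (negbTE neq).
    - by case=> -[i _ ->] /=; rewrite (negbTE neq).
have nrm g : d = normal g -> [/\ prereq d = Top,
   forall v, eval v (conseq d) -> eval v (justif d) &
   forall v, eval v (justif d) -> models v (facts (thy md W I)) -> exists v',
        [/\ eval v' (conseq d), models v' (facts (thy md W I)) &
            forall p' d', defaults_of (thy md W I) p' d' ->
              eval v (conseq d') -> eval v' (conseq d')]].
  by move=> ->; split=> // v vj vV; exists v.
case: md cp nrm => // _ nrm.
- by case=> i [j [_ _ e]]; apply: nrm e.
- by case=> -[i _ e]; apply: nrm e.
Qed.

Lemma rank_gt0 r p : ranking r -> 0 < rank r p.
Proof.
case=> _ /allP h; rewrite /rank.
have [lt|ge] := ltnP (index p (unzip1 r)) (size (unzip2 r)).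
  exact: h (mem_nth 1 lt).
by rewrite nth_default.
Qed.

Lemma rank_bounded r : exists N, forall p, rank r p <= N.
Proof.
exists (\max_(i <- unzip2 r) i).+1 => p; rewrite /rank.
have [lt|ge] := ltnP (index p (unzip1 r)) (size (unzip2 r)).
  by apply: leqW; apply: leq_bigmax_seq => //; apply: mem_nth.
by rewrite nth_default.
Qed.

(** * Atoms and occurrences *)

Definition atoms A (f : form A) : seq A := [seq x.1 | x <- occurrences true f].

Lemma atoms_s A (f : form A) s : [seq x.1 | x <- occurrences s f] = atoms f.
Proof.
rewrite /atoms; elim: f s => //= [a IHa|a IHa b IHb|a IHa b IHb|a IHa b IHb] s.
- by rewrite IHa (IHa false).
- by rewrite !map_cat IHa IHb.
- by rewrite !map_cat IHa IHb.
- by rewrite !map_cat IHa IHb (IHa false).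
Qed.

Lemma eq_pev_in (A : eqType) (P P' N N' : A -> bool) s (f : form A) :
  {in atoms f, P =1 P'} -> {in atoms f, N =1 N'} -> pev P N s f = pev P' N' s f.
Proof.
elim: f s => [p|||a IHa|a IHa b IHb|a IHa b IHb|a IHa b IHb] s //= eP eN.
- by rewrite eP ?eN // inE.
- by rewrite IHa // => x; rewrite -(atoms_s _ false) => xa; [apply: eP|apply: eN].
- rewrite IHa ?IHb // => x xa; (try apply: eP); (try apply: eN);
  by rewrite /atoms /= map_cat mem_cat xa ?orbT.
- rewrite IHa ?IHb // => x xa; (try apply: eP); (try apply: eN);
  by rewrite /atoms /= map_cat mem_cat xa ?orbT.
- rewrite IHa ?IHb // => x xa; (try apply: eP); (try apply: eN);
  by rewrite /atoms /= map_cat mem_cat (atoms_s _ false) xa ?orbT.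
Qed.

(** Classical truth is the signed value in which the negative copy of every atom is the exact
    complement of the positive one; the polarity then makes no difference. *)
Lemma eval_pev A (v : A -> bool) s f : eval v f = pev v (fun p => ~~ v p) s f.
Proof.
elim: f s => [p|||a IHa|a IHa b IHb|a IHa b IHb|a IHa b IHb] s //=.
- by case: s; rewrite ?negbK.
- by rewrite -IHa.
- by rewrite -IHa -IHb.
- by rewrite -IHa -IHb.
- by rewrite -IHa -IHb.
Qed.

Lemma In_map (A : eqType) B (h : A -> B) s y :
  List.In y [seq h x | x <- s] <-> exists2 x, x \in s & y = h x.
Proof.
elim: s => [|a s IH] /=; first by split=> // -[].
rewrite IH; split=> [[<-|[x xs ->]]|[x]].
- by exists a; rewrite // inE eqxx.
- by exists x; rewrite // inE xs orbT.
- by rewrite inE => /orP [/eqP -> ->|xs ->]; [left | right; exists x].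
Qed.

Lemma In_flatten_map (A : eqType) B (F : A -> seq B) s y :
  List.In y (flatten [seq F x | x <- s]) <-> exists2 x, x \in s & List.In y (F x).
Proof.
elim: s => [|a s IH] /=; first by split=> // -[].
rewrite List.in_app_iff IH; split=> [[h|[x xs h]]|[x]].
- by exists a; rewrite // inE eqxx.
- by exists x; rewrite // inE xs orbT.
- by rewrite inE => /orP [/eqP ->|xs]; [left | right; exists x].
Qed.

Lemma all_In A (b : pred A) s : all b s <-> forall x, List.In x s -> b x.
Proof.
elim: s => [|a s IH] /=; first by split.
split=> [/andP [ba /IH h] x [<-|/h]|h] //.
by apply/andP; split; [apply: h; left | apply/IH => x xs; apply: h; right].
Qed.

Lemma has_In A (b : pred A) s : has b s <-> exists2 x, List.In x s & b x.
Proof.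
elim: s => [|a s IH] /=; first by split=> // -[].
split=> [/orP [ba|/IH [x xs bx]]|[x [<- ->//|xs bx]]]; first by exists a => //; left.
  by exists x => //; right.
by rewrite (IH.2 (ex_intro2 _ _ x xs bx)) orbT.
Qed.

Lemma occurrences_label s I f :
  [seq (x.1.1, x.2) | x <- occurrences s (label I f)] = occurrences s f.
Proof.
by elim: f s I => //= a IHa b IHb s I; rewrite map_cat IHa IHb.
Qed.

Lemma all_occurrences_label I W :
  [seq (x.1.1, x.2) | x <- all_occurrences (label_all I W)] = all_occurrences W.
Proof.
rewrite /all_occurrences; elim: W I => //= f W IH I.
by rewrite map_cat occurrences_label IH.
Qed.

(** * Reduction to the atoms of the input *)

Section Finite.
Variables (md : mode) (W : seq sentence) (I : seq nat) (r : seq (nat * nat)).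
Variable rel : seq nat.
Let T := thy md W I.
Let rho := rank r.

Definition occs : seq (nat * nat * bool) := all_occurrences (label_all I W).

Definition indices (b : bool) (p : nat) : seq nat :=
  [seq x.1.2 | x <- occs & (x.1.1 == p) && (x.2 == b)].

Definition dlist_of (p : nat) : seq xform :=
  if cmp md W p then
    if md is M2 then [seq link_pos p i | i <- indices true p] ++
                     [seq link_neg p j | j <- indices false p]
    else flatten [seq [seq And (link_pos p i) (link_neg p j) | j <- indices false p]
                 | i <- indices true p]
  else [:: conseq (delta p)].

Definition dlist : seq (nat * xform) := flatten [seq [seq (p, g) | g <- dlist_of p] | p <- rel].

Definition bsat (m : xatom -> bool) : bool :=
  all (fun f => eval m (polarize (posx md W) (negx md W) true f)) (label_all I W).

Definition fbetter (m z : xatom -> bool) : bool :=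
  has (fun d => [&& eval z d.2, ~~ eval m d.2 &
    all (fun d' => (rho d'.1 <= rho d.1) ==> eval m d'.2 ==> eval z d'.2) dlist]) dlist.

Lemma mem_indices b p i : (i \in indices b p) = ((p, i, b) \in occs).
Proof.
apply/mapP/idP => [[[[q j] c]]|h]; last by exists (p, i, b); rewrite // mem_filter /= !eqxx.
by rewrite mem_filter /= => /andP [/andP [/eqP -> /eqP ->] h] ->.
Qed.

Lemma dlist_ofP p g : List.In g (dlist_of p) <->
  exists2 d, defaults_of T p d & g = conseq d.
Proof.
rewrite /dlist_of /T /=; case: ifP => _; last first.
  by split=> [[<-|//]|[_ -> ->]]; [exists (delta p) | left].
have mp i : (i \in indices true p) <-> pos_index W I p i by rewrite mem_indices.
have mn i : (i \in indices false p) <-> neg_index W I p i by rewrite mem_indices.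
have H : List.In g (flatten [seq [seq And (link_pos p i) (link_neg p j)
      | j <- indices false p] | i <- indices true p]) <->
    exists2 d, (exists i j, [/\ pos_index W I p i, neg_index W I p j &
      d = normal (And (link_pos p i) (link_neg p j))]) & g = conseq d.
  rewrite In_flatten_map; split.
    case=> i /mp hi /In_map [j /mn hj ->].
    by eexists; [exists i, j; split|].
  case=> _ [i [j [/mp hi /mn hj ->]]] ->; exists i => //; apply/In_map.
  by exists j.
case: (md) => //; rewrite List.in_app_iff !In_map; split.
  case=> -[i]; first by move=> /mp hi ->; eexists; [left; exists i|].
  by move=> /mn hi ->; eexists; [right; exists i|].
by case=> _ [[i hi ->]|[i hi ->]] ->; [left|right]; exists i => //; [apply/mp|apply/mn].
Qed.

Lemma dlistP p g : List.In (p, g) dlist <-> p \in rel /\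
  exists2 d, defaults_of T p d & g = conseq d.
Proof.
rewrite -dlist_ofP In_flatten_map; split=> [[q qr]|[pr pg]].
  by rewrite List.in_map_iff => -[g' [[<- <-] h]].
by exists p => //; apply/List.in_map_iff; exists g.
Qed.

Lemma bsatP m : bsat m <-> models m (facts T).
Proof.
rewrite facts_thyP /bsat; elim: (label_all I W) => [|f l IH] /=; first by split.
rewrite eval_polarize; split=> [/andP [hf /IH hl]|h]; first by constructor.
by inversion h; subst; apply/andP; split=> //; apply/IH.
Qed.

Hypothesis rk : ranking r.
Hypothesis relW : forall p s, (p, s) \in all_occurrences W -> p \in rel.

(* Makes the default of every atom outside [rel] true. *)
Definition fixv (m : xatom -> bool) (x : xatom) : bool :=
  match x with
  | Base p | Plus p => (p \in rel) && m x
  | Minus p => (p \in rel) ==> m x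
  | _ => m x
  end.

Lemma cmp_rel p : cmp md W p -> p \in rel.
Proof. by rewrite /cmp; case: md => // /andP [/relW]. Qed.

Lemma label_rel f x : List.In f (label_all I W) -> x \in atoms f -> x.1 \in rel.
Proof.
move=> fW /mapP [[[p i] s] xf ->] /=; apply: (relW (s := s)).
rewrite -(all_occurrences_label I); apply/mapP; exists (p, i, s) => //.
rewrite /all_occurrences; elim: (label_all I W) fW => //= g l IH [->|/IH h].
  by rewrite mem_cat xf.
by rewrite mem_cat h orbT.
Qed.

Lemma fixv_sat m : bsat (fixv m) = bsat m.
Proof.
rewrite /bsat; have := label_rel; elim: (label_all I W) => //= f l IH H.
congr andb; last by apply: IH => g x gl; apply: H; right.
rewrite !eval_polarize; apply: eq_pev_in => x xf /=; have xr := H f x (or_introl erefl) xf;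
  by rewrite /posx /negx; case: ifP => //= _; rewrite xr.
Qed.

Lemma fixv_rel m p d : p \in rel -> defaults_of T p d ->
  eval (fixv m) (conseq d) = eval m (conseq d).
Proof.
move=> pr; rewrite /T /=; case: ifP => _; last by move=> ->; rewrite !eval_delta /= pr.
case: (md).
- by case=> i [j [_ _ ->]] /=; rewrite pr.
- by case=> i [j [_ _ ->]] /=; rewrite pr.
- by case=> -[i _ ->] /=; rewrite pr.
Qed.

Lemma fixv_irrel m p d : p \notin rel -> defaults_of T p d -> eval (fixv m) (conseq d).
Proof.
move=> npr; rewrite /T /=; case: ifP => [/cmp_rel|_ ->]; first by rewrite (negbTE npr).
by rewrite eval_delta /= (negbTE npr).
Qed.

Lemma fbetterP m z : fbetter m z -> better T rho m (fixv z).
Proof.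
move=> /has_In [[p g] /dlistP [pr [d pd ->]] /and3P [/= zd md_ /all_In al]].
exists p, d; split=> //; first by rewrite (fixv_rel _ pr).
move=> p' d' le pd' md'; have [pr'|npr'] := boolP (p' \in rel); last exact: fixv_irrel pd'.
rewrite (fixv_rel _ pr') //.
have := al (p', conseq d'); rewrite /= le md' /=; apply.
by apply/dlistP; split=> //; exists d'.
Qed.

Lemma better_fbetter m z : better T rho (fixv m) z -> fbetter m z.
Proof.
case=> p [d [pd zd nmd H]].
have pr : p \in rel by apply: contraNT nmd => npr; apply: fixv_irrel pd.
apply/has_In; exists (p, conseq d); first by apply/dlistP; split=> //; exists d.
rewrite /= zd -(fixv_rel _ pr pd) nmd /=; apply/all_In => -[p' g'] /dlistP [pr' [d' pd' ->]].
apply/implyP => /= le; apply/implyP => md'; apply: (H p') => //.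
by rewrite (fixv_rel _ pr').
Qed.

Definition fmax m : Prop := bsat m /\ forall z, bsat z -> ~~ fbetter m z.

Lemma maximal_fmax m : maximal T rho m -> fmax m.
Proof.
case=> /bsatP mV mm; split=> // z zV; apply/negP => /fbetterP; apply: mm.
by apply/bsatP; rewrite fixv_sat.
Qed.

Lemma fmax_maximal m : fmax m -> maximal T rho (fixv m).
Proof.
case=> mV mm; split; first by apply/bsatP; rewrite fixv_sat.
by move=> z /bsatP zV /better_fbetter; apply/negP/mm.
Qed.

Variable phi : xform.
Hypothesis Hphi : forall m, eval (fixv m) phi = eval m phi.

Let rg := fun p => rank_gt0 p rk.
Let sn := @thy_seminormal md W I.

Theorem credulous_fin : credulous T (hierarchic_extensions T rho) phi <->
  exists m, forall z, if bsat m then bsat z ==> ~~ fbetter m z &&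
      (all (fun d => eval m d.2 ==> eval z d.2) dlist ==> eval z phi)
    else ~~ bsat z.
Proof.
rewrite (credulousE sn rg (rank_bounded r)); split=> [[nV|[m [mm mp]]]|[m Hm]].
- exists (fun=> true) => z; rewrite (_ : bsat _ = false); last by apply/negP => /bsatP /nV.
  by apply/negP => /bsatP /nV.
- have [mV mx] := maximal_fmax mm; exists m => z; rewrite mV.
  apply/implyP => zV; rewrite mx //=; apply/implyP => /all_In al.
  rewrite -Hphi; apply: mp; first by apply/bsatP; rewrite fixv_sat.
  move=> p d pd md_; have [pr|npr] := boolP (p \in rel); last exact: fixv_irrel pd.
  rewrite (fixv_rel _ pr) //; have := al (p, conseq d); rewrite /= md_; apply.
  by apply/dlistP; split=> //; exists d.
- move: Hm; case mV: (bsat m) => Hm; [right|left]; last first.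
    by move=> v /bsatP vV; have := Hm v; rewrite vV.
  exists (fixv m); split.
    by apply: fmax_maximal; split=> // z zV; have := Hm z; rewrite zV => /andP [].
  move=> z /bsatP zV al; have := Hm z; rewrite zV => /= /andP [_ /implyP]; apply.
  apply/all_In => -[p g] /dlistP [pr [d pd ->]] /=; apply/implyP => md_.
  by apply: (al p) => //; rewrite (fixv_rel _ pr).
Qed.

Theorem skeptical_fin : ~ skeptical T (hierarchic_extensions T rho) phi <->
  exists m, forall z, [&& bsat m, ~~ eval m phi & bsat z ==> ~~ fbetter m z].
Proof.
rewrite (skepticalE sn rg (rank_bounded r)); split=> [[m mm nm]|[m Hm]].
  have [mV mx] := maximal_fmax mm; exists m => z; rewrite mV nm /=.
  by apply/implyP; apply: mx.
have /and3P [mV nm _] := Hm m; exists (fixv m); last by rewrite Hphi.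
by apply: fmax_maximal; split=> // z zV; have /and3P [_ _] := Hm z; rewrite zV.
Qed.

(** There is one witness for each entry of a finite list of defaults, so all witnesses can be
    guessed at once. *)
Theorem prudent_fin : ~ prudent T (hierarchic_extensions T rho) phi <->
  exists v, [/\ bsat v, ~~ eval v phi & forall d, List.In d dlist ->
    eval v d.2 \/ exists2 m, fmax m & ~~ eval m d.2].
Proof.
rewrite (prudentE sn rg (rank_bounded r)); split=> [[v [vV nv H]]|[v [vV nv H]]].
  exists v; split=> //; first exact/bsatP.
  move=> [p g] /dlistP [pr [d pd ->]] /=; have [|[m mm nm]] := H _ _ pd; first by left.
  by right; exists m => //; apply: maximal_fmax.
exists (fixv v); split; [by apply/bsatP; rewrite fixv_sat | by rewrite Hphi |].
move=> p d pd; have [pr|npr] := boolP (p \in rel); last by left; apply: fixv_irrel pd.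
have /H [vd|[m mm nm]] : List.In (p, conseq d) dlist by apply/dlistP; split=> //; exists d.
  by left; rewrite (fixv_rel _ pr).
by right; exists (fixv m); [apply: fmax_maximal | rewrite (fixv_rel _ pr)].
Qed.

End Finite.

(** * Formulas in Polish notation *)

Notation bits := (seq bool).
Definition tAtom : bits := [:: false; false; false].
Definition tTop : bits := [:: false; false; true].
Definition tBot : bits := [:: false; true; false].
Definition tNot : bits := [:: false; true; true].
Definition tAnd : bits := [:: true; false; false].
Definition tOr : bits := [:: true; false; true].
Definition tImp : bits := [:: true; true; false].

Fixpoint toks A (key : A -> bits) (f : form A) : seq (bits * bits) :=
  match f with
  | Atom a => [:: (tAtom, key a)]
  | Top => [:: (tTop, [::])]
  | Bot => [:: (tBot, [::])]
  | Not a => (tNot, [::]) :: toks key a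
  | And a b => (tAnd, [::]) :: toks key a ++ toks key b
  | Or a b => (tOr, [::]) :: toks key a ++ toks key b
  | Imp a b => (tImp, [::]) :: toks key a ++ toks key b
  end.

(** Prefix notation read from the right needs only a stack of truth values, so evaluation is a fold.
    A valuation is given as the list of the keys of the true atoms. *)
Definition tstep (v : seq bits) (t : bits * bits) (s : seq bool) : seq bool :=
  if t.1 == tAtom then (t.2 \in v) :: s
  else if t.1 == tTop then true :: s
  else if t.1 == tBot then false :: s
  else if t.1 == tNot then ~~ head false s :: behead s
  else if t.1 == tAnd then (head false s && head false (behead s)) :: behead (behead s)
  else if t.1 == tOr then (head false s || head false (behead s)) :: behead (behead s)
  else (head false s ==> head false (behead s)) :: behead (behead s).

Definition teval (v : seq bits) (ts : seq (bits * bits)) : bool :=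
  head false (foldr (tstep v) [::] ts).

Lemma foldr_tstep A (key : A -> bits) v f s :
  foldr (tstep v) s (toks key f) = eval (fun a => key a \in v) f :: s.
Proof.
by elim: f s => //= [a IHa|a IHa b IHb|a IHa b IHb|a IHa b IHb] s;
  rewrite ?foldr_cat ?IHb ?IHa.
Qed.

Lemma teval_toks A (key : A -> bits) v f :
  teval v (toks key f) = eval (fun a => key a \in v) f.
Proof. by rewrite /teval foldr_tstep. Qed.

Lemma sz_behead (A : encType) (s : seq A) : sz (behead s) <= sz s.
Proof. by case: s => //= a s; rewrite sz_cons; lia. Qed.

Lemma poly_teval : poly (fun q : seq bits * seq (bits * bits) => teval q.1 q.2).
Proof.
rewrite /teval; plib.
pref (poly_foldr (f := fun q : seq bits * seq (bits * bits) => tstep q.1) (p := fun=> 2) _ _ _ _ _).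
- by ptac.
- by ptac.
- by rewrite /tstep; ptac.
- by pbd.
- move=> g a b; rewrite /tstep.
  have h c (x : bool) : sz c <= sz a -> sz (x :: c) <= sz a + 2.
    by rewrite sz_cons; move: (sz_bool x); szlia.
  have h1 := sz_behead a; have h2 := leq_trans (sz_behead (behead a)) h1.
  by do ![case: ifP => _; first by apply: h]; apply: h.
Qed.

Definition tkeys (ts : seq (bits * bits)) : seq bits :=
  [seq t.2 | t <- ts & t.1 == tAtom].

Lemma tkeys_toks A (key : A -> bits) f : tkeys (toks key f) = [seq key a | a <- atoms f].
Proof.
rewrite /tkeys; elim: f => //= [a ->|a IHa b IHb|a IHa b IHb|a IHa b IHb].
- by rewrite -(atoms_s _ false).
- by rewrite filter_cat map_cat IHa IHb /atoms /= !map_cat.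
- by rewrite filter_cat map_cat IHa IHb /atoms /= !map_cat.
- by rewrite filter_cat map_cat IHa IHb /atoms /= !map_cat (atoms_s _ false).
Qed.

(** * The quantified condition on an abstract instance *)

(* Comparison of canonical binary numbers, least significant bit first. *)
Definition leb (a b : bits) : bool :=
  if size a < size b then true else if size b < size a then false
  else foldl (fun acc p => if p.1 == p.2 then acc else p.2) true (zip a b).

Lemma poly_leb : poly (fun q : bits * bits => leb q.1 q.2).
Proof.
rewrite /leb; ptac.
pref (poly_foldl (f := fun (_ : bits * bits) acc (p : bool * bool) =>
  if p.1 == p.2 then acc else p.2) (p := fun=> 1) _ _ _ _ _).
- by ptac.
- by ptac.
- by ptac.
- by pbd.
- by move=> _ a [x y] /=; case: ifP => _; rewrite ?leq_addr //; move: (sz_bool y); szlia.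
Qed.

Definition bval (s : bits) : nat := foldr (fun (b : bool) n => b + n.*2) 0 s.

Lemma bval_lt s : bval s < 2 ^ size s.
Proof. by elim: s => //= b s IH; rewrite expnS; case: b; lia. Qed.

Lemma bval_ge s : last true s -> s != [::] -> 2 ^ (size s).-1 <= bval s.
Proof.
elim: s => //= b [|c s] IH /= l _; first by rewrite l.
by have := IH l isT; rewrite /= expnS; lia.
Qed.

Lemma leb_bval a b : last true a -> last true b -> leb a b = (bval a <= bval b).
Proof.
move=> la lb; rewrite /leb; case: ltngtP => [lt|gt|eq].
- have bb : b != [::] by case: b lt {lb}.
  have := bval_lt a; have := bval_ge lb bb.
  have : 2 ^ size a <= 2 ^ (size b).-1 by rewrite leq_exp2l //; lia.
  by lia.
- have ba : a != [::] by case: a gt {la}.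
  have := bval_lt b; have := bval_ge la ba.
  have : 2 ^ size b <= 2 ^ (size a).-1 by rewrite leq_exp2l //; lia.
  by lia.
- have H (acc : bool) u w : size u = size w ->
    foldl (fun acc p => if p.1 == p.2 then acc else p.2) acc (zip u w) =
    if acc then bval u <= bval w else bval u < bval w.
    elim: u w acc {la lb eq} => [|x u IH] [|y w] acc //= => [_|[e]]; first by case: acc.
    by rewrite IH //; case: x; case: y; case: acc => /=; lia.
  exact: (H true).
Qed.

Section Generic.

Notation kform := (form bits).
Variables (V : kform) (D : seq (bits * kform)) (phi : kform).
Implicit Types u w : bits -> bool.

Definition kbetter u w : bool :=
  has (fun d => [&& eval w d.2, ~~ eval u d.2 &
    all (fun d' => leb d'.1 d.1 ==> eval u d'.2 ==> eval w d'.2) D]) D.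

Definition kcred u w : bool :=
  if eval u V then eval w V ==> ~~ kbetter u w &&
      (all (fun d => eval u d.2 ==> eval w d.2) D ==> eval w phi)
  else ~~ eval w V.

Definition kskep u w : bool :=
  [&& eval u V, ~~ eval u phi & eval w V ==> ~~ kbetter u w].

Definition kblocks (d : bits * kform) u w : bool :=
  [&& eval u V, ~~ eval u d.2 & eval w V ==> ~~ kbetter u w].

End Generic.

(** The facts, the defaults with the binary codes of their ranks, and the conclusion, with formulas
    as token lists. *)
Definition gp : Type := (seq (bits * bits) * seq (bits * seq (bits * bits)) * seq (bits * bits))%type.
Canonical enc_gp := Eval hnf in EncType (enc : gp -> tree).

Definition gp_of (V : form bits) (D : seq (bits * form bits)) (phi : form bits) : gp :=
  (toks id V, [seq (d.1, toks id d.2) | d <- D], toks id phi).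

(** Keys may repeat. [gval] makes a key true as soon as one of its positions carries [true], and the
    certificate of a valuation writes the same bit at all of them. *)
Definition gkeys (g : gp) : seq bits :=
  tkeys g.1.1 ++ flatten [seq tkeys d.2 | d <- g.1.2] ++ tkeys g.2.

Definition gval (g : gp) (y : bits) : seq bits :=
  [seq p.1 | p <- zip (gkeys g) y & p.2].

Definition gbetter (g : gp) (u w : seq bits) : bool :=
  has (fun d => [&& teval w d.2, ~~ teval u d.2 &
    all (fun d' => leb d'.1 d.1 ==> teval u d'.2 ==> teval w d'.2) g.1.2]) g.1.2.

Definition gcred (g : gp) (u w : seq bits) : bool :=
  if teval u g.1.1 then teval w g.1.1 ==> ~~ gbetter g u w &&
      (all (fun d => teval u d.2 ==> teval w d.2) g.1.2 ==> teval w g.2)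
  else ~~ teval w g.1.1.

Definition gskep (g : gp) (u w : seq bits) : bool :=
  [&& teval u g.1.1, ~~ teval u g.2 & teval w g.1.1 ==> ~~ gbetter g u w].

Definition gblocks (g : gp) (d : bits * seq (bits * bits)) (u w : seq bits) : bool :=
  [&& teval u g.1.1, ~~ teval u d.2 & teval w g.1.1 ==> ~~ gbetter g u w].

Definition drop_as (l : seq bits) (y : bits) : bits := foldl (fun a _ => behead a) y l.

Definition gprud_step (g : gp) (v w : seq bits) (a : bool * bits)
    (d : bits * seq (bits * bits)) : bool * bits :=
  (a.1 && (teval v d.2 || gblocks g d (gval g a.2) w), drop_as (gkeys g) a.2).

Definition gprud (g : gp) (y : bits) (w : seq bits) : bool :=
  let v := gval g y in
  [&& teval v g.1.1, ~~ teval v g.2 &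
      (foldl (gprud_step g v w) (true, drop_as (gkeys g) y) g.1.2).1].

(** One block of bits for the main valuation and one for every default, as the prudent case demands;
    the two other cases read only the first block. *)
Definition gclock (g : gp) : nat := size (gkeys g) * (size g.1.2).+1.

(** * Valuations as certificates *)

Section GP.
Variables (V : form bits) (D : seq (bits * form bits)) (phi : form bits).
Let g := gp_of V D phi.

Lemma teval_V u : teval u g.1.1 = eval (mem u) V.
Proof. exact: teval_toks. Qed.

Lemma teval_phi u : teval u g.2 = eval (mem u) phi.
Proof. exact: teval_toks. Qed.

Lemma gbetterE u w : gbetter g u w = kbetter D (mem u) (mem w).
Proof.
rewrite /gbetter /kbetter has_map; apply: eq_has => d /=; rewrite !teval_toks.
congr [&& _, _ & _]; rewrite all_map; apply: eq_all => d' /=.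
by rewrite !teval_toks.
Qed.

Lemma gcredE u w : gcred g u w = kcred V D phi (mem u) (mem w).
Proof.
rewrite /gcred /kcred !teval_V teval_phi gbetterE all_map.
congr (if _ then _ ==> _ && (_ ==> _) else _); apply: eq_all => d /=.
by rewrite !teval_toks.
Qed.

Lemma gskepE u w : gskep g u w = kskep V D phi (mem u) (mem w).
Proof. by rewrite /gskep /kskep !teval_V teval_phi gbetterE. Qed.

Lemma gblocksE d u w : gblocks g (d.1, toks id d.2) u w = kblocks V D d (mem u) (mem w).
Proof. by rewrite /gblocks /kblocks !teval_V teval_toks gbetterE. Qed.

Lemma eval_in (A : eqType) (f : form A) u w : {in atoms f, u =1 w} -> eval u f = eval w f.
Proof.
by move=> e; rewrite !(eval_pev _ true); apply: eq_pev_in => // x xf; rewrite e.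
Qed.

Definition gbits (u : bits -> bool) : bits := [seq u k | k <- gkeys g].

Lemma mem_gval u y k : k \in gkeys g -> (k \in gval g (gbits u ++ y)) = u k.
Proof.
rewrite /gval /gbits => kg.
have -> : zip (gkeys g) ([seq u k | k <- gkeys g] ++ y) = [seq (k, u k) | k <- gkeys g].
  by elim: (gkeys g) => [|a l IH] /=; [case: y | rewrite IH].
apply/mapP/idP => [[p]|uk]; first by rewrite mem_filter => /andP [p2 /mapP [a _ e]] ->; move: p2; rewrite e.
by exists (k, u k) => //; rewrite mem_filter /= uk /=; apply/mapP; exists k; rewrite // uk.
Qed.

Definition agree u w : Prop := [/\ eval u V = eval w V, eval u phi = eval w phi &
  forall d, List.In d D -> eval u d.2 = eval w d.2].

Lemma agree_refl u : agree u u.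
Proof. by []. Qed.

Lemma agree_gval u y : agree (mem (gval g (gbits u ++ y))) u.
Proof.
have H f : {subset atoms f <= gkeys g} -> eval (mem (gval g (gbits u ++ y))) f = eval u f.
  by move=> s; apply: eval_in => k /s kg; apply: mem_gval kg.
have sub f : tkeys (toks id f) = atoms f by rewrite tkeys_toks map_id.
split; [apply: H|apply: H|move=> d dD; apply: H] => k kf.
- by rewrite mem_cat sub kf.
- by rewrite /gkeys /g /= !mem_cat (sub phi) kf !orbT.
- rewrite !mem_cat /g /= -map_comp.
  suff -> : k \in flatten [seq tkeys (toks id d.2) | d <- D] by rewrite orbT.
  elim: D dD => //= e l IH [->|/IH h]; rewrite mem_cat ?h ?orbT //.
  by rewrite sub kf.
Qed.

Lemma eq_has_In A (b1 b2 : pred A) l : (forall d, List.In d l -> b1 d = b2 d) ->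
  has b1 l = has b2 l.
Proof.
by elim: l => //= a l IH h; rewrite h ?IH //; [move=> d dl; apply: h; right|left].
Qed.

Lemma eq_all_In A (b1 b2 : pred A) l : (forall d, List.In d l -> b1 d = b2 d) ->
  all b1 l = all b2 l.
Proof.
by elim: l => //= a l IH h; rewrite h ?IH //; [move=> d dl; apply: h; right|left].
Qed.

Section Agree.
Variables u u' w w' : bits -> bool.
Hypotheses (au : agree u u') (aw : agree w w').

Lemma agree_kbetter : kbetter D u w = kbetter D u' w'.
Proof.
have [_ _ hu] := au; have [_ _ hw] := aw.
apply: eq_has_In => d dD; rewrite hu // hw //; congr [&& _, _ & _].
by apply: eq_all_In => d' d'D; rewrite hu // hw.
Qed.

Lemma agree_kcred : kcred V D phi u w = kcred V D phi u' w'.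
Proof.
have [h1 h2 h3] := au; have [k1 k2 k3] := aw.
rewrite /kcred h1 k1 k2 agree_kbetter; congr (if _ then _ ==> _ && (_ ==> _) else _).
by apply: eq_all_In => d dD; rewrite h3 // k3.
Qed.

Lemma agree_kskep : kskep V D phi u w = kskep V D phi u' w'.
Proof.
by have [h1 h2 _] := au; have [k1 _ _] := aw; rewrite /kskep h1 h2 k1 agree_kbetter.
Qed.

Lemma agree_kblocks d : List.In d D -> kblocks V D d u w = kblocks V D d u' w'.
Proof.
move=> dD; have [h1 _ h3] := au; have [k1 _ _] := aw.
by rewrite /kblocks h1 h3 // k1 agree_kbetter.
Qed.

End Agree.

Lemma size_gbits u : size (gbits u) = size (gkeys g).
Proof. by rewrite size_map. Qed.

Lemma kcred_bits : (exists u, forall w, kcred V D phi u w) <->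
  exists2 y, size y = gclock g & forall z, size z = size (gkeys g) ->
    gcred g (gval g y) (gval g z).
Proof.
split=> [[u Hu]|[y sy Hy]].
  exists (gbits u ++ nseq (size (gkeys g) * size D) false).
    by rewrite size_cat size_gbits size_nseq /gclock /= size_map mulnS.
  by move=> z _; rewrite gcredE (agree_kcred (agree_gval _ _) (agree_refl _)).
exists (mem (gval g y)) => w.
have := Hy (gbits w) (size_gbits w); rewrite gcredE -[gbits w]cats0.
by rewrite (agree_kcred (agree_refl _) (agree_gval _ _)).
Qed.

Lemma kskep_bits : (exists u, forall w, kskep V D phi u w) <->
  exists2 y, size y = gclock g & forall z, size z = size (gkeys g) ->
    gskep g (gval g y) (gval g z).
Proof.
split=> [[u Hu]|[y sy Hy]].
  exists (gbits u ++ nseq (size (gkeys g) * size D) false).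
    by rewrite size_cat size_gbits size_nseq /gclock /= size_map mulnS.
  by move=> z _; rewrite gskepE (agree_kskep (agree_gval _ _) (agree_refl _)).
exists (mem (gval g y)) => w.
have := Hy (gbits w) (size_gbits w); rewrite gskepE -[gbits w]cats0.
by rewrite (agree_kskep (agree_refl _) (agree_gval _ _)).
Qed.

Lemma drop_asE (l : seq bits) y : drop_as l y = drop (size l) y.
Proof.
by rewrite /drop_as; elim: l y => [|a l IH] [|b y] //=; rewrite ?drop0 // IH.
Qed.

Fixpoint kchk v w (y : bits) (l : seq (bits * form bits)) : bool :=
  if l is d :: l' then (eval v d.2 || kblocks V D d (mem (gval g y)) w) &&
    kchk v w (drop (size (gkeys g)) y) l'
  else true.

Lemma kprud_bits : (exists v, [/\ eval v V, ~~ eval v phi & forall d, List.In d D ->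
    eval v d.2 \/ exists u, forall w, kblocks V D d u w]) <->
  exists2 y, size y = gclock g & forall z, size z = size (gkeys g) ->
    gprud g y (gval g z).
Proof.
have F v w l (b : bool) y : (foldl (gprud_step g v w) (b, y) [seq (d.1, toks id d.2) | d <- l]).1 =
   b && kchk (mem v) (mem w) y l.
  elim: l b y => [|d l IH] b y /=; first by rewrite andbT.
  by rewrite IH drop_asE teval_toks gblocksE -andbA.
split=> [[v [vV nv H]]|[y sy Hy]].
  have [ys [sy Hys]] : exists ys, size ys = size (gkeys g) * size D /\
      forall w, kchk v w ys D.
    suff X l : (forall d, List.In d l -> List.In d D) ->
        exists ys, size ys = size (gkeys g) * size l /\ forall w, kchk v w ys l by exact: X.
    elim: l => [|d l IH] sub; first by exists [::]; rewrite muln0.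
    have [|ys [sy Hys]] := IH; first by move=> e el; apply: sub; right.
    have dD := sub d (or_introl erefl).
    have [u Hu] : exists u, forall w, eval v d.2 || kblocks V D d u w.
      have [->|[u Hu]] := H d dD; first by exists (fun=> true).
      by exists u => w; rewrite Hu orbT.
    exists (gbits u ++ ys); split; first by rewrite size_cat size_gbits sy mulnS.
    move=> w /=; rewrite (agree_kblocks (agree_gval _ _) (agree_refl _) dD) Hu /=.
    by rewrite drop_size_cat ?size_gbits.
  exists (gbits v ++ ys).
    by rewrite size_cat size_gbits sy /gclock /= size_map mulnS.
  have [a1 a2 a3] := agree_gval v ys.
  move=> z _; rewrite /gprud teval_V teval_phi a1 a2 vV nv /= F /= drop_asE.
  rewrite drop_size_cat ?size_gbits //.
  suff X l yy : (forall d, List.In d l -> List.In d D) -> kchk v (mem (gval g z)) yy l ->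
      kchk (mem (gval g (gbits v ++ ys))) (mem (gval g z)) yy l by apply: X (Hys _).
  elim: l yy => [|d l IH] yy //= sub /andP [h1 h2].
  rewrite a3 ?h1 ?IH //; [by move=> e el; apply: sub; right | by apply: sub; left].
exists (mem (gval g y)); have := Hy (nseq (size (gkeys g)) false) (size_nseq _ _).
rewrite /gprud teval_V teval_phi => /and3P [vV nv _]; split=> // d dD.
have [|nvd] := boolP (eval (mem (gval g y)) d.2); first by left.
right.
have : forall w, kchk (mem (gval g y)) (mem (gval g (gbits w ++ [::]))) (drop_as (gkeys g) y) D.
  move=> w; have := Hy (gbits w) (size_gbits w); rewrite /gprud => /and3P [_ _].
  by rewrite F /= cats0.
(* The block of [y] that belongs to [d] is fixed before [w], so it is a witness for all [w] at once;
   the induction walks along the list to this block. *)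
suff X l yy : List.In d l ->
    (forall w, kchk (mem (gval g y)) (mem (gval g (gbits w ++ [::]))) yy l) ->
    exists u, forall w, kblocks V D d u w by apply: X.
elim: l yy => //= e l IH yy [->|dl] Hw; last first.
  by apply: (IH (drop (size (gkeys g)) yy) dl) => w; have /andP [] := Hw w.
exists (mem (gval g yy)) => w; have /andP [+ _] := Hw w.
by rewrite (negbTE nvd) /= (agree_kblocks (agree_refl _) (agree_gval _ _) dD).
Qed.

End GP.

Lemma poly_gkeys : poly gkeys.
Proof. by rewrite /gkeys /tkeys; ptac. Qed.

#[export] Hint Resolve poly_gkeys : poly.

Lemma poly_teval2 (G : encType) (v : G -> seq bits) (ts : G -> seq (bits * bits)) :
  poly v -> poly ts -> poly (fun x => teval (v x) (ts x)).
Proof. by move=> hv ht; exact: (poly_comp poly_teval (poly_pair hv ht)). Qed.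

Lemma poly_leb2 (G : encType) (a b : G -> bits) : poly a -> poly b ->
  poly (fun x => leb (a x) (b x)).
Proof. by move=> ha hb; exact: (poly_comp poly_leb (poly_pair ha hb)). Qed.

Ltac puser ::= lazymatch goal with
  | |- poly (fun x => teval (@?f x) (@?g x)) => refine (@poly_teval2 _ f g _ _)
  | |- poly (fun x => leb (@?f x) (@?g x)) => refine (@poly_leb2 _ f g _ _)
  end; cbv beta.

Lemma poly_gval (G : encType) (g : G -> gp) (y : G -> bits) : poly g -> poly y ->
  poly (fun x => gval (g x) (y x)).
Proof. by move=> hg hy; rewrite /gval; ptac. Qed.

Lemma poly_gbetter (G : encType) (g : G -> gp) (u w : G -> seq bits) :
  poly g -> poly u -> poly w -> poly (fun x => gbetter (g x) (u x) (w x)).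
Proof. by move=> hg hu hw; rewrite /gbetter; ptac. Qed.

Lemma sz_drop_as l y : sz (drop_as l y) <= sz y.
Proof.
rewrite /drop_as; elim: l y => //= a l IH y.
exact: leq_trans (IH _) (sz_behead _).
Qed.

Lemma poly_drop_as (G : encType) (l : G -> seq bits) (y : G -> bits) : poly l -> poly y ->
  poly (fun x => drop_as (l x) (y x)).
Proof.
move=> hl hy; rewrite /drop_as.
pref (poly_foldl (f := fun (_ : G) (a : bits) (_ : bits) => behead a) (p := fun=> 0) hl hy _ _ _).
- by ptac.
- by pbd.
- by move=> _ a b; rewrite addn0; apply: sz_behead.
Qed.

Ltac puser ::= lazymatch goal with
  | |- poly (fun x => teval (@?f x) (@?g x)) => refine (@poly_teval2 _ f g _ _)
  | |- poly (fun x => leb (@?f x) (@?g x)) => refine (@poly_leb2 _ f g _ _)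
  | |- poly (fun x => gval (@?f x) (@?g x)) => refine (@poly_gval _ f g _ _)
  | |- poly (fun x => gbetter (@?f x) (@?g x) (@?h x)) => refine (@poly_gbetter _ f g h _ _ _)
  | |- poly (fun x => drop_as (@?f x) (@?g x)) => refine (@poly_drop_as _ f g _ _)
  end; cbv beta.

Lemma poly_gcred : poly (fun q : gp * bits * bits => gcred q.1.1 (gval q.1.1 q.1.2) (gval q.1.1 q.2)).
Proof.
by rewrite /gcred; ptac.
Qed.

Lemma poly_gskep : poly (fun q : gp * bits * bits => gskep q.1.1 (gval q.1.1 q.1.2) (gval q.1.1 q.2)).
Proof.
by rewrite /gskep; ptac.
Qed.

Lemma poly_gprud : poly (fun q : gp * bits * bits => gprud q.1.1 q.1.2 (gval q.1.1 q.2)).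
Proof.
rewrite /gprud; ptac.
pref (poly_foldl (f := fun q : gp * bits * bits => gprud_step q.1.1 (gval q.1.1 q.1.2) (gval q.1.1 q.2))
  (p := fun=> 1) _ _ _ _ _).
- by ptac.
- by ptac.
- rewrite /gprud_step /gblocks.
  by ptac.
- by pbd.
- move=> q [b y] d; rewrite /gprud_step /= !szE.
  have := sz_drop_as (gkeys q.1.1) y; move: (drop_as _ y) => y'.
  move: (b && _) => c; move: (sz_bool c); szlia.
Qed.

Lemma poly_gclock : poly gclock.
Proof. by rewrite /gclock; ptac. Qed.

(** * Parsing *)

Lemma pair_step_suffix n s : sz (iter n pair_step s).2 <= sz s.2.
Proof.
elim: n s => // n IH s; rewrite iterSr; apply: leq_trans (IH _) _.
case: s => [[[] a] [|[] [|c r]]] //=; rewrite ?sz_cons; szlia.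
Qed.

Lemma sz_pair_decode w : sz (pair_decode w).2 <= sz w.
Proof. exact: pair_step_suffix. Qed.

Lemma sz_fst (A B : encType) (p : A * B) : sz p.1 <= sz p.
Proof. by case: p => a b; rewrite sz_pair /=; szlia. Qed.

Lemma sz_tail (A : encType) (a : A) s : sz s <= sz (a :: s).
Proof. exact: sz_behead (a :: s). Qed.

Opaque pair_decode.

(** * A decoding loop *)

Section Dloop.
Variables (C A : encType) (stop : C -> bool) (nxt : C -> A -> C) (item : bits -> A * bits).

(** The control state decides when to stop: a flag for sequences, the number of formulas still due
    for Polish notation. A stopped state is a fixed point, so surplus iterations do no harm. *)
Definition dstep (s : C * seq A * bits) : C * seq A * bits :=
  if stop s.1.1 then s
  else (nxt s.1.1 (item s.2).1, (item s.2).1 :: s.1.2, (item s.2).2).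

Definition dloop (c : C) (x : bits) : seq A * bits :=
  let s := iter (size x).+1 dstep (c, [::], x) in (rev s.1.2, s.2).

Lemma dstepE c acc x : stop c = false ->
  dstep (c, acc, x) = (nxt c (item x).1, (item x).1 :: acc, (item x).2).
Proof. by move=> e; rewrite /dstep /= e. Qed.

Lemma iter_dstep_stop n s : stop s.1.1 -> iter n dstep s = s.
Proof. by move=> ss; elim: n => //= n ->; rewrite /dstep ss. Qed.

Lemma dloopE c x j c' l r : iter j dstep (c, [::], x) = (c', rev l, r) -> stop c' ->
  j <= (size x).+1 -> dloop c x = (l, r).
Proof.
move=> e sc le; rewrite /dloop -(subnK le) iterD e iter_dstep_stop //=.
by rewrite revK.
Qed.

Hypothesis item_sz : forall x, sz (item x).2 <= sz x.

Lemma dstep_rest n s : sz (iter n dstep s).2 <= sz s.2.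
Proof.
elim: n => //= n IH; apply: leq_trans IH; rewrite {1}/dstep; case: ifP => //= _.
Qed.

Lemma dloop_rest c x : sz (dloop c x).2 <= sz x.
Proof. exact: (dstep_rest (size x).+1 (c, [::], x)). Qed.

Hypotheses (pstop : poly stop) (pnxt : poly (fun q : C * A => nxt q.1 q.2)).
Hypothesis pitem : poly item.
Hypothesis nxt_sz : forall c a, sz (nxt c a) <= sz c + 1.

Lemma poly_dloop c : poly (dloop c).
Proof.
have [p hp [mp bp]] := poly_bound pitem.
have h : poly (fun x : bits => iter (sz (size x).+1) dstep (c, [::], x)).
  pref (poly_iter_sz (f := fun _ : bits => dstep)
    (p := fun n => (sz c + n.+1 + n.+1 * (p n).+1 + n).+2) _ _ _ _ _).
  - by ptac.
  - by ptac.
  - rewrite /dstep; ptac.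
    by pref (poly_comp (f := fun q : bits * (C * seq A * bits) => (q.2.1.1, (item q.2.2).1)) pnxt _); ptac.
  - apply: pbounded_S; apply: pbounded_S; apply: pbounded_add; last exact: pbounded_id.
    apply: pbounded_add; first by pbd.
    by apply: pbounded_mul; pbd.
  - move=> x k; rewrite sz_nat => le_k.
    set s := iter k dstep (c, [::], x).
    have h2 : sz s.2 <= sz x by apply: (dstep_rest k (c, [::], x)).
    have h1 : sz s.1.1 <= sz c + k /\ sz s.1.2 <= k * (p (sz x)).+1.
      rewrite /s {s h2}; elim: k {le_k} => [|k [IH1 IH2]] /=.
        by rewrite mul0n addn0.
      have : sz (iter k dstep (c, [::], x)).2 <= sz x := dstep_rest k (c, [::], x).
      move: IH1 IH2; set s := iter k _ _ => i1 i2 i3.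
      rewrite /dstep; case: ifP => _ /=; first by split; [lia | rewrite mulSn; lia].
      split; first by apply: leq_trans (nxt_sz _ _) _; lia.
      rewrite sz_cons mulSn addSn ltnS leq_add //.
      exact: leq_trans (sz_fst _) (leq_trans (bp s.2) (mp _ _ i3)).
    have [h3 h4] := h1; have h5 := size_leq_sz x.
    apply: (@leq_trans ((sz c + k + k * (p (sz x)).+1).+1 + sz x).+1).
      rewrite sz_prod (sz_prod s.1) ltnS; apply: leq_add => //; rewrite ltnS.
      exact: leq_add.
    have h6 : k * (p (sz x)).+1 <= (sz x).+1 * (p (sz x)).+1.
      by rewrite leq_mul2r (leq_trans le_k) ?orbT.
    rewrite addSn !ltnS leq_add2r; apply: leq_add => //; rewrite leq_add2l.
    exact: leq_trans le_k _.
rewrite /dloop.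
pref (poly_comp (g := fun s : C * seq A * bits => (rev s.1.2, s.2))
  (f := fun x : bits => iter (size x).+1 dstep (c, [::], x)) _ _); first by ptac.
by apply: (poly_ext h) => x; rewrite sz_nat.
Qed.

End Dloop.

Arguments dstep : simpl never.
Arguments dloop : simpl never.

(** * Decoding sequences and formulas *)

Section DecSeq.
Variables (A : encType) (dec : bits -> A * bits).

Definition seq_item (x : bits) : option A * bits :=
  if x is b :: r then if b then (Some (dec r).1, (dec r).2) else (None, r)
  else (None, [::]).

Definition dec_seq (x : bits) : seq A * bits :=
  let p := dloop (fun c : bool => c) (fun _ (a : option A) => if a is Some _ then false else true)
             seq_item false x in
  (flatten [seq if o is Some a then [:: a] else [::] | o <- p.1], p.2).

Lemma dec_seqK B (code : B -> bits) (g : B -> A) s r :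
  (forall b r, dec (code b ++ r) = (g b, r)) ->
  dec_seq (code_seq code s ++ r) = (map g s, r).
Proof.
move=> H; rewrite /dec_seq.
rewrite (@dloopE _ _ _ _ _ _ _ (size s).+1 true (rcons [seq Some (g b) | b <- s] None) r) //.
- congr pair; rewrite map_rcons -cats1 flatten_cat /= cats0.
  by elim: s => //= b s ->.
- rewrite rev_rcons.
  suff E acc : iter (size s).+1 (dstep (fun c : bool => c)
      (fun _ (a : option A) => if a is Some _ then false else true) seq_item)
      (false, acc, code_seq code s ++ r) = (true, None :: rev [seq Some (g b) | b <- s] ++ acc, r).
    by rewrite E cats0.
  elim: s acc => [|b s IH] acc //.
  have -> : code_seq code (b :: s) ++ r = true :: code b ++ code_seq code s ++ r.
    by rewrite /code_seq /= -!catA.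
  by rewrite iterSr dstepE //= H /= -iterS IH rev_cons cat_rcons.
- rewrite ltnS size_cat /code_seq size_cat /=.
  by elim: s => //= b s IH; rewrite size_cat; lia.
Qed.

Hypotheses (pdec : poly dec) (sdec : forall x, sz (dec x).2 <= sz x).

Lemma seq_item_sz x : sz (seq_item x).2 <= sz x.
Proof.
case: x => [|[] r] //=.
exact: leq_trans (sdec r) (sz_tail _ _).
Qed.

Lemma poly_dec_seq : poly dec_seq.
Proof.
have h : poly (dloop (fun c : bool => c) (fun _ (a : option A) => if a is Some _ then false else true)
   seq_item false).
  apply: (poly_dloop (C := enc_bool) (A := enc_option A)).
  - exact: seq_item_sz.
  - by ptac.
  - by pref (poly_match_option (l := fun q : bool * option A => q.2) (h := fun _ _ => false) _ _ _); ptac.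
  - by rewrite /seq_item; ptac.
  - by move=> c [a|]; rewrite /sz /=; lia.
rewrite /dec_seq; pref (poly_comp (g := fun p : seq (option A) * bits =>
  (flatten [seq if o is Some a then [:: a] else [::] | o <- p.1], p.2)) _ h).
by ptac.
Qed.

End DecSeq.

Definition tokcode (t : bits * bits) : bits :=
  t.1 ++ (if t.1 == tAtom then pair_code (t.2, [::]) else [::]).

Lemma code_natE n r : code_nat n ++ r = pair_code (binary n, r).
Proof. by rewrite /code_nat /code_seq /pair_code -catA. Qed.

Lemma code_formE f : code_form f = flatten [seq tokcode t | t <- toks binary f].
Proof.
elim: f => //= [p|a -> //|a -> b ->|a -> b ->|a -> b ->].
- by rewrite cats0 -code_natE cats0.
- by rewrite map_cat flatten_cat.
- by rewrite map_cat flatten_cat.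
- by rewrite map_cat flatten_cat.
Qed.

Definition dec_token (x : bits) : (bits * bits) * bits :=
  if x is a :: r then if r is b :: r then if r is c :: r then
    if [:: a; b; c] == tAtom then ((tAtom, (pair_decode r).1), (pair_decode r).2)
    else (([:: a; b; c], [::]), r)
  else (([::], [::]), [::]) else (([::], [::]), [::]) else (([::], [::]), [::]).

Arguments dec_token : simpl never.

(** The number of subformulas still due: an atom or a constant settles one, a negation replaces one
    by one, a binary connective one by two. *)
Definition need (n : nat) (t : bits * bits) : nat :=
  if (t.1 == tAtom) || (t.1 == tTop) || (t.1 == tBot) then n.-1
  else if t.1 == tNot then n else n.+1.

Definition dec_form : bits -> seq (bits * bits) * bits :=
  dloop (fun n : nat => n == 0) need dec_token 1.

Arguments dec_form : simpl never.
Arguments dec_seq : simpl never.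

Lemma dec_formK f r : dec_form (code_form f ++ r) = (toks binary f, r).
Proof.
apply: (@dloopE _ _ _ _ _ _ _ (size (toks binary f)) 0) => //.
  suff E n acc : iter (size (toks binary f)) (dstep (fun n : nat => n == 0) need dec_token)
      (n.+1, acc, code_form f ++ r) = (n, rev (toks binary f) ++ acc, r).
    by rewrite E cats0.
  elim: f n acc r => [p|||a IHa|a IHa b IHb|a IHa b IHb|a IHa b IHb] n acc r //.
  - by rewrite /= dstepE // /dec_token /= code_natE pair_codeK.
  - by rewrite iterSr dstepE // IHa rev_cons cat_rcons.
  - have -> : size (toks binary (And a b)) = (size (toks binary b) + size (toks binary a)).+1.
      by rewrite /= size_cat addnC.
    rewrite iterSr dstepE // iterD.
    have -> : dec_token (code_form (And a b) ++ r) = (tAnd, [::], code_form a ++ code_form b ++ r).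
      by rewrite /dec_token /= catA.
    by rewrite /= IHa IHb rev_cons rev_cat cat_rcons catA.
  - have -> : size (toks binary (Or a b)) = (size (toks binary b) + size (toks binary a)).+1.
      by rewrite /= size_cat addnC.
    rewrite iterSr dstepE // iterD.
    have -> : dec_token (code_form (Or a b) ++ r) = (tOr, [::], code_form a ++ code_form b ++ r).
      by rewrite /dec_token /= catA.
    by rewrite /= IHa IHb rev_cons rev_cat cat_rcons catA.
  - have -> : size (toks binary (Imp a b)) = (size (toks binary b) + size (toks binary a)).+1.
      by rewrite /= size_cat addnC.
    rewrite iterSr dstepE // iterD.
    have -> : dec_token (code_form (Imp a b) ++ r) = (tImp, [::], code_form a ++ code_form b ++ r).
      by rewrite /dec_token /= catA.
    by rewrite /= IHa IHb rev_cons rev_cat cat_rcons catA.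
apply: leqW; rewrite size_cat; apply: leq_trans (leq_addr _ _).
by elim: f => //= [a IHa|a IHa b IHb|a IHa b IHb|a IHa b IHb]; rewrite ?size_cat; lia.
Qed.

Lemma dec_token_sz x : sz (dec_token x).2 <= sz x.
Proof.
case: x => [|a [|b [|c r]]] //; rewrite /dec_token; case: ifP => _ /=;
  last by do 2!apply: leq_trans (sz_tail _ _); apply: sz_tail.
by apply: leq_trans (sz_pair_decode r) _; do 2!apply: leq_trans (sz_tail _ _); apply: sz_tail.
Qed.

Lemma dec_form_rest x : sz (dec_form x).2 <= sz x.
Proof. exact: (dloop_rest _ _ dec_token_sz). Qed.

Lemma poly_dec_form : poly dec_form.
Proof.
apply: (poly_dloop (C := enc_nat) (A := enc_prod (enc_seq enc_bool) (enc_seq enc_bool))).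
- exact: dec_token_sz.
- by ptac.
- by rewrite /need; ptac.
- by rewrite /dec_token; ptac.
- by move=> c a; rewrite /need; case: (_ || _); last case: (_ == _); rewrite !sz_nat; lia.
Qed.

Opaque dec_form dec_seq.

(** * Instances: parsing, encoding and validity *)

Definition dec_pair (x : bits) : (bits * bits) * bits :=
  (((pair_decode x).1, (pair_decode (pair_decode x).2).1), (pair_decode (pair_decode x).2).2).

Lemma poly_dec_pair : poly dec_pair.
Proof. by rewrite /dec_pair; ptac. Qed.

Lemma dec_pair_rest x : sz (dec_pair x).2 <= sz x.
Proof. exact: leq_trans (sz_pair_decode _) (sz_pair_decode _). Qed.

Definition inst : Type :=
  (seq (seq (bits * bits)) * seq (bits * bits) * seq bits * seq (bits * bits))%type.
Canonical enc_inst := Eval hnf in EncType (enc : inst -> tree).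

Definition parse (hasI : bool) (x : bits) : inst :=
  let a := dec_seq dec_form x in
  let b := dec_form a.2 in
  let c := if hasI then dec_seq pair_decode b.2 else ([::], b.2) in
  let d := dec_seq dec_pair c.2 in
  (a.1, b.1, c.1, d.1).

Definition recode (hasI : bool) (i : inst) : bits :=
  code_seq (fun ts => flatten [seq tokcode t | t <- ts]) i.1.1.1 ++
  flatten [seq tokcode t | t <- i.1.1.2] ++
  (if hasI then code_seq (fun k => pair_code (k, [::])) i.1.2 else [::]) ++
  code_seq (fun k => pair_code (k.1, [::]) ++ pair_code (k.2, [::])) i.2.

Definition input (hasI : bool) (W : seq sentence) (f : sentence) (I : seq nat)
    (r : seq (nat * nat)) : bits :=
  code_seq code_form W ++ code_form f ++
  (if hasI then code_seq code_nat I else [::]) ++ code_rank r.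

Definition inst_of (W : seq sentence) (f : sentence) (I : seq nat) (r : seq (nat * nat)) : inst :=
  ([seq toks binary g | g <- W], toks binary f, [seq binary i | i <- I],
   [seq (binary x.1, binary x.2) | x <- r]).

Lemma eq_code_seq A B (c : A -> bits) (d : B -> bits) (g : A -> B) s :
  (forall a, c a = d (g a)) -> code_seq c s = code_seq d (map g s).
Proof.
move=> e; rewrite /code_seq -map_comp; congr (flatten _ ++ _).
by apply: eq_map => a /=; rewrite e.
Qed.

Lemma code_nat_pair n : code_nat n = pair_code (binary n, [::]).
Proof. by rewrite -[LHS]cats0 code_natE. Qed.

Lemma inputE hasI W f I r : input hasI W f I r = recode hasI (inst_of W f I r).
Proof.
rewrite /input /recode /=; congr (_ ++ _); last congr (_ ++ _); last congr (_ ++ _).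
- by apply: eq_code_seq => g; rewrite code_formE.
- by rewrite code_formE.
- by case: hasI => //; apply: eq_code_seq => n; rewrite code_nat_pair.
- by apply: eq_code_seq => -[a b] /=; rewrite !code_nat_pair.
Qed.

Lemma parse_input hasI W f I r : (hasI = false -> I = [::]) ->
  parse hasI (input hasI W f I r) = inst_of W f I r.
Proof.
move=> hI; rewrite /parse /input.
rewrite (dec_seqK (g := toks binary)); last by move=> *; apply: dec_formK.
cbn [fst snd]; rewrite dec_formK; cbn [fst snd].
have K n s : pair_decode (code_nat n ++ s) = (binary n, s) by rewrite code_natE pair_codeK.
have L : dec_seq dec_pair (code_rank r) = ([seq (binary x.1, binary x.2) | x <- r], [::]).
  rewrite -[code_rank r]cats0; apply: dec_seqK => -[a b] s /=.
  by rewrite /dec_pair -catA !K.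
case: hasI hI => [_|/(_ erefl) ->]; last by rewrite /= L.
by rewrite (dec_seqK (g := binary)) //= L.
Qed.

Opaque dec_pair.

Lemma poly_parse hasI : poly (parse hasI).
Proof.
have h1 : poly (dec_seq dec_form) := poly_dec_seq poly_dec_form dec_form_rest.
have h2 : poly (dec_seq pair_decode) := poly_dec_seq poly_pair_decode sz_pair_decode.
have pd := poly_dec_pair.
have h3 : poly (dec_seq dec_pair).
  exact: poly_dec_seq pd dec_pair_rest.
have h4 := poly_dec_form.
by case: hasI; rewrite /parse /=; ptac.
Qed.

Lemma poly_code_seq (G A : encType) (c : G -> A -> bits) (s : G -> seq A) :
  poly (fun q : G * A => c q.1 q.2) -> poly s -> poly (fun x => code_seq (c x) (s x)).
Proof. by move=> hc hs; rewrite /code_seq; ptac. Qed.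

Lemma poly_tokcode : poly tokcode.
Proof. by rewrite /tokcode; ptac. Qed.

#[export] Hint Resolve poly_tokcode : poly.

Lemma poly_recode hasI : poly (recode hasI).
Proof.
rewrite /recode; plib; first by pref (poly_code_seq (c := fun _ _ => flatten _) _ _); ptac.
plib; first by ptac.
plib; last by pref (poly_code_seq (c := fun _ k => pair_code (k.1, [::]) ++ pair_code (k.2, [::])) _ _); ptac.
case: hasI; last by ptac.
by pref (poly_code_seq (c := fun _ k => pair_code (k, [::])) _ _); ptac.
Qed.

Lemma last_pos_bits b p : last b (pos_bits p).
Proof. by elim: p b => //= p IH b. Qed.

Lemma last_binary n : last true (binary n).
Proof. by rewrite /binary; case: (bin_of_nat n) => // p; apply: last_pos_bits. Qed.

(** With the least significant bit first, the canonical binary words are the empty one and those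
    ending in [true]; this explains the test [last true] wherever a key is to be a number. *)
Lemma binary_onto s : last true s -> exists n, binary n = s.
Proof.
case: s => [|b s] l; first by exists 0.
have [p ep] : exists p, pos_bits p = b :: s.
  elim: s b l => [|c s IH] b /= l.
    by exists BinNums.xH; rewrite /= l.
  have [p ep] := IH c l.
  by exists (if b then BinNums.xI p else BinNums.xO p); case: b; rewrite /= ep.
by exists (nat_of_bin (BinNums.Npos p)); rewrite /binary nat_of_binK.
Qed.

Lemma bval_binary n : bval (binary n) = n.
Proof.
rewrite /binary -[RHS]bin_of_natK; case: (bin_of_nat n) => //= p.
by elim: p => //= p ->; rewrite ?add0n // NatTrec.doubleE.
Qed.

Lemma binary_inj : injective binary.
Proof. by move=> m n e; rewrite -(bval_binary m) e bval_binary. Qed.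

Lemma toks_inj A (key : A -> bits) : injective key ->
  forall f g a b, toks key f ++ a = toks key g ++ b -> f = g /\ a = b.
Proof.
move=> ki; elim=> [p|||f IHf|f IHf f' IHf'|f IHf f' IHf'|f IHf f' IHf']
  [q|||g|g g'|g g'|g g'] a b //=.
- by case=> /ki -> ->.
- by case.
- by case.
- by case=> /IHf [-> ->].
- by rewrite -!catA => -[/IHf [-> /IHf' [-> ->]]].
- by rewrite -!catA => -[/IHf [-> /IHf' [-> ->]]].
- by rewrite -!catA => -[/IHf [-> /IHf' [-> ->]]].
Qed.

Lemma code_form_inj : injective code_form.
Proof.
move=> f g e; have := dec_formK f [::]; rewrite e dec_formK => -[e'].
by have [] := @toks_inj _ _ binary_inj g f [::] [::]; rewrite ?cats0.
Qed.

Lemma NoDup_code W : List.NoDup W <-> uniq [seq code_form f | f <- W].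
Proof.
elim: W => [|f W IH] /=; first by split=> // _; constructor.
have H : (code_form f \in [seq code_form g | g <- W]) <-> List.In f W.
  elim: W {IH} => //= g W IH; rewrite inE; split.
    by case/orP => [/eqP /code_form_inj ->|/IH]; [left|right].
  by case=> [->|/IH ->]; rewrite ?eqxx ?orbT.
split=> [nd|/andP [nf u]].
  inversion nd as [|? ? nf nW]; subst; apply/andP; split; last exact/IH.
  by apply/negP => /H fW; apply: nf.
by constructor; [move=> /H fW; rewrite fW in nf | apply/IH].
Qed.

(** Read from the right like evaluation, but keeping only the height of the stack; the flag fails on
    missing operands and on malformed tokens. *)
Definition wfstep (t : bits * bits) (s : bool * nat) : bool * nat :=
  if t.1 == tAtom then (s.1 && last true t.2, s.2.+1)
  else if (t.1 == tTop) || (t.1 == tBot) then (s.1 && (t.2 == [::]), s.2.+1)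
  else if t.1 == tNot then ([&& s.1, t.2 == [::] & 0 < s.2], s.2)
  else if [|| t.1 == tAnd, t.1 == tOr | t.1 == tImp] then
    ([&& s.1, t.2 == [::] & 1 < s.2], s.2.-1)
  else (false, s.2).

Definition wf (ts : seq (bits * bits)) : bool :=
  let s := foldr wfstep (true, 0) ts in s.1 && (s.2 == 1).

Lemma wf_toks f : wf (toks binary f).
Proof.
have E g n : foldr wfstep (true, n) (toks binary g) = (true, n.+1).
  by elim: g n => //= [p|a IHa|a IHa b IHb|a IHa b IHb|a IHa b IHb] n;
    rewrite /= ?foldr_cat ?IHb ?IHa //= /wfstep /= last_binary.
by rewrite /wf E.
Qed.

Lemma wfP ts : wf ts -> exists f, ts = toks binary f.
Proof.
suff H d : foldr wfstep (true, 0) ts = (true, d) ->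
    exists2 fs, size fs = d & ts = flatten [seq toks binary f | f <- fs].
  rewrite /wf; case E: (foldr _ _ _) => [[] d] //= /eqP d1.
  have [fs sf ->] := H _ E; case: fs sf => [|f [|g fs]]; rewrite d1 //= => _.
  by exists f; rewrite cats0.
elim: ts d => [|[tg k] ts IH] d /=; first by case=> <-; exists [::].
case E: (foldr _ _ _) => [ok n]; rewrite {1}/wfstep /=.
have [->|_] := eqVneq tg tAtom.
  case=> /andP [okt /binary_onto [p <-]] <-; rewrite okt in E.
  by have [fs <- ->] := IH _ E; exists (Atom p :: fs).
case: ifP => [tb|_].
  case=> /andP [okt /eqP ->] <-; rewrite okt in E; have [fs <- ->] := IH _ E.
  by case/orP: tb => /eqP ->; [exists (Top :: fs) | exists (Bot :: fs)].
have [->|_] := eqVneq tg tNot.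
  case=> /and3P [okt /eqP -> n0] <-; rewrite okt in E.
  have [[|f fs] sf ->] := IH _ E; first by rewrite -sf in n0.
  by exists (Not f :: fs).
case: ifP => // tb; case=> /and3P [okt /eqP -> n1] <-; rewrite okt in E.
have [[|f [|g fs]] sf ->] := IH _ E; rewrite -?sf // in n1 *.
by case/or3P: tb => /eqP ->; [exists (And f g :: fs) | exists (Or f g :: fs)
  | exists (Imp f g :: fs)]; rewrite //= catA.
Qed.

Lemma poly_last : poly (last true).
Proof.
apply: (@poly_ext _ _ (fun s : bits => head true (rev s))); first by ptac.
by move=> s; case/lastP: s => // s x; rewrite rev_rcons last_rcons.
Qed.

#[export] Hint Resolve poly_last : poly.

Lemma poly_wf : poly wf.
Proof.
have h : poly (fun ts => foldr wfstep (true, 0) ts).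
  pref (poly_foldr (l := fun ts : seq (bits * bits) => ts)
    (f := fun _ => wfstep) (p := fun=> 3) _ (poly_const _ _) _ _ _).
  - by ptac.
  - by rewrite /wfstep; ptac.
  - by pbd.
  - move=> _ [b n] [tg k]; have B (c : bool) (m : nat) : m <= n.+1 -> sz (c, m) <= sz (b, n) + 3.
      by rewrite !sz_pair !sz_nat; move: (sz_bool c); szlia.
    rewrite /wfstep /=; do ![case: ifP => _; first by apply: B; lia]; apply: B; lia.
by rewrite /wf; pref (poly_comp (g := fun s : bool * nat => s.1 && (s.2 == 1)) _ h); ptac.
Qed.

#[export] Hint Resolve poly_wf : poly.

Lemma poly_tkeys : poly tkeys.
Proof. by rewrite /tkeys; ptac. Qed.

#[export] Hint Resolve poly_tkeys : poly.

(** Comparing the input with the code of its parse replaces error handling in the parser. The other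
    tests ensure that tokens and bit words come from genuine formulas and numbers and that the
    conditions on facts, indices and ranking hold. *)
Definition valid (hasI ord : bool) (x : bits) (i : inst) : bool :=
  [&& recode hasI i == x, all wf i.1.1.1, wf i.1.1.2, all (last true) i.1.2 &
  [&& all (fun k => [&& last true k.1, last true k.2 & k.2 != [::]]) i.2,
      uniq [seq flatten [seq tokcode t | t <- ts] | ts <- i.1.1.1],
      uniq [seq k.1 | k <- i.2],
      (if hasI then uniq i.1.2 && (size i.1.2 == size (flatten [seq tkeys ts | ts <- i.1.1.1]))
       else i.1.2 == [::]) &
      ord ==> (size i.2 == 0)]].

Lemma map_onto A B (h : A -> B) (s : seq B) :
  (forall y, List.In y s -> exists x, y = h x) -> exists l, s = map h l.
Proof.
elim: s => [|y s IH] H; first by exists [::].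
have [x ->] := H y (or_introl erefl); have [|l ->] := IH.
  by move=> z zs; apply: H; right.
by exists (x :: l).
Qed.

Lemma size_tkeys_all W :
  size (flatten [seq tkeys ts | ts <- [seq toks binary f | f <- W]]) = size (all_occurrences W).
Proof.
rewrite /all_occurrences; elim: W => //= f W IH.
by rewrite !size_cat IH tkeys_toks !size_map.
Qed.

Definition instance (hasI ord : bool) W I r : Prop :=
  [/\ List.NoDup W, ranking r, (if hasI then index_set W I else I = [::])
    & ord -> r = [::]].

Lemma validP hasI ord x : valid hasI ord x (parse hasI x) <->
  exists W f I r, [/\ instance hasI ord W I r, x = input hasI W f I r &
                      parse hasI x = inst_of W f I r].
Proof.
have M W f I r : valid hasI ord (input hasI W f I r) (inst_of W f I r) <->
    instance hasI ord W I r.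
  rewrite /valid -inputE eqxx /= wf_toks.
  have -> : all wf [seq toks binary g | g <- W] by rewrite all_map; apply/all_In => g _; apply: wf_toks.
  have -> : all (last true) [seq binary i | i <- I].
    by rewrite all_map; apply/all_In => g _; apply: last_binary.
  have -> : all (fun k => [&& last true k.1, last true k.2 & k.2 != [::]])
      [seq (binary x.1, binary x.2) | x <- r] = all (leq 1) (unzip2 r).
    rewrite /unzip2 !all_map; apply: eq_all => -[a b] /=; rewrite !last_binary /=.
    by rewrite -[[::]]/(binary 0) (inj_eq binary_inj) lt0n.
  have -> : [seq flatten [seq tokcode t | t <- ts] | ts <- [seq toks binary g | g <- W]] =
      [seq code_form g | g <- W].
    by rewrite -map_comp; apply: eq_map => g; rewrite code_formE.
  have -> : [seq k.1 | k <- [seq (binary x.1, binary x.2) | x <- r]] = map binary (unzip1 r).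
    by rewrite /unzip1 -!map_comp.
  rewrite (map_inj_uniq binary_inj) (map_inj_uniq binary_inj) !size_map size_tkeys_all /=.
  split.
    case/and5P => h1 /NoDup_code nd h0 h2 h3; split=> //.
      by case: (hasI) h2 => [/andP [u /eqP s]|]; [split | case: (I)].
    by move=> o; move: h3; rewrite o /= => /eqP /size0nil.
  case=> /NoDup_code -> [-> ->] h2 h3; rewrite /=; apply/andP; split.
    by case: (hasI) h2 => [[-> ->]|->]; rewrite ?eqxx.
  by apply/implyP => /h3 ->.
split=> [v|[W [f [I [r [ins ex ->]]]]]]; last by rewrite ex; apply/M.
have /and5P [/eqP rx /all_In wW /wfP [f ef] /all_In cI /and5P [/all_In cr _ _ _ _]] := v.
have [W eW] : exists W, (parse hasI x).1.1.1 = [seq toks binary g | g <- W].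
  by apply: map_onto => ts /wW /wfP.
have [I eI] : exists I, (parse hasI x).1.2 = [seq binary i | i <- I].
  by apply: map_onto => k /cI /binary_onto [n <-]; exists n.
have [r er] : exists r, (parse hasI x).2 = [seq (binary y.1, binary y.2) | y <- r].
  apply: map_onto => -[a b] /cr /and3P [/= /binary_onto [m <-] /binary_onto [n <-] _].
  by exists (m, n).
have ep : parse hasI x = inst_of W f I r.
  by rewrite /inst_of -eW -ef -eI -er; case: (parse _ _) => [[[? ?] ?] ?].
have ex : x = input hasI W f I r by rewrite inputE -ep.
exists W, f, I, r; split=> //; by apply/(M W f I r); rewrite -ex -ep.
Qed.

Lemma poly_valid hasI ord : poly (fun q : bits * inst => valid hasI ord q.1 q.2).
Proof.
have hr := poly_recode hasI.
by rewrite /valid; case: hasI hr => hr; case: ord; ptac.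
Qed.

(** * Membership in the second level of the polynomial hierarchy *)

Definition kB (p : bits) : bits := [:: false, false & p].
Definition kP (p : bits) : bits := [:: false, true & p].
Definition kM (p : bits) : bits := [:: true, false & p].
Definition kPI (p i : bits) : bits := [:: true, true, false & pair_code (p, i)].
Definition kMI (p i : bits) : bits := [:: true, true, true & pair_code (p, i)].

Definition xkey (x : xatom) : bits :=
  match x with
  | Base p => kB (binary p)
  | Plus p => kP (binary p)
  | Minus p => kM (binary p)
  | PlusI p i => kPI (binary p) (binary i)
  | MinusI p i => kMI (binary p) (binary i)
  end.

Lemma xkey_inj : injective xkey.
Proof.
have pc p q : pair_code p = pair_code q -> p = q by move=> e; rewrite -(pair_codeK p) e pair_codeK.
move=> [p|p|p|p i|p i] [q|q|q|q j|q j] //= [].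
- by move=> /binary_inj ->.
- by move=> /binary_inj ->.
- by move=> /binary_inj ->.
- by move=> /pc [/binary_inj -> /binary_inj ->].
- by move=> /pc [/binary_inj -> /binary_inj ->].
Qed.

Definition kpos (cs : seq bits) (p i : bits) : bits := if p \in cs then kPI p i else kP p.
Definition kneg (cs : seq bits) (p i : bits) : bits := if p \in cs then kMI p i else kM p.

(* State: the polarities of the subformulas still to be read, the unused
   indices, the output tokens and the occurrences (polarity and atom) so far. *)
Definition sstep (cs : seq bits)
    (s : seq bool * seq bits * (seq (bits * bits) * seq bits)) (t : bits * bits) :
    seq bool * seq bits * (seq (bits * bits) * seq bits) :=
  if t.1 == tAtom then
    (behead s.1.1, behead s.1.2,
     (if head true s.1.1 then (tAtom, kpos cs t.2 (head [::] s.1.2)) :: s.2.1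
      else (tAtom, kneg cs t.2 (head [::] s.1.2)) :: (tNot, [::]) :: s.2.1,
      (head true s.1.1 :: t.2) :: s.2.2))
  else if (t.1 == tTop) || (t.1 == tBot) then (behead s.1.1, s.1.2, (t :: s.2.1, s.2.2))
  else if t.1 == tNot then
    (~~ head true s.1.1 :: behead s.1.1, s.1.2, (t :: s.2.1, s.2.2))
  else if t.1 == tImp then
    (~~ head true s.1.1 :: head true s.1.1 :: behead s.1.1, s.1.2, (t :: s.2.1, s.2.2))
  else (head true s.1.1 :: head true s.1.1 :: behead s.1.1, s.1.2, (t :: s.2.1, s.2.2)).

Definition scan (cs I : seq bits) (ts : seq (bits * bits)) : seq (bits * bits) * seq bits :=
  let s := foldl (sstep cs) ([:: true], I, ([::], [::])) ts in (rev s.2.1, rev s.2.2).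

Lemma size_occurrences A s (f : form A) : size (occurrences s f) = size (occurrences true f).
Proof.
by have := congr1 size (atoms_s f s); have := congr1 size (atoms_s f true); rewrite !size_map => _.
Qed.

Lemma drop_take_sub T (s : seq T) m n : drop n (take m s) = take (m - n) (drop n s).
Proof.
case: (leqP n m) => h; first by rewrite take_drop subnK.
have -> : m - n = 0 by apply/eqP; rewrite subn_eq0 ltnW.
by rewrite take0 drop_oversize // size_take_min; apply: leq_trans (geq_minl _ _) (ltnW h).
Qed.

(** Labelling consumes one index per occurrence and ignores the rest of the list. *)
Lemma label_take m I f : size (occurrences true f) <= m -> label (take m I) f = label I f.
Proof.
elim: f I m => //= [p|a IHa|a IHa b IHb|a IHa b IHb|a IHa b IHb] I m.
- by case: m I => [|m] [|i I].
- by rewrite size_occurrences => h; rewrite IHa.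
- rewrite size_cat => h; rewrite take_takel; last by lia.
  rewrite drop_take_sub IHb //; lia.
- rewrite size_cat => h; rewrite take_takel; last by lia.
  rewrite drop_take_sub IHb //; lia.
- rewrite size_cat size_occurrences => h; rewrite take_takel; last by lia.
  rewrite drop_take_sub IHb //; lia.
Qed.

(** The polarities of the pending operands wait on a stack, so the induction must be general in the
    rest [st] of this stack, in the spare indices and in the output so far, which is accumulated in
    reverse. *)
Lemma foldl_sstep cs (pos neg : nat * nat -> xatom) f s st I out occ :
  (forall p i, xkey (pos (p, i)) = kpos cs (binary p) (binary i)) ->
  (forall p i, xkey (neg (p, i)) = kneg cs (binary p) (binary i)) ->
  foldl (sstep cs) (s :: st, [seq binary i | i <- I], (out, occ)) (toks binary f) =
  (st, [seq binary i | i <- drop (size (occurrences true f)) I],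
   (catrev (toks xkey (polarize pos neg s (label I f))) out,
    catrev [seq x.2 :: binary x.1 | x <- occurrences s f] occ)).
Proof.
move=> hp hn.
have fc t l1 l2 x : foldl (sstep cs) x (t :: l1 ++ l2) =
    foldl (sstep cs) (foldl (sstep cs) (sstep cs x t) l1) l2 by rewrite /= foldl_cat.
elim: f s st I out occ => [p|||a IHa|a IHa b IHb|a IHa b IHb|a IHa b IHb] s st I out occ.
- have eh : head [::] [seq binary i | i <- I] = binary (head 0 I) by case: I.
  have eb : behead [seq binary i | i <- I] = [seq binary i | i <- drop 1 I].
    by case: (I) => //= i I'; rewrite drop0.
  by rewrite [foldl _ _ _]/= /sstep /= eh eb; case: s => /=; rewrite ?hp ?hn.
- by rewrite /= drop0.
- by rewrite /= drop0.
- rewrite [toks _ _]/= [foldl _ _ _]/= [X in foldl _ X _]/(sstep _ _ _) /= IHa.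
  by rewrite [size (occurrences false a)]size_occurrences.
- rewrite [toks _ _]/= fc {fc}.
  rewrite (_ : sstep _ _ _ = ([:: s, s & st], [seq binary i | i <- I], ((tAnd, [::]) :: out, occ))) //.
  rewrite IHa IHb drop_drop /= size_cat addnC label_take // map_cat !catrev_catl.
  by [].
- rewrite [toks _ _]/= fc {fc}.
  rewrite (_ : sstep _ _ _ = ([:: s, s & st], [seq binary i | i <- I], ((tOr, [::]) :: out, occ))) //.
  rewrite IHa IHb drop_drop /= size_cat addnC label_take // map_cat !catrev_catl.
  by [].
- rewrite [toks _ _]/= fc {fc}.
  rewrite (_ : sstep _ _ _ = ([:: ~~ s, s & st], [seq binary i | i <- I], ((tImp, [::]) :: out, occ))) //.
  rewrite IHa IHb drop_drop /= size_cat [size (occurrences false a)]size_occurrences addnC.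
  by rewrite label_take // map_cat !catrev_catl.
Qed.

Lemma scanE cs (pos neg : nat * nat -> xatom) f I :
  (forall p i, xkey (pos (p, i)) = kpos cs (binary p) (binary i)) ->
  (forall p i, xkey (neg (p, i)) = kneg cs (binary p) (binary i)) ->
  scan cs [seq binary i | i <- I] (toks binary f) =
  (toks xkey (polarize pos neg true (label I f)),
   [seq x.2 :: binary x.1 | x <- occurrences true f]).
Proof. by move=> hp hn; rewrite /scan (foldl_sstep _ _ _ _ _ _ hp hn) /= -!/(rev _) !revK. Qed.

Lemma scan0E f : scan [::] [::] (toks binary f) =
  (toks xkey (signed f), [seq x.2 :: binary x.1 | x <- occurrences true f]).
Proof.
rewrite (@scanE [::] (fun x => Plus x.1) (fun x => Minus x.1) f [::]) //.
by rewrite polarize_label.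
Qed.

Opaque scan.

(** The conjunction has the occurrences of [W] with the same polarities and in the same order, so
    one scan labels all facts. *)
Definition conjW (W : seq sentence) : sentence := foldr (@And nat) Top W.

Lemma occurrences_conjW W : occurrences true (conjW W) = all_occurrences W.
Proof. by rewrite /all_occurrences; elim: W => //= f W ->. Qed.

Lemma label_conjW I W : occurrences true (label I (conjW W)) = all_occurrences (label_all I W).
Proof. by rewrite /all_occurrences; elim: W I => //= f W IH I; rewrite IH. Qed.

Lemma bsat_conjW md W I m :
  bsat md W I m = eval m (polarize (posx md W) (negx md W) true (label I (conjW W))).
Proof.
rewrite /bsat eval_polarize; move: (posx md W) (negx md W) => pos neg.
by elim: W I => //= f W IH I; rewrite eval_polarize IH.
Qed.

Lemma toks_conjW W : toks binary (conjW W) =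
  flatten [seq (tAnd, [::]) :: ts | ts <- [seq toks binary f | f <- W]] ++ [:: (tTop, [::])].
Proof. by elim: W => //= f W ->; rewrite catA. Qed.

Lemma occurrences_label_zip s I f : size I = size (occurrences true f) ->
  occurrences s (label I f) = [seq ((x.1.1, x.2), x.1.2) | x <- zip (occurrences s f) I].
Proof.
elim: f s I => //= [p|||a IHa|a IHa b IHb|a IHa b IHb|a IHa b IHb] s I; first by case: I => [|i []].
- by case: I.
- by case: I.
- by rewrite size_occurrences; apply: IHa.
- rewrite size_cat => sI.
  have h1 : size (take (size (occurrences true a)) I) = size (occurrences true a).
    by rewrite size_take sI; case: ifP => //; lia.
  rewrite IHa // IHb ?size_drop ?sI; last by lia.
  by rewrite -map_cat -zip_cat ?cat_take_drop // h1 size_occurrences.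
- rewrite size_cat => sI.
  have h1 : size (take (size (occurrences true a)) I) = size (occurrences true a).
    by rewrite size_take sI; case: ifP => //; lia.
  rewrite IHa // IHb ?size_drop ?sI; last by lia.
  by rewrite -map_cat -zip_cat ?cat_take_drop // h1 size_occurrences.
- rewrite size_cat [size (occurrences false a)]size_occurrences => sI.
  have h1 : size (take (size (occurrences true a)) I) = size (occurrences true a).
    by rewrite size_take sI; case: ifP => //; lia.
  rewrite IHa // IHb ?size_drop ?sI; last by lia.
  by rewrite -map_cat -zip_cat ?cat_take_drop // h1 size_occurrences.
Qed.

Definition tLP (k a : bits) : seq (bits * bits) :=
  [:: (tAnd, [::]); (tImp, [::]); (tAtom, kB k); (tAtom, kPI k a);
      (tImp, [::]); (tAtom, kPI k a); (tAtom, kB k)].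
Definition tLN (k a : bits) : seq (bits * bits) :=
  [:: (tAnd, [::]); (tImp, [::]); (tNot, [::]); (tAtom, kB k); (tAtom, kMI k a);
      (tImp, [::]); (tAtom, kMI k a); (tNot, [::]); (tAtom, kB k)].
Definition tDL (k : bits) : seq (bits * bits) :=
  [:: (tAnd, [::]); (tAnd, [::]); (tImp, [::]); (tAtom, kB k); (tAtom, kP k);
      (tImp, [::]); (tAtom, kP k); (tAtom, kB k);
      (tAnd, [::]); (tImp, [::]); (tNot, [::]); (tAtom, kB k); (tAtom, kM k);
      (tImp, [::]); (tAtom, kM k); (tNot, [::]); (tAtom, kB k)].

Definition iconj (i : inst) : seq (bits * bits) :=
  flatten [seq (tAnd, [::]) :: ts | ts <- i.1.1.1] ++ [:: (tTop, [::])].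

(** Atoms and polarities do not depend on the labelling, so this scan can run with no complementary
    atoms and no indices. *)
Definition iocc (i : inst) : seq bits := (scan [::] [::] (iconj i)).2.

Definition irel (i : inst) : seq bits :=
  [seq behead o | o <- iocc i ++ (scan [::] [::] i.1.1.2).2].

Definition icmp (md : mode) (i : inst) : seq bits :=
  if md is M0 then [::]
  else [seq k <- irel i | (true :: k \in iocc i) && (false :: k \in iocc i)].

Definition iidx (i : inst) (b : bool) (k : bits) : seq bits :=
  [seq o.2 | o <- zip (iocc i) i.1.2 & o.1 == b :: k].

Definition idl (md : mode) (i : inst) (k : bits) : seq (seq (bits * bits)) :=
  if k \in icmp md i then
    if md is M2 then [seq tLP k a | a <- iidx i true k] ++ [seq tLN k a | a <- iidx i false k]
    else flatten [seq [seq (tAnd, [::]) :: tLP k a ++ tLN k b | b <- iidx i false k]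
                 | a <- iidx i true k]
  else [:: tDL k].

(** [[:: true]] is the binary code of 1, the rank of atoms without an entry. *)
Definition irank (i : inst) (k : bits) : bits :=
  foldr (fun e acc => if e.1 == k then e.2 else acc) [:: true] i.2.

Definition iphi (sg : bool) (i : inst) : seq (bits * bits) :=
  if sg then (scan [::] [::] i.1.1.2).1
  else [seq (t.1, if t.1 == tAtom then kB t.2 else [::]) | t <- i.1.1.2].

Definition mk (md : mode) (sg : bool) (i : inst) : gp :=
  ((scan (icmp md i) i.1.2 (iconj i)).1,
   flatten [seq [seq (irank i k, ts) | ts <- idl md i k] | k <- irel i],
   iphi sg i).

Definition translate (sg : bool) : sentence -> xform := if sg then signed else unsigned.

Section MkE.
Variables (md : mode) (sg : bool) (W : seq sentence) (f : sentence).
Variables (I : seq nat) (r : seq (nat * nat)).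
Hypothesis sizeI : (if md is M0 then True else size I = size (all_occurrences W)).
Let i := inst_of W f I r.

Definition irelN : seq nat := atoms (conjW W) ++ atoms f.

Lemma iconjE : iconj i = toks binary (conjW W).
Proof. by rewrite toks_conjW. Qed.

Lemma ioccE : iocc i = [seq x.2 :: binary x.1 | x <- all_occurrences W].
Proof.
by rewrite /iocc iconjE scan0E /= occurrences_conjW.
Qed.

Lemma irelE : irel i = [seq binary p | p <- irelN].
Proof.
rewrite /irel ioccE (_ : i.1.1.2 = toks binary f) // scan0E /=.
by rewrite /irelN /atoms occurrences_conjW !map_cat -!map_comp.
Qed.

Lemma icmpE p : (binary p \in icmp md i) = cmp md W p.
Proof.
rewrite /icmp /cmp; case: (md) => //;
rewrite mem_filter irelE mem_map; try exact: binary_inj;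
have m b : (b :: binary p \in iocc i) = ((p, b) \in all_occurrences W) by
  rewrite ioccE -(@mem_map _ _ (fun x : nat * bool => x.2 :: binary x.1)) // => -[? ?] [? ?] [-> /binary_inj ->].
all: rewrite !m /complementary; case h: ((p, true) \in all_occurrences W) => //=;
  rewrite (_ : p \in irelN) ?andbT // /irelN mem_cat /atoms occurrences_conjW;
  by apply/orP; left; apply/mapP; exists (p, true).
Qed.

Lemma iidxE b p : md <> M0 -> iidx i b (binary p) = [seq binary j | j <- indices W I b p].
Proof.
move=> nm; have sI : size I = size (all_occurrences W) by case: (md) nm sizeI.
rewrite /iidx ioccE /indices /occs -label_conjW occurrences_label_zip; last first.
  by rewrite occurrences_conjW.
rewrite occurrences_conjW /=; elim: (all_occurrences W) I sI => [|[q c] l IH] [|j J] //= [sJ].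
rewrite eqseq_cons (inj_eq binary_inj) andbC.
by case: ifP => _ /=; rewrite IH.
Qed.

Lemma idlE p : idl md i (binary p) = [seq toks xkey g | g <- dlist_of md W I p].
Proof.
rewrite /idl /dlist_of icmpE; case: ifP => // cp.
have nm : md <> M0 by move: cp; rewrite /cmp; case: (md).
rewrite (iidxE true p nm) (iidxE false p nm); case: (md) nm => // _.
- rewrite map_flatten -!map_comp; congr flatten; apply: eq_map => a /=.
  by rewrite -!map_comp.
- by rewrite map_cat -!map_comp.
Qed.

Lemma irankE p : irank i (binary p) = binary (rank r p).
Proof.
rewrite /irank /rank /=; elim: (r) => //= -[a b] l IH /=.
by rewrite (inj_eq binary_inj) IH; case: eqP.
Qed.

Lemma toks_map A B (h : A -> B) key g : toks key (map_form h g) = toks (fun a => key (h a)) g.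
Proof. by elim: g => //= [a ->|a -> b ->|a -> b ->|a -> b ->]. Qed.

Lemma mkE : mk md sg i =
  gp_of (map_form xkey (polarize (posx md W) (negx md W) true (label I (conjW W))))
        [seq (binary (rank r d.1), map_form xkey d.2) | d <- dlist md W I irelN]
        (map_form xkey (translate sg f)).
Proof.
rewrite /mk /gp_of; congr (_, _, _).
- rewrite toks_map iconjE (_ : i.1.2 = [seq binary j | j <- I]) //.
  rewrite (@scanE _ (posx md W) (negx md W)) // => p j.
    by rewrite /posx /kpos icmpE /=; case: ifP.
  by rewrite /negx /kneg icmpE /=; case: ifP.
- rewrite irelE -!map_comp /dlist map_flatten -map_comp; congr flatten.
  apply: eq_map => p /=; rewrite idlE irankE -!map_comp; apply: eq_map => g /=.
  by rewrite toks_map.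
- rewrite toks_map /iphi /translate; case: sg => /=.
    by rewrite scan0E.
  by elim: (f) => //= [a ->|a IHa b IHb|a IHa b IHb|a IHa b IHb]; rewrite ?map_cat ?IHa ?IHb.
Qed.

End MkE.

(** * The translation of instances is polynomial *)

Lemma sz_pair_code (k i : bits) : sz (pair_code (k, i)) <= sz i + 3 * sz k + 2.
Proof.
rewrite /pair_code sz_cat sz_cons /= (_ : sz false = 0) //.
suff : sz (flatten [seq [:: true; b] | b <- k]) <= 3 * sz k by lia.
elim: k => //= b k IH; rewrite !sz_cons (_ : sz true = 1) //; lia.
Qed.

Lemma sz_kpos cs k i : sz (kpos cs k i) <= sz i + 3 * sz k + 10.
Proof.
rewrite /kpos /kPI /kP; have := sz_pair_code k i.
by case: ifP => _; rewrite !sz_cons (_ : sz true = 1) // (_ : sz false = 0) //; lia.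
Qed.

Lemma sz_kneg cs k i : sz (kneg cs k i) <= sz i + 3 * sz k + 10.
Proof.
rewrite /kneg /kMI /kM; have := sz_pair_code k i.
have e : sz true = 1 by []. have e' : sz false = 0 by [].
by case: ifP => _; rewrite !sz_cons e ?e'; lia.
Qed.

Lemma sz_sstep cs s t : sz (sstep cs s t) <= sz s + (4 * (sz cs + sz t) + 60).
Proof.
case: s => [[st I] [out occ]]; case: t => [tag key]; rewrite /sstep /=.
have hb (b : bool) : sz b <= 1 := sz_bool b.
case: ifP => _.
  have : sz (behead I) + sz (head [::] I) <= sz I.
    by case: I => [|i I] //=; rewrite ?szE //; lia.
  have := sz_kpos cs key (head [::] I); have := sz_kneg cs key (head [::] I).
  have := sz_behead st; have := hb (head true st).
  move: (kpos _ _ _) (kneg _ _ _) => k1 k2.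
  move: (head true st) (behead I) (head [::] I) (behead st) => b I' i st'.
  have e1 : sz tAtom = 3 by []. have e2 : sz tNot = 5 by [].
  by move: tAtom tNot e1 e2 => ta tn e1 e2; case: b; rewrite !szE; move: e1 e2; szlia.
have h := sz_behead st; have h1 := hb (head true st); have h2 := hb (~~ head true st).
move: (head true st) (~~ head true st) (behead st) h h1 h2 => b b' st' h h1 h2.
by do ?[case: ifP => _]; rewrite !szE; move: h h1 h2; szlia.
Qed.

Transparent scan.

Lemma poly_scan (G : encType) (cs I : G -> seq bits) (ts : G -> seq (bits * bits)) :
  poly cs -> poly I -> poly ts -> poly (fun x => scan (cs x) (I x) (ts x)).
Proof.
move=> hc hI ht.
have h : poly (fun x => foldl (sstep (cs x)) ([:: true], I x, ([::], [::])) (ts x)).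
  have [p hp [mp bp]] := poly_bound hc.
  pref (poly_foldl (f := fun x => sstep (cs x)) (p := fun n => 4 * (p n + n) + 60) ht _ _ _ _).
  - by ptac.
  - by rewrite /sstep /kpos /kneg /kP /kM /kPI /kMI; ptac.
  - by pbd.
  - move=> x s t; apply: leq_trans (sz_sstep _ _ _) _.
    have := bp x; have := mp (sz x) (sz x + sz t) (leq_addr _ _); lia.
by rewrite /scan; ptac.
Qed.

Opaque scan.

Ltac puser ::= lazymatch goal with
  | |- poly (fun x => scan (@?f x) (@?g x) (@?h x)) => refine (@poly_scan _ f g h _ _ _)
  end; cbv beta.

Lemma poly_iconj : poly iconj.
Proof. by rewrite /iconj; ptac. Qed.

#[export] Hint Resolve poly_iconj : poly.

Lemma poly_iocc : poly iocc.
Proof. by rewrite /iocc; ptac. Qed.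

#[export] Hint Resolve poly_iocc : poly.

Lemma poly_irel : poly irel.
Proof. by rewrite /irel; ptac. Qed.

#[export] Hint Resolve poly_irel : poly.

Lemma poly_icmp md : poly (icmp md).
Proof. by rewrite /icmp; case: md; ptac. Qed.

#[export] Hint Resolve poly_icmp : poly.

Lemma poly_iidx b : poly (fun q : inst * bits => iidx q.1 b q.2).
Proof. by rewrite /iidx; ptac. Qed.

Lemma poly_idl md : poly (fun q : inst * bits => idl md q.1 q.2).
Proof.
have h b (G : encType) (i : G -> inst) (k : G -> bits) : poly i -> poly k ->
    poly (fun x => iidx (i x) b (k x)).
  by move=> hi hk; exact: (poly_comp (poly_iidx b) (poly_pair hi hk)).
have hs b (G : encType) : poly (fun q : inst * bits * G => iidx q.1.1 b q.1.2) by apply: h; ptac.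
have hc := poly_icmp md.
rewrite /idl /tLP /tLN /tDL /kP /kM /kB /kPI /kMI; pref (poly_if _ _ _); [by ptac| |by ptac].
case: md {hc} => [||]; [by ptac; apply: h; ptac|by ptac; apply: h; ptac|].
by ptac; apply: h; ptac.
Qed.

Lemma poly_irank : poly (fun q : inst * bits => irank q.1 q.2).
Proof.
rewrite /irank.
pref (poly_foldr (f := fun (q : inst * bits) (e : bits * bits) (acc : bits) =>
   if e.1 == q.2 then e.2 else acc) (p := fun n => n) _ _ _ _ _).
- by ptac.
- by ptac.
- by ptac.
- by pbd.
- by move=> [i k] a [e1 e2] /=; case: ifP => _; rewrite !szE; szlia.
Qed.

Lemma poly_mk md sg : poly (mk md sg).
Proof.
rewrite /mk; pref (poly_pair _ _); last first.
  by rewrite /iphi /kB; case: sg; ptac.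
pref (poly_pair _ _); first by ptac.
pref (poly_flatten _); pref (poly_map _ _); last by ptac.
pref (poly_map (f := fun (q : inst * bits) ts => (irank q.1 q.2, ts)) _ _); last exact: poly_idl.
ptac; by pref (poly_comp (f := fun q : inst * bits * seq (bits * bits) => q.1) poly_irank _); ptac.
Qed.

Lemma eval_map A B (h : A -> B) u g : eval u (map_form h g) = eval (fun x => u (h x)) g.
Proof. by elim: g => //= [a ->|a -> b ->|a -> b ->|a -> b ->]. Qed.

(** Since keys are injective, the valuations of keys induce all valuations of atoms, so quantifying
    over the former is quantifying over the latter. *)
Lemma xkey_onto (m : xatom -> bool) : exists u : bits -> bool, (fun x => u (xkey x)) = m.
Proof.
exists (fun k => `[< exists2 x, xkey x = k & m x >]); apply: functional_extensionality_dep => x.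
by apply/asboolP/idP => [[y /xkey_inj ->]|mx] //; exists x.
Qed.

Lemma leb_binary a b : leb (binary a) (binary b) = (a <= b).
Proof. by rewrite leb_bval ?last_binary // !bval_binary. Qed.

(** * The quantified conditions for concrete instances *)

Section Decide.
Variables (md : mode) (sg : bool) (W : seq sentence) (f : sentence).
Variables (I : seq nat) (r : seq (nat * nat)).
Hypothesis sizeI : (if md is M0 then True else size I = size (all_occurrences W)).
Hypothesis rk : ranking r.

Let rel := irelN W f.
Let T := thy md W I.
Let Es := hierarchic_extensions T (rank r).
Let V := map_form xkey (polarize (posx md W) (negx md W) true (label I (conjW W))).
Let D := [seq (binary (rank r d.1), map_form xkey d.2) | d <- dlist md W I rel].
Let phi := map_form xkey (translate sg f).
Let g := mk md sg (inst_of W f I r).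
Let un (u : bits -> bool) x := u (xkey x).

Lemma gE : g = gp_of V D phi.
Proof. exact: mkE. Qed.

Lemma eval_V u : eval u V = bsat md W I (un u).
Proof. by rewrite bsat_conjW eval_map. Qed.

Lemma kbetterE u w : kbetter D u w = fbetter md W I r rel (un u) (un w).
Proof.
rewrite /kbetter /fbetter has_map; apply: eq_has => d /=; rewrite !eval_map.
congr [&& _, _ & _]; rewrite all_map; apply: eq_all => d' /=.
by rewrite !eval_map leb_binary.
Qed.

Lemma irelN_W p s : (p, s) \in all_occurrences W -> p \in rel.
Proof.
move=> h; rewrite /rel /irelN mem_cat /atoms occurrences_conjW.
by apply/orP; left; apply/mapP; exists (p, s).
Qed.

Lemma eval_translate m : eval (fixv rel m) (translate sg f) = eval m (translate sg f).
Proof.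
have h : {in atoms f, forall p, p \in rel} by move=> p pf; rewrite /rel /irelN mem_cat pf orbT.
rewrite /translate; case: sg; last first.
  rewrite /unsigned !eval_map !(eval_pev _ true); apply: eq_pev_in => p /h pr /=; by rewrite pr.
by rewrite /signed !eval_polarize; apply: eq_pev_in => p /h pr /=; rewrite pr.
Qed.

Lemma credulous_decide : credulous T Es (translate sg f) <->
  exists2 y, size y = gclock g & forall z, size z = size (gkeys g) ->
    gcred g (gval g y) (gval g z).
Proof.
rewrite gE -kcred_bits (credulous_fin md I rk irelN_W eval_translate).
have E u w : kcred V D phi u w = (if bsat md W I (un u) then
    bsat md W I (un w) ==> ~~ fbetter md W I r rel (un u) (un w) &&
      (all (fun d => eval (un u) d.2 ==> eval (un w) d.2) (dlist md W I rel) ==>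
       eval (un w) (translate sg f)) else ~~ bsat md W I (un w)).
  rewrite /kcred !eval_V kbetterE all_map eval_map.
  congr (if _ then _ ==> _ && (_ ==> _) else _); apply: eq_all => d /=.
  by rewrite !eval_map.
split=> [[m Hm]|[u Hu]].
  by have [u eu] := xkey_onto m; exists u => w; rewrite E /un eu.
by exists (un u) => z; have [w <-] := xkey_onto z; rewrite -E.
Qed.

Lemma skeptical_decide : ~ skeptical T Es (translate sg f) <->
  exists2 y, size y = gclock g & forall z, size z = size (gkeys g) ->
    gskep g (gval g y) (gval g z).
Proof.
rewrite gE -kskep_bits (skeptical_fin md I rk irelN_W eval_translate).
have E u w : kskep V D phi u w = [&& bsat md W I (un u), ~~ eval (un u) (translate sg f) &
    bsat md W I (un w) ==> ~~ fbetter md W I r rel (un u) (un w)].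
  by rewrite /kskep !eval_V kbetterE eval_map.
split=> [[m Hm]|[u Hu]].
  by have [u eu] := xkey_onto m; exists u => w; rewrite E /un eu.
by exists (un u) => z; have [w <-] := xkey_onto z; rewrite -E.
Qed.

Lemma prudent_decide : ~ prudent T Es (translate sg f) <->
  exists2 y, size y = gclock g & forall z, size z = size (gkeys g) ->
    gprud g y (gval g z).
Proof.
rewrite gE -kprud_bits (prudent_fin md I rk irelN_W eval_translate).
have B d u w : kblocks V D (binary (rank r d.1), map_form xkey d.2) u w =
    [&& bsat md W I (un u), ~~ eval (un u) d.2 &
    bsat md W I (un w) ==> ~~ fbetter md W I r rel (un u) (un w)].
  by rewrite /kblocks !eval_V kbetterE /= eval_map.
have FM m d : fmax md W I r rel m /\ ~~ eval m d.2 <->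
   forall z, [&& bsat md W I m, ~~ eval m d.2 & bsat md W I z ==> ~~ fbetter md W I r rel m z].
  split=> [[[mV mx] nm] z|H]; first by rewrite mV nm; apply/implyP/mx.
  have /and3P [mV nm _] := H m; split=> //; split=> // z zV.
  by have /and3P [_ _] := H z; rewrite zV.
split=> [[v [vV nv H]]|[u [uV nu H]]].
  have [u eu] := xkey_onto v; exists u; rewrite eval_V eval_map /un eu; split=> // d' /List.in_map_iff [d [<- dD]] /=.
  rewrite eval_map eu; have [|[m fm nm]] := H d dD; [by left|right].
  have [k ek] := xkey_onto m; exists k => w; rewrite B /un ek; have /FM := conj fm nm; exact.
exists (un u); rewrite -eval_V; split=> //; first by move: nu; rewrite eval_map.
move=> d dD; have /H [ud|[k Hk]] : List.In (binary (rank r d.1), map_form xkey d.2) D.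
    by apply/List.in_map_iff; exists d.
  by left; move: ud; rewrite /= eval_map.
have /FM [fm nm] z : [&& bsat md W I (un k), ~~ eval (un k) d.2 &
    bsat md W I z ==> ~~ fbetter md W I r rel (un k) z].
  by have [w <-] := xkey_onto z; rewrite -B.
by right; exists (un k).
Qed.

End Decide.

(** An ordinary instance carries no ranking. Appending [false], the code of the empty ranking, turns
    it into a hierarchic instance with all ranks 1, so one parser and one language cover both
    kinds. *)
Definition adj (ord : bool) (x : bits) : bits := if ord then rcons x false else x.

Lemma adj_inj ord : injective (adj ord).
Proof. by case: ord => // x y /rcons_inj [->]. Qed.

(** * The decision problems as languages *)

Section Language.
Variables (md : mode) (sg ord : bool).
Let hasI := if md is M0 then false else true.

Definition dlang (R : consequence) : language :=
  [set x | exists W f I r, [/\ instance hasI ord W I r, adj ord x = input hasI W f I r &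
     R (thy md W I) (hierarchic_extensions (thy md W I) (rank r)) (translate sg f)]].

Let pr (x : bits) := parse hasI (adj ord x).
Let ok (x : bits) := valid hasI ord (adj ord x) (pr x).
Let G (x : bits) := mk md sg (pr x).

Lemma dlangE (R : consequence) (c : gp -> Prop) :
  (forall W f I r, ranking r -> (if md is M0 then True else size I = size (all_occurrences W)) ->
     R (thy md W I) (hierarchic_extensions (thy md W I) (rank r)) (translate sg f) <->
     c (mk md sg (inst_of W f I r))) ->
  forall x, dlang R x <-> ok x /\ c (G x).
Proof.
move=> H x; have sI W I r : instance hasI ord W I r ->
    if md is M0 then True else size I = size (all_occurrences W).
  by case=> _ _; rewrite /hasI; case: (md) => // -[].
split=> [[W [f [I [r [ins ex hR]]]]]|[/validP [W [f [I [r [ins ex ep]]]]] hc]].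
  have ep : pr x = inst_of W f I r.
    rewrite /pr ex parse_input // => h; case: ins => _ _; by rewrite h.
  split; first by apply/validP; exists W, f, I, r.
  by rewrite /G ep; apply/H => //; [case: ins | exact: sI ins].
exists W, f, I, r; split=> //; apply/H; [by case: ins | exact: sI ins |].
by rewrite -ep.
Qed.

Lemma poly_ok : poly ok.
Proof.
have ha : poly (adj ord).
  rewrite /adj; case: ord; last exact: poly_id.
  by apply: (@poly_ext _ _ (fun x => x ++ [:: false])); [ptac | move=> x; rewrite cats1].
have hp := poly_parse hasI.
exact: (poly_comp (poly_valid hasI ord) (poly_pair ha (poly_comp hp ha))).
Qed.

Lemma poly_G : poly G.
Proof.
have ha : poly (adj ord).
  rewrite /adj; case: ord; last exact: poly_id.
  by apply: (@poly_ext _ _ (fun x => x ++ [:: false])); [ptac | move=> x; rewrite cats1].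
exact: (poly_comp (poly_mk md sg) (poly_comp (poly_parse hasI) ha)).
Qed.

Lemma dlang_Sigma2P R (C : gp * bits * bits -> bool) : poly C ->
  (forall x, dlang R x <-> ok x /\ exists2 y, size y = gclock (G x) &
     forall z, size z = size (gkeys (G x)) -> C (G x, y, z)) -> Sigma2P (dlang R).
Proof.
move=> hC H; have hG := poly_G; have hok := poly_ok; have hg := poly_gclock.
apply: (Sigma2P_intro (clock1 := fun x => gclock (G x))
  (clock2 := fun q : bits * bits => size (gkeys (G q.1)))
  (V := fun q : bits * bits * bits => ok q.1.1 && C (G q.1.1, q.1.2, q.2))).
- by ptac.
- by ptac.
- by ptac.
- move=> x; rewrite H; split=> [[o [y sy Hy]]|[y sy Hy]].
    by exists y => // z sz_; rewrite /= o Hy.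
  (* Any [z] of the right length reveals that the input is well-formed. *)
  have /andP [o _] := Hy (nseq (size (gkeys (G x))) false) (size_nseq _ _).
  by split=> //; exists y => // z sz_; have /andP [] := Hy z sz_.
Qed.

Lemma dlang_Pi2P R (C : gp * bits * bits -> bool) : poly C ->
  (forall x, dlang R x <-> ok x /\ ~ exists2 y, size y = gclock (G x) &
     forall z, size z = size (gkeys (G x)) -> C (G x, y, z)) -> Pi2P (dlang R).
Proof.
move=> hC H; have hG := poly_G; have hok := poly_ok; have hg := poly_gclock.
apply: (Sigma2P_intro (clock1 := fun x => gclock (G x))
  (clock2 := fun q : bits * bits => size (gkeys (G q.1)))
  (V := fun q : bits * bits * bits => ok q.1.1 ==> C (G q.1.1, q.1.2, q.2))).
- by ptac.
- by ptac.
- by ptac.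
- move=> x; rewrite /setC /= H; split=> [n|[y sy Hy] [o]].
    (* Ill-formed inputs lie in the complement and must be accepted, so any certificate of the right
       length will do. *)
    have [o|no] := boolP (ok x); last first.
      by exists (nseq (gclock (G x)) false); rewrite ?size_nseq // => z _; rewrite /= (negbTE no).
    have [y sy Hy] : exists2 y, size y = gclock (G x) &
       forall z, size z = size (gkeys (G x)) -> C (G x, y, z).
      by apply: contrapT => h; apply: n.
    by exists y => // z sz_; rewrite /= o Hy.
  by apply; exists y => // z sz_; have /implyP := Hy z sz_; apply.
Qed.

Lemma credulous_Sigma2P : Sigma2P (dlang credulous).
Proof.
apply: (dlang_Sigma2P poly_gcred); apply: (dlangE (c := fun g => exists2 y, size y = gclock g &
  forall z, size z = size (gkeys g) -> gcred g (gval g y) (gval g z))) => W f I r rk sI.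
exact: credulous_decide.
Qed.

Lemma skeptical_Pi2P : Pi2P (dlang skeptical).
Proof.
apply: (dlang_Pi2P poly_gskep); apply: (dlangE (c := fun g => ~ exists2 y, size y = gclock g &
  forall z, size z = size (gkeys g) -> gskep g (gval g y) (gval g z))) => W f I r rk sI.
by rewrite -(skeptical_decide sg f sI rk); split=> [h|/contrapT].
Qed.

Lemma prudent_Pi2P : Pi2P (dlang prudent).
Proof.
apply: (dlang_Pi2P poly_gprud); apply: (dlangE (c := fun g => ~ exists2 y, size y = gclock g &
  forall z, size z = size (gkeys g) -> gprud g y (gval g z))) => W f I r rk sI.
by rewrite -(prudent_decide sg f sI rk); split=> [h|/contrapT].
Qed.

End Language.

Definition is_ordinary (h : kind) : bool := if h is Ordinary then true else false.

Lemma rank_nil : rank [::] = (fun=> 1).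
Proof. by apply: functional_extensionality_dep => p; rewrite /rank nth_nil. Qed.

Lemma extensions_thy md W I :
  extensions (thy md W I) = hierarchic_extensions (thy md W I) (rank [::]).
Proof. by rewrite rank_nil; apply: extensions_hierarchic; apply: thy_seminormal. Qed.

Lemma problem0E h R sg : problem0 h R (translate sg) = dlang M0 sg (is_ordinary h) R.
Proof.
apply/seteqP; case: h => /=; split=> x.
- case=> W [f [nd -> hR]]; exists W, f, [::], [::]; split=> //.
    by rewrite /adj /input /= -cats1 -!catA.
  by rewrite -extensions_thy -(T0E W [::]).
- case=> W [f [I [r [[nd rk /= eI er] ex hR]]]]; rewrite eI (er erefl) in ex hR.
  exists W, f; split=> //; last by rewrite (T0E W [::]) extensions_thy.
  apply: (@adj_inj true); rewrite [LHS]ex /adj /input /= -cats1 -!catA //.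
- case=> W [f [r [nd rk -> hR]]]; exists W, f, [::], r; split=> //.
  by rewrite -(T0E W [::]).
- case=> W [f [I [r [[nd rk /= eI _] ex hR]]]]; rewrite eI in ex hR.
  by exists W, f, r; split=> //; rewrite (T0E W [::]).
Qed.

Lemma problemIE h R md : md <> M0 ->
  problemI h (thy md) R = dlang md false (is_ordinary h) R.
Proof.
move=> nm; have hI : (if md is M0 then false else true) = true by case: md nm.
rewrite /dlang hI; apply/seteqP; case: h => /=; split=> x.
- case=> W [f [I [nd iI -> hR]]]; exists W, f, I, [::]; split=> //.
    by rewrite /adj /input /= -cats1 -!catA.
  by rewrite -extensions_thy.
- case=> W [f [I [r [[nd rk /= iI er] ex hR]]]]; rewrite (er erefl) in ex hR.
  exists W, f, I; split=> //; last by rewrite extensions_thy.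
  by apply: (@adj_inj true); rewrite [LHS]ex /adj /input /= -cats1 -!catA.
- by case=> W [f [I [r [nd iI rk -> hR]]]]; exists W, f, I, r.
- by case=> W [f [I [r [[nd rk /= iI _] ex hR]]]]; exists W, f, I, r.
Qed.

(** * Formulas computed in polynomial time *)

Definition bigand A (l : seq A) (F : A -> sentence) : sentence :=
  foldr (fun a f => And (F a) f) Top l.

Definition bigor A (l : seq A) (F : A -> sentence) : sentence :=
  foldr (fun a f => Or (F a) f) Bot l.

(** The bounded until operator of temporal logic, with [g] as the last chance: a machine may halt at
    any time up to the bound, and nothing is said about later times. *)
Definition until A (l : seq A) (H S : A -> sentence) (g : sentence) : sentence :=
  foldr (fun a f => Or (H a) (And (S a) f)) g l.

Definition cst (b : bool) : sentence := if b then Top else Bot.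

Lemma eval_bigand A v (l : seq A) F : eval v (bigand l F) = all (fun a => eval v (F a)) l.
Proof. by elim: l => //= a l ->. Qed.

Lemma eval_bigor A v (l : seq A) F : eval v (bigor l F) = has (fun a => eval v (F a)) l.
Proof. by elim: l => //= a l ->. Qed.

Lemma eval_cst v b : eval v (cst b) = b.
Proof. by case: b. Qed.

Lemma eval_until v m n H S : eval v (until (iota m n) H S (H (m + n))) <->
  exists j, [/\ j <= n, forall i, i < j -> eval v (S (m + i)) & eval v (H (m + j))].
Proof.
elim: n m => [|n IH] m /=.
  by split=> [h|[[|j] [// _ _]]]; exists 0.
rewrite addnS -addSn; split.
  case/orP => [h|/andP [s /IH [j [le_j hs hh]]]]; first by exists 0; rewrite addn0.
  exists j.+1; rewrite addnS; split=> // -[|i] lt; first by rewrite addn0.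
  by rewrite addnS; apply: hs.
case=> -[|j] [le_j hs hh]; first by rewrite addn0 in hh; rewrite hh.
apply/orP; right; apply/andP; split; first by rewrite -[m]addn0 hs.
apply/IH; exists j; rewrite addSnnS; split=> // i lt.
by rewrite addSnnS; apply: hs.
Qed.

Lemma atomsE A (f : form A) : atoms f = [seq x.1 | x <- occurrences false f].
Proof. by rewrite atoms_s. Qed.

(* The atoms of the formulas below have names starting with the bit [false];
   the other names are left for the atoms of the reduction. *)
Definition fresh_ok (f : sentence) : bool := all (fun p => ~~ head true (binary p)) (atoms f).

Definition fcode (f : sentence) : bits * seq bits := (code_form f, [seq binary p | p <- atoms f]).

(** The list of atoms is computed along with the code, because the reductions have to enumerate the
    existential atoms and to count occurrences. *)
Definition pform (G : encType) (F : G -> sentence) : Prop :=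
  poly (fun g => fcode (F g)) /\ forall g, fresh_ok (F g).

Lemma atoms_And A (a b : form A) : atoms (And a b) = atoms a ++ atoms b.
Proof. by rewrite /atoms /= map_cat. Qed.

Lemma atoms_Or A (a b : form A) : atoms (Or a b) = atoms a ++ atoms b.
Proof. by rewrite /atoms /= map_cat. Qed.

Lemma atoms_Imp A (a b : form A) : atoms (Imp a b) = atoms a ++ atoms b.
Proof. by rewrite [atoms a]atomsE /atoms /= map_cat. Qed.

Lemma atoms_Not A (a : form A) : atoms (Not a) = atoms a.
Proof. by rewrite [atoms a]atomsE. Qed.

Section PForm.
Variable G : encType.
Implicit Types F H : G -> sentence.

Lemma pform_code F : pform F -> poly (fun g => code_form (F g)).
Proof. by case=> h _; exact: (poly_fst h). Qed.

Lemma pform_atoms F : pform F -> poly (fun g => [seq binary p | p <- atoms (F g)]).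
Proof. by case=> h _; exact: (poly_snd h). Qed.

Lemma pform_intro F (c : G -> bits) (l : G -> seq bits) : poly c -> poly l ->
  (forall g, fcode (F g) = (c g, l g)) -> (forall g, fresh_ok (F g)) -> pform F.
Proof.
by move=> hc hl e o; split=> //; apply: poly_ext (poly_pair hc hl) _ => g; rewrite e.
Qed.

Lemma pform_Top : pform (fun _ : G => Top).
Proof. by split=> //; exact: poly_const. Qed.

Lemma pform_Bot : pform (fun _ : G => Bot).
Proof. by split=> //; exact: poly_const. Qed.

Lemma pform_Not F : pform F -> pform (fun g => Not (F g)).
Proof.
move=> hF; have hc := pform_code hF; have hl := pform_atoms hF.
apply: (pform_intro (c := fun g => [:: false; true; true] ++ code_form (F g)) _ hl).
- by ptac.
- by move=> g; rewrite /fcode atoms_Not.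
- by move=> g; rewrite /fresh_ok atoms_Not; apply: (proj2 hF).
Qed.

Lemma pform_And F H : pform F -> pform H -> pform (fun g => And (F g) (H g)).
Proof.
move=> hF hH; have c1 := pform_code hF; have l1 := pform_atoms hF.
have c2 := pform_code hH; have l2 := pform_atoms hH.
apply: (pform_intro (c := fun g => [:: true; false; false] ++ code_form (F g) ++ code_form (H g))
  (l := fun g => [seq binary p | p <- atoms (F g)] ++ [seq binary p | p <- atoms (H g)])).
- by pref (poly_cat _ _); [ptac | pref (poly_cat _ _)].
- by pref (poly_cat _ _).
- by move=> g; rewrite /fcode atoms_And map_cat.
- by move=> g; rewrite /fresh_ok atoms_And all_cat; apply/andP; split; [apply: (proj2 hF)|apply: (proj2 hH)].
Qed.

Lemma pform_Or F H : pform F -> pform H -> pform (fun g => Or (F g) (H g)).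
Proof.
move=> hF hH; have c1 := pform_code hF; have l1 := pform_atoms hF.
have c2 := pform_code hH; have l2 := pform_atoms hH.
apply: (pform_intro (c := fun g => [:: true; false; true] ++ code_form (F g) ++ code_form (H g))
  (l := fun g => [seq binary p | p <- atoms (F g)] ++ [seq binary p | p <- atoms (H g)])).
- by pref (poly_cat _ _); [ptac | pref (poly_cat _ _)].
- by pref (poly_cat _ _).
- by move=> g; rewrite /fcode atoms_Or map_cat.
- by move=> g; rewrite /fresh_ok atoms_Or all_cat; apply/andP; split; [apply: (proj2 hF)|apply: (proj2 hH)].
Qed.

Lemma pform_Imp F H : pform F -> pform H -> pform (fun g => Imp (F g) (H g)).
Proof.
move=> hF hH; have c1 := pform_code hF; have l1 := pform_atoms hF.
have c2 := pform_code hH; have l2 := pform_atoms hH.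
apply: (pform_intro (c := fun g => [:: true; true; false] ++ code_form (F g) ++ code_form (H g))
  (l := fun g => [seq binary p | p <- atoms (F g)] ++ [seq binary p | p <- atoms (H g)])).
- by pref (poly_cat _ _); [ptac | pref (poly_cat _ _)].
- by pref (poly_cat _ _).
- by move=> g; rewrite /fcode atoms_Imp map_cat.
- by move=> g; rewrite /fresh_ok atoms_Imp all_cat; apply/andP; split; [apply: (proj2 hF)|apply: (proj2 hH)].
Qed.

Lemma pform_Iff F H : pform F -> pform H -> pform (fun g => Iff (F g) (H g)).
Proof. by move=> hF hH; apply: pform_And; apply: pform_Imp. Qed.

Lemma pform_if (b : G -> bool) F H : poly b -> pform F -> pform H -> pform (fun g => if b g then F g else H g).
Proof.
move=> hb [hF oF] [hH oH]; split; last by move=> g; case: (b g).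
by apply: poly_ext (poly_if hb hF hH) _ => g; case: (b g).
Qed.

Lemma pform_cst (b : G -> bool) : poly b -> pform (fun g => cst (b g)).
Proof. by move=> hb; apply: pform_if => //; [apply: pform_Top|apply: pform_Bot]. Qed.

Lemma pform_bigand_fin A (l : seq A) (F : G -> A -> sentence) :
  (forall a, pform (F^~ a)) -> pform (fun g => bigand l (F g)).
Proof. by move=> h; elim: l => [|a l IH] /=; [apply: pform_Top|apply: pform_And]. Qed.

Lemma pform_bigor_fin A (l : seq A) (F : G -> A -> sentence) :
  (forall a, pform (F^~ a)) -> pform (fun g => bigor l (F g)).
Proof. by move=> h; elim: l => [|a l IH] /=; [apply: pform_Bot|apply: pform_Or]. Qed.

Section Lists.
Variables (A : encType) (l : G -> seq A).
Hypothesis hl : poly l.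

Lemma poly_flatten_map (B : encType) (c : G -> A -> seq B) :
  poly (fun q : G * A => c q.1 q.2) -> poly (fun g => flatten [seq c g a | a <- l g]).
Proof. by move=> hc; pref (poly_flatten _); pref (poly_map _ hl). Qed.

Lemma pform_bigand (F : G -> A -> sentence) : pform (fun q : G * A => F q.1 q.2) ->
  pform (fun g => bigand (l g) (F g)).
Proof.
case=> hF oF; have hc := poly_fst hF; have ha := poly_snd hF.
apply: (pform_intro (c := fun g => flatten [seq [:: true; false; false] ++ code_form (F g a) | a <- l g]
    ++ [:: false; false; true])
  (l := fun g => flatten [seq [seq binary p | p <- atoms (F g a)] | a <- l g])).
- pref (poly_cat _ _); last by ptac.
  by apply: poly_flatten_map; pref (poly_cat _ _); [ptac | exact: hc].
- by apply: poly_flatten_map; exact: ha.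
- move=> g; rewrite /fcode; congr pair; elim: (l g) => //= a s IH; first by rewrite IH -catA.
  by rewrite atoms_And map_cat IH.
- move=> g; elim: (l g) => //= a s IH; rewrite /fresh_ok atoms_And all_cat.
  by apply/andP; split=> //; exact: (oF (g, a)).
Qed.

Lemma pform_until (H S : G -> A -> sentence) (B : G -> sentence) :
  pform (fun q : G * A => H q.1 q.2) -> pform (fun q : G * A => S q.1 q.2) -> pform B ->
  pform (fun g => until (l g) (H g) (S g) (B g)).
Proof.
move=> [hH oH] [hS oS] [hB oB].
have c1 := poly_fst hH; have a1 := poly_snd hH; have c2 := poly_fst hS; have a2 := poly_snd hS.
have c3 := poly_fst hB; have a3 := poly_snd hB.
apply: (pform_intro (c := fun g => flatten [seq [:: true; false; true] ++ code_form (H g a) ++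
      [:: true; false; false] ++ code_form (S g a) | a <- l g] ++ code_form (B g))
  (l := fun g => flatten [seq [seq binary p | p <- atoms (H g a)] ++
      [seq binary p | p <- atoms (S g a)] | a <- l g] ++ [seq binary p | p <- atoms (B g)])).
- pref (poly_cat _ _); last exact: c3.
  apply: poly_flatten_map; pref (poly_cat _ _); first by ptac.
  by pref (poly_cat _ _); [exact: c1 | pref (poly_cat _ _); [ptac | exact: c2]].
- pref (poly_cat _ _); last exact: a3.
  by apply: poly_flatten_map; pref (poly_cat _ _); [exact: a1 | exact: a2].
- move=> g; rewrite /fcode; congr pair; elim: (l g) => //= a s IH; first by rewrite IH /= -!catA.
  by rewrite atoms_Or atoms_And !map_cat IH -!catA.
- move=> g; elim: (l g) => [|a s IH]; first exact: oB.
  rewrite /fresh_ok /= atoms_Or atoms_And !all_cat.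
  by apply/and3P; split=> //; [exact: (oH (g, a)) | exact: (oS (g, a))].
Qed.

End Lists.

End PForm.

(** The leading [false] marks the atoms of run formulas, [y] tells universal from existential ones,
    the list is coded in unary, and the closing [true] makes the word the canonical code of a
    number. *)
Definition name_bits (y : bool) (l : seq nat) : bits :=
  [:: false, y & flatten [seq rcons (nseq n true) false | n <- l] ++ [:: true]].

Definition name (y : bool) (l : seq nat) : nat := bval (name_bits y l).

Lemma binary_bval b : last true b -> binary (bval b) = b.
Proof. by move=> /binary_onto [n <-]; rewrite bval_binary. Qed.

Lemma binary_name y l : binary (name y l) = name_bits y l.
Proof. by apply: binary_bval; rewrite /name_bits /= last_cat. Qed.

Lemma name_inj y l y' l' : name y l = name y' l' -> y = y' /\ l = l'.
Proof.
move=> /(congr1 binary); rewrite !binary_name => -[->]; rewrite !cats1 => /rcons_inj [e]; split=> //.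
elim: l l' e => [|n l IH] [|m l'] //=; try by rewrite -?cats1 -?catA; case: (n) || case: (m).
rewrite !cat_rcons => e.
have F k s : find negb (nseq k true ++ false :: s) = k by elim: k => //= k ->.
have nm : n = m by rewrite -(F n (flatten [seq rcons (nseq n true) false | n <- l])) e F.
by subst m; move/eqP: e; rewrite eqseq_cat // eqxx /= eqseq_cons /= => /eqP /IH ->.
Qed.

Lemma poly_name_bits (G : encType) y (l : G -> seq nat) : poly l ->
  poly (fun g => name_bits y (l g)).
Proof.
move=> hl; have hn : poly (fun n : nat => rcons (nseq n true) false).
  apply: (@poly_ext _ _ (fun n : nat => [seq true | _ <- iota 0 n] ++ [:: false])); first by ptac.
  have E s : [seq true | _ : nat <- s] = nseq (size s) true by elim: s => //= a s ->.
  by move=> n; rewrite cats1 E size_iota.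
rewrite /name_bits; ptac.
by refine (@poly_comp _ _ _ (fun q : G * nat => q.2) _ hn _); ptac.
Qed.

Lemma pform_atom (G : encType) y (l : G -> seq nat) : poly l ->
  pform (fun g => Atom (name y (l g))).
Proof.
move=> hl; have hn := poly_name_bits y hl.
apply: (pform_intro (c := fun g => [:: false; false; false] ++ pair_code (name_bits y (l g), [::]))
  (l := fun g => [:: name_bits y (l g)])).
- by ptac.
- by ptac.
- by move=> g; rewrite /fcode /= code_nat_pair binary_name.
- by move=> g; rewrite /fresh_ok /= binary_name.
Qed.

Ltac pftac := repeat (first
  [ assumption
  | lazymatch goal with
    | |- pform (fun x => Top) => exact: pform_Top
    | |- pform (fun x => Bot) => exact: pform_Bot
    | |- pform (fun x => Not (@?a x)) => refine (@pform_Not _ a _)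
    | |- pform (fun x => And (@?a x) (@?b x)) => refine (@pform_And _ a b _ _)
    | |- pform (fun x => Or (@?a x) (@?b x)) => refine (@pform_Or _ a b _ _)
    | |- pform (fun x => Iff (@?a x) (@?b x)) => refine (@pform_Iff _ a b _ _)
    | |- pform (fun x => cst (@?b x)) => refine (@pform_cst _ b _)
    | |- pform (fun x => Atom (name ?y (@?l x))) => refine (@pform_atom _ y l _)
    | |- pform (fun x => bigand ?l (@?F x)) => refine (@pform_bigand_fin _ _ l F _) => ?
    | |- pform (fun x => bigor ?l (@?F x)) => refine (@pform_bigor_fin _ _ l F _) => ?
    | |- pform (fun x => bigand (@?l x) (@?F x)) => refine (@pform_bigand _ _ l _ F _)
    | |- pform (fun x => until (@?l x) (@?H x) (@?S x) (@?B x)) =>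
        refine (@pform_until _ _ l _ H S B _ _ _)
    end; cbv beta
  | lazymatch goal with |- poly _ => idtac end; solve [ptac]
  | refine (@pform_if _ _ _ _ _ _ _); cbv beta ]).

(** * Describing machine runs by formulas *)

Section RunFormula.
Variable M : machine.
Notation sym := (symbol (aux M)).
Notation K := 'I_(ntapes M).+1.
Implicit Types (y : bool) (g B t pos : nat) (k : K) (s : sym) (q : state M) (c : config M).
Implicit Type v : nat -> bool.

(* Cells are numbered relative to the head, which is always at [B]: moving the
   head shifts the whole tape. *)
Definition cellv B (tp : tape sym) pos : sym :=
  if pos < B then nth None (left tp) (B - pos).-1
  else nth None (scanned tp :: right tp) (pos - B).

Definition cell y g t k pos s : nat := name y [:: 0; g; t; val k; pos; nat_of_ord (enum_rank s)].

Definition stat y g t q : nat := name y [:: 1; g; t; nat_of_ord (enum_rank q)].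

(* Cells at the border of the window are unconstrained, so what is known at time
   [t] shrinks with [t]. *)
Definition range B t : seq nat := [seq p <- iota 0 (2 * B).+1 | (t <= p) && (p + t <= 2 * B)].

Lemma mem_range B t pos : (pos \in range B t) = (t <= pos) && (pos + t <= 2 * B).
Proof. by rewrite mem_filter mem_iota; lia. Qed.

Definition cfg y g B t q (C : K -> nat -> sym -> sentence) : sentence :=
  And (bigand (enum {: state M}) (fun q' => Iff (Atom (stat y g t q')) (cst (q' == q))))
      (bigand (range B t) (fun pos => bigand (enum {: K}) (fun k =>
         bigand (enum {: sym}) (fun s => Iff (Atom (cell y g t k pos s)) (C k pos s))))).

(** With the head fixed at [B], a head move to the left shows at [pos] what was one cell further
    left. *)
Definition src (d : direction) pos : nat :=
  match d with GoLeft => pos.-1 | Stay => pos | GoRight => pos.+1 end.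

Definition actf y g B t (a : {ffun K -> sym * direction}) k pos s : sentence :=
  if src (a k).2 pos == B then cst (s == (a k).1) else Atom (cell y g t k (src (a k).2 pos) s).

Definition samef y g t k pos s : sentence := Atom (cell y g t k pos s).

(** Directions are coded by [option bool], so that the finitely many actions can be enumerated. *)
Definition acts : seq {ffun K -> sym * direction} :=
  [seq [ffun k => ((f k).1, if (f k).2 is Some b then if b then GoLeft else GoRight else Stay)]
  | f : {ffun K -> sym * option bool} <- enum {: {ffun K -> sym * option bool}}].

Lemma acts_all a : List.In a acts.
Proof.
apply/In_map; exists [ffun k => ((a k).1, match (a k).2 with
  GoLeft => Some true | Stay => None | GoRight => Some false end)]; first by rewrite mem_enum.
by apply/ffunP => k; rewrite !ffunE /=; case: (a k) => s [].
Qed.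

Definition scanf y g B t (sg : {ffun K -> sym}) : sentence :=
  bigand (enum {: K}) (fun k => Atom (cell y g t k B (sg k))).

(** [Fy] and [Fn] are the claims that the oracle says yes or no. They are joined disjunctively: the
    formula guesses the answer and must justify the guess. *)
Definition stepf y g B t (Fy Fn : sentence) : sentence :=
  bigor (enum {: state M}) (fun q => And (Atom (stat y g t q))
    match query q with
    | Some (qy, qn) => Or (And Fy (cfg y g B t.+1 qy (samef y g t)))
                          (And Fn (cfg y g B t.+1 qn (samef y g t)))
    | None => bigor (enum {: {ffun K -> sym}}) (fun sg => And (scanf y g B t sg)
        (bigor (enum {: state M}) (fun q' => bigor acts (fun a =>
           if trans q sg q' a then cfg y g B t.+1 q' (actf y g B t a) else Bot))))
    end).

(** A query always has an answer, so a halted configuration is one that neither queries nor has a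
    transition. *)
Definition haltf y g B t : sentence :=
  bigor (enum {: state M}) (fun q => And (Atom (stat y g t q))
    (bigor (enum {: {ffun K -> sym}}) (fun sg => And (scanf y g B t sg)
      (cst [&& accepting q, query q == None :> option (state M * state M) &
        [forall q', all (fun a => ~~ trans q sg q' a) acts]])))).

Definition runf y g T B ini (Fy Fn : nat -> sentence) : sentence :=
  And (cfg y g B 0 (start M) ini)
      (until (iota 0 T) (haltf y g B) (fun t => stepf y g B t (Fy t) (Fn t)) (haltf y g B T)).

Definition encodes v y g B t c : Prop :=
  (forall q, v (stat y g t q) = (q == cstate c)) /\
  forall k pos s, t <= pos -> pos + t <= 2 * B ->
    v (cell y g t k pos s) = (cellv B (ctapes c k) pos == s).

Lemma cfgP v y g B t q C : eval v (cfg y g B t q C) <->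
  (forall q', v (stat y g t q') = (q' == q)) /\
  forall k pos s, t <= pos -> pos + t <= 2 * B -> v (cell y g t k pos s) = eval v (C k pos s).
Proof.
rewrite [eval _ _]/= !eval_bigand; split.
  case/andP => /allP h1 /allP h2; split.
    move=> q'; have := h1 q' (mem_enum _ _); rewrite eval_Iff eval_cst /= => /eqP; exact.
  move=> k pos s l1 l2; have := h2 pos; rewrite mem_range l1 l2 => /(_ isT).
  rewrite eval_bigand => /allP /(_ k (mem_enum _ _)); rewrite eval_bigand.
  by move=> /allP /(_ s (mem_enum _ _)); rewrite eval_Iff => /eqP.
case=> h1 h2; apply/andP; split.
  by apply/allP => q' _; rewrite eval_Iff eval_cst /= h1 eqxx.
apply/allP => pos; rewrite mem_range => /andP [l1 l2]; rewrite eval_bigand; apply/allP => k _.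
by rewrite eval_bigand; apply/allP => s _; rewrite eval_Iff /= h2 ?eqxx.
Qed.

Lemma cellv_act B (a : sym * direction) (tp : tape sym) pos : 0 < pos ->
  cellv B (act a tp) pos = if src a.2 pos == B then a.1 else cellv B tp (src a.2 pos).
Proof.
case: a tp => s d [L h R]; case: pos => // p _; rewrite /cellv /act /=.
case: d => /=.
- case: (ltngtP p B) => [lt|lt|->].
  + case: (ltngtP p.+1 B) lt => [lt _|lt lt'|<- _]; last by rewrite subnn subSnn /= nth0.
      by rewrite nth_behead; congr nth; lia.
    by lia.
  + have -> : (p.+1 < B) = false by lia.
    have -> : p.+1 - B = (p - B.+1).+2 by lia.
    by have -> : p - B = (p - B.+1).+1 by lia.
  + by rewrite ltnNge leqnSn /= subSnn.
- case: (ltngtP p.+1 B) => [lt|lt|->] //=; last by rewrite subnn.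
  by have -> : p.+1 - B = (p - B).+1 by lia.
- case: (ltngtP p.+2 B) => [lt|lt|e].
  + by have -> : (B - p.+1).-1 = (B - p.+2).-1.+1 by lia.
  + have -> : p.+2 - B = (p.+1 - B).+1 by lia.
    case: (p.+1 - B) => [|i] /=; first by rewrite nth0.
    by rewrite nth_behead.
  + by rewrite -e subSnn.
Qed.

Lemma has_enum1 (T : finType) (x : T) (P : pred T) :
  has (fun a => (a == x) && P a) (enum {: T}) = P x.
Proof.
apply/hasP/idP => [[a _ /andP [/eqP ->]] //|h]; exists x; rewrite ?mem_enum //.
by rewrite eqxx.
Qed.

Lemma scanfE v y g B t c sg : encodes v y g B t c -> t <= B ->
  eval v (scanf y g B t sg) = (sg == [ffun k => scanned (ctapes c k)]).
Proof.
case=> _ h le; rewrite /scanf eval_bigand.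
have E k s : v (cell y g t k B s) = (scanned (ctapes c k) == s).
  by rewrite h //; [rewrite /cellv ltnn subnn | lia].
apply/allP/eqP => [al|-> k _]; last by rewrite /= E ffunE.
by apply/ffunP => k; rewrite ffunE; have := al k (mem_enum _ _); rewrite /= E => /eqP.
Qed.

Definition hstep (P Q : Prop) c c' : Prop :=
  match query (cstate c) with
  | Some (qyes, qno) => (P /\ c' = Config qyes (ctapes c)) \/ (Q /\ c' = Config qno (ctapes c))
  | None => exists q a, trans (cstate c) [ffun i => scanned (ctapes c i)] q a /\
                        c' = Config q [ffun i => act (a i) (ctapes c i)]
  end.

Lemma eval_act v y g B t c q a : encodes v y g B t c -> t < B ->
  eval v (cfg y g B t.+1 q (actf y g B t a)) <->
  encodes v y g B t.+1 (Config q [ffun k => act (a k) (ctapes c k)]).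
Proof.
move=> [h1 h2] lt; rewrite cfgP.
have E k pos s : t < pos -> pos + t.+1 <= 2 * B -> eval v (actf y g B t a k pos s) =
    (cellv B (act (a k) (ctapes c k)) pos == s).
  move=> l1 l2; rewrite cellv_act; last by lia.
  rewrite /actf; case: ifP => [_|/eqP ns]; first by rewrite eval_cst eq_sym.
  by rewrite /= h2 //; case: (a k).2 => /=; lia.
split=> -[k1 k2]; split=> //= k pos s l1 l2; first by rewrite k2 // E // ffunE.
by rewrite k2 // E //= ffunE.
Qed.

Lemma eval_same v y g B t c q : encodes v y g B t c -> t < B ->
  eval v (cfg y g B t.+1 q (samef y g t)) <-> encodes v y g B t.+1 (Config q (ctapes c)).
Proof.
move=> [h1 h2] lt; rewrite cfgP.
by split=> -[k1 k2]; split=> //= k pos s l1 l2; rewrite k2 //= h2 //; lia.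
Qed.

Lemma stepfE v y g B t c Fy Fn : encodes v y g B t c -> t < B ->
  eval v (stepf y g B t Fy Fn) <->
  exists2 c', encodes v y g B t.+1 c' & hstep (eval v Fy) (eval v Fn) c c'.
Proof.
move=> e lt; rewrite /stepf /hstep eval_bigor.
under eq_has => q do rewrite /= (proj1 e).
rewrite has_enum1; case: (query (cstate c)) => [[qy qn]|].
  have E F H : eval v (Or F H) = eval v F || eval v H by [].
  have E' F H : eval v (And F H) = eval v F && eval v H by [].
  rewrite E !E'; split.
    by case/orP => /andP [h] /(eval_same _ e lt) h'; [exists (Config qy (ctapes c)); [|left]
      | exists (Config qn (ctapes c)); [|right]].
  by case=> c' ec [[h ec']|[h ec']]; rewrite ec' in ec; apply/orP; [left|right]; rewrite h;
    apply/(eval_same _ e lt).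
rewrite eval_bigor.
under eq_has => sg do rewrite /= (scanfE _ e (ltnW lt)).
rewrite has_enum1 eval_bigor; split.
  case/hasP => q' _; rewrite eval_bigor => /has_In [a _]; case: ifP => // tr /(eval_act _ _ e lt) h.
  by eexists; [exact: h | exists q', a].
case=> c' ec [q' [a [tr ec']]]; apply/hasP; exists q'; rewrite ?mem_enum // eval_bigor.
apply/has_In; exists a; first exact: acts_all.
by rewrite tr; apply/(eval_act _ _ e lt); rewrite -ec'.
Qed.

Lemma haltfE A v y g B t c : encodes v y g B t c -> t <= B ->
  eval v (haltf y g B t) <-> halted A c /\ accepting (cstate c).
Proof.
move=> e le; rewrite /haltf eval_bigor.
under eq_has => q do rewrite /= (proj1 e).
rewrite has_enum1 eval_bigor.
under eq_has => sg do rewrite /= (scanfE _ e le).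
rewrite has_enum1 eval_cst /halted /step; split.
  case/and3P => -> /eqP -> /forallP nt; split=> // c' [q [a [tr _]]].
  by have /all_In /(_ a (acts_all a)) := nt q; rewrite tr.
case=> hh acc; rewrite acc /=; apply/andP; split.
  case eq: (query (cstate c)) hh => [[qy qn]|] // hh; exfalso.
  have [w|w] := pselect (A (word (ctapes c ord_max))).
    by apply: (hh (Config qy (ctapes c))); left.
  by apply: (hh (Config qn (ctapes c))); right.
case: (query (cstate c)) hh => [[qy qn]|] hh.
  exfalso; have [w|w] := pselect (A (word (ctapes c ord_max))).
    by apply: (hh (Config qy (ctapes c))); left.
  by apply: (hh (Config qn (ctapes c))); right.
apply/forallP => q; apply/all_In => a _; apply/negP => tr.
by apply: (hh (Config q [ffun i => act (a i) (ctapes c i)])); exists q, a.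
Qed.

Definition same_tag y g v v' : Prop :=
  forall i l, v (name y [:: i, g & l]) = v' (name y [:: i, g & l]).

Lemma encodes_tag y g v v' B t c : same_tag y g v v' -> encodes v y g B t c -> encodes v' y g B t c.
Proof.
move=> st [h1 h2]; split=> [q|k pos s l1 l2]; first by rewrite -h1 [RHS]st.
by rewrite -h2 // [RHS]st.
Qed.

Lemma haltf_tag y g v v' B t : same_tag y g v v' -> eval v (haltf y g B t) = eval v' (haltf y g B t).
Proof.
move=> st; rewrite /haltf !eval_bigor; apply: eq_has => q /=; rewrite [v _]st; congr andb.
rewrite !eval_bigor; apply: eq_has => sg /=; rewrite !eval_cst !eval_bigand; congr andb.
by apply: eq_all => k; exact: st.
Qed.

Lemma run_rcons A n c d e : run A n c d -> step A d e -> run A n.+1 c e.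
Proof.
elim: n c => [|n IH] c /= => [-> h|[c' s r] h]; first by exists e.
by exists c' => //; apply: IH h.
Qed.

(* [S] collects the valuations that agree on the run; different members can
   refute different wrong oracle answers. *)
Lemma runf_sound A y g T B ini Fy Fn w (S : set (nat -> bool)) v0 :
  T < B -> S v0 -> (forall v, S v -> eval v (runf y g T B ini Fy Fn)) ->
  (forall k pos s, pos <= 2 * B ->
     eval v0 (ini k pos s) = (cellv B (ctapes (init M w) k) pos == s)) ->
  (forall v, S v -> same_tag y g v0 v) ->
  (forall t c, t < T -> run A t (init M w) c -> encodes v0 y g B t c ->
     exists2 v, S v & (eval v (Fy t) -> A (word (ctapes c ord_max))) /\
                      (eval v (Fn t) -> ~ A (word (ctapes c ord_max)))) ->
  accepts M A w.
Proof.
move=> ltTB S0 HS hini tag hook.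
have H v : S v -> exists j, [/\ j <= T, forall i, i < j -> eval v (stepf y g B i (Fy i) (Fn i)) &
    eval v (haltf y g B j)].
  by move=> Sv; have /andP [_ /eval_until] := HS v Sv.
have exn : exists n, eval v0 (haltf y g B n) by have [j [_ _ hj]] := H _ S0; exists j.
(* Halting formulas only involve atoms on which all of [S] agrees. Hence no member of [S] halts
   before the least halting time [n], and each satisfies every step formula before it. *)
case: (ex_minnP exn) => n hn nmin.
have leT : n <= T by have [j [le_j _ hj]] := H _ S0; exact: leq_trans (nmin _ hj) le_j.
have HS' v t : S v -> t < n -> eval v (stepf y g B t (Fy t) (Fn t)).
  move=> Sv lt; have [j [_ hs hh]] := H v Sv; apply: hs; apply: leq_trans lt _.
  by apply: nmin; rewrite (haltf_tag _ _ (tag v Sv)).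
have claim t : t <= n -> exists2 c, run A t (init M w) c & encodes v0 y g B t c.
  elim: t => [|t IH] le.
    exists (init M w) => //; have /andP [/cfgP [h1 h2] _] := HS _ S0.
    by split=> // k pos s l1 l2; rewrite h2 // hini //; lia.
  have [c rc ec] := IH (ltnW le).
  (* A member of [S] chosen for this configuration, under which neither answer of the oracle can be
     claimed wrongly. *)
  have [v Sv [h1 h2]] := hook t c (leq_trans le leT) rc ec.
  have ltB : t < B by apply: ltn_trans ltTB; apply: leq_trans le leT.
  have := HS' v t Sv le; rewrite (stepfE _ _ (encodes_tag (tag v Sv) ec) ltB) => -[c' ec' hst].
  exists c'; last by apply: encodes_tag ec' => i l; rewrite (tag v Sv).
  apply: run_rcons rc _; move: hst; rewrite /hstep /step.
  by case: (query _) => [[qy qn]|] // [[/h1 a ->]|[/h2 a ->]]; [left|right].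
have [c rc ec] := claim n (leqnn n).
have /(haltfE A ec) [] := hn; first by apply: ltnW; apply: leq_ltn_trans ltTB.
by exists n, c.
Qed.

Lemma runf_complete A y g T B ini Fy Fn w n (cs : nat -> config M) v :
  n <= T -> T < B -> cs 0 = init M w -> (forall t, t < n -> step A (cs t) (cs t.+1)) ->
  halted A (cs n) -> accepting (cstate (cs n)) -> (forall t, encodes v y g B t (cs t)) ->
  (forall k pos s, pos <= 2 * B ->
     eval v (ini k pos s) = (cellv B (ctapes (init M w) k) pos == s)) ->
  (forall t, t < n -> query (cstate (cs t)) <> None ->
     (A (word (ctapes (cs t) ord_max)) -> eval v (Fy t)) /\
     (~ A (word (ctapes (cs t) ord_max)) -> eval v (Fn t))) ->
  eval v (runf y g T B ini Fy Fn).
Proof.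
move=> leT ltB c0 st hh acc ec hini hook; rewrite /runf.
have E F H : eval v (And F H) = eval v F && eval v H by [].
rewrite E; apply/andP; split.
  apply/cfgP; have [h1 h2] := ec 0; rewrite c0 in h1 h2; split=> // k pos s l1 l2.
  by rewrite h2 // hini //; lia.
apply/(eval_until v 0 T); exists n; split=> // [t lt|]; last first.
  by apply/(haltfE A (ec n)); [apply: ltnW; apply: leq_ltn_trans ltB | split].
have ltB' : t < B by apply: ltn_trans ltB; apply: leq_trans leT.
apply/(stepfE _ _ (ec t) ltB'); exists (cs t.+1) => //.
have := hook t lt; have := st t lt; rewrite /step /hstep.
case: (query _) => [[qy qn]|] // h [] // k1 k2.
by case: h => [[/k1 a ->]|[/k2 a ->]]; [left|right].
Qed.

Lemma run_trace A n c c' : run A n c c' ->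
  exists cs, [/\ cs 0 = c, cs n = c' & forall t, t < n -> step A (cs t) (cs t.+1)].
Proof.
elim: n c => [|n IH] c /= => [->|[d s /IH [cs [h0 hn hs]]]]; first by exists (fun=> c').
exists (fun t => if t is t'.+1 then cs t' else c); split=> // -[_|t lt]; first by rewrite h0.
exact: hs.
Qed.

Lemma trace_run A n (cs : nat -> config M) : (forall t, t < n -> step A (cs t) (cs t.+1)) ->
  forall t, t <= n -> run A t (cs 0) (cs t).
Proof.
move=> h; elim=> [|t IH] lt //; apply: run_rcons (IH (ltnW lt)) _; exact: h.
Qed.

Lemma cell_eq y y' g t k pos s l : name y l = cell y' g t k pos s ->
  y = y' /\ l = [:: 0; g; t; val k; pos; nat_of_ord (enum_rank s)].
Proof. exact: name_inj. Qed.

Lemma stat_eq y y' g t q l : name y l = stat y' g t q ->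
  y = y' /\ l = [:: 1; g; t; nat_of_ord (enum_rank q)].
Proof. exact: name_inj. Qed.

(** It is false at all names with another tag, so that the descriptions of several runs can be
    joined by a disjunction. *)
Definition rval y g B (cs : nat -> config M) (p : nat) : bool :=
  `[< (exists t k pos s, p = cell y g t k pos s /\ cellv B (ctapes (cs t) k) pos = s) \/
      (exists t q, p = stat y g t q /\ cstate (cs t) = q) >].

Lemma rval_encodes y g B cs v : same_tag y g (rval y g B cs) v ->
  forall t, encodes v y g B t (cs t).
Proof.
move=> st t; split=> [q|k pos s _ _].
  rewrite -[LHS]st; apply/asboolP/eqP => [[[t' [k [pos [s [/cell_eq [_ //]]]]]]|[t' [q' [/stat_eq [_]]]]]|->].
    by move=> [-> /val_inj /enum_rank_inj ->].
  by right; exists t, (cstate (cs t)).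
rewrite -[LHS]st; apply/asboolP/eqP => [[[t' [k' [pos' [s' [/cell_eq [_]]]]]]|[t' [q' [/stat_eq [_ //]]]]]|e].
  by move=> [-> /val_inj -> -> /val_inj /enum_rank_inj ->].
by left; exists t, k, pos, s.
Qed.

Lemma rval_tag y g B cs y' i g' l : rval y g B cs (name y' [:: i, g' & l]) -> y' = y /\ g' = g.
Proof.
by move=> /asboolP [[t [k [pos [s [/cell_eq [-> [_ -> _]]]]]]]|[t [q [/stat_eq [-> [_ -> _]]]]]].
Qed.

Lemma word_run A n w c k : run A n (init M w) c ->
  size (left (ctapes c k)) + size (right (ctapes c k)) <= size w + n.
Proof.
move=> /run_trace [cs [h0 <- hs]].
elim: n hs => [|n IH] hs.
  rewrite h0 /= ffunE addn0; case: ifP => // _; by rewrite /load /= size_behead size_map leq_pred.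
have := IH (fun t lt => hs t (ltnW lt)); have := hs n (ltnSn n); rewrite /step.
case: (query _) => [[qy qn]|]; first by case=> -[_ ->] /=; lia.
case=> q [a [_ ->]] /=; rewrite ffunE /act; case: (a k) => s [] /=; rewrite ?size_behead; lia.
Qed.

Lemma size_bit_prefix (r : seq sym) : size (bit_prefix r) <= size r.
Proof. by elim: r => // -[[b|a]|] r IH. Qed.

Lemma size_word A n w c : run A n (init M w) c ->
  size (word (ctapes c ord_max)) <= size w + n + 1.
Proof.
move=> /(word_run ord_max) h; rewrite /word; set r := _ :: _.
have e : size r = (size (right (ctapes c ord_max))).+1 by [].
by move: r e (size_bit_prefix r) => r; lia.
Qed.

Section Poly.
Variables (G : encType) (y : bool) (g B : G -> nat).
Hypotheses (hg : poly g) (hB : poly B).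

Lemma pform_cfg (t : G -> nat) q C : poly t ->
  (forall k s, pform (fun x : G * nat => C x.1 k x.2 s)) ->
  pform (fun x => cfg y (g x) (B x) (t x) q (C x)).
Proof.
move=> ht hC; rewrite /cfg /stat /cell; pftac.
refine (@pform_bigand _ _ (fun x => range (B x) (t x)) _ _ _).
- by rewrite /range; ptac.
- by pftac; exact: hC.
Qed.

Lemma pform_scanf (t : G -> nat) sg : poly t -> pform (fun x => scanf y (g x) (B x) (t x) sg).
Proof. by move=> ht; rewrite /scanf /cell; pftac. Qed.

Lemma pform_samef (t : G -> nat) k s : poly t -> pform (fun x : G * nat => samef y (g x.1) (t x.1) k x.2 s).
Proof. by move=> ht; rewrite /samef /cell; pftac. Qed.

Lemma pform_actf (t : G -> nat) a k s : poly t ->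
  pform (fun x : G * nat => actf y (g x.1) (B x.1) (t x.1) a k x.2 s).
Proof. by move=> ht; rewrite /actf /cell; case: (a k).2 => /=; pftac. Qed.

Lemma pform_stepf (t : G -> nat) Fy Fn : poly t -> pform Fy -> pform Fn ->
  pform (fun x => stepf y (g x) (B x) (t x) (Fy x) (Fn x)).
Proof.
move=> ht h1 h2; have ht1 : poly (fun x => (t x).+1) by ptac.
rewrite /stepf; apply: pform_bigor_fin => q; apply: pform_And; first by rewrite /stat; pftac.
case: (query q) => [[qy qn]|].
  by apply: pform_Or; apply: pform_And => //; apply: pform_cfg => // k s; apply: pform_samef.
apply: pform_bigor_fin => sg; apply: pform_And; first exact: pform_scanf.
apply: pform_bigor_fin => q'; apply: pform_bigor_fin => a; case: (trans _ _ _ _); last exact: pform_Bot.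
by apply: pform_cfg => // k s; apply: pform_actf.
Qed.

Lemma pform_haltf (t : G -> nat) : poly t -> pform (fun x => haltf y (g x) (B x) (t x)).
Proof.
move=> ht; rewrite /haltf; apply: pform_bigor_fin => q; apply: pform_And; first by rewrite /stat; pftac.
apply: pform_bigor_fin => sg; apply: pform_And; first exact: pform_scanf.
by case: (_ && _); [apply: pform_Top | apply: pform_Bot].
Qed.

End Poly.

Lemma pform_runf (G : encType) y (g T B : G -> nat) ini Fy Fn :
  poly g -> poly T -> poly B -> (forall k s, pform (fun x : G * nat => ini x.1 k x.2 s)) ->
  pform (fun x : G * nat => Fy x.1 x.2) -> pform (fun x : G * nat => Fn x.1 x.2) ->
  pform (fun x => runf y (g x) (T x) (B x) (ini x) (Fy x) (Fn x)).
Proof.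
move=> hg hT hB hi h1 h2; rewrite /runf; apply: pform_And.
  by apply: pform_cfg => //; ptac.
have hg' : poly (fun q : G * nat => g q.1) by ptac.
have hB' : poly (fun q : G * nat => B q.1) by ptac.
have ht' : poly (fun q : G * nat => q.2) by ptac.
apply: (@pform_until _ _ (fun x => iota 0 (T x)) _ (fun x t => haltf y (g x) (B x) t)
  (fun x t => stepf y (g x) (B x) t (Fy x t) (Fn x t))).
- by ptac.
- exact: pform_haltf.
- exact: pform_stepf.
- exact: pform_haltf.
Qed.

End RunFormula.

Lemma poly_nth (G : encType) (s : G -> bits) (n : G -> nat) : poly s -> poly n ->
  poly (fun g => nth false (s g) (n g)).
Proof.
move=> hs hn; have h : poly (fun g => iter (n g) behead (s g)).
  pref (poly_iter (f := fun _ : G => behead) (p := fun=> 0) hn hs _ _ _); [by ptac|by pbd|].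
  by move=> g a; rewrite addn0; apply: sz_behead.
apply: (poly_ext (poly_head false h)) => g.
elim: (n g) (s g) => [|k IH] l; first by rewrite nth0.
by rewrite iterSr IH nth_behead.
Qed.

Lemma cellv_load (M : machine) B u pos : cellv B (load M u) pos =
  if pos < B then None else nth None [seq Some (inl b) | b <- u] (pos - B).
Proof.
rewrite /cellv /load /=; case: ifP => _; first by rewrite nth_nil.
by case: u => [|b u] //=; case: (pos - B) => //= k; rewrite nth_nil.
Qed.

Definition is_bit (T : finType) (s : symbol T) : bool := if s is Some (inl _) then true else false.

(** The query word ends at the first cell that holds no input bit, so its bit [i] is present only if
    all cells up to [i] hold bits. *)
Lemma nth_bit_prefix (M N : machine) (r : seq (symbol (aux M))) i :
  nth (None : symbol (aux N)) [seq Some (inl b) | b <- bit_prefix r] i =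
  if all (fun j => is_bit (nth None r j)) (iota 0 i.+1) then
    if nth None r i is Some (inl b) then Some (inl b) else None
  else None.
Proof.
elim: i r => [|i IH] r; first by case: r => [|[[b|a]|] r].
have -> : iota 0 i.+2 = 0 :: [seq 1 + j | j <- iota 0 i.+1] 
  by rewrite [LHS](_ : _ = 0 :: iota (1 + 0) i.+1) // iotaDl.
move: (iota 0 i.+1) IH => l IH.
by case: r => [|[[b|a]|] r] /=; rewrite ?nth_nil ?IH ?all_map.
Qed.

(* Names of the existentially quantified variables. *)
Definition is_X (p : nat) : bool := ~~ nth true (binary p) 1.

Lemma is_X_name y l : is_X (name y l) = ~~ y.
Proof. by rewrite /is_X binary_name. Qed.

(** * Acceptance by an oracle machine as a quantified formula *)

Section Cook.
Variables (M N : machine) (A : language) (eM eN : nat).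
Hypothesis timeM : forall x n c, run A n (init M x) c -> n <= size x ^ eM + eM.
Hypothesis timeN : forall x n c, run set0 n (init N x) c -> n <= size x ^ eN + eN.
Hypothesis decN : decides set0 N A.
Hypothesis freeN : oracle_free N.

(** A query word has length at most [size x + timeboundM x + 1], which bounds the runs of [N]. The
    window of [M] exceeds its time bound by the window of [N], because at each query time that many
    cells of the query tape must still be known. *)
Definition timeboundM (x : bits) : nat := size x ^ eM + eM.
Definition timeboundN (x : bits) : nat := (size x + timeboundM x + 1) ^ eN + eN.
Definition windowN (x : bits) : nat := (timeboundN x).+1.
Definition windowM (x : bits) : nat := (timeboundM x + windowN x).+1.

Notation TM := timeboundM.
Notation TN := timeboundN.
Notation BM := windowM.
Notation BN := windowN.

Definition bitf (x : bits) t j : sentence :=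
  Or (Atom (@cell M false 0 t ord_max (BM x + j) (Some (inl true))))
     (Atom (@cell M false 0 t ord_max (BM x + j) (Some (inl false)))).

(** The input of the subrun is not constant: it is read off the query tape of [M] at time [t],
    through the atoms that describe the run of [M]. *)
Definition iniN (x : bits) t (k : 'I_(ntapes N).+1) pos (s : symbol (aux N)) : sentence :=
  if (val k == 0) && (BN x <= pos) then
    match s with
    | None => Not (bigand (iota 0 (pos - BN x).+1) (bitf x t))
    | Some (inl b) => And (bigand (iota 0 (pos - BN x).+1) (bitf x t))
        (Atom (@cell M false 0 t ord_max (BM x + (pos - BN x)) (Some (inl b))))
    | Some (inr _) => Bot
    end
  else cst (s == None).

Definition iniM (x : bits) (k : 'I_(ntapes M).+1) pos (s : symbol (aux M)) : sentence :=
  if (val k == 0) && (BM x <= pos) then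
    match s with
    | None => cst (size x <= pos - BM x)
    | Some (inl b) => cst (((pos - BM x).+1 <= size x) && (nth false x (pos - BM x) == b))
    | Some (inr _) => Bot
    end
  else cst (s == None).

Definition subrunf (x : bits) t y g : sentence :=
  @runf N y g (TN x) (BN x) (iniN x t) (fun=> Bot) (fun=> Bot).

(** Tags keep the runs apart. The run of [M] has number 0, so the guessed run behind a positive
    answer at time [t] has number [t.+1]. All negative answers share one tag, since its atoms are
    quantified universally. *)
Definition cookf (x : bits) : sentence :=
  @runf M false 0 (TM x) (BM x) (iniM x) (fun t => subrunf x t false t.+1)
    (fun t => Not (subrunf x t true 0)).

Lemma eval_iniM v x k pos s :
  eval v (iniM x k pos s) = (cellv (BM x) (ctapes (init M x) k) pos == s).
Proof.
rewrite /iniM /= ffunE cellv_load -[val k == 0]/(k == ord0).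
case: (k == ord0) => /=; last by rewrite eval_cst nth_nil if_same eq_sym.
rewrite leqNgt; case: (pos < BM x) => /=; first by rewrite eval_cst eq_sym.
move: (pos - BM x) => i; case: (leqP (size x) i) => h.
  have -> : nth (None : symbol (aux M)) [seq Some (inl b) | b <- x] i = None.
    by rewrite nth_default ?size_map.
  by case: s => [[b|a]|]; rewrite ?eval_cst.
by rewrite (nth_map false) //; case: s => [[b|a]|]; rewrite ?eval_cst.
Qed.

Section Subrun.
Variables (v : nat -> bool) (x : bits) (t : nat) (c : config M).
Hypotheses (le_t : t <= TM x) (ec : encodes v false 0 (BM x) t c).
Let w := word (ctapes c ord_max).

Lemma eval_iniN k pos s : pos <= 2 * BN x ->
  eval v (iniN x t k pos s) = (cellv (BN x) (ctapes (init N w) k) pos == s).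
Proof.
move=> lp; rewrite /iniN /= ffunE cellv_load -[val k == 0]/(k == ord0).
case: (k == ord0) => /=; last by rewrite eval_cst nth_nil if_same eq_sym.
rewrite leqNgt; case: (ltnP pos (BN x)) => /= lep; first by rewrite eval_cst eq_sym.
have : pos - BN x <= BN x by lia.
move: (pos - BN x) => i li; rewrite /w /word; set r := _ :: _.
have C j s' : j <= i -> v (@cell M false 0 t ord_max (BM x + j) s') = (nth None r j == s').
  move=> lj; rewrite (proj2 ec) /windowM ?(_ : windowN x = BN x) //; try lia.
  by rewrite /cellv ltnNge leq_addr /= addKn.
have Bt j : j <= i -> eval v (bitf x t j) = is_bit (nth None r j).
  by move=> lj; rewrite /= !C //; case: (nth None r j) => [[[]|a]|].
have E : eval v (bigand (iota 0 i.+1) (bitf x t)) =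
    all (fun j => is_bit (nth None r j)) (iota 0 i.+1).
  rewrite eval_bigand; apply: eq_in_all => j; rewrite mem_iota => /andP [_ lj].
  by apply: Bt; move: lj; lia.
rewrite (nth_bit_prefix N); case: s => [[b|a]|].
- have -> F : eval v (And F (Atom (@cell M false 0 t ord_max (BM x + i) (Some (inl b))))) =
      eval v F && (nth None r i == Some (inl b)) by rewrite -C.
  by rewrite E; case: all => //=; case: (nth None r i) => [[b'|a']|].
- by case: all => //=; case: (nth None r i) => [[b'|a']|].
- rewrite [LHS](_ : _ = ~~ eval v (bigand (iota 0 i.+1) (bitf x t))) // E.
  case: (boolP (all _ _)) => [/allP /(_ i)|_] //=; rewrite -[0 :: _]/(iota 0 i.+1) mem_iota ltnSn => /(_ isT).
  by case: (nth None r i) => [[b'|a']|].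
Qed.

Lemma subrunf_sound y g : eval v (subrunf x t y g) -> A w.
Proof.
move=> h; apply/decN.
apply: (@runf_sound N set0 y g (TN x) (BN x) (iniN x t) (fun=> Bot) (fun=> Bot) w [set v] v) => //.
- by move=> _ ->.
- by move=> k pos s; apply: eval_iniN.
- by move=> _ ->.
- by move=> t' c' _ _ _; exists v.
Qed.

End Subrun.

(** The run is chosen before valuation and tag: the same run can be guessed to support a positive
    answer, or be put in place of the universal atoms to refute a negative one. *)
Lemma subrunf_complete x w : A w -> size w <= size x + TM x + 1 ->
  exists cs : nat -> config N, forall v t (c : config M) y g, t <= TM x -> encodes v false 0 (BM x) t c ->
    word (ctapes c ord_max) = w -> same_tag y g (rval y g (BN x) cs) v ->
    eval v (subrunf x t y g).
Proof.
move=> /decN [n [d [rn hd acc]]] sw; have [cs [h0 hn hs]] := run_trace rn.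
exists cs => v t c y g le_t ec ew st.
apply: (@runf_complete N set0 y g (TN x) (BN x) (iniN x t) (fun=> Bot) (fun=> Bot) w n cs v) => //.
- apply: leq_trans (timeN rn) _; rewrite leq_add2r; case: (eN) => // e; rewrite leq_exp2r //.
- by rewrite hn.
- by rewrite hn.
- exact: rval_encodes.
- by move=> k pos s lp; rewrite -ew; apply: eval_iniN.
Qed.

Lemma cookfE x : accepts M A x <->
  exists u, forall v, (forall p, is_X p -> v p = u p) -> eval v (cookf x).
Proof.
have BT : TM x < BM x by rewrite /windowM; lia.
split=> [[n [c [rn hc acc]]]|[u Hu]].
  have leT : n <= TM x := timeM rn.
  have [cs [h0 hn hs]] := run_trace rn.
  pose w t := word (ctapes (cs t) ord_max).
  have sw t : t <= n -> size (w t) <= size x + TM x + 1.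
    move=> le; have := trace_run hs le; rewrite h0 => /size_word h.
    by apply: leq_trans h _; lia.
  have /choice [csN HN] t : exists csN : nat -> config N, t <= n -> A (w t) ->
      forall v (c : config M) y g, t <= TM x -> encodes v false 0 (BM x) t c ->
      word (ctapes c ord_max) = w t -> same_tag y g (rval y g (BN x) csN) v ->
      eval v (subrunf x t y g).
    have [[le a]|na] := pselect (t <= n /\ A (w t)); last by exists (fun=> init N [::]) => le a; case: na.
    have [cs' H] := subrunf_complete a (sw t le); exists cs' => _ _ v c' y g.
    exact: H.
  (* The existential atoms describe the run of [M] together with an accepting run of [N] for each
     positive answer; the tags are distinct, so the disjunction does not mix the runs. *)
  exists (fun p => rval false 0 (BM x) cs p ||
    `[< exists t, rval false t.+1 (BN x) (csN t) p >]) => v Hv.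
  have tagM : same_tag false 0 (rval false 0 (BM x) cs) v.
    move=> i l; rewrite Hv ?is_X_name //; case h: (rval _ _ _ _ _) => //=.
    by apply/esym/asboolP => -[t /rval_tag [_]].
  have tagN t : same_tag false t.+1 (rval false t.+1 (BN x) (csN t)) v.
    move=> i l; rewrite Hv ?is_X_name //.
    have -> /= : rval false 0 (BM x) cs (name false [:: i, t.+1 & l]) = false.
      by apply/negP => /rval_tag [_].
    apply/idP/asboolP => [h|[t' h]]; first by exists t.
    by have [_ [e]] := rval_tag h; rewrite e in h *.
  have ec := rval_encodes tagM.
  apply: (@runf_complete M A false 0 (TM x) (BM x) (iniM x) _ _ x n cs v) => //.
  - by rewrite hn.
  - by rewrite hn.
  - by move=> k pos s _; apply: eval_iniM.
  - move=> t lt _; have le_t : t <= TM x by lia.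
    split=> [a|na]; first by apply: (HN t (ltnW lt) a v (cs t)).
    by apply/negP => /(subrunf_sound le_t (ec t)).
pose S : set (nat -> bool) := [set v | forall p, is_X p -> v p = u p].
apply: (@runf_sound M A false 0 (TM x) (BM x) (iniM x) _ _ x S u) => //.
- exact: Hu.
- by move=> k pos s _; apply: eval_iniM.
- by move=> v Sv i l; rewrite Sv // is_X_name.
(* If the query word is outside [A], no valuation justifies a positive answer. If it is in [A],
   setting the universal atoms to an accepting run of [N] defeats a claimed negative answer. *)
- move=> t c lt rc ec; have [a|na] := pselect (A (word (ctapes c ord_max))); last first.
    by exists u => //; split=> // /(subrunf_sound (ltnW lt) ec).
  have sw : size (word (ctapes c ord_max)) <= size x + TM x + 1.
    by apply: leq_trans (size_word rc) _; lia.
  have [cs H] := subrunf_complete a sw.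
  exists (fun p => if is_X p then u p else rval true 0 (BN x) cs p); first by move=> p ->.
  split=> // /negP []; apply: (H _ t c true 0 (ltnW lt)) => //.
    by apply: encodes_tag ec => i l; rewrite is_X_name.
  by move=> i l; rewrite is_X_name.
Qed.

Lemma poly_TM : poly TM.
Proof. by rewrite /timeboundM; ptac. Qed.

Lemma poly_TN : poly TN.
Proof. by have h := poly_TM; rewrite /timeboundN; ptac. Qed.

Lemma poly_BN : poly BN.
Proof. by have h := poly_TN; rewrite /windowN; ptac. Qed.

Lemma poly_BM : poly BM.
Proof. by have h := poly_TM; have h' := poly_BN; rewrite /windowM; ptac. Qed.

Lemma pform_subrunf (G : encType) (x : G -> bits) (t : G -> nat) y (g : G -> nat) :
  poly x -> poly t -> poly g -> pform (fun z => subrunf (x z) (t z) y (g z)).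
Proof.
move=> hx ht hg; have hM := poly_BM; have hN := poly_BN; have hT := poly_TN.
apply: pform_runf; [by ptac|by ptac|by ptac| |exact: pform_Bot|exact: pform_Bot].
move=> k s; rewrite /iniN /bitf /cell; apply: pform_if; [by ptac| |by pftac].
have hb : poly (fun z : G * nat => iota 0 (z.2 - BN (x z.1)).+1) by ptac.
case: s => [[b|a]|]; [apply: pform_And; last by pftac|exact: pform_Bot|apply: pform_Not].
  by refine (@pform_bigand _ _ _ hb _ _); pftac.
by refine (@pform_bigand _ _ _ hb _ _); pftac.
Qed.

Lemma pform_cookf : pform cookf.
Proof.
have hM := poly_BM; have hN := poly_BN; have hT := poly_TM.
apply: pform_runf; [by ptac|by ptac|by ptac| | |].
- move=> k s; rewrite /iniM; apply: pform_if; [by ptac| |by pftac].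
  case: s => [[b|a]|]; [apply: pform_cst|exact: pform_Bot|by pftac].
  apply: poly_andb; first by ptac.
  pref (poly_eqb _ _); last by ptac.
  by apply: poly_nth; ptac.
- by apply: pform_subrunf; ptac.
- by apply: pform_Not; apply: pform_subrunf; ptac.
Qed.

End Cook.

Theorem cook L : Sigma2P L -> exists2 F, pform F & forall x, L x <->
  exists u, forall v, (forall p, is_X p -> v p = u p) -> eval v (F x).
Proof.
case=> A [N [fN [eN tN] dN]] [M [[eM tM] dM]].
exists (cookf M N eM eN); first exact: pform_cookf.
by move=> x; rewrite dM; apply: cookfE.
Qed.

(** * Hardness *)

(** Both copies act upwards: a positive occurrence reads [P], a negative one the negation of [N], so
    enlarging [P] and [N] can only help a formula read positively. Signed facts therefore survive
    the raising of signed atoms. *)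
Lemma pev_mono (A : eqType) (P P' N N' : A -> bool) s (f : form A) :
  (forall x, (x, true) \in occurrences s f -> P x -> P' x) ->
  (forall x, (x, false) \in occurrences s f -> N x -> N' x) ->
  if s then pev P N s f -> pev P' N' s f else pev P' N' s f -> pev P N s f.
Proof.
elim: f s => [p|||a IHa|a IHa b IHb|a IHa b IHb|a IHa b IHb] [] //= hP hN.
- by apply: hP; rewrite inE.
- by apply: contra; apply: hN; rewrite inE.
- by apply: contra; exact: (IHa false).
- by apply: contra; exact: (IHa true).
- have ha := IHa true; have hb := IHb true; case/andP => h1 h2; apply/andP; split.
    by apply: ha h1 => x xa; [apply: hP|apply: hN]; rewrite mem_cat xa.
  by apply: hb h2 => x xa; [apply: hP|apply: hN]; rewrite mem_cat xa orbT.
- have ha := IHa false; have hb := IHb false; case/andP => h1 h2; apply/andP; split.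
    by apply: ha h1 => x xa; [apply: hP|apply: hN]; rewrite mem_cat xa.
  by apply: hb h2 => x xa; [apply: hP|apply: hN]; rewrite mem_cat xa orbT.
- have ha := IHa true; have hb := IHb true; case/orP => h; apply/orP; [left|right].
    by apply: ha h => x xa; [apply: hP|apply: hN]; rewrite mem_cat xa.
  by apply: hb h => x xa; [apply: hP|apply: hN]; rewrite mem_cat xa orbT.
- have ha := IHa false; have hb := IHb false; case/orP => h; apply/orP; [left|right].
    by apply: ha h => x xa; [apply: hP|apply: hN]; rewrite mem_cat xa.
  by apply: hb h => x xa; [apply: hP|apply: hN]; rewrite mem_cat xa orbT.
- have ha := IHa false; have hb := IHb true => /implyP h; apply/implyP => h'.
  apply: hb => [x xa|x xa|]; [apply: hP|apply: hN|apply: h]; rewrite ?mem_cat ?xa ?orbT //.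
  by apply: ha h' => x xa; [apply: hP|apply: hN]; rewrite mem_cat xa.
- have ha := IHa true; have hb := IHb false => /implyP h; apply/implyP => h'.
  apply: hb => [x xa|x xa|]; [apply: hP|apply: hN|apply: h]; rewrite ?mem_cat ?xa ?orbT //.
  by apply: ha h' => x xa; [apply: hP|apply: hN]; rewrite mem_cat xa.
Qed.

Lemma eq_pev_occ (A : eqType) (P P' N N' : A -> bool) s (f : form A) :
  (forall x, (x, true) \in occurrences s f -> P x = P' x) ->
  (forall x, (x, false) \in occurrences s f -> N x = N' x) ->
  pev P N s f = pev P' N' s f.
Proof.
move=> hP hN.
have h1 : if s then pev P N s f -> pev P' N' s f else pev P' N' s f -> pev P N s f.
  by apply: pev_mono => x xs; [rewrite hP|rewrite hN].
have h2 : if s then pev P' N' s f -> pev P N s f else pev P N s f -> pev P' N' s f.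
  by apply: pev_mono => x xs; [rewrite hP|rewrite hN].
by case: s hP hN h1 h2 => hP hN h1 h2; apply/idP/idP.
Qed.

Lemma pev_label (P N : nat -> bool) s J f :
  pev (fun x => P x.1) (fun x => N x.1) s (label J f) = pev P N s f.
Proof. by elim: f s J => //= [a IHa|a IHa b IHb|a IHa b IHb|a IHa b IHb] s J; rewrite ?IHa ?IHb. Qed.

Lemma pev_conjW (P N : nat * nat -> bool) I C : pev P N true (label I (conjW C)) <->
  forall f, List.In f (label_all I C) -> pev P N true f.
Proof.
elim: C I => [|g C IH] I /=; first by split.
split=> [/andP [hg /IH hC] f [<-|] //|h]; first exact: hC.
by apply/andP; split; [apply: h; left | apply/IH => f fC; apply: h; right].
Qed.

Lemma In_label_all I C f : List.In f (label_all I C) ->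
  exists J g, List.In g C /\ f = label J g.
Proof.
elim: C I => //= g C IH I [<-|/IH [J [g' [gC ->]]]]; first by do 2 eexists; split; first by left.
by exists J, g'; split=> //; right.
Qed.

Lemma label_all_In I C g : List.In g C -> exists J, List.In (label J g) (label_all I C).
Proof.
elim: C I => //= h C IH I [<-|/IH H]; first by eexists; left.
by have [J hJ] := H (drop (size (occurrences true h)) I); exists J; right.
Qed.

Lemma all_occurrencesP (A : eqType) (C : seq (form A)) x :
  x \in all_occurrences C <-> exists2 f, List.In f C & x \in occurrences true f.
Proof.
rewrite /all_occurrences; elim: C => [|f C IH] /=; first by split=> // -[].
rewrite mem_cat; split.
  by case/orP => [h|/IH [g gC h]]; [exists f; first by left | exists g; first by right].
by case=> g [<-|gC] h; rewrite ?h //; apply/orP; right; apply/IH; exists g.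
Qed.

(** * Defaults of a conjunction of clauses, uniformly in the mode *)

Section Clauses.
Variables (md : mode) (C : seq sentence) (I : seq nat).
Let W := [:: conjW C].
Let T := thy md W I.
Implicit Types z m : xatom -> bool.

Definition pos_value z (x : nat * nat) : bool := z (posx md W x).
Definition neg_value z (x : nat * nat) : bool := z (negx md W x).

Definition occurs p i s : Prop := (p, i, s) \in all_occurrences (label_all I C).

Lemma label_W : label_all I W = [:: label I (conjW C)].
Proof. by rewrite /= label_take. Qed.

Lemma models_W z : models z (facts T) <->
  forall f, List.In f (label_all I C) -> pev (pos_value z) (neg_value z) true f.
Proof.
rewrite facts_thyP label_W -pev_conjW; split=> [h|h]; first by inversion h.
by constructor.
Qed.

Lemma occ_W : all_occurrences (label_all I W) = all_occurrences (label_all I C).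
Proof. by rewrite label_W /all_occurrences /= cats0 label_conjW. Qed.

Lemma occurs_W p s : ((p, s) \in all_occurrences W) <-> exists i, occurs p i s.
Proof.
rewrite -(all_occurrences_label I) occ_W; split; last first.
  by case=> i h; apply/mapP; exists (p, i, s).
by move=> /mapP [[[q i] s'] h [-> ->]]; exists i.
Qed.

Lemma complementary_W p : complementary W p <-> (exists i, occurs p i true) /\ exists j, occurs p j false.
Proof. by rewrite -!occurs_W /complementary; split=> [/andP|[-> ->]]. Qed.

Definition satisfied p z : Prop := forall d, defaults_of T p d -> eval z (conseq d).

(** In every mode a default links the unsigned atom to a positive copy, to a negative copy, or to
    both. For [delta p] the indices are arbitrary, since its copies do not depend on them. *)
Variant default_spec p d : Prop :=
| DefBoth i j of (cmp md W p -> occurs p i true /\ occurs p j false) &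
    (forall z, eval z (conseq d) =
       (z (Base p) == pos_value z (p, i)) && (z (Base p) != neg_value z (p, j)))
| DefPos i of occurs p i true & md = M2 & cmp md W p &
    (forall z, eval z (conseq d) = (z (Base p) == pos_value z (p, i)))
| DefNeg j of occurs p j false & md = M2 & cmp md W p &
    (forall z, eval z (conseq d) = (z (Base p) != neg_value z (p, j))).

Lemma defaultP p d : defaults_of T p d -> default_spec p d.
Proof.
rewrite /T /= /pos_index /neg_index occ_W; case: ifP => cp; last first.
  move=> ->; apply: (@DefBoth p _ 0 0); first by rewrite cp.
  by move=> z; rewrite eval_delta /pos_value /neg_value /posx /negx /= cp.
have both : (exists i j, [/\ occurs p i true, occurs p j false &
    d = normal (And (link_pos p i) (link_neg p j))]) -> default_spec p d.
  case=> i [j [hi hj ->]]; apply: (@DefBoth p _ i j) => // z.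
  have E a b : eval z (And a b) = eval z a && eval z b by [].
  by rewrite E eval_link_pos eval_link_neg /pos_value /neg_value /posx /negx /= cp.
have c2 : md = M2 -> (exists2 i, occurs p i true & d = normal (link_pos p i)) \/
   (exists2 j, occurs p j false & d = normal (link_neg p j)) -> default_spec p d.
  move=> em [[i hi ->]|[j hj ->]].
    apply: (@DefPos p _ i) => // z.
    by rewrite eval_link_pos /pos_value /posx /= cp.
  apply: (@DefNeg p _ j) => // z.
  by rewrite eval_link_neg /neg_value /negx /= cp.
by case em: (md) both c2 => both c2; [exact: both|exact: both|exact: c2].
Qed.

Lemma default_both p : cmp md W p = false \/ md <> M2 ->
  forall i j, (cmp md W p -> occurs p i true /\ occurs p j false) ->
  exists2 d, defaults_of T p d & forall z, eval z (conseq d) =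
       (z (Base p) == pos_value z (p, i)) && (z (Base p) != neg_value z (p, j)).
Proof.
move=> h i j o; rewrite /T /= /pos_index /neg_index occ_W; case: ifP h o => cp h o.
  have [hi hj] := o isT; exists (normal (And (link_pos p i) (link_neg p j))).
    by case: h => //; case: (md) => // _; exists i, j.
  move=> z; have E a b : eval z (And a b) = eval z a && eval z b by [].
  by rewrite E eval_link_pos eval_link_neg /pos_value /neg_value /posx /negx /= cp.
exists (delta p) => // z; by rewrite eval_delta /pos_value /neg_value /posx /negx /= cp.
Qed.

Lemma default_pos p i : md = M2 -> cmp md W p -> occurs p i true ->
  exists2 d, defaults_of T p d & forall z, eval z (conseq d) = (z (Base p) == pos_value z (p, i)).
Proof.
move=> em cp o; rewrite /T /= /pos_index /neg_index occ_W cp; exists (normal (link_pos p i)).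
  by rewrite em; left; exists i.
by move=> z; rewrite eval_link_pos /pos_value /posx /= cp.
Qed.

Lemma default_neg p j : md = M2 -> cmp md W p -> occurs p j false ->
  exists2 d, defaults_of T p d & forall z, eval z (conseq d) = (z (Base p) != neg_value z (p, j)).
Proof.
move=> em cp o; rewrite /T /= /pos_index /neg_index occ_W cp; exists (normal (link_neg p j)).
  by rewrite em; right; exists j.
by move=> z; rewrite eval_link_neg /neg_value /negx /= cp.
Qed.

Lemma classical_sat p z : (forall i, pos_value z (p, i) = z (Base p)) ->
  (forall j, neg_value z (p, j) = ~~ z (Base p)) -> satisfied p z.
Proof.
by move=> hP hN d /defaultP [i j _|i _ _ _|j _ _ _] ->; rewrite ?hP ?hN ?eqxx //; case: (z _).
Qed.

Lemma sat_classical p z : satisfied p z ->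
  (forall i, occurs p i true -> pos_value z (p, i) = z (Base p)) /\
  (forall j, occurs p j false -> neg_value z (p, j) = ~~ z (Base p)).
Proof.
move=> st; case cp: (cmp md W p); last first.
  have H i j : (z (Base p) == pos_value z (p, i)) && (z (Base p) != neg_value z (p, j)).
    have o : cmp md W p -> occurs p i true /\ occurs p j false by rewrite cp.
    have [d dd <-] := default_both (or_introl cp) o.
    exact: st.
  split=> i _; first by have /andP [/eqP -> _] := H i i.
  by have /andP [_] := H i i; case: (z _); case: (neg_value _ _).
have [[i0 o0] [j0 o0']] : (exists i, occurs p i true) /\ exists j, occurs p j false.
  by apply/complementary_W; move: cp; rewrite /cmp; case: (md).
have [em|nm] := pselect (md = M2).
  split=> i oi.
    by have [d dd e] := default_pos em cp oi; have := st d dd; rewrite e => /eqP ->.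
  have [d dd e] := default_neg em cp oi; have := st d dd; rewrite e.
  by case: (z _); case: (neg_value _ _).
have H i j : occurs p i true -> occurs p j false ->
    (z (Base p) == pos_value z (p, i)) && (z (Base p) != neg_value z (p, j)).
  move=> oi oj; have [d dd <-] := default_both (or_intror nm) (i := i) (j := j) (fun _ => conj oi oj).
  exact: st.
split=> i oi; first by have /andP [/eqP -> _] := H i j0 oi o0'.
by have /andP [_] := H i0 i o0 oi; case: (z _); case: (neg_value _ _).
Qed.

(** Where a link holds, the signed copy already has the value that the disjunction gives it, so
    raising breaks no default. *)
Lemma raise_sat p m z d : z (Base p) = m (Base p) ->
  (forall i, pos_value z (p, i) = pos_value m (p, i) || m (Base p)) ->
  (forall j, neg_value z (p, j) = neg_value m (p, j) || ~~ m (Base p)) ->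
  defaults_of T p d -> eval m (conseq d) -> eval z (conseq d).
Proof.
move=> hB hP hN /defaultP [i j _|i _ _ _|j _ _ _] e; rewrite !e hB ?hP ?hN;
  by case: (m _); case: (pos_value m _); case: (neg_value m _).
Qed.

(** With all occurring copies of [p] true in [z], a default that asks for both links fails there. A
    negative link alone would make [p] false in [z], whereas [z] inherits the positive links of
    [m]. *)
Lemma glut_sat p m z d : (exists i, occurs p i true) -> (exists j, occurs p j false) ->
  m (Base p) -> (forall i, pos_value m (p, i)) -> (forall j, neg_value m (p, j)) ->
  (forall i, occurs p i true -> pos_value z (p, i)) -> (forall j, occurs p j false -> neg_value z (p, j)) ->
  (forall d', defaults_of T p d' -> eval m (conseq d') -> eval z (conseq d')) ->
  defaults_of T p d -> eval z (conseq d) -> eval m (conseq d).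
Proof.
move=> [i0 oi0] [j0 oj0] mB mP mN zP zN sup dd.
case: (defaultP dd) => [i j o|i oi _ _|j oj em cp] e; rewrite !e.
- have [o1 o2] : pos_value z (p, i) /\ neg_value z (p, j).
    case cp: (cmp md W p) o => o; first by have [] := o isT; split; [apply: zP|apply: zN].
    have e1 : pos_value z (p, i) = pos_value z (p, i0) by rewrite /pos_value /posx /= cp.
    have e2 : neg_value z (p, j) = neg_value z (p, j0) by rewrite /neg_value /negx /= cp.
    by rewrite e1 e2; split; [apply: zP|apply: zN].
  by rewrite o1 o2; case: (z _).
- by rewrite mB mP.
- have [d' dd' e'] := default_pos em cp oi0.
  have := sup d' dd'; rewrite !e' mB mP zP // => /(_ isT) /eqP ->.
  by rewrite zN.
Qed.

End Clauses.

(** * Names of the auxiliary atoms *)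

Definition regular (p : nat) : bool := ~~ head true (binary p).

(** All auxiliary names start with [true], unlike the atoms of run formulas. Two of the prefixes are
    closed by [false], which keeps the kinds apart, and the final [true] makes each word
    canonical. *)
Definition av_bits (k : bits) : bits := [:: true, false & k ++ [:: true]].
Definition bv_bits (k : bits) : bits := [:: true, true, false & k ++ [:: true]].
Definition tv_bits : bits := [:: true; true; true].
Definition uv_bits : bits := [:: true; true; true; true].

Definition av p : nat := bval (av_bits (binary p)).
Definition bv p : nat := bval (bv_bits (binary p)).
Definition tv : nat := bval tv_bits.
Definition uv : nat := bval uv_bits.

Lemma binary_av p : binary (av p) = av_bits (binary p).
Proof. by apply: binary_bval; rewrite /= last_cat. Qed.

Lemma binary_bv p : binary (bv p) = bv_bits (binary p).
Proof. by apply: binary_bval; rewrite /= last_cat. Qed.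

Lemma binary_tv : binary tv = tv_bits.
Proof. exact: binary_bval. Qed.

Lemma binary_uv : binary uv = uv_bits.
Proof. exact: binary_bval. Qed.

Definition binE := (binary_av, binary_bv, binary_tv, binary_uv).

Lemma av_eq p q : (av p == av q) = (p == q).
Proof.
apply/eqP/eqP => [|-> //] /(congr1 binary); rewrite !binE => -[].
by rewrite !cats1 => /rcons_inj [/binary_inj].
Qed.

Lemma bv_eq p q : (bv p == bv q) = (p == q).
Proof.
apply/eqP/eqP => [|-> //] /(congr1 binary); rewrite !binE => -[].
by rewrite !cats1 => /rcons_inj [/binary_inj].
Qed.

Lemma neq_binary p q : binary p != binary q -> (p == q) = false.
Proof. by apply: contraNF => /eqP ->. Qed.

Lemma av_bv p q : ((av p == bv q) = false) * ((bv q == av p) = false).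
Proof. by split; apply: neq_binary; rewrite !binE. Qed.

Lemma av_tv p : ((av p == tv) = false) * ((tv == av p) = false).
Proof. by split; apply: neq_binary; rewrite !binE. Qed.

Lemma av_uv p : ((av p == uv) = false) * ((uv == av p) = false).
Proof. by split; apply: neq_binary; rewrite !binE. Qed.

Lemma bv_tv p : ((bv p == tv) = false) * ((tv == bv p) = false).
Proof. by split; apply: neq_binary; rewrite !binE. Qed.

Lemma bv_uv p : ((bv p == uv) = false) * ((uv == bv p) = false).
Proof. by split; apply: neq_binary; rewrite !binE. Qed.

Lemma tv_uv : ((tv == uv) = false) * ((uv == tv) = false).
Proof. by split; apply: neq_binary; rewrite !binE. Qed.

Lemma reg_eq p q : regular p -> regular q = false -> (p == q) = false.
Proof. by move=> rp; apply: contraFF => /eqP <-. Qed.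

Lemma reg_new p : (regular (av p) = false) * (regular (bv p) = false) *
  (regular tv = false) * (regular uv = false).
Proof. by rewrite /regular !binE. Qed.

Definition nameE := (av_eq, bv_eq, av_bv, av_tv, av_uv, bv_tv, bv_uv, tv_uv, reg_new).

Definition gad (p : nat) : seq sentence :=
  [:: Atom (av p); Imp (Atom (av p)) (Atom p); Atom (bv p); Imp (Atom (bv p)) (Not (Atom p))].

Definition clauses (sk : bool) (X : seq nat) (psi : sentence) : seq sentence :=
  (if sk then [:: Atom tv; Imp (Atom tv) (And (Not psi) (Atom uv))] else [::]) ++
  flatten [seq gad p | p <- X].

(** * Models of the gadget clauses *)

Section Gadget.
Variables (md : mode) (sk : bool) (X : seq nat) (psi : sentence) (I : seq nat).
Hypothesis regX : {in X, forall p, regular p}.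
Hypothesis regpsi : {in atoms psi, forall p, regular p}.

Let C := clauses sk X psi.
Let W := [:: conjW C].
Let T := thy md W I.
Implicit Types z m : xatom -> bool.
Notation occ := (occurs C I).
Notation pval := (pos_value md C).
Notation nval := (neg_value md C).
Notation sat p z := (satisfied md C I p z).

Variant clause_spec (f : form (nat * nat)) : Prop :=
| ClA p i of p \in X & f = Atom (av p, i)
| ClAX p i j of p \in X & f = Imp (Atom (av p, i)) (Atom (p, j))
| ClB p i of p \in X & f = Atom (bv p, i)
| ClBX p i j of p \in X & f = Imp (Atom (bv p, i)) (Not (Atom (p, j)))
| ClT i of sk & f = Atom (tv, i)
| ClTU i J j of sk & f = Imp (Atom (tv, i)) (And (Not (label J psi)) (Atom (uv, j))).

Lemma clauseP f : List.In f (label_all I C) -> clause_spec f.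
Proof.
move=> /In_label_all [J [g [gC ->]]]; move: gC; rewrite /C /clauses List.in_app_iff => -[].
  case: ifP => // h [<-|[<-|//]]; first exact: (ClT h).
  exact: (ClTU h).
move=> /In_flatten_map [p pX [<-|[<-|[<-|[<-|//]]]]].
- exact: (ClA pX).
- exact: (ClAX pX).
- exact: (ClB pX).
- exact: (ClBX pX).
Qed.

Lemma gad_clause p g : p \in X -> List.In g (gad p) -> exists J, List.In (label J g) (label_all I C).
Proof.
move=> pX gp; apply: label_all_In; rewrite /C /clauses List.in_app_iff; right.
by apply/In_flatten_map; exists p.
Qed.

Lemma exA p : p \in X -> exists i, List.In (Atom (av p, i)) (label_all I C).
Proof. by move=> pX; have [|J h] := @gad_clause p (Atom (av p)) pX; [left | eexists; exact: h]. Qed.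

Lemma exAX p : p \in X -> exists i j, List.In (Imp (Atom (av p, i)) (Atom (p, j))) (label_all I C).
Proof.
move=> pX; have [|J h] := @gad_clause p (Imp (Atom (av p)) (Atom p)) pX; first by right; left.
by do 2 eexists; exact: h.
Qed.

Lemma exB p : p \in X -> exists i, List.In (Atom (bv p, i)) (label_all I C).
Proof.
by move=> pX; have [|J h] := @gad_clause p (Atom (bv p)) pX; [right; right; left | eexists; exact: h].
Qed.

Lemma exBX p : p \in X -> exists i j,
  List.In (Imp (Atom (bv p, i)) (Not (Atom (p, j)))) (label_all I C).
Proof.
move=> pX; have [|J h] := @gad_clause p (Imp (Atom (bv p)) (Not (Atom p))) pX.
  by right; right; right; left.
by do 2 eexists; exact: h.
Qed.

Lemma exT : sk -> exists i, List.In (Atom (tv, i)) (label_all I C).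
Proof.
move=> h; have [|J hJ] := @label_all_In I C (Atom tv); first by rewrite /C /clauses h; left.
by eexists; exact: hJ.
Qed.

Lemma exTU : sk -> exists i J j,
  List.In (Imp (Atom (tv, i)) (And (Not (label J psi)) (Atom (uv, j)))) (label_all I C).
Proof.
move=> h; have [|J hJ] := @label_all_In I C (Imp (Atom tv) (And (Not psi) (Atom uv))).
  by rewrite /C /clauses h; right; left.
by do 3 eexists; exact: hJ.
Qed.

Lemma occI f p i s : List.In f (label_all I C) -> (p, i, s) \in occurrences true f -> occ p i s.
Proof. by move=> fC pf; apply/all_occurrencesP; exists f. Qed.

Lemma atoms_label J s f x : x \in occurrences s (label J f) -> x.1.1 \in atoms f.
Proof.
move=> h; rewrite -(atoms_s f s) -(occurrences_label s J); apply/mapP; exists (x.1.1, x.2) => //.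
by apply/mapP; exists x.
Qed.

Lemma occP p i s : occ p i s -> exists f, [/\ List.In f (label_all I C), clause_spec f &
  (p, i, s) \in occurrences true f].
Proof. by move=> /all_occurrencesP [f fC h]; exists f; split=> //; apply: clauseP. Qed.

Lemma psi_reg J s p i s' : (p, i, s') \in occurrences s (label J psi) -> regular p.
Proof. by move=> /atoms_label /regpsi. Qed.

Lemma not_psi J s q i s' : regular q = false -> ((q, i, s') \in occurrences s (label J psi)) = false.
Proof. by move=> h; apply/negP => /psi_reg; rewrite h. Qed.

Lemma new_reg p q : regular p = false -> regular q -> (p == q) = false.
Proof. by move=> rp rq; rewrite eq_sym reg_eq. Qed.

(* [q] is one of the new atoms. *)
Lemma new_occ q i s : regular q = false -> occ q i s -> exists f,
  [/\ List.In f (label_all I C), clause_spec f &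
   match f with
   | Atom x => [/\ x.1 == q, x.2 = i & s = true]
   | Imp (Atom x) (And _ (Atom y)) =>
       [/\ x.1 == q, x.2 = i & s = false] \/ [/\ y.1 == q, y.2 = i & s = true]
   | Imp (Atom x) _ => [/\ x.1 == q, x.2 = i & s = false]
   | _ => False
   end].
Proof.
move=> rq /occP [f [fC sp pf]]; exists f; split=> //.
case: sp pf => [p j pX|p j k pX|p j pX|p j k pX|j h|j J k h] -> /=;
  rewrite ?mem_cat ?inE ?mem_cat ?inE ?not_psi //= ?xpair_eqE.
- by case/andP => /andP [/eqP -> /eqP ->] /eqP ->.
- by rewrite (new_reg rq (regX pX)) !andFb orbF => /andP [/andP [/eqP -> /eqP ->] /eqP ->].
- by case/andP => /andP [/eqP -> /eqP ->] /eqP ->.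
- by rewrite (new_reg rq (regX pX)) !andFb orbF => /andP [/andP [/eqP -> /eqP ->] /eqP ->].
- by case/andP => /andP [/eqP -> /eqP ->] /eqP ->.
- by case/orP => /andP [/andP [/eqP -> /eqP ->] /eqP ->]; [left|right].
Qed.

Ltac nope := by [case; rewrite ?nameE | case=> -[]; rewrite ?nameE].

(** [X] may list an atom repeatedly, so [av p] may occur more than twice; each occurrence still sits
    in a clause about [p]. *)
Lemma occ_av p i s : occ (av p) i s -> if s then List.In (Atom (av p, i)) (label_all I C)
  else exists j, List.In (Imp (Atom (av p, i)) (Atom (p, j))) (label_all I C).
Proof.
move=> /new_occ [|f [fC sp h]]; first by rewrite nameE.
case: sp h fC => [q j qX|q j k qX|q j qX|q j k qX|j _|j J k _] -> /=; try nope.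
- by case; rewrite nameE => /eqP <- <- ->.
- by case; rewrite nameE => /eqP <- <- -> h; exists k.
Qed.

Lemma occ_bv p i s : occ (bv p) i s -> if s then List.In (Atom (bv p, i)) (label_all I C)
  else exists j, List.In (Imp (Atom (bv p, i)) (Not (Atom (p, j)))) (label_all I C).
Proof.
move=> /new_occ [|f [fC sp h]]; first by rewrite nameE.
case: sp h fC => [q j qX|q j k qX|q j qX|q j k qX|j _|j J k _] -> /=; try nope.
- by case; rewrite nameE => /eqP <- <- ->.
- by case; rewrite nameE => /eqP <- <- -> h; exists k.
Qed.

Lemma occ_tv i s : occ tv i s -> if s then List.In (Atom (tv, i)) (label_all I C)
  else exists J j, List.In (Imp (Atom (tv, i)) (And (Not (label J psi)) (Atom (uv, j)))) (label_all I C).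
Proof.
move=> /new_occ [|f [fC sp h]]; first by rewrite (reg_new 0).
case: sp h fC => [q j qX|q j k qX|q j qX|q j k qX|j _|j J k _] -> /=; try nope.
- by case=> _ <- ->.
- case=> -[]; rewrite ?nameE // => _ <- -> h; by exists J, k.
Qed.

Definition superset m z : Prop := forall p d, defaults_of T p d ->
  eval m (conseq d) -> eval z (conseq d).

Lemma maximalP m : maximal T (rank [::]) m <-> models m (facts T) /\
  forall z, models z (facts T) -> superset m z -> superset z m.
Proof.
rewrite rank_nil; split=> -[mV H]; split=> // z zV.
  move=> sup p d dd zd; apply: contrapT => /negP md_; apply: (H z zV).
  by exists p, d; split=> // p' d' _; apply: sup.
case=> p [d [dd zd nm sup]]; move/negP: nm; apply; apply: (H z zV _ p d dd zd).
by move=> p' d' dd'; apply: (sup p').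
Qed.

Section Standard.
Variable e : nat -> bool.

(** The atoms sacrificed by the standard valuation, whose two copies are both true: for each [x] the
    premise that disagrees with [e x], and [tv]. *)
Definition glut p : bool := (sk && (p == tv)) ||
  has (fun x => (p == bv x) && e x || (p == av x) && ~~ e x) X.

(** Among the auxiliary atoms only [uv] is made false: it is the conclusion to be refuted. *)
Definition evar p : bool := if regular p then e p else p != uv.

Definition stdv (x : xatom) : bool :=
  match x with
  | Base p | Plus p | PlusI p _ => evar p || glut p
  | Minus p | MinusI p _ => ~~ evar p || glut p
  end.

Lemma glutP p : glut p -> (sk /\ p = tv) \/
  exists2 x, x \in X & (p = bv x /\ e x) \/ (p = av x /\ ~~ e x).
Proof.
case/orP => [/andP [h /eqP ->]|/hasP [x xX h]]; [by left | right; exists x => //].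
by case/orP: h => /andP [/eqP -> ->]; [left|right].
Qed.

Lemma glut_reg p : regular p -> glut p = false.
Proof.
move=> rp; apply/negP => /glutP [[_ ep]|[x _ [[ep _]|[ep _]]]]; move: rp;
  by rewrite ep ?(reg_new 0) // nameE.
Qed.

Lemma glut_av p : p \in X -> glut (av p) = ~~ e p.
Proof.
move=> pX; apply/idP/idP => [/glutP [[_ /eqP]|[x _ [[/eqP]|[/eqP]]]]|np]; rewrite ?nameE //.
  by move=> /eqP ->.
by apply/orP; right; apply/hasP; exists p => //; rewrite nameE eqxx np.
Qed.

Lemma glut_bv p : p \in X -> glut (bv p) = e p.
Proof.
move=> pX; apply/idP/idP => [/glutP [[_ /eqP]|[x _ [[/eqP]|[/eqP]]]]|np]; rewrite ?nameE //.
  by move=> /eqP ->.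
by apply/orP; right; apply/hasP; exists p => //; rewrite nameE eqxx np.
Qed.

Lemma glut_uv : glut uv = false.
Proof. by apply/negP => /glutP [[_ /eqP]|[x _ [[/eqP]|[/eqP]]]]; rewrite ?nameE. Qed.

Lemma pval_std p i : pval stdv (p, i) = evar p || glut p.
Proof. by rewrite /pos_value /posx /=; case: ifP. Qed.

Lemma nval_std p i : nval stdv (p, i) = ~~ evar p || glut p.
Proof. by rewrite /neg_value /negx /=; case: ifP. Qed.

Lemma evar_reg p : regular p -> evar p = e p.
Proof. by rewrite /evar => ->. Qed.

Lemma std_models : models stdv (facts T).
Proof.
apply/models_W => f /clauseP [p i pX|p i j pX|p i pX|p i j pX|i h|i J j h] ->.
- by rewrite /= pval_std /evar !nameE.
- rewrite /= pval_std nval_std glut_av // (evar_reg (regX pX)).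
  by rewrite glut_reg ?regX // orbF /evar !nameE /= negbK implybb.
- by rewrite /= pval_std /evar !nameE.
- rewrite /= !nval_std glut_bv // (evar_reg (regX pX)).
  by rewrite glut_reg ?regX // orbF /evar !nameE /= negbK implybb.
- by rewrite /= pval_std /glut h eqxx orbT.
- by rewrite /= nval_std /glut h eqxx orbT.
Qed.

Lemma std_sat p : ~~ glut p -> sat p stdv.
Proof.
move=> /negbTE ng; apply: classical_sat => i; rewrite ?pval_std ?nval_std //= ng ?orbF //.
Qed.

Section Above.
Variable z : xatom -> bool.
Hypothesis zV : forall f, List.In f (label_all I C) -> pev (pval z) (nval z) true f.
Hypothesis sup : superset stdv z.

Lemma above_sat p : ~~ glut p -> sat p z.
Proof. by move=> ng d dd; exact: (sup dd (std_sat ng dd)). Qed.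

(** The premise that agrees with [e p] is not sacrificed, so it is classical in [z], and its two
    clauses force the value of [p]. *)
Lemma above_X p : p \in X -> z (Base p) = e p.
Proof.
move=> pX; have [xP xN] := sat_classical (above_sat (negbT (glut_reg (regX pX)))).
case ep: (e p).
  have ng : ~~ glut (av p) by rewrite glut_av // ep.
  have [aP aN] := sat_classical (above_sat ng).
  have [i hi] := exA pX; have [j [k hj]] := exAX pX.
  have oi : occ (av p) i true by apply: (occI hi); rewrite /= inE.
  have oj : occ (av p) j false by apply: (occI hj); rewrite /= inE eqxx.
  have ok : occ p k true by apply: (occI hj); rewrite /= !inE eqxx orbT.
  have := zV hi; rewrite /= aP // => bA; have := zV hj; rewrite /= aN // bA /= xP //.
have ng : ~~ glut (bv p) by rewrite glut_bv // ep.
have [bP bN] := sat_classical (above_sat ng).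
have [i hi] := exB pX; have [j [k hj]] := exBX pX.
have oi : occ (bv p) i true by apply: (occI hi); rewrite /= inE.
have oj : occ (bv p) j false by apply: (occI hj); rewrite /= inE eqxx.
have ok : occ p k false by apply: (occI hj); rewrite /= !inE eqxx orbT.
have := zV hi; rewrite /= bP // => bB; have := zV hj; rewrite /= bN // bB /= xN // negbK.
by move=> /negbTE.
Qed.

Lemma above_av p j : p \in X -> ~~ e p -> occ (av p) j false -> nval z (av p, j).
Proof.
move=> pX np /occ_av [k hk]; have := zV hk.
have [xP _] := sat_classical (above_sat (negbT (glut_reg (regX pX)))).
have ok : occ p k true by apply: (occI hk); rewrite /= !inE eqxx orbT.
by rewrite /= xP // above_X // (negbTE np) implybF negbK.
Qed.

Lemma above_bv p j : p \in X -> e p -> occ (bv p) j false -> nval z (bv p, j).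
Proof.
move=> pX ep /occ_bv [k hk]; have := zV hk.
have [_ xN] := sat_classical (above_sat (negbT (glut_reg (regX pX)))).
have ok : occ p k false by apply: (occI hk); rewrite /= !inE eqxx orbT.
by rewrite /= xN // above_X // ep implybF negbK.
Qed.

Hypothesis Hpsi : sk -> forall v, {in X, v =1 e} -> eval v psi.

(** No atom of [psi] is sacrificed, so [psi] is evaluated classically in [z] and is true there; the
    implication from [tv] can then hold only through the negative copy of [tv]. *)
Lemma above_tv j : sk -> occ tv j false -> nval z (tv, j).
Proof.
move=> h /occ_tv [J [k hk]]; have := zV hk; rewrite /=; case: (nval z (tv, j)) => //=.
suff -> : pev (pval z) (nval z) false (label J psi) = eval (fun p => z (Base p)) psi.
  by rewrite Hpsi //; move=> p; apply: above_X.
rewrite (eval_pev _ false) -(pev_label _ _ _ J); apply: eq_pev_occ => -[p i] pi /=.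
  have [xP _] := sat_classical (above_sat (negbT (glut_reg (psi_reg pi)))).
  by apply: xP; apply: (occI hk); rewrite /= !inE mem_cat pi orbT.
have [_ xN] := sat_classical (above_sat (negbT (glut_reg (psi_reg pi)))).
by apply: xN; apply: (occI hk); rewrite /= !inE mem_cat pi orbT.
Qed.

(** A sacrificed atom keeps both kinds of copies true in [z], the positive ones by its unit clause
    and the negative ones as forced above, so [glut_sat] forbids any gain. *)
Lemma above_superset : superset z stdv.
Proof.
move=> p d dd zd; have [gl|ng] := boolP (glut p); last exact: (std_sat ng dd).
have sB : stdv (Base p) by rewrite /= gl orbT.
have sP i : pval stdv (p, i) by rewrite pval_std gl orbT.
have sN i : nval stdv (p, i) by rewrite nval_std gl orbT.
have sp d' : defaults_of T p d' -> eval stdv (conseq d') -> eval z (conseq d') := sup (p := p) (d := d').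
case/glutP: (gl) => [[h ep]|[x xX [[ep ex]|[ep ex]]]]; subst p.
- have [i hi] := exT h; have [j [J [k hj]]] := exTU h.
  apply: (glut_sat _ _ sB sP sN _ _ sp dd zd).
  + by exists i; apply: (occI hi); rewrite /= inE.
  + by exists j; apply: (occI hj); rewrite /= inE eqxx.
  + by move=> i' /occ_tv /zV.
  + by move=> j'; apply: above_tv.
- have [i hi] := exB xX; have [j [k hj]] := exBX xX.
  apply: (glut_sat _ _ sB sP sN _ _ sp dd zd).
  + by exists i; apply: (occI hi); rewrite /= inE.
  + by exists j; apply: (occI hj); rewrite /= inE eqxx.
  + by move=> i' /occ_bv /zV.
  + by move=> j'; apply: above_bv.
- have [i hi] := exA xX; have [j [k hj]] := exAX xX.
  apply: (glut_sat _ _ sB sP sN _ _ sp dd zd).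
  + by exists i; apply: (occI hi); rewrite /= inE.
  + by exists j; apply: (occI hj); rewrite /= inE eqxx.
  + by move=> i' /occ_av /zV.
  + by move=> j'; apply: above_av.
Qed.

End Above.

Lemma std_maximal : (sk -> forall v, {in X, v =1 e} -> eval v psi) -> maximal T (rank [::]) stdv.
Proof.
move=> Hpsi; apply/maximalP; split; first exact: std_models.
by move=> z /models_W zV sup; apply: above_superset.
Qed.

End Standard.

Section Raise.
Variables (m : xatom -> bool) (v : nat -> bool).
Hypothesis mV : models m (facts T).
Hypothesis agree : {in X, forall p, v p = m (Base p)}.

(** Atoms that are not kept are reset to classical values: [tv] and [uv] to true, the others to
    those of [v]. Kept atoms are only raised, which preserves the gadget clauses by monotonicity. *)
Definition kept p : bool :=
  ~~ ((p \in atoms psi) && (p \notin X) || sk && ((p == tv) || (p == uv))).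

Definition newval p : bool := if (p == tv) || (p == uv) then true else v p.

Definition raise (x : xatom) : bool :=
  match x with
  | Base p => if kept p then m x else newval p
  | Plus p | PlusI p _ => if kept p then m x || m (Base p) else newval p
  | Minus p | MinusI p _ => if kept p then m x || ~~ m (Base p) else ~~ newval p
  end.

Lemma pval_raise p i : pval raise (p, i) = if kept p then pval m (p, i) || m (Base p) else newval p.
Proof. by rewrite /pos_value /posx /=; case: ifP. Qed.

Lemma nval_raise p i : nval raise (p, i) =
  if kept p then nval m (p, i) || ~~ m (Base p) else ~~ newval p.
Proof. by rewrite /neg_value /negx /=; case: ifP. Qed.

Lemma raise_sat_new p : ~~ kept p -> sat p raise.
Proof.
by move=> /negbTE nk; apply: classical_sat => i; rewrite ?pval_raise ?nval_raise //= nk.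
Qed.

Lemma raise_superset : superset m raise.
Proof.
move=> p d dd; case kp: (kept p); last by move=> _; exact: (raise_sat_new (negbT kp) dd).
apply: (raise_sat (m := m) _ _ _ dd); first by rewrite /= kp.
- by move=> i; rewrite pval_raise kp.
- by move=> i; rewrite nval_raise kp.
Qed.

Lemma kept_X p : p \in X -> kept p.
Proof.
move=> pX; rewrite /kept pX andbF /= negb_and !(reg_eq (regX pX)) ?(reg_new 0) //.
by rewrite orbT.
Qed.

Lemma kept_av p : kept (av p).
Proof.
rewrite /kept !nameE andbF orbF; apply/negP => /andP [/regpsi].
by rewrite nameE.
Qed.

Lemma kept_bv p : kept (bv p).
Proof.
rewrite /kept !nameE andbF orbF; apply/negP => /andP [/regpsi].
by rewrite nameE.
Qed.

Lemma raise_psi p : p \in atoms psi -> raise (Base p) = v p.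
Proof.
move=> pp; rewrite /=; have [pX|npX] := boolP (p \in X); first by rewrite kept_X // agree.
rewrite /kept pp npX /= /newval !(reg_eq (regpsi pp)) ?(reg_new 0) //.
Qed.

Lemma raise_ge p i : p \in atoms psi ->
  (v p -> pval raise (p, i)) /\ (~~ v p -> nval raise (p, i)).
Proof.
move=> pp; have := raise_psi pp; rewrite pval_raise nval_raise /=.
by case: ifP => _ <-; split=> // ->; rewrite orbT.
Qed.

Lemma raise_models : (sk -> ~~ eval v psi) -> models raise (facts T).
Proof.
move=> nv; apply/models_W => f fC; have mf : pev (pval m) (nval m) true f by move/models_W: mV; apply.
have mono : (forall x s, (x, s) \in occurrences true f -> kept x.1) ->
    pev (pval raise) (nval raise) true f.
  move=> kf; apply: (@pev_mono _ (pval m) _ (nval m) _ true) mf => -[p i] /kf /= kp.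
    by rewrite pval_raise kp => ->.
  by rewrite nval_raise kp => ->.
case: (clauseP fC) mono => [p i pX|p i j pX|p i pX|p i j pX|i h|i J j h] ef mono.
- by apply: mono => x s; rewrite ef /= inE => /eqP [-> _]; exact: kept_av.
- by apply: mono => x s; rewrite ef /= !inE => /orP [] /eqP [-> _]; [exact: kept_av|exact: kept_X].
- by apply: mono => x s; rewrite ef /= inE => /eqP [-> _]; exact: kept_bv.
- by apply: mono => x s; rewrite ef /= !inE => /orP [] /eqP [-> _]; [exact: kept_bv|exact: kept_X].
- by rewrite ef /= pval_raise /kept h eqxx orbT /newval eqxx.
- have ku : kept uv = false by rewrite /kept h eqxx !orbT.
  rewrite ef /= pval_raise ku {1}/newval eqxx orbT andbT.
  (* The copies in [raise] lie above the classical copies given by [v]. As [psi] sits in a negative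
     position, its signed value lies below its value under [v], which is false. *)
  apply/implyP => _; apply: contra (nv h); rewrite (eval_pev _ false) -(pev_label _ _ _ J).
  by apply: (@pev_mono _ _ _ _ _ false) => -[p k] /atoms_label /(raise_ge k) [].
Qed.

End Raise.

Lemma std_psi : forall z e, models z (facts T) -> superset (stdv e) z -> {in X, forall p, z (Base p) = e p}.
Proof. by move=> z e /models_W zV sup p; apply: above_X. Qed.

(** If some [v] refuted [psi], raising [m] along [v] would keep all defaults of [m] and gain the
    violated one, against maximality. *)
Lemma raised_psi m : maximal T (rank [::]) m -> sk ->
  (exists p d, [/\ (p == tv) || (p == uv), defaults_of T p d & ~~ eval m (conseq d)]) ->
  forall v, {in X, v =1 (fun p => m (Base p))} -> eval v psi.
Proof.
move=> /maximalP [mV mx] h [p [d [pt dd nd]]] v ag; apply: contraNT nd => nv.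
have nk : ~~ kept p by rewrite /kept h pt orbT.
exact: (mx _ (raise_models mV ag (fun=> nv)) (@raise_superset m v) p d dd (raise_sat_new m v nk dd)).
Qed.

Lemma sat_tv z : models z (facts T) -> sk -> sat tv z -> exists2 j, occ uv j true & pval z (uv, j).
Proof.
move=> /models_W zV h st; have [tP tN] := sat_classical st.
have [i hi] := exT h; have [j [J [k hj]]] := exTU h.
have oi : occ tv i true by apply: (occI hi); rewrite /= inE.
have oj : occ tv j false by apply: (occI hj); rewrite /= inE eqxx.
have ok : occ uv k true by apply: (occI hj); rewrite /= !inE mem_cat inE eqxx !orbT.
exists k => //; have := zV _ hi; rewrite /= tP // => bt; have := zV _ hj.
by rewrite /= tN // bt /= => /andP [].
Qed.

Lemma sat_uv z : models z (facts T) -> sk -> sat tv z -> sat uv z -> z (Base uv).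
Proof.
move=> zV h st su; have [j oj] := sat_tv zV h st; have [uP _] := sat_classical su.
by rewrite uP.
Qed.

End Gadget.

(** * Reductions for unsigned conclusions *)

Definition qbf (X : seq nat) (psi : sentence) : Prop :=
  exists e : nat -> bool, forall v, {in X, v =1 e} -> eval v psi.

Lemma ranking_nil : ranking [::].
Proof. by []. Qed.

(** A signed conclusion could be true merely because both copies of some [p] in [X] are true. The
    signed form of this formula puts the conflict at a premise, by demanding a true negative copy of
    [av p] or [bv p]; maximality then makes [p] classical. *)
Definition no_glut (X : seq nat) : sentence :=
  bigand X (fun p => Or (Not (Atom (av p))) (Not (Atom (bv p)))).

Lemma std_uv sk X e : evar e uv || glut sk X e uv = false.
Proof. by rewrite glut_uv orbF /evar (reg_new 0) eqxx. Qed.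

Section Reductions.
Variables (md : mode) (X : seq nat) (psi : sentence) (I : seq nat).
Hypothesis regX : {in X, forall p, regular p}.
Hypothesis regpsi : {in atoms psi, forall p, regular p}.

Let T sk := thy md [:: conjW (clauses sk X psi)] I.
Let Es sk := hierarchic_extensions (T sk) (rank [::]).
Let sn sk := @thy_seminormal md [:: conjW (clauses sk X psi)] I.
Let rg := fun p => rank_gt0 p ranking_nil.

(** The unsigned conclusion reads the [Base] atoms. Raising a maximal [m] realizes every [v] that
    agrees with it on [X], so entailment of [psi] covers all these [v]. *)
Lemma credulous_qbf : credulous (T false) (Es false) (unsigned psi) <-> qbf X psi.
Proof.
rewrite (credulousE (@sn false) rg (rank_bounded [::])); split.
  case=> [nV|[m [mm H]]].
    by case: (nV (stdv false X (fun=> true))); apply: std_models.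
  have [mV _] := mm; exists (fun p => m (Base p)) => v ag.
  have := H _ (raise_models regX regpsi mV ag (fun h => False_ind _ (notF h)))
    (@raise_superset md false X psi I m v).
  rewrite /unsigned eval_map; congr is_true; apply: eval_in => p pp.
  exact: raise_psi.
case=> e He; right; exists (stdv false X e); split; first exact: std_maximal.
move=> z zV sup; rewrite /unsigned eval_map; apply: He => p pX.
exact: (std_psi regX zV sup).
Qed.

Lemma maximal_glut m : maximal (T true) (rank [::]) m ->
  (exists p d, [/\ (p == tv) || (p == uv), defaults_of (T true) p d & ~~ eval m (conseq d)]) ->
  qbf X psi.
Proof. by move=> mm h; exists (fun p => m (Base p)); apply: (raised_psi regX regpsi mm). Qed.

Lemma unsat_uv z : models z (facts (T true)) -> ~~ z (Base uv) ->
  exists p d, [/\ (p == tv) || (p == uv), defaults_of (T true) p d & ~~ eval z (conseq d)].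
Proof.
move=> zV; apply: contraNP => no.
have h p : (p == tv) || (p == uv) -> satisfied md (clauses true X psi) I p z.
  by move=> pp d dd; apply: contrapT => /negP nd; apply: no; exists p, d.
by apply: (sat_uv zV) => //; apply: h; rewrite eqxx ?orbT.
Qed.

Lemma skeptical_qbf : ~ skeptical (T true) (Es true) (unsigned (Atom uv)) <-> qbf X psi.
Proof.
rewrite (skepticalE (@sn true) rg (rank_bounded [::])); split.
  case=> m mm nm; apply: (maximal_glut mm); apply: unsat_uv nm.
  by case: mm.
case=> e He; exists (stdv true X e); first exact: std_maximal.
by apply/negPf; exact: std_uv.
Qed.

(** From a suitable [e], the standard valuation serves as its own witness: every default that it
    violates is violated by a maximal model, namely itself. *)
Lemma prudent_qbf : ~ prudent (T true) (Es true) (unsigned (Atom uv)) <-> qbf X psi.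
Proof.
rewrite (prudentE (@sn true) rg (rank_bounded [::])); split.
  case=> v [vV nv H]; have [p [d [pp dd nd]]] := unsat_uv vV nv.
  have [|[m mm nm]] := H p d dd; first by rewrite (negbTE nd).
  by apply: (maximal_glut mm); exists p, d.
case=> e He; exists (stdv true X e); 
  have mx : maximal (T true) (rank [::]) (stdv true X e) by apply: std_maximal.
split; first by case: mx.
  by apply/negPf; exact: std_uv.
by move=> p d dd; case: (boolP (eval (stdv true X e) (conseq d))) => h; [left|right; exists (stdv true X e)].
Qed.

End Reductions.

(** * Reductions for signed conclusions *)

Section SignedReductions.
Variables (X : seq nat) (psi : sentence) (I : seq nat).
Hypothesis regX : {in X, forall p, regular p}.
Hypothesis regpsi : {in atoms psi, forall p, regular p}.

Let T sk := thy M0 [:: conjW (clauses sk X psi)] I.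
Let Es sk := hierarchic_extensions (T sk) (rank [::]).
Let sn sk := @thy_seminormal M0 [:: conjW (clauses sk X psi)] I.
Let rg := fun p => rank_gt0 p ranking_nil.

(** The implication from [tv] yields the positive copy of [uv] directly, so only the default of [tv]
    is at stake. *)
Lemma signed_skeptical_qbf : ~ skeptical (T true) (Es true) (signed (Atom uv)) <-> qbf X psi.
Proof.
rewrite (skepticalE (@sn true) rg (rank_bounded [::])); split.
  case=> m mm nm; apply: (maximal_glut regX regpsi mm); have [mV _] := mm.
  apply: contrapT => no.
  have h : satisfied M0 (clauses true X psi) I tv m.
    move=> d dd; apply: contrapT => /negP nd; apply: no; exists tv, d.
    by rewrite eqxx.
  by have [j _] := sat_tv mV isT h; rewrite /pos_value /posx /= in nm *; rewrite (negbTE nm).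
case=> e He; exists (stdv true X e); first exact: std_maximal.
by apply/negPf; exact: std_uv.
Qed.

Lemma eval_no_glut z : eval z (signed (no_glut X)) = all (fun p => z (Minus (av p)) || z (Minus (bv p))) X.
Proof. by rewrite /signed /no_glut; elim: X => //= p l ->; rewrite !negbK. Qed.

Definition decide_x (m : xatom -> bool) (x : nat) (b : bool) (a : xatom) : bool :=
  match a with
  | Base p | Plus p => if p == x then b else m a
  | Minus p => if p == x then ~~ b else m a
  | _ => m a
  end.

(** Once [av x] or [bv x] has a true negative copy, the clauses no longer force both copies of [x],
    so [x] could be made classical without losing a default. *)
Lemma decided m x : maximal (T false) (rank [::]) m -> x \in X ->
  m (Minus (av x)) || m (Minus (bv x)) -> satisfied M0 (clauses false X psi) I x m.
Proof.
(* [x] becomes true if the implication from [bv x] already holds through its premise; otherwise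
   [mab] says the same about [av x], and [x] may be false. *)
move=> /maximalP [mV mx] xX mab; pose b := m (Minus (bv x)); pose z := decide_x m x b.
have av_x p q : q \in X -> (av p == q) = false.
  by move=> qX; rewrite eq_sym (reg_eq (regX qX)) ?nameE.
have bv_x p q : q \in X -> (bv p == q) = false.
  by move=> qX; rewrite eq_sym (reg_eq (regX qX)) ?nameE.
have zV : models z (facts (T false)).
  apply/models_W => f fC; have := proj1 (models_W M0 _ I m) mV f fC.
  case: (clauseP fC) => [p i pX|p i j pX|p i pX|p i j pX|//|//] ->;
    rewrite /= /pos_value /neg_value /posx /negx /= ?av_x ?bv_x //.
    case: ifP => // /eqP ->; rewrite /b; move: mab.
    by case: (m (Minus (av x))); case: (m (Minus (bv x))).
  case: ifP => // /eqP ->; rewrite /b.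
  by case: (m (Minus (bv x))).
have zx : satisfied M0 (clauses false X psi) I x z.
  by apply: classical_sat => i; rewrite /pos_value /neg_value /posx /negx /= eqxx.
move=> d dd; apply: (mx z zV _ x d dd (zx d dd)) => p d' dd'.
case: (eqVneq p x) => [px|npx]; first by move=> _; apply: zx; rewrite -px.
by move: dd' => /= ->; rewrite !eval_delta /= (negbTE npx).
Qed.

Lemma sat_M0 sk z p : satisfied M0 (clauses sk X psi) I p z ->
  z (Plus p) = z (Base p) /\ z (Minus p) = ~~ z (Base p).
Proof.
move=> /(_ (delta p) erefl); rewrite eval_delta.
by case: (z _); case: (z _); case: (z _).
Qed.

Lemma signed_classical sk z : (forall p, p \in atoms psi -> satisfied M0 (clauses sk X psi) I p z) ->
  eval z (signed psi) = eval (fun p => z (Base p)) psi.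
Proof.
move=> H; rewrite /signed eval_polarize (eval_pev _ true).
by apply: eq_pev_in => p /H /sat_M0 [/= h1 h2].
Qed.

Lemma signed_credulous_qbf :
  credulous (T false) (Es false) (signed (And psi (no_glut X))) <-> qbf X psi.
Proof.
have E z : eval z (signed (And psi (no_glut X))) =
    eval z (signed psi) && all (fun p => z (Minus (av p)) || z (Minus (bv p))) X.
  by rewrite -eval_no_glut.
rewrite (credulousE (@sn false) rg (rank_bounded [::])); split.
  case=> [nV|[m [mm H]]].
    by case: (nV (stdv false X (fun=> true))); apply: std_models.
  have [mV _] := mm; exists (fun p => m (Base p)) => v ag.
  have /andP [_ /allP ng] : eval m (signed psi) &&
      all (fun p => m (Minus (av p)) || m (Minus (bv p))) X by rewrite -E; apply: H.
  have mX p : p \in X -> satisfied M0 (clauses false X psi) I p m.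
    by move=> pX; apply: decided => //; apply: ng.
  have sup := @raise_superset M0 false X psi I m v.
  have := H _ (raise_models regX regpsi mV ag (fun h => False_ind _ (notF h))) sup.
  rewrite E => /andP [+ _]; rewrite (signed_classical (sk := false)).
    by congr is_true; apply: eval_in => p pp; exact: raise_psi.
  move=> p pp; have [pX|npX] := boolP (p \in X).
    by move=> d dd; exact: (sup p d dd (mX p pX d dd)).
  by apply: raise_sat_new; rewrite /kept pp npX.
case=> e He; right; exists (stdv false X e); split; first exact: std_maximal.
move=> z zV sup; have /models_W zV' := zV; rewrite E; apply/andP; split.
  rewrite (signed_classical (sk := false)).
    by apply: He => p pX; exact: (std_psi regX zV sup).
  by move=> p pp; apply: (above_sat sup); rewrite glut_reg ?regpsi.
apply/allP => p pX; case ep: (e p).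
  have [i [j h]] := exBX false psi I pX; apply/orP; right.
  have oi : occurs (clauses false X psi) I (bv p) i false by apply: (occI h); rewrite /= inE eqxx.
  exact: (above_bv regX regpsi zV' sup pX ep oi).
have [i [j h]] := exAX false psi I pX; apply/orP; left.
have oi : occurs (clauses false X psi) I (av p) i false by apply: (occI h); rewrite /= inE eqxx.
exact: (above_av regX regpsi zV' sup pX (negbT ep) oi).
Qed.

End SignedReductions.

(** * Computing the reductions on codes *)

Lemma input_inj hasI W f I r W' f' I' r' : (hasI = false -> I = [::]) ->
  (hasI = false -> I' = [::]) -> input hasI W f I r = input hasI W' f' I' r' ->
  [/\ W = W', f = f', I = I' & r = r'].
Proof.
move=> h h' e; have := parse_input W f r h; rewrite e (parse_input W' f' r' h') => -[].
have ti : injective (toks binary).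
  by move=> a b ab; have [] := @toks_inj _ _ binary_inj a b [::] [::]; rewrite ?cats0.
move=> /(inj_map ti) -> /ti -> /(inj_map binary_inj) -> er; split=> //.
by apply/esym; move: er; apply: inj_map => -[a b] [c d] [/binary_inj -> /binary_inj ->].
Qed.

(* Distinct indices whose binary codes are easily computed. *)
Definition ones_index (k : nat) : nat := bval (nseq k.+1 true).

Lemma binary_ones_index k : binary (ones_index k) = nseq k.+1 true.
Proof. by apply: binary_bval; elim: k. Qed.

Lemma ones_index_inj : injective ones_index.
Proof.
by move=> k l /(congr1 binary); rewrite !binary_ones_index => /(congr1 size); rewrite !size_nseq => -[].
Qed.

Lemma poly_ones_index : poly (fun n : nat => code_seq code_nat [seq ones_index k | k <- iota 0 n]).
Proof.
have hs : poly (fun k : nat => true :: pair_code (nseq k.+1 true, [::])).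
  have E s : [seq true | _ : nat <- s] = nseq (size s) true by elim: s => //= a s ->.
  apply: (@poly_ext _ _ (fun k : nat => true :: pair_code ([seq true | _ <- iota 0 k.+1], [::]))).
    by ptac.
  by move=> k; rewrite E size_iota.
apply: (@poly_ext _ _ (fun n : nat =>
    flatten [seq true :: pair_code (nseq k.+1 true, [::]) | k <- iota 0 n] ++ [:: false])).
  pref (poly_cat _ _); last by ptac.
  pref (poly_flatten _).
  refine (@poly_map _ _ _ (fun _ k => true :: pair_code (nseq k.+1 true, [::])) _ _ _); last by ptac.
  by refine (@poly_comp _ _ _ (fun q : nat * nat => q.2) _ hs _); ptac.
move=> n; rewrite /code_seq -map_comp; congr (flatten _ ++ _); apply: eq_map => k /=.
by rewrite code_nat_pair binary_ones_index.
Qed.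

(** The facts are one formula, hence free of duplicates, and the ranking is empty, so one map serves
    both kinds of problem. [n] gives the length of the index list. *)
Theorem reducible_dlang md sg ord R L (F phi : bits -> sentence) (n : bits -> nat) :
  poly (fun x => code_form (F x)) -> poly (fun x => code_form (phi x)) -> poly n ->
  (forall x, n x = size (occurrences true (F x))) ->
  (forall x I, L x <-> R (thy md [:: F x] I)
     (hierarchic_extensions (thy md [:: F x] I) (rank [::])) (translate sg (phi x))) ->
  reducible L (dlang md sg ord R).
Proof.
move=> hF hp hn nE HL; pose hasI := if md is M0 then false else true.
pose I x := if hasI then [seq ones_index k | k <- iota 0 (n x)] else [::].
(* The code of the empty ranking, which [adj] supplies in the ordinary case. *)
pose tl : bits := if ord then [::] else [:: false].
pose red x := (true :: code_form (F x)) ++ [:: false] ++ code_form (phi x) ++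
  (if hasI then code_seq code_nat [seq ones_index k | k <- iota 0 (n x)] else [::]) ++ tl.
have ex x : adj ord (red x) = input hasI [:: F x] (phi x) (I x) [::].
  rewrite /adj /input /red /I /tl /code_rank /code_seq /=; case: (hasI); case: (ord);
    by rewrite -?cats1 -?catA /= -?catA.
have h0 x : hasI = false -> I x = [::] by rewrite /I => ->.
exists red.
  apply: poly_polytime; rewrite /red; have hi := poly_ones_index.
  by case: (hasI); ptac; refine (@poly_comp _ _ _ n _ hi _).
move=> x; split=> [/(HL x (I x)) hR|[W [f [J [r [[_ _ hJ _] e hR]]]]]].
  exists [:: F x], (phi x), (I x), [::]; split=> //; split=> //.
    by constructor=> //; constructor.
  rewrite -/hasI /I; case: (hasI) => //; split.
    by rewrite (map_inj_uniq ones_index_inj) iota_uniq.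
  by rewrite size_map size_iota nE /all_occurrences /= cats0.
rewrite ex in e; have hJ' : hasI = false -> J = [::] by move=> h; move: hJ; rewrite -/hasI h.
have [eW ef eI er] := input_inj (h0 x) hJ' e.
by apply/(HL x J); rewrite eW ef er.
Qed.

Opaque pair_code.

Definition catom (k : bits) : bits := [:: false; false; false] ++ pair_code (k, [::]).

Lemma code_conjW C : code_form (conjW C) =
  flatten [seq [:: true; false; false] ++ code_form g | g <- C] ++ [:: false; false; true].
Proof. by elim: C => //= g C ->; rewrite -catA. Qed.

Definition cgad (k : bits) : bits :=
  ([:: true; false; false] ++ catom (av_bits k)) ++
  ([:: true; false; false; true; true; false] ++ catom (av_bits k) ++ catom k) ++
  ([:: true; false; false] ++ catom (bv_bits k)) ++
  ([:: true; false; false; true; true; false] ++ catom (bv_bits k) ++ [:: false; true; true] ++ catom k).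

(** The reduction handles only codes, never formulas, so the code of the clauses is spelled out from
    the codes of the atoms and of [psi]. *)
Definition cclauses (sk : bool) (ks : seq bits) (c : bits) : bits :=
  (if sk then ([:: true; false; false] ++ catom tv_bits) ++
     ([:: true; false; false; true; true; false] ++ catom tv_bits ++
      [:: true; false; false; false; true; true] ++ c ++ catom uv_bits) else [::]) ++
  flatten [seq cgad k | k <- ks] ++ [:: false; false; true].

Lemma code_clauses sk X psi : code_form (conjW (clauses sk X psi)) =
  cclauses sk [seq binary p | p <- X] (code_form psi).
Proof.
have E p : code_nat p = pair_code (binary p, [::]) := code_nat_pair p.
rewrite code_conjW /clauses map_cat flatten_cat -catA /cclauses; congr (_ ++ (_ ++ _)).
  by case: sk => //=; rewrite /catom !E !binE /= ?cats0 -?catA.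
elim: X => //= p X ->; move: (flatten [seq cgad k | k <- _]) => l.
rewrite /cgad /catom !E !binE.
move: (pair_code (av_bits _, _)) (pair_code (bv_bits _, _)) (pair_code (binary p, _)) => a b c.
have A (s t u : bits) : (s ++ t) ++ u = s ++ (t ++ u) by rewrite catA.
by do 8 rewrite /= ?A.
Qed.

Lemma size_clauses sk X psi : size (occurrences true (conjW (clauses sk X psi))) =
  (if sk then (size (atoms psi)).+3 else 0) + 6 * size X.
Proof.
rewrite occurrences_conjW /clauses /all_occurrences map_cat flatten_cat size_cat; congr addn.
  case: sk => //=; rewrite cats0 size_cat /= -(atoms_s psi false) size_map.
  by rewrite addn1.
by elim: X => //= p X IH; rewrite IH mulnS.
Qed.

Lemma code_no_glut X : code_form (no_glut X) =
  flatten [seq [:: true; false; false; true; false; true; false; true; true] ++ catom (av_bits k) ++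
     [:: false; true; true] ++ catom (bv_bits k) | k <- [seq binary p | p <- X]] ++
  [:: false; false; true].
Proof.
have E p : code_nat p = pair_code (binary p, [::]) := code_nat_pair p.
rewrite /no_glut; elim: X => //= p X ->; rewrite /catom !E !binE.
by do 2 rewrite /= -?catA.
Qed.

(** * From quantified formulas to the consequence relations *)

Section Hardness.
Variables (L : language) (F : bits -> sentence).
Hypothesis hF : pform F.
Hypothesis HF : forall x, L x <->
  exists u, forall v, (forall p, is_X p -> v p = u p) -> eval v (F x).

Let X x := [seq p <- atoms (F x) | is_X p].

Lemma regF x : {in atoms (F x), forall p, regular p}.
Proof. by move=> p pF; have /allP := proj2 hF x; apply. Qed.

Lemma regX x : {in X x, forall p, regular p}.
Proof. by move=> p; rewrite mem_filter => /andP [_ /regF]. Qed.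

Lemma LE x : L x <-> qbf (X x) (F x).
Proof.
rewrite HF; split=> -[u Hu]; exists u => v ag; last first.
  by apply: Hu => p; rewrite mem_filter => /andP [/ag].
(* Existential names that do not occur in the formula are absent from [X x], and there [v] may
   differ from [u] without effect on the value. *)
have <- : eval (fun p => if is_X p then u p else v p) (F x) = eval v (F x); last first.
  by apply: Hu => p ->.
apply: eval_in => p pF; case: ifP => // px.
by apply/esym/ag; rewrite mem_filter px.
Qed.

Lemma poly_X : poly (fun x => [seq binary p | p <- X x]).
Proof.
have ha := pform_atoms hF.
apply: (@poly_ext _ _ (fun x => [seq k <- [seq binary p | p <- atoms (F x)] | ~~ head true (behead k)])).
  refine (@poly_filter _ _ (fun _ k => ~~ head true (behead k)) _ _ ha).
  by ptac.
move=> x; rewrite filter_map; congr map; apply: eq_filter => p /=.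
by rewrite /is_X; case: (binary p) => [|a [|b l]].
Qed.

Lemma poly_cclauses sk : poly (fun x => code_form (conjW (clauses sk (X x) (F x)))).
Proof.
have hc := pform_code hF; have hX := poly_X.
apply: (@poly_ext _ _ (fun x => cclauses sk [seq binary p | p <- X x] (code_form (F x)))); last first.
  by move=> x; rewrite code_clauses.
have hk : poly cgad by rewrite /cgad /catom /av_bits /bv_bits; ptac.
rewrite /cclauses; pref (poly_cat _ _).
  case: sk; last by ptac.
  pref (poly_cat _ _); first by ptac.
  do 3 (pref (poly_cat _ _); first by ptac).
  by pref (poly_cat _ _); [exact: hc | ptac].
pref (poly_cat _ _); last by ptac.
pref (poly_flatten _).
refine (@poly_map _ _ _ (fun _ k => cgad k) _ _ hX).
by refine (@poly_comp _ _ _ (fun q : bits * bits => q.2) _ hk _); ptac.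
Qed.

Lemma poly_size_clauses sk :
  poly (fun x => (if sk then (size (atoms (F x))).+3 else 0) + 6 * size (X x)).
Proof.
have ha := poly_size (pform_atoms hF); have hX := poly_size poly_X.
have h1 : poly (fun x => size (X x)) by apply: poly_ext hX _ => x; rewrite size_map.
have h2 : poly (fun x => size (atoms (F x))) by apply: poly_ext ha _ => x; rewrite size_map.
pref (poly_addn _ _); last by pref (poly_muln _ _); [ptac|].
by case: sk; [do 3 (pref (poly_succ _))|ptac].
Qed.

Lemma poly_no_glut : poly (fun x => code_form (And (F x) (no_glut (X x)))).
Proof.
have hc := pform_code hF; have hX := poly_X.
apply: (@poly_ext _ _ (fun x => [:: true; false; false] ++ code_form (F x) ++
  flatten [seq [:: true; false; false; true; false; true; false; true; true] ++ catom (av_bits k) ++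
     [:: false; true; true] ++ catom (bv_bits k) | k <- [seq binary p | p <- X x]] ++
  [:: false; false; true])); last by move=> x; rewrite [RHS]/= code_no_glut.
pref (poly_cat _ _); first by ptac.
pref (poly_cat _ _); first exact: hc.
pref (poly_cat _ _); last by ptac.
pref (poly_flatten _).
refine (@poly_map _ _ _ (fun _ k => [:: true; false; false; true; false; true; false; true; true] ++
  catom (av_bits k) ++ [:: false; true; true] ++ catom (bv_bits k)) _ _ hX).
by rewrite /catom /av_bits /bv_bits; ptac.
Qed.

Lemma credulous_hard md ord : reducible L (dlang md false ord credulous).
Proof.
apply: (reducible_dlang _ (poly_cclauses false) (pform_code hF) (poly_size_clauses false)).
  by move=> x; rewrite size_clauses.
move=> x I; rewrite LE -(credulous_qbf md I (@regX x) (@regF x)).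
by [].
Qed.

Lemma signed_credulous_hard ord : reducible L (dlang M0 true ord credulous).
Proof.
apply: (reducible_dlang _ (poly_cclauses false) poly_no_glut (poly_size_clauses false)).
  by move=> x; rewrite size_clauses.
by move=> x I; rewrite LE -(signed_credulous_qbf I (@regX x) (@regF x)).
Qed.

Lemma negE (P Q : Prop) : (~ P <-> Q) -> (~ Q <-> P).
Proof. by case=> h1 h2; split=> [nQ|p /h2]; [apply: contrapT => /h1 | apply]. Qed.

Lemma skeptical_hard md ord : reducible (~` L) (dlang md false ord skeptical).
Proof.
apply: (reducible_dlang (phi := fun=> Atom uv) _ (poly_cclauses true) _ (poly_size_clauses true)).
- exact: poly_const.
- by move=> x; rewrite size_clauses.
- by move=> x I; rewrite /setC /= LE; apply: negE; apply: skeptical_qbf; [apply: regX|apply: regF].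
Qed.

Lemma prudent_hard md ord : reducible (~` L) (dlang md false ord prudent).
Proof.
apply: (reducible_dlang (phi := fun=> Atom uv) _ (poly_cclauses true) _ (poly_size_clauses true)).
- exact: poly_const.
- by move=> x; rewrite size_clauses.
- by move=> x I; rewrite /setC /= LE; apply: negE; apply: prudent_qbf; [apply: regX|apply: regF].
Qed.

Lemma signed_skeptical_hard ord : reducible (~` L) (dlang M0 true ord skeptical).
Proof.
apply: (reducible_dlang (phi := fun=> Atom uv) _ (poly_cclauses true) _ (poly_size_clauses true)).
- exact: poly_const.
- by move=> x; rewrite size_clauses.
- by move=> x I; rewrite /setC /= LE; apply: negE; apply: signed_skeptical_qbf; [apply: regX|apply: regF].
Qed.

End Hardness.

(** * Completeness *)

Lemma complete_credulous md ord : complete Sigma2P (dlang md false ord credulous).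
Proof.
split; first exact: credulous_Sigma2P.
by move=> L /cook [F hF HF]; apply: (credulous_hard hF HF).
Qed.

Lemma complete_signed_credulous ord : complete Sigma2P (dlang M0 true ord credulous).
Proof.
split; first exact: credulous_Sigma2P.
by move=> L /cook [F hF HF]; apply: (signed_credulous_hard hF HF).
Qed.

Lemma complete_skeptical md ord : complete Pi2P (dlang md false ord skeptical).
Proof.
split; first exact: skeptical_Pi2P.
by move=> L /cook [F hF HF]; rewrite -[L]setCK; apply: (skeptical_hard hF HF).
Qed.

Lemma complete_signed_skeptical ord : complete Pi2P (dlang M0 true ord skeptical).
Proof.
split; first exact: skeptical_Pi2P.
by move=> L /cook [F hF HF]; rewrite -[L]setCK; apply: (signed_skeptical_hard hF HF).
Qed.

Lemma complete_prudent md ord : complete Pi2P (dlang md false ord prudent).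
Proof.
split; first exact: prudent_Pi2P.
by move=> L /cook [F hF HF]; rewrite -[L]setCK; apply: (prudent_hard hF HF).
Qed.

Theorem theorem10 (h : kind) :
  (* (a) *)
  (complete Sigma2P (problem0 h credulous unsigned) /\
   complete Sigma2P (problemI h T1 credulous) /\
   complete Sigma2P (problemI h T2 credulous)) /\
  (* (b) *)
  (complete Pi2P (problem0 h skeptical unsigned) /\
   complete Pi2P (problemI h T1 skeptical) /\
   complete Pi2P (problemI h T2 skeptical)) /\
  (* (c) *)
  (complete Pi2P (problem0 h prudent unsigned) /\
   Pi2P (problemI h T1 prudent) /\
   Pi2P (problemI h T2 prudent)) /\
  (* (d) *)
  complete Sigma2P (problem0 h credulous signed) /\
  (* (e) *)
  complete Pi2P (problem0 h skeptical signed) /\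
  (* (f) *)
  Pi2P (problem0 h prudent signed).
Proof.
have eU R : problem0 h R unsigned = dlang M0 false (is_ordinary h) R := problem0E h R false.
have eS R : problem0 h R signed = dlang M0 true (is_ordinary h) R := problem0E h R true.
have e1 R : problemI h T1 R = dlang M1 false (is_ordinary h) R by apply: (@problemIE h R M1).
have e2 R : problemI h T2 R = dlang M2 false (is_ordinary h) R by apply: (@problemIE h R M2).
rewrite !eU !eS !e1 !e2; repeat match goal with |- _ /\ _ => split end; try exact: complete_credulous; try exact: complete_skeptical;
  try exact: complete_prudent; try exact: complete_signed_credulous;
  try exact: complete_signed_skeptical; exact: prudent_Pi2P.
Qed.
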